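(* Let $N\ge 1$ and consider the spaces $\mathcal{W}_h$, $\mathcal{V}_h$, the bilinear form $B^{DG}_h(\cdot,\cdot)$ with penalty parameter $\eta$, and the norm $|||\cdot|||$ defined in the context. There exist a constant $\eta_0>0$, independent of $h$, and, for each $\eta>\eta_0$, a constant $h_0>0$, independent of $h$, such that whenever $\eta>\eta_0$ and $h<h_0$ the following hold: 1. there exists a constant $\alpha>0$, independent of $h$, such that $$\inf_{w\in\mathcal{W}_h\setminus\{0\}}\ \sup_{v\in\mathcal{V}_h\setminus\{0\}}\frac{B^{DG}_h(w,v)}{|||w|||\,|||v|||}\ \ge\ \alpha;$$ 2. if $v\in\mathcal{V}_h$ satisfies $B^{DG}_h(w,v)=0$ for all $w\in\mathcal{W}_h$, then $v=0$.
   Context: Domain and data. $\Omega\subset\mathbb{R}^2$ is a bounded domain whose boundary $\partial\Omega$ is piecewise of class $C^2$. $\boldsymbol b=(b_1,b_2)^{T}$ with $b_1,b_2\in W^1_\infty(\Omega)$, $c\in L^\infty(\Omega)$, and $c(\boldsymbol x)+\frac12\nabla\cdot\boldsymbol b(\boldsymbol x)\ge 0$ on $\overline\Omega$. If $\Omega_h\not\subset\Omega$ (see below), $\boldsymbol b$ and $c$ are continuously extended to a fixed ($h$-independent) neighbourhood of $\Omega$ containing $\Omega_h$, remaining in $W^1_\infty$ and $L^\infty$ respectively, and keep the same names. Meshes. $\mathcal{T}_h=\{T^k\}_{k=1}^K$ is a conforming triangulation into non-overlapping straight-sided (closed) triangles (two elements meet in a complete edge, a vertex or the empty set), $\Omega_h=\bigcup_k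 T^k$, $h_k$ is the diameter of $T^k$, $h=\max_k h_k$. A family of such meshes is considered, with the following constants $\rho,\mu,C_{\partial\Omega}$ independent of $h$. All vertices of the polygon $\partial\Omega_h$ lie on $\partial\Omega$; no element has more than one edge on $\partial\Omega_h$; $h_k/\rho_k\le\rho$, where $\rho_k$ is the maximal radius of a ball inscribed in $T^k$; $\mu h_k\le h_e$ for each edge $e$ of $T^k$, $h_e$ being the length of $e$. Points where $\partial\Omega$ is not $C^2$, and points separating convex and concave portions of $\partial\Omega$, are vertices of $\partial\Omega_h$, so that convex and concave portions of $\partial\Omega$ correspond to convex and concave portions of $\partial\Omega_h$. The mesh is fine enough to resolve the local curvature of $\partial\Omega$, and the Hausdorff distance of $\partial\Omega$ and $\partial\Omega_h$ is at most $C_{\partial\Omega}h^2$. $\mathcal{E}_h$ is the set of all edges, $\Gamma=\bigcup_k\partial T^k$, $\Gamma_0=\Gamma\setminus\partial\Omega_h$. $I^B$ is the set of indices $k$ such that $T^k$ has an edge $e^{kB}$ on $\partial\Omega_h$; for $k\in I^B$, $\Delta_k$ is the closed set of smallest area delimited by $\partial\Omega$ and $e^{kB}$, and $O_k$ is the vertex of $T^k$ not on $e^{kB}$. Discrete spaces. $\mathcal{P}_N(T)$ denotes polynomials of total degree at most $N$ on $T$. Each $T^k$ carries a $\mathcal{P}_N$-unisolvent set of $N_p=(N+1)(N+2)/2$ discontinuous Galerkin nodes (the affine image of a fixed reference nodal set) that includes the vertices and has $N+1$ nodes on each edge. For $k\in I^B$, let $P^k_1,\dots,P^k_{N-1}$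 be the points of $\partial\Omega$ obtained as the nearest intersection with $\partial\Omega$ of the lines through $O_k$ and each of the $N-1$ nodes in the interior of $e^{kB}$; let $P^k_N,P^k_{N+1}$ be the two vertices of $e^{kB}$ (which lie on $\partial\Omega$). Then $\mathcal{V}_h=\{v\in L^2(\Omega_h): v|_{T^k}\in\mathcal{P}_N(T^k)\ \forall k,\ v|_{\partial\Omega_h}=0\}$, with functions extended by $0$ to $\Omega\setminus\Omega_h$; and $\mathcal{W}_h=\{w\in L^2(\Omega_h): w|_{T^k}\in\mathcal{P}_N(T^k)\ \forall k,\ w(P^k_r)=0,\ r=1,\dots,N+1,\ \forall k\in I^B\}$, where for $k\in I^B$ the polynomial expression of $w$ on $T^k$ is also used on $\Delta_k$. Jumps and averages. On an interior edge shared by $T^k,T^\ell$, with $\boldsymbol n^{k\ell}$ the unit normal outward to $T^k$: $\{\!\{v\}\!\}=\frac{v^k+v^\ell}2$, $\{\!\{\boldsymbol q\}\!\}=\frac{\boldsymbol q^k+\boldsymbol q^\ell}{2}$, $[\![v]\!]=\boldsymbol n^{k\ell}(v^k-v^\ell)$. On a boundary edge $e^{kB}$ with outward unit normal $\boldsymbol n^{kB}$: $\{\!\{v\}\!\}=v^k$, $\{\!\{\boldsymbol q\}\!\}=\boldsymbol q^k$, $[\![v]\!]=\boldsymbol n^{kB}v^k$. $\boldsymbol n_e$ is a unit normal to the edge $e$. $\nabla_h$ is the elementwise gradient. Bilinear form, with a constant penalty parameter $\eta>0$: $$B^{DG}_h(w,v)=(\nabla_h w,\nabla_h v)_{L^2(\Omega_h)}-(\boldsymbol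 b w,\nabla_h v)_{L^2(\Omega_h)}+(cw,v)_{L^2(\Omega_h)}-\int_{\Gamma_0}[\![w]\!]\cdot\{\!\{\nabla_h v\}\!\}\,ds-\int_{\Gamma_0}[\![v]\!]\cdot\{\!\{\nabla_h w\}\!\}\,ds$$ $$+\int_{\Gamma}\frac{\eta}{h_e}[\![v]\!]\cdot[\![w]\!]\,ds+\int_{\Gamma_0}\boldsymbol b\cdot[\![v]\!]\,\{\!\{w\}\!\}\,ds+\int_\Gamma\frac{|\boldsymbol b\cdot\boldsymbol n_e|}{2}[\![v]\!]\cdot[\![w]\!]\,ds.$$ DG norm: $$|||u|||^2=\sum_{k=1}^K\big(\|u\|^2_{H^1(T^k)}+h_k^2|u|^2_{H^2(T^k)}\big)+\sum_{e\in\mathcal{E}_h}h_e^{-1}\|[\![u]\!]\|^2_{L^2(e)}+\sum_{e\in\mathcal{E}_h}\tfrac12\big\||\boldsymbol b\cdot\boldsymbol n_e|^{1/2}[\![u]\!]\big\|^2_{L^2(e)}.$$ *)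

(* Defs.v *)
From HB Require Import structures.
From mathcomp Require Import all_boot all_order all_algebra.
From mathcomp Require Import all_classical all_reals all_analysis.

Set Implicit Arguments.
Unset Strict Implicit.
Unset Printing Implicit Defensive.

Import Order.TTheory GRing.Theory Num.Theory.
Import numFieldNormedType.Exports.
Local Open Scope classical_set_scope.
Local Open Scope ring_scope.

(* The plane is R * R. The norm that the library puts on a product is the max
   norm; it generates the usual topology, but every length below is measured
   with the Euclidean norm [enorm]. *)
Notation leb1 := (@lebesgue_measure _).
Notation leb2 := (@lebesgue_measure _ \x @lebesgue_measure _)%E.

Section Plane.
Context {R : realType}.
Implicit Types (x y p q u : R * R) (A B S : set (R * R)).

Definition dot x y : R := x.1 * y.1 + x.2 * y.2.
Definition enorm x : R := Num.sqrt (dot x x).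
Definition dist x y : R := enorm (x - y).
Definition rot90 x : R * R := (- x.2, x.1).

Definition eball p (r : R) : set (R * R) := [set x | dist x p < r].
Definition ecball p (r : R) : set (R * R) := [set x | dist x p <= r].

Definition bdry A : set (R * R) := closure A `\` A°.

Definition segment p q : set (R * R) :=
  [set p + t *: (q - p) | t in `[0, 1]].
Definition line p q : set (R * R) := range (fun t : R => p + t *: (q - p)).

Definition diam A : R := sup [set d | exists x y, [/\ A x, A y & d = dist x y]].
Definition inradius A : R := sup [set r | 0 <= r /\ exists p, ecball p r `<=` A].

Definition hausdorff A B : \bar R :=
  let excess A B :=
    ereal_sup [set ereal_inf [set (dist x y)%:E | y in B] | x in A] in
  maxe (excess A B) (excess B A).

Definition simple_arc A p q : Prop := exists gam : R -> R * R,
  [/\ {within `[0, 1], continuous gam}, gam 0 = p, gam 1 = q,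
      {in `[0, 1] &, injective gam} & A = gam @` `[0, 1]].

End Plane.

Section Domain.
Context {R : realType}.
Implicit Types (Omega A : set (R * R)) (p : R * R).

Definition class_C2 (V : normedModType R) (g : R -> V) : Prop :=
  [/\ forall t, derivable g t 1,
      forall t, derivable (derive1 g) t 1 &
      continuous (derive1 (derive1 g))].

Definition bounded_domain Omega : Prop :=
  [/\ Omega !=set0, open Omega, connected Omega & bounded_set Omega].

(* Near p, in the orthonormal frame (u, rot90 u) centred at p, Omega is the strict
   epigraph of a C^2 function of one variable. *)
Definition C2_boundary_at Omega p : Prop :=
  bdry Omega p /\
  exists (r : R) (u : R * R) (f : R -> R),
    [/\ 0 < r, enorm u = 1, class_C2 f &
        forall x, eball p r x ->
          (Omega x <-> f (dot (x - p) u) < dot (x - p) (rot90 u))].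

(* The boundary is a finite union of regular arcs that are C^2 up to their end
   points; distinct arcs meet at most at end points, and away from the end
   points the boundary is C^2 in the above sense. *)
Definition piecewise_C2_boundary Omega : Prop :=
  exists (n : nat) (g : 'I_n -> R -> R * R),
    [/\ forall i, [/\ class_C2 (g i),
                      {in `[0, 1], forall t, derive1 (g i) t != 0} &
                      {in `[0, 1] &, injective (g i)}],
        forall i j s t, i != j -> s \in `[0, 1] -> t \in `[0, 1] ->
          g i s = g j t -> (s = 0 \/ s = 1) /\ (t = 0 \/ t = 1),
        bdry Omega = \bigcup_i (g i @` `[0, 1]) &
        forall i t, t \in `]0, 1[ -> C2_boundary_at Omega (g i t)].

Definition convex_portion Omega A : Prop := A `<=` bdry Omega /\
  forall p, A p -> exists2 r : R, 0 < r & convex_set (eball p r `&` Omega).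
Definition concave_portion Omega A : Prop := A `<=` bdry Omega /\
  forall p, A p -> exists2 r : R, 0 < r & convex_set (eball p r `\` Omega).

End Domain.

Section Coefficients.
Context {R : realType}.
Implicit Types (Omega U : set (R * R)) (f g c : R * R -> R).

Definition e1 : R * R := (1, 0).
Definition e2 : R * R := (0, 1).

Definition iter_derive (s : seq (R * R)) (f : R * R -> R) : R * R -> R :=
  foldr (fun v h => 'D_v h : R * R -> R) f s.

Definition smooth f : Prop :=
  forall s : seq (R * R), {subset s <= [:: e1; e2]} ->
    continuous (iter_derive s f) /\
    forall x, derivable (iter_derive s f) x e1 /\
              derivable (iter_derive s f) x e2.

Definition test_function U f : Prop :=
  let supp := closure [set x | f x != 0] in
  [/\ smooth f, compact supp & supp `<=` U].

Definition Linfty U f : Prop :=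
  measurable_fun U f /\
  exists M : R, {ae leb2, forall x, U x -> `|f x| <= M}.

Definition weak_derivative U (v : R * R) f g : Prop :=
  forall phi, test_function U phi ->
    \int[leb2]_(x in U) (f x * 'D_v phi x) =
    - \int[leb2]_(x in U) (g x * phi x).

Definition W1infty U f : Prop :=
  Linfty U f /\
  exists g1 g2, [/\ Linfty U g1, Linfty U g2,
                    weak_derivative U e1 f g1 & weak_derivative U e2 f g2].

(* b and c live on the open set U: this is Omega itself, or a neighbourhood of
   the closure of Omega to which they have been extended. Edge integrals use
   point values of b, so b denotes the continuous representative. *)
Definition coefficients Omega U (b : R * R -> R * R) c : Prop :=
  [/\ open U /\ Omega `<=` U,
      {within U `|` closure Omega, continuous b},
      W1infty U (fun x => (b x).1) /\ W1infty U (fun x => (b x).2),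
      Linfty U c &
      exists g1 g2,
        [/\ Linfty U g1, Linfty U g2,
            weak_derivative U e1 (fun x => (b x).1) g1,
            weak_derivative U e2 (fun x => (b x).2) g2 &
            {ae leb2, forall x, Omega x -> 0 <= c x + (g1 x + g2 x) / 2}]].

End Coefficients.

(* Local edge i of element k is the one opposite to its local vertex i. *)
Record mesh (R : realType) := Mesh {
  nel : nat;
  vtx : 'I_nel -> 'I_3 -> R * R }.

Section Mesh.
Context {R : realType}.
Variable M : mesh R.
Implicit Types (k l : 'I_(nel M)) (i j : 'I_3).

Definition va k i : R * R := vtx k (i + 1).
Definition vb k i : R * R := vtx k (i - 1).

Definition elt k : set (R * R) :=
  [set x | exists lam : 'I_3 -> R,
     [/\ forall i, 0 <= lam i, \sum_i lam i = 1 & x = \sum_i lam i *: vtx k i]].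
Definition edge k i : set (R * R) := segment (va k i) (vb k i).
Definition len k i : R := dist (va k i) (vb k i).

Definition same_edge k i l j : bool :=
  (va k i == va l j) && (vb k i == vb l j) ||
  (va k i == vb l j) && (vb k i == va l j).

Definition Omegah : set (R * R) := \bigcup_k elt k.
Definition hk k : R := diam (elt k).
Definition hmax : R := \big[Num.max/0]_k hk k.

Definition bd_edge k i : Prop := edge k i `<=` bdry Omegah.
Definition bd_vertex : set (R * R) :=
  [set p | exists k i, bd_edge k i /\ (p = va k i \/ p = vb k i)].

Definition conforming : Prop := forall k l, k != l ->
  [\/ elt k `&` elt l = set0,
      exists i j, vtx k i = vtx l j /\ elt k `&` elt l = [set vtx k i] |
      exists i j, same_edge k i l j /\ elt k `&` elt l = edge k i].

(* A is the part of the boundary of Omega that together with the boundary edge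
   i of element k delimits Delta_k: it joins the end points of the edge and
   contains no other vertex of the polygon; its interior lies in a convex or in
   a concave portion of the boundary; and, the mesh resolving its curvature, it
   is met exactly once by every line through the vertex O_k opposite to the
   edge and a point of the edge. *)
Definition subtended_arc (Omega : set (R * R)) k i (A : set (R * R)) : Prop :=
  let ends := [set va k i; vb k i] in
  [/\ simple_arc A (va k i) (vb k i),
      A `<=` bdry Omega,
      A `&` bd_vertex = ends,
      convex_portion Omega (A `\` ends) \/ concave_portion Omega (A `\` ends) &
      forall x, edge k i x -> exists! p, A p /\ line (vtx k i) x p].

Record admissible_mesh (Omega : set (R * R)) (rho mu C : R) : Prop := {
  mesh_nondegenerate : forall k,
    dot (vtx k 1 - vtx k 0) (rot90 (vtx k 2 - vtx k 0)) != 0;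
  mesh_conforming : conforming;
  mesh_one_bd_edge : forall k i j, bd_edge k i -> bd_edge k j -> i = j;
  mesh_shape : forall k, hk k / inradius (elt k) <= rho;
  mesh_edge_length : forall k i, mu * hk k <= len k i;
  mesh_vertices : bd_vertex `<=` bdry Omega;
  mesh_corners : forall p, bdry Omega p -> ~ C2_boundary_at Omega p ->
    bd_vertex p;
  mesh_arcs : forall k i, bd_edge k i -> exists A, subtended_arc Omega k i A;
  mesh_hausdorff :
    (hausdorff (bdry Omega) (bdry Omegah) <= (C * hmax ^+ 2)%:E)%E }.

(* An edge of the mesh, seen from one adjacent element: (k, i, Some l) is the
   interior edge i of T^k shared with T^l and counted once thanks to k < l;
   (k, i, None) is a boundary edge. *)
Definition mesh_edge := ('I_(nel M) * 'I_3 * option 'I_(nel M))%type.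

Definition Gamma0 : pred mesh_edge := fun e =>
  let: (k, i, nb) := e in
  if nb is Some l then (k < l)%N && [exists j, same_edge k i l j] else false.
Definition GammaB : pred mesh_edge := fun e =>
  let: (k, i, nb) := e in
  if nb is Some _ then false else `[< bd_edge k i >].
Definition Eh : pred mesh_edge := predU Gamma0 GammaB.

Implicit Type e : mesh_edge.

Definition elen e : R := len e.1.1 e.1.2.

Definition unit_normal e : R * R :=
  let: (k, i, _) := e in
  let n := (len k i)^-1 *: rot90 (vb k i - va k i) in
  Num.sg (dot n (va k i - vtx k i)) *: n.

Definition edge_integral e (f : R * R -> R) : R :=
  let: (k, i, _) := e in
  len k i * \int[leb1]_(t in `[0, 1]) f (va k i + t *: (vb k i - va k i)).

End Mesh.

(* A mesh family on which b and c are known on Omega_h: either no extension is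
   needed, or they are extended to a fixed neighbourhood U of the closure. *)
Definition mesh_family (R : realType) (Omega U : set (R * R)) (rho mu C : R)
    (Th : set (mesh R)) : Prop :=
  (forall M, Th M -> admissible_mesh M Omega rho mu C) /\
  ((U = Omega /\ forall M, Th M -> Omegah M `<=` closure Omega) \/
   (closure Omega `<=` U /\ forall M, Th M -> Omegah M `<=` U)).

Section Spaces.
Context {R : realType}.
Implicit Types (p : {poly {poly R}}) (x : R * R).

(* In {poly {poly R}} the outer variable is the first coordinate. *)
Definition ev p x : R := p.[x.1, x.2].
Definition d1 p : {poly {poly R}} := deriv p.
Definition d2 p : {poly {poly R}} := map_poly (@deriv R) p.
Definition grad p x : R * R := (ev (d1 p) x, ev (d2 p) x).

Definition total_degree_le (N : nat) p : Prop :=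
  forall i j : nat, (N < i + j)%N -> p`_i`_j = 0.

Definition Np (N : nat) : nat := (N.+1 * N.+2) %/ 2.

(* Nodes on the reference triangle with vertices (0,0), (1,0) and (0,1). *)
Record reference_nodes (N : nat) (nd : 'I_(Np N) -> R * R) : Prop := {
  nodes_inside : forall n,
    [/\ 0 <= (nd n).1, 0 <= (nd n).2 & (nd n).1 + (nd n).2 <= 1];
  nodes_vertices : forall x, x \in [:: (0, 0); (1, 0); (0, 1)] ->
    exists n, nd n = x;
  nodes_edge0 : #|[set n | (nd n).1 + (nd n).2 == 1]%SET| = N.+1;
  nodes_edge1 : #|[set n | (nd n).1 == 0]%SET| = N.+1;
  nodes_edge2 : #|[set n | (nd n).2 == 0]%SET| = N.+1;
  nodes_unisolvent : forall p, total_degree_le N p ->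
    (forall n, ev p (nd n) = 0) -> p = 0 }.

Variables (N : nat) (nd : 'I_(Np N) -> R * R) (M : mesh R).

Definition node (k : 'I_(nel M)) (n : 'I_(Np N)) : R * R :=
  vtx k 0 + (nd n).1 *: (vtx k 1 - vtx k 0) + (nd n).2 *: (vtx k 2 - vtx k 0).

Definition inner_edge_node (k : 'I_(nel M)) (i : 'I_3) (n : 'I_(Np N)) : Prop :=
  [/\ edge k i (node k n), node k n <> va k i & node k n <> vb k i].

(* P k n is the point of the boundary of Omega assigned to node n of T^k, when
   this node is interior to a boundary edge. *)
Definition boundary_points (Omega : set (R * R))
    (P : 'I_(nel M) -> 'I_(Np N) -> R * R) : Prop :=
  forall k i n, bd_edge k i -> inner_edge_node k i n ->
    let cut := bdry Omega `&` line (vtx k i) (node k n) in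
    cut (P k n) /\ forall q, cut q -> dist (node k n) (P k n) <= dist (node k n) q.

(* An element of L^2(Omega_h) that is polynomial on every element is given by
   its polynomials; it is zero in L^2 iff all of them are. *)
Definition broken := {ffun 'I_(nel M) -> {poly {poly R}}}.

Definition Vh : set broken := [set v |
  (forall k, total_degree_le N (v k)) /\
  (forall k i, bd_edge k i -> forall x, edge k i x -> ev (v k) x = 0)].

Definition Wh (P : 'I_(nel M) -> 'I_(Np N) -> R * R) : set broken := [set w |
  (forall k, total_degree_le N (w k)) /\
  (forall k i, bd_edge k i ->
     [/\ ev (w k) (va k i) = 0, ev (w k) (vb k i) = 0 &
         forall n, inner_edge_node k i n -> ev (w k) (P k n) = 0])].

End Spaces.

Section Forms.
Context {R : realType}.
Variable M : mesh R.
Implicit Types (u v w : broken M) (e : mesh_edge M).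

Definition jump u e (x : R * R) : R * R :=
  let: (k, _, nb) := e in
  (if nb is Some l then ev (u k) x - ev (u l) x else ev (u k) x)
    *: unit_normal e.

Definition avg u e (x : R * R) : R :=
  let: (k, _, nb) := e in
  if nb is Some l then (ev (u k) x + ev (u l) x) / 2 else ev (u k) x.

Definition avg_grad u e (x : R * R) : R * R :=
  let: (k, _, nb) := e in
  if nb is Some l then 2^-1 *: (grad (u k) x + grad (u l) x) else grad (u k) x.

Definition L2_elt (k : 'I_(nel M)) (p : {poly {poly R}}) : R :=
  \int[leb2]_(x in elt k) (ev p x ^+ 2).

Variables (b : R * R -> R * R) (c : R * R -> R).

Definition BDG (eta : R) w v : R :=
  \sum_k \int[leb2]_(x in elt k) dot (grad (w k) x) (grad (v k) x)
  - \sum_k \int[leb2]_(x in elt k) dot (ev (w k) x *: b x) (grad (v k) x)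
  + \sum_k \int[leb2]_(x in elt k) (c x * ev (w k) x * ev (v k) x)
  - \sum_(e | Gamma0 e)
      edge_integral e (fun x => dot (jump w e x) (avg_grad v e x))
  - \sum_(e | Gamma0 e)
      edge_integral e (fun x => dot (jump v e x) (avg_grad w e x))
  + \sum_(e | Eh e)
      edge_integral e (fun x =>
        eta / elen e * dot (jump v e x) (jump w e x))
  + \sum_(e | Gamma0 e)
      edge_integral e (fun x => dot (b x) (jump v e x) * avg w e x)
  + \sum_(e | Eh e)
      edge_integral e (fun x =>
        `|dot (b x) (unit_normal e)| / 2 * dot (jump v e x) (jump w e x)).

Definition DGnorm u : R := Num.sqrt (
  \sum_k (L2_elt k (u k) + (L2_elt k (d1 (u k)) + L2_elt k (d2 (u k)))
          + hk k ^+ 2 * (L2_elt k (d1 (d1 (u k))) + L2_elt k (d1 (d2 (u k)))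
                         + L2_elt k (d2 (d2 (u k)))))
  + \sum_(e | Eh e)
      (elen e)^-1 * edge_integral e (fun x => enorm (jump u e x) ^+ 2)
  + \sum_(e | Eh e)
      2^-1 * edge_integral e (fun x =>
        enorm (Num.sqrt `|dot (b x) (unit_normal e)| *: jump u e x) ^+ 2)).

End Forms.

(* Main.v *)
(** W_h and V_h are compared through their nodal values: w in W_h is replaced by the v in V_h that agrees with w at all
nodes off the boundary edges.  On a fine mesh each arc cut off by a boundary edge lies within o(h_k) of the edge, so the
boundary nodes are displaced by o(h_k) only, and inverse estimates bound the energy of w - v by a small multiple of the
energy of w (and conversely, starting from v).  On V_h the form is coercive: integrating the convection term by parts on each
element leaves c + div b / 2, which is nonnegative on Omega; what remains is the thin strip of Omega_h outside Omega, where
the indicator of a neighbourhood of the boundary is dominated by directional derivatives of uniformly small functions, so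
that another integration by parts absorbs it.  The Poincare inequality comes in the same way from the derivative of x_1.
Coercivity on V_h, continuity, and the smallness of w - v give the inf-sup condition and the injectivity. *)
Require Import Defs.
From HB Require Import structures.
From mathcomp Require Import all_boot all_order all_algebra.
From mathcomp Require Import all_classical all_reals all_analysis.
From mathcomp Require Import measurable_realfun.
From mathcomp Require Import ring lra zify.
Set Implicit Arguments.
Unset Strict Implicit.
Unset Printing Implicit Defensive.
Import Order.TTheory GRing.Theory Num.Theory.
Import numFieldNormedType.Exports.
Local Open Scope classical_set_scope.
Local Open Scope ring_scope.

(** Two obstacles shape the development. First, [b] is known only through its continuous
    representative and its weak derivatives, so the divergence theorem on a triangle is extracted
    from the definition of weak derivative: the test functions are polynomials times cutoffs of
    barycentric coordinates built from exp(-1/t), and the derivatives of the cutoffs concentrate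
    into edge integrals. Second, a small Hausdorff distance between the two boundaries does not tell
    which complementary components the polygon fills; a priori it could cover a hole of Omega. That
    Omega_h leaves Omega only by a thin strip is therefore proved topologically: on fine meshes,
    membership in Omega_h flips when a C^2 boundary point of Omega is crossed, is constant away from
    the boundary, and is false far away. The flip rests on the subtended arcs, which must be short
    because they contain no inner mesh vertex. The threshold for eta depends only on the constant of
    the inverse estimates; h_0 depends on eta through the continuity constant, relative to which w -
    v must be small. *)

Section Plane_algebra.
Context {R : realType}.
Implicit Types (x y z : R * R) (a : R).

Lemma fst_add x y : (x + y).1 = x.1 + y.1. Proof. by []. Qed.
Lemma snd_add x y : (x + y).2 = x.2 + y.2. Proof. by []. Qed.
Lemma fst_opp x : (- x).1 = - x.1. Proof. by []. Qed.
Lemma snd_opp x : (- x).2 = - x.2. Proof. by []. Qed.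
Lemma fst_scale a x : (a *: x).1 = a * x.1. Proof. by []. Qed.
Lemma snd_scale a x : (a *: x).2 = a * x.2. Proof. by []. Qed.
Lemma fst_zero : (0 : R * R).1 = 0. Proof. by []. Qed.
Lemma snd_zero : (0 : R * R).2 = 0. Proof. by []. Qed.
Definition coordE := (fst_add, snd_add, fst_opp, snd_opp, fst_scale, snd_scale, fst_zero, snd_zero).

Lemma pair_eqP x y : x.1 = y.1 -> x.2 = y.2 -> x = y.
Proof. by case: x y => [? ?] [? ?] /= -> ->. Qed.

Definition cross x y : R := x.1 * y.2 - x.2 * y.1.

Lemma dot_ge0 x : 0 <= dot x x.
Proof. by rewrite /dot -!expr2 addr_ge0 ?sqr_ge0. Qed.

Lemma enorm_ge0 x : 0 <= enorm x. Proof. exact: sqrtr_ge0. Qed.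

Lemma enorm_sqr x : enorm x ^+ 2 = dot x x.
Proof. by rewrite sqr_sqrtr // dot_ge0. Qed.

Lemma enorm_eq0 x : enorm x = 0 -> x = 0.
Proof.
move=> h; have := enorm_sqr x; rewrite h expr0n /= /dot => /esym/eqP.
rewrite -!expr2 paddr_eq0 ?sqr_ge0 // !sqrf_eq0 => /andP[/eqP h1 /eqP h2].
exact: pair_eqP.
Qed.

Lemma enorm0 : enorm (0 : R * R) = 0.
Proof. by rewrite /enorm /dot !mulr0 addr0 sqrtr0. Qed.

Lemma enormN x : enorm (- x) = enorm x.
Proof. by rewrite /enorm /dot !coordE !mulrNN. Qed.

Lemma enormZ a x : enorm (a *: x) = `|a| * enorm x.
Proof.
rewrite /enorm /dot !coordE.
have -> : a * x.1 * (a * x.1) + a * x.2 * (a * x.2) = a ^+ 2 * (x.1 * x.1 + x.2 * x.2) by ring.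
by rewrite sqrtrM ?sqr_ge0 // sqrtr_sqr.
Qed.

Lemma dot_le x y : dot x y <= enorm x * enorm y.
Proof.
have [h|h] := leP (dot x y) 0; first by apply: le_trans h _; rewrite mulr_ge0 ?enorm_ge0.
rewrite -(ler_pXn2r (n := 2)) ?nnegrE ?mulr_ge0 ?enorm_ge0 ?(ltW h) //.
rewrite exprMn !enorm_sqr /dot.
have : 0 <= (x.1 * y.2 - x.2 * y.1) ^+ 2 by apply: sqr_ge0.
by nra.
Qed.

Lemma norm_dot_le x y : `|dot x y| <= enorm x * enorm y.
Proof.
rewrite ler_norml dot_le andbT lerNl -(enormN x); apply: le_trans (dot_le _ _).
by have -> : dot (- x) y = - dot x y by rewrite /dot !coordE; ring.
Qed.

Lemma ler_enormD x y : enorm (x + y) <= enorm x + enorm y.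
Proof.
rewrite -(ler_pXn2r (n := 2)) ?nnegrE ?addr_ge0 ?enorm_ge0 //.
rewrite sqrrD !enorm_sqr; have := dot_le x y; rewrite /dot !coordE => h.
rewrite mulr2n; nra.
Qed.

Lemma dist_tri x y z : dist x z <= dist x y + dist y z.
Proof.
rewrite /dist; have -> : x - z = (x - y) + (y - z) by rewrite addrA subrK.
exact: ler_enormD.
Qed.

Lemma dist_sym x y : dist x y = dist y x.
Proof. by rewrite /dist -enormN opprB. Qed.

Lemma dist_ge0 x y : 0 <= dist x y. Proof. exact: enorm_ge0. Qed.

Lemma distxx x : dist x x = 0.
Proof. by rewrite /dist subrr enorm0. Qed.

Lemma dist_eq0 x y : dist x y = 0 -> x = y.
Proof. by move=> /enorm_eq0/eqP; rewrite subr_eq0 => /eqP. Qed.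

Lemma coord1_le_enorm x : `|x.1| <= enorm x.
Proof.
rewrite -(ler_pXn2r (n := 2)) ?nnegrE ?enorm_ge0 //.
by rewrite enorm_sqr real_normK ?num_real // /dot -!expr2 lerDl sqr_ge0.
Qed.

Lemma coord2_le_enorm x : `|x.2| <= enorm x.
Proof.
rewrite -(ler_pXn2r (n := 2)) ?nnegrE ?enorm_ge0 //.
by rewrite enorm_sqr real_normK ?num_real // /dot -!expr2 lerDr sqr_ge0.
Qed.

Lemma enorm_le_coords x : enorm x <= `|x.1| + `|x.2|.
Proof.
rewrite -(ler_pXn2r (n := 2)) ?nnegrE ?enorm_ge0 ?addr_ge0 //.
rewrite enorm_sqr sqrrD !real_normK ?num_real // /dot -!expr2.
by rewrite -addrA lerD2l lerDr mulrn_wge0 // mulr_ge0.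
Qed.

Lemma enorm_rot90 x : enorm (rot90 x) = enorm x.
Proof. by rewrite /enorm /dot /= mulrNN addrC. Qed.

Lemma cross_le x y : `|cross x y| <= enorm x * enorm y.
Proof.
have -> : cross x y = dot (rot90 x) y by rewrite /cross /dot /=; ring.
by rewrite -(enorm_rot90 x) norm_dot_le.
Qed.

Lemma nbhs_eball x e : 0 < e -> nbhs x (eball x e).
Proof.
move=> e0; apply/nbhs_ballP; exists (e / 2) => /=; first by rewrite divr_gt0.
move=> y [/=]; rewrite /ball /= => h1 h2; rewrite /eball /= /dist.
apply: (le_lt_trans (enorm_le_coords _)); rewrite !coordE [X in _ < X]splitr.
by rewrite distrC (distrC y.2) ltrD.
Qed.

Lemma nbhs_eballP x (A : set (R * R)) :
  nbhs x A -> exists2 e : R, 0 < e & eball x e `<=` A.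
Proof.
move=> /nbhs_ballP[e /= e0 he]; exists e => // y; rewrite /eball /= /dist => h.
apply: he; split; rewrite /ball /= distrC.
  exact: le_lt_trans (coord1_le_enorm (y - x)) h.
exact: le_lt_trans (coord2_le_enorm (y - x)) h.
Qed.

Lemma open_eball x e : open (eball x e).
Proof.
rewrite openE => y; rewrite /eball /= => h.
rewrite /interior; have e0 : 0 < e - dist y x by rewrite subr_gt0.
apply: filterS (nbhs_eball _ e0) => z; rewrite /eball /= => hz.
by apply: le_lt_trans (dist_tri _ y _) _; lra.
Qed.

Lemma continuous_dist x : continuous (fun y => dist y x).
Proof.
move=> y; apply/cvgrPdist_lt => e e0; apply: filterS (nbhs_eball _ e0) => z.
rewrite /eball /= => h; apply: le_lt_trans h; rewrite ler_norml.
have := dist_tri y z x; have := dist_tri z y x; rewrite (dist_sym y z); lra.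
Qed.

Lemma closed_ecball x e : closed (ecball x e).
Proof.
have -> : ecball x e = (fun y => dist y x) @^-1` [set t | t <= e] by [].
by apply: preimage_closed; [move=> y _; exact: continuous_dist|exact: closed_le].
Qed.

Lemma heine_borel2 (A : set (R * R)) (r : R) : closed A ->
  (forall x, A x -> enorm x <= r) -> compact A.
Proof.
move=> cA hA; apply: (@subclosed_compact _ _ (`[- r, r]%classic `*` `[- r, r]%classic)) => //.
  by apply: compact_setX; exact: segment_compact.
move=> x /hA h; split; rewrite /= in_itv /= -ler_norml.
  exact: le_trans (coord1_le_enorm _) h.
exact: le_trans (coord2_le_enorm _) h.
Qed.

Lemma compact_enorm_bounded (A : set (R * R)) : compact A ->
  exists2 r : R, 0 <= r & forall x, A x -> enorm x <= r.
Proof.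
move=> cA; have [->|/set0P A0] := eqVneq A set0; first by exists 0.
have [|M _ hM] := @compact_EVT_max _ R (fun x => dist x 0) A A0 cA.
  by apply: continuous_subspaceT; exact: continuous_dist.
exists (dist M 0); first exact: dist_ge0.
by move=> x Ax; have := hM x (mem_set Ax); rewrite {1}/dist subr0.
Qed.

End Plane_algebra.

(** * Triangles in barycentric coordinates *)

Section Triangle.
Context {R : realType}.
Implicit Types (p : 'I_3 -> R * R) (i j : 'I_3) (x : R * R).

Lemma I3P i : [\/ i = 0, i = 1 | i = 2].
Proof.
by case: i => [[|[|[|//]]] h]; [apply: Or31|apply: Or32|apply: Or33]; exact/val_inj.
Qed.

Lemma I3_succ : prod (prod (prod (prod (prod
  ((0 + 1 : 'I_3) = 1) ((1 + 1 : 'I_3) = 2)) ((2 + 1 : 'I_3) = 0))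
  ((0 - 1 : 'I_3) = 2)) ((1 - 1 : 'I_3) = 0)) ((2 - 1 : 'I_3) = 1).
Proof. by split; [split; [split; [split; [split|]|]|]|]; exact/val_inj. Qed.

Lemma sum3 (V : nmodType) (F : 'I_3 -> V) : \sum_i F i = F 0 + F 1 + F 2.
Proof.
rewrite !big_ord_recl big_ord0 addr0 addrA.
by congr (F _ + F _ + F _); exact/val_inj.
Qed.

Lemma sum3_at (V : nmodType) (F : 'I_3 -> V) i : \sum_j F j = F i + F (i + 1) + F (i - 1).
Proof.
rewrite sum3; have [->|->|->] := I3P i; rewrite !I3_succ //.
  by rewrite [RHS]addrC addrA.
by rewrite -[RHS]addrA addrC.
Qed.

Definition tri p : set (R * R) := [set x | exists lam : 'I_3 -> R,
  [/\ forall i, 0 <= lam i, \sum_i lam i = 1 & x = \sum_i lam i *: p i]].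

Definition tdet p := cross (p 1 - p 0) (p 2 - p 0).

Lemma tdetE p i : tdet p = cross (p (i + 1) - p i) (p (i - 1) - p i).
Proof.
rewrite /tdet /cross; have [->|->|->] := I3P i; rewrite !I3_succ !coordE; ring.
Qed.

(** A ratio of signed areas, so an explicit affine function of [x]: no linear system has to be
    solved, and it is meaningful outside the triangle too. *)
Definition bary p i x := cross (p (i + 1) - x) (p (i - 1) - x) / tdet p.

Lemma bary_affine p i x :
  bary p i x = (p (i + 1) - p (i - 1)).2 / tdet p * x.1
    + (p (i - 1) - p (i + 1)).1 / tdet p * x.2 + cross (p (i + 1)) (p (i - 1)) / tdet p.
Proof. rewrite /bary /cross !coordE; ring. Qed.

Lemma bary_sum p x : tdet p != 0 -> \sum_i bary p i x = 1.
Proof.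
move=> d0; rewrite sum3 /bary -!mulrDl -[RHS](divff d0); congr (_ / _).
rewrite !I3_succ /tdet /cross !coordE; ring.
Qed.

Lemma bary_comb p x : tdet p != 0 -> x = \sum_i bary p i x *: p i.
Proof.
rewrite sum3 /bary !I3_succ => d0; apply: pair_eqP; move: d0;
  rewrite /tdet /cross !coordE => d0; field=> //.
Qed.

Lemma bary_of p (lam : 'I_3 -> R) i : tdet p != 0 -> \sum_j lam j = 1 ->
  bary p i (\sum_j lam j *: p j) = lam i.
Proof.
move=> d0; rewrite (sum3_at _ i) => hs.
have E : lam i = 1 - lam (i + 1) - lam (i - 1) by rewrite -hs; ring.
apply: (mulIf d0); rewrite /bary mulfVK // (tdetE p i) (sum3_at _ i) E /cross !coordE; ring.
Qed.

Lemma triP p x : tdet p != 0 -> tri p x <-> forall i, 0 <= bary p i x.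
Proof.
move=> d0; split => [[lam [l0 l1 ->]] i|h]; first by rewrite bary_of.
by exists (bary p ^~ x); split => //; [exact: bary_sum|exact: bary_comb].
Qed.

(** Coordinates adapted to edge [i]: [s] is the barycentric coordinate that vanishes on the edge,
    [t] runs along it from vertex [i + 1] to vertex [i - 1]. *)
Definition tpt p i (s t : R) := p (i + 1) + s *: (p i - p (i + 1)) + t *: (p (i - 1) - p (i + 1)).

Lemma bary_tpt p i s t : tdet p != 0 ->
  [/\ bary p i (tpt p i s t) = s, bary p (i - 1) (tpt p i s t) = t &
      bary p (i + 1) (tpt p i s t) = 1 - s - t].
Proof.
move=> d0.
pose lam := fun j : 'I_3 => if j == i then s else if j == i - 1 then t else 1 - s - t.
have n1 : (i - 1 == i) = false by have [->|->|->] := I3P i; rewrite ?I3_succ.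
have n2 : (i + 1 == i) = false by have [->|->|->] := I3P i; rewrite ?I3_succ.
have n3 : (i + 1 == i - 1) = false by have [->|->|->] := I3P i; rewrite ?I3_succ.
have l1 : lam i = s by rewrite /lam eqxx.
have l2 : lam (i - 1) = t by rewrite /lam n1 eqxx.
have l3 : lam (i + 1) = 1 - s - t by rewrite /lam n2 n3.
have hs : \sum_j lam j = 1 by rewrite (sum3_at _ i) l1 l2 l3; ring.
have -> : tpt p i s t = \sum_j lam j *: p j.
  by rewrite (sum3_at _ i) l1 l2 l3; apply: pair_eqP; rewrite /tpt !coordE; ring.
by rewrite !bary_of.
Qed.

Lemma continuous_bary p i : continuous (bary p i).
Proof.
have -> : bary p i = fun x => (p (i + 1) - p (i - 1)).2 / tdet p * x.1
    + (p (i - 1) - p (i + 1)).1 / tdet p * x.2 + cross (p (i + 1)) (p (i - 1)) / tdet p.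
  by apply/funext => x; exact: bary_affine.
move=> x; apply: cvgD; last exact: cvg_cst.
by apply: cvgD; apply: cvgM; [exact: cvg_cst|exact: cvg_fst|exact: cvg_cst|exact: cvg_snd].
Qed.

Lemma bary_le1 p i x : tdet p != 0 -> tri p x -> bary p i x <= 1.
Proof.
move=> d0 /(triP _ d0) h; rewrite -(bary_sum x d0) (sum3_at _ i) -addrA lerDl.
by rewrite addr_ge0.
Qed.

Lemma tri_closed p : tdet p != 0 -> closed (tri p).
Proof.
move=> d0; have -> : tri p = \bigcap_(i in [set: 'I_3]) (bary p i @^-1` [set t | 0 <= t]).
  by apply/seteqP; split => x; [move/(triP _ d0) => h i _; exact: h|move=> h; apply/(triP _ d0) => i; exact: h].
apply: closed_bigI => i _; apply: preimage_closed; last exact: closed_ge.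
by move=> x _; exact: continuous_bary.
Qed.

Lemma tri_bounded p x : tri p x -> enorm x <= \sum_i enorm (p i).
Proof.
move=> [lam [l0 l1 ->]].
have h i : enorm (lam i *: p i) <= enorm (p i).
  rewrite enormZ ger0_norm // ler_piMl ?enorm_ge0 // -l1 (sum3_at _ i) -addrA lerDl.
  by rewrite addr_ge0.
rewrite !sum3; apply: (le_trans (ler_enormD _ _)); apply: lerD => //.
by apply: (le_trans (ler_enormD _ _)); apply: lerD.
Qed.

Lemma tri_compact p : tdet p != 0 -> compact (tri p).
Proof. by move=> d0; apply: heine_borel2 (tri_closed d0) (@tri_bounded p). Qed.

Lemma tri_interior p x : tdet p != 0 -> (forall i, 0 < bary p i x) -> (tri p)° x.
Proof.
move=> d0 h; have H : \forall y \near x, forall i, 0 < bary p i y.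
  have n i : \forall y \near x, 0 < bary p i y.
    exact: (continuous_bary (x := x) (open_nbhs_nbhs (conj (@open_gt _ 0) (h i)))).
  near=> y => i; have [->|->|->] := I3P i; near: y; exact: n.
by apply: filterS H => y hy; apply/(triP _ d0) => i; exact: ltW.
Unshelve. all: by end_near. Qed.

End Triangle.

(** * Continuity relative to a subset *)

Section Within_continuity.
Context {R : realType}.

Lemma within_comp (X Y Z : topologicalType) (A : set X) (B : set Y) (g : X -> Y) (f : Y -> Z) :
  {within A, continuous g} -> (forall x, A x -> B (g x)) ->
  {within B, continuous f} -> {within A, continuous (f \o g)}.
Proof.
move=> /subspace_continuousP cg gAB /subspace_continuousP cf; apply/subspace_continuousP => x Ax V nV.
have h1 := cf _ (gAB _ Ax) V nV.
have h2 := cg _ Ax _ h1.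
rewrite /nbhs /= /within /= in h2 *; near=> z => Az.
have h3 : A z -> B (g z) -> V (f (g z)) by near: z; exact: h2.
by apply: h3 => //; exact: gAB.
Unshelve. all: by end_near. Qed.

Lemma within_dist (B : set (R * R)) (f : R * R -> R) (y : R * R) (e : R) :
  {within B, continuous f} -> B y -> 0 < e ->
  exists2 d : R, 0 < d & forall z, B z -> dist z y < d -> `|f z - f y| < e.
Proof.
move=> /subspace_continuousP cf By e0.
have /nbhs_eballP[d d0 hd] : nbhs y [set z | B z -> `|f z - f y| < e].
  have := cf y By; move=> /cvgrPdist_lt /(_ e e0); rewrite near_withinE.
  by apply: filterS => z h Bz; rewrite distrC; exact: h.
by exists d => // z Bz h; apply: hd Bz.
Qed.

End Within_continuity.

(** * Integration of bounded measurable functions *)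

Section Bounded_measurable.
Context d (T : measurableType d) (R : realType).
Implicit Types (D : set T) (f g : T -> R).

(** Nearly all integrands below are bounded and measurable on a set of finite measure; this class is
    closed under the ring operations, so one predicate replaces the integrability conditions. *)
Definition bm D f := measurable_fun D f /\ exists M : R, forall x, D x -> `|f x| <= M.

Lemma bmD D f g : bm D f -> bm D g -> bm D (fun x => f x + g x).
Proof.
move=> [mf [M hM]] [mg [M' hM']]; split; first exact: measurable_funD.
exists (M + M') => x Dx; apply: (le_trans (ler_normD _ _)).
by apply: lerD; [exact: hM|exact: hM'].
Qed.

Lemma bmM D f g : bm D f -> bm D g -> bm D (fun x => f x * g x).
Proof.
move=> [mf [M hM]] [mg [M' hM']]; split; first exact: measurable_funM.
by exists (M * M') => x Dx; rewrite normrM ler_pM ?hM ?hM'.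
Qed.

Lemma bm_cst D (a : R) : bm D (fun=> a).
Proof. by split; [exact: measurable_cst|exists `|a|]. Qed.

Lemma bmN D f : bm D f -> bm D (fun x => - f x).
Proof.
move=> [mf [M hM]]; split; first exact: measurableT_comp.
by exists M => x Dx; rewrite normrN hM.
Qed.

Lemma bmB D f g : bm D f -> bm D g -> bm D (fun x => f x - g x).
Proof. by move=> bf bg; exact: bmD bf (bmN bg). Qed.

Lemma bmZ D (a : R) f : bm D f -> bm D (fun x => a * f x).
Proof. by move=> bf; exact: bmM (bm_cst _ _) bf. Qed.

Lemma bmX D f n : bm D f -> bm D (fun x => f x ^+ n).
Proof.
move=> bf; elim: n => [|n IH]; first by under eq_fun do rewrite expr0; exact: bm_cst.
by under eq_fun do rewrite exprS; exact: bmM.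
Qed.

Lemma bm_norm D f : bm D f -> bm D (fun x => `|f x|).
Proof.
move=> [mf [M hM]]; split; first exact: measurableT_comp.
by exists M => x Dx; rewrite normr_id hM.
Qed.

Lemma bm_sum D (I : Type) (r : seq I) (P : pred I) (F : I -> T -> R) :
  (forall i, P i -> bm D (F i)) -> bm D (fun x => \sum_(i <- r | P i) F i x).
Proof.
move=> bF; elim: r => [|i r IH].
  by under eq_fun do rewrite big_nil; exact: bm_cst.
under eq_fun do rewrite big_cons.
by case: (boolP (P i)) => // Pi; apply: bmD => //; exact: bF.
Qed.

Lemma bm_ext D f g : (forall x, D x -> f x = g x) -> bm D f -> bm D g.
Proof.
move=> fg [mf [M hM]]; split.
  by apply: eq_measurable_fun mf => x /set_mem; exact: fg.
by exists M => x Dx; rewrite -fg // hM.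
Qed.

Lemma bm_sub D D' f : measurable D -> D' `<=` D -> bm D f -> bm D' f.
Proof.
move=> mD DD [mf [M hM]]; split; first exact: measurable_funS mf.
by exists M => x /DD; exact: hM.
Qed.

Context (mu : {measure set T -> \bar R}).
Context (D : set T) (mD : measurable D) (fD : (mu D < +oo)%E).
Implicit Types (h k : T -> R).

Lemma bm_integrable h : bm D h -> mu.-integrable D (EFin \o h).
Proof.
move=> [mh [M hM]]; apply: measurable_bounded_integrable => //.
exists M; split; first exact: num_real.
by move=> N MN x Dx /=; exact: le_trans (hM _ Dx) (ltW MN).
Qed.

Lemma RintD h k : bm D h -> bm D k ->
  \int[mu]_(x in D) (h x + k x) = \int[mu]_(x in D) h x + \int[mu]_(x in D) k x.
Proof. by move=> bh bk; apply: RintegralD => //; exact: bm_integrable. Qed.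

Lemma RintB h k : bm D h -> bm D k ->
  \int[mu]_(x in D) (h x - k x) = \int[mu]_(x in D) h x - \int[mu]_(x in D) k x.
Proof. by move=> bh bk; apply: RintegralB => //; exact: bm_integrable. Qed.

Lemma RintZ (a : R) h : bm D h ->
  \int[mu]_(x in D) (a * h x) = a * \int[mu]_(x in D) h x.
Proof. by move=> bh; apply: RintegralZl => //; exact: bm_integrable. Qed.

Lemma Rint_sum (I : Type) (r : seq I) (P : pred I) (F : I -> T -> R) :
  (forall i, P i -> bm D (F i)) ->
  \int[mu]_(x in D) (\sum_(i <- r | P i) F i x) =
  \sum_(i <- r | P i) \int[mu]_(x in D) F i x.
Proof.
move=> bF; elim: r => [|i r IH].
  rewrite big_nil; under eq_Rintegral do rewrite big_nil.
  by rewrite Rintegral_cst // mul0r.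
rewrite big_cons; under eq_Rintegral do rewrite big_cons.
case: ifPn => // Pi; rewrite RintD ?IH //; first exact: bF.
exact: bm_sum.
Qed.

Lemma Rint_le h k : bm D h -> bm D k -> (forall x, D x -> h x <= k x) ->
  \int[mu]_(x in D) h x <= \int[mu]_(x in D) k x.
Proof. by move=> bh bk hk; apply: le_Rintegral => //; exact: bm_integrable. Qed.

Lemma Rint_norm h : bm D h ->
  `|\int[mu]_(x in D) h x| <= \int[mu]_(x in D) `|h x|.
Proof. by move=> bh; apply: le_normr_Rintegral => //; exact: bm_integrable. Qed.

(** Pointwise |hk| <= t h^2 + k^2/t. The factor 1/2 is given up and no square root appears; the free
    weight [t] takes the place of the Cauchy-Schwarz inequality in the later estimates. *)
Lemma Rint_young (t : R) h k : 0 < t -> bm D h -> bm D k ->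
  `|\int[mu]_(x in D) (h x * k x)| <=
  t * \int[mu]_(x in D) (h x ^+ 2) + t^-1 * \int[mu]_(x in D) (k x ^+ 2).
Proof.
move=> t0 bh bk; apply: (le_trans (Rint_norm (bmM bh bk))).
rewrite -!RintZ -?RintD; try by [exact: bmX|exact: bmZ (bmX _ _)].
apply: Rint_le; first exact: bm_norm (bmM bh bk).
  by apply: bmD; apply: bmZ; exact: bmX.
move=> x Dx; rewrite normrM.
have -> : t^-1 * k x ^+ 2 = t * (t^-1 * `|k x|) ^+ 2.
  rewrite exprMn real_normK ?num_real // expr2 !mulrA divff ?gt_eqF //.
  by rewrite mul1r.
have -> : `|h x| * `|k x| = t * (`|h x| * (t^-1 * `|k x|)).
  by rewrite mulrCA (mulrA t) divff ?gt_eqF // mul1r.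
rewrite -(real_normK (num_real (h x))) -mulrDr ler_pM2l //.
by move: `|h x| (t^-1 * `|k x|) => u v; nra.
Qed.

End Bounded_measurable.

(** * Borel measurability in the plane *)

Section Plane_measurability.
Context {R : realType}.
Implicit Types (A D : set (R * R)) (f : R * R -> R).

Lemma nbhs_rect A (x : R * R) : nbhs x A -> exists2 e : R, 0 < e &
  forall y : R * R, `|y.1 - x.1| < e -> `|y.2 - x.2| < e -> A y.
Proof.
move=> /nbhs_ballP[e /= e0 he]; exists e => // y y1 y2; apply: he.
by split => /=; rewrite /ball /= distrC.
Qed.

(** The measurable sets come from the product structure, so an open set is written as the countable
    union of the rational open rectangles contained in it. *)
Lemma open_measurable2 A : open A -> measurable A.
Proof.
move=> oA.
pose F (q : rat * rat * (rat * rat)) : set (R * R) :=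
  `]ratr q.1.1, ratr q.1.2[%classic `*` `]ratr q.2.1, ratr q.2.2[%classic.
pose G q := if `[< F q `<=` A >] then F q else set0.
have -> : A = \bigcup_q G q.
  apply/seteqP; split => [x Ax|x [q _]]; last first.
    by rewrite /G; case: asboolP => // h /h.
  have := nbhs_rect (open_nbhs_nbhs (conj oA Ax)) => -[e e0 he].
  have [a ha] := @rat_in_itvoo R (x.1 - e) x.1 ltac:(lra).
  have [b hb] := @rat_in_itvoo R x.1 (x.1 + e) ltac:(lra).
  have [c hc] := @rat_in_itvoo R (x.2 - e) x.2 ltac:(lra).
  have [d hd] := @rat_in_itvoo R x.2 (x.2 + e) ltac:(lra).
  move: ha hb hc hd; rewrite !in_itv /= => /andP[a1 a2] /andP[b1 b2] /andP[c1 c2] /andP[d1 d2].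
  have FA : F ((a, b), (c, d)) `<=` A.
    move=> y [/=]; rewrite !in_itv /= => /andP[y1 y2] /andP[y3 y4].
    by apply: he; rewrite ltr_norml; apply/andP; split; lra.
  exists ((a, b), (c, d)) => //; rewrite /G; case: asboolP => // _.
  by split => /=; rewrite in_itv /=; apply/andP.
apply: countable_bigcupT_measurable; first exact: countableP.
move=> q; rewrite /G; case: asboolP => // _.
by apply: measurableX; exact: measurable_itv.
Qed.

Lemma closed_measurable2 A : closed A -> measurable A.
Proof. by move/closed_openC/open_measurable2/measurableC; rewrite setCK. Qed.

Lemma cont_measurable2 D f : measurable D -> {within D, continuous f} -> measurable_fun D f.
Proof.
move=> mD /continuousP cf; apply: (measurability _ (RGenOpens.measurableE R)).
move=> _ [_ [a [b ->] <-]].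
have /cf /open_subspaceP [V oV VD] : open (`]a, b[%classic : set R) by exact: interval_open.
rewrite setIC -VD; apply: measurableI => //; exact: open_measurable2.
Qed.

Lemma bm_cont D f : compact D -> {within D, continuous f} -> bm D f.
Proof.
move=> cD cf; split.
  apply: cont_measurable2 cf; apply: closed_measurable2.
  by apply: compact_closed cD; exact: norm_hausdorff.
have [->|/set0P D0] := eqVneq D set0; first by exists 0.
have [|M _ hM] := @compact_EVT_max _ R (fun x => `|f x|) D D0 cD.
  by move=> x; apply: continuous_comp; [exact: cf|exact: norm_continuous].
by exists `|f M| => x Dx; apply: hM; exact: mem_set.
Qed.

Lemma leb2_fin D (r : R) : measurable D ->
  (forall x, D x -> `|x.1| <= r /\ `|x.2| <= r) -> (leb2 D < +oo)%E.
Proof.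
move=> mD hD.
have DD : D `<=` `[- r, r]%classic `*` `[- r, r]%classic.
  by move=> x /hD[]; rewrite !ler_norml => h1 h2; split => /=; rewrite in_itv.
apply: (@le_lt_trans _ _ (leb2 (`[- r, r]%classic `*` `[- r, r]%classic))).
  by apply: le_measure => //; rewrite inE //; apply: measurableX; exact: measurable_itv.
rewrite product_measure1E; [|exact: measurable_itv..].
have h : (@lebesgue_measure R `[(- r)%R, r]%classic < +oo)%E.
  by rewrite lebesgue_measure_itv /=; case: ifP => _; rewrite -?EFinB ltry.
by apply: lte_mul_pinfty => //; rewrite ge0_fin_numE.
Qed.

End Plane_measurability.

(** * Affine change of variables on the line *)

Section Affine_1D.
Context {R : realType}.
Local Notation mu := (@lebesgue_measure R).

Lemma affine_measurable (a b : R) : measurable_fun setT (fun x : R => a * x + b).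
Proof.
apply: continuous_measurable_fun => x.
by apply: cvgD; [apply: cvgM; [exact: cvg_cst|exact: cvg_id]|exact: cvg_cst].
Qed.

(** By uniqueness of Lebesgue measure: the push-forward under the affine map, rescaled by |a|, has
    the right value on half-open intervals. *)
Lemma leb1_affine (a b : R) (A : set R) : a != 0 -> measurable A ->
  mu ((fun x : R => a * x + b) @^-1` A) = ((`|a|^-1)%:E * mu A)%E.
Proof.
move=> a0 mA.
have na : 0 < `|a| by rewrite normr_gt0.
have mf : measurable_fun setT ((fun x : R => a * x + b) : measurableTypeR R -> measurableTypeR R).
  exact: affine_measurable.
pose nu := pushforward mu ((fun x : R => a * x + b) : measurableTypeR R -> measurableTypeR R).
pose m := mscale (NngNum (ltW na)) nu.
suff H : forall X : set R, ocitv X -> mu X = m mf X.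
  have := @lebesgue_measure_unique R (m mf) H A mA.
  rewrite /m /mscale /nu /= /pushforward => ->.
  by rewrite muleA -EFinM mulVf ?gt_eqF // mul1e.
move=> _ [[c d] /= _ <-]; rewrite /m /mscale /nu /= /pushforward.
have [a_gt|a_lt] := ltP 0 a.
  have -> : (fun x : R => a * x + b) @^-1` `]c, d] = `](c - b) / a, (d - b) / a]%classic.
    apply/seteqP; split => x /=; rewrite !in_itv /= ltr_pdivrMr // ler_pdivlMr // => /andP[h1 h2]; apply/andP; split; lra.
  rewrite !lebesgue_measure_itv /= !lte_fin ltr_pM2r ?invr_gt0 // ltrD2r.
  case: ifP => _; last by rewrite mule0.
  by rewrite -!EFinB -EFinM gtr0_norm // -mulrBl; congr EFin; field; lra.
have a_neg : a < 0 by rewrite lt_neqAle a0.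
have -> : (fun x : R => a * x + b) @^-1` `]c, d] = `[(d - b) / a, (c - b) / a[%classic.
  by apply/seteqP; split => x /=; rewrite !in_itv /= ltr_ndivlMr // ler_ndivrMr // => /andP[h1 h2]; apply/andP; split; lra.
rewrite !lebesgue_measure_itv /= !lte_fin ltr_nM2r ?invr_lt0 // ltrD2r.
case: ifP => _; last by rewrite mule0.
by rewrite -!EFinB -EFinM ltr0_norm // -mulrBl; congr EFin; field; lra.
Qed.

Lemma ge0_integral_affine (a b : R) (f : R -> \bar R) : a != 0 ->
  measurable_fun setT f -> (forall x, 0 <= f x)%E ->
  (\int[mu]_x f (a * x + b)%R = (`|a|^-1)%:E * \int[mu]_x f x)%E.
Proof.
move=> a0 mf f0.
have na : 0 < `|a| by rewrite normr_gt0.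
have mg : measurable_fun setT ((fun x : R => a * x + b) : measurableTypeR R -> measurableTypeR R).
  exact: affine_measurable.
have iv : 0 <= `|a|^-1 by rewrite invr_ge0.
rewrite -(@ge0_integral_mscale _ _ _ mu setT measurableT (NngNum iv)) //.
have := @ge0_integral_pushforward _ _ _ _ R _ mg mu setT f measurableT mf (fun x _ => f0 x).
rewrite preimage_setT /= => <-.
by apply: eq_measure_integral => //= A mA _; rewrite /mscale /=; exact: (leb1_affine b a0 mA).
Qed.

End Affine_1D.

(** * Affine change of variables in the plane *)

Section Affine_2D.
Context {R : realType}.
Local Notation mu := (@lebesgue_measure R).
Local Open Scope ereal_scope.

Lemma tonelli (f : R * R -> \bar R) : measurable_fun setT f -> (forall x, 0 <= f x) ->
  \int[leb2]_z f z = \int[mu]_x \int[mu]_y f (x, y).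
Proof. by move=> mf f0; rewrite fubini_tonelli1. Qed.

Lemma tonelli_swap (f : R * R -> \bar R) : measurable_fun setT f -> (forall x, 0 <= f x) ->
  \int[mu]_x \int[mu]_y f (x, y) = \int[mu]_y \int[mu]_x f (x, y).
Proof. by move=> mf f0; rewrite fubini_tonelli. Qed.

Lemma affine2_measurable (a b c d e f : R) :
  measurable_fun setT (fun z : R * R => ((a * z.1 + b * z.2 + e)%R, (c * z.1 + d * z.2 + f)%R)).
Proof.
have m (p q r : R) : measurable_fun setT (fun z : R * R => (p * z.1 + q * z.2 + r)%R).
  apply: measurable_funD; last exact: measurable_cst.
  by apply: measurable_funD; apply: measurable_funM; (exact: measurable_cst || exact: measurable_fst || exact: measurable_snd).
exact: measurable_fun_pair.
Qed.

(** For [d != 0] the map is resolved into one-variable affine maps: for a fixed first coordinate the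
    inner integral has slope [d]; after exchanging the integrals the other one has slope
    [a - b * c / d], the Schur complement, and the product of both slopes is the determinant. *)
Let aux (a b c d e f : R) (F : R * R -> \bar R) : d != 0%R -> (a * d - b * c != 0)%R ->
  measurable_fun setT F -> (forall x, 0 <= F x) ->
  \int[leb2]_z F ((a * z.1 + b * z.2 + e)%R, (c * z.1 + d * z.2 + f)%R) =
  (`|a * d - b * c|^-1)%:E * \int[leb2]_z F z.
Proof.
move=> d0 det0 mF F0.
have mFa (p q r p' q' r' : R) : measurable_fun setT
    (fun z : R * R => F ((p * z.1 + q * z.2 + r)%R, (p' * z.1 + q' * z.2 + r')%R)).
  exact: measurableT_comp mF (affine2_measurable _ _ _ _ _ _).
rewrite (tonelli (mFa a b e c d f) (fun=> F0 _)) /=.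
pose al := (a - b * c / d)%R.
have al0 : al != 0%R.
  apply: contra det0 => /eqP; rewrite /al => h; apply/eqP.
  have : (d * (a - b * c / d) = 0)%R by rewrite h mulr0.
  by rewrite mulrBr (mulrCA d) divff // mulr1 [(d * a)%R]mulrC.
pose H z := F ((al * z.1 + (b / d) * z.2 + (e - b * f / d))%R, (0 * z.1 + 1 * z.2 + 0)%R).
have mH : measurable_fun setT H by exact: mFa.
have Hsec x : measurable_fun setT (fun y => H (x, y)).
  exact: measurable_fun_pair2 mH.
have Hsec2 y : measurable_fun setT (fun x => F (x, y)).
  exact: measurable_fun_pair1 mF.
transitivity (\int[mu]_x ((`|d|^-1)%:E * \int[mu]_y H (x, y))).
  apply: eq_integral => x _.
  rewrite -(@ge0_integral_affine R d (c * x + f) (fun y => H (x, y))) //; last by move=> y; exact: F0.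
  apply: eq_integral => y _; rewrite /H /=; congr F; congr pair; [rewrite /al; field=> //|ring].
rewrite ge0_integralZl_EFin //; try first [by move=> x _; apply: integral_ge0 => y _; exact: F0
  | exact: (@measurable_fun_fubini_tonelli_F _ _ _ _ R mu H mH (fun z => F0 _))].
rewrite (@tonelli_swap H) //; last by move=> z; exact: F0.
transitivity ((`|d|^-1)%:E * \int[mu]_y ((`|al|^-1)%:E * \int[mu]_x F (x, y))).
  congr (_ * _); apply: eq_integral => y _.
  rewrite -(@ge0_integral_affine R al ((b / d) * y + (e - b * f / d)) (fun x => F (x, y))) //.
  apply: eq_integral => x _; rewrite /H /=; congr F; congr pair; ring.
rewrite ge0_integralZl_EFin //; try first [by move=> x _; apply: integral_ge0 => y _; exact: F0
  | exact: (@measurable_fun_fubini_tonelli_G _ _ _ _ R mu F mF F0)].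
rewrite -tonelli_swap // -tonelli // muleA -EFinM -invfM -normrM; congr ((_^-1)%:E * _).
by congr (`|_|%R); rewrite /al; field=> //.
Qed.

Lemma tonelli_sym (F : R * R -> \bar R) :
  measurable_fun setT F -> (forall x, 0 <= F x) ->
  \int[leb2]_z F (z.2, z.1) = \int[leb2]_z F z.
Proof.
move=> mF F0; rewrite tonelli //=; last first.
  apply: (measurableT_comp mF); apply: measurable_fun_pair; [exact: measurable_snd|exact: measurable_fst].
by rewrite -tonelli_swap // -tonelli.
Qed.

(** If [d = 0] then [b != 0], and exchanging the two target coordinates reduces to the previous
    case. *)
Lemma ge0_integral_affine2 (a b c d e f : R) (F : R * R -> \bar R) : (a * d - b * c != 0)%R ->
  measurable_fun setT F -> (forall x, 0 <= F x) ->
  \int[leb2]_z F ((a * z.1 + b * z.2 + e)%R, (c * z.1 + d * z.2 + f)%R) =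
  (`|a * d - b * c|^-1)%:E * \int[leb2]_z F z.
Proof.
move=> det0 mF F0; have [d0|d0] := eqVneq d 0%R; last exact: aux.
have b0 : b != 0%R by apply: contraNneq det0 => ->; rewrite d0 mulr0 mul0r subrr.
pose F' (z : R * R) := F (z.2, z.1).
have mF' : measurable_fun setT F'.
  apply: (measurableT_comp mF); apply: measurable_fun_pair; [exact: measurable_snd|exact: measurable_fst].
have det1 : (c * b - d * a != 0)%R by rewrite -oppr_eq0 opprB mulrC [(c * b)%R]mulrC.
have := @aux c d a b f e F' b0 det1 mF' (fun z => F0 _); rewrite {1}/F' /= => ->.
by rewrite /F' tonelli_sym // distrC [(c * b)%R]mulrC [(d * a)%R]mulrC.
Qed.

End Affine_2D.

(** * Integrals over plane sets of finite measure *)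

Section Plane_integral.
Context {R : realType}.
Context (D : set (R * R)) (mD : measurable D) (fD : (leb2 D < +oo)%E).
Implicit Types (h k : R * R -> R).

Lemma integrable2 h : bm D h -> leb2.-integrable D (EFin \o h).
Proof. by move=> bh; exact: (@bm_integrable _ (measurableTypeR R * measurableTypeR R)%type R leb2 D mD fD). Qed.

Lemma Rint2D h k : bm D h -> bm D k ->
  \int[leb2]_(x in D) (h x + k x) = \int[leb2]_(x in D) h x + \int[leb2]_(x in D) k x.
Proof. by move=> bh bk; exact: (@RintD _ (measurableTypeR R * measurableTypeR R)%type R leb2 D mD fD). Qed.

Lemma Rint2Z (a : R) h : bm D h ->
  \int[leb2]_(x in D) (a * h x) = a * \int[leb2]_(x in D) h x.
Proof. by move=> bh; exact: (@RintZ _ (measurableTypeR R * measurableTypeR R)%type R leb2 D mD fD). Qed.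

Lemma Rint2_sum (I : Type) (r : seq I) (P : pred I) (F : I -> R * R -> R) :
  (forall i, P i -> bm D (F i)) ->
  \int[leb2]_(x in D) (\sum_(i <- r | P i) F i x) =
  \sum_(i <- r | P i) \int[leb2]_(x in D) F i x.
Proof. by move=> bh; exact: (@Rint_sum _ (measurableTypeR R * measurableTypeR R)%type R leb2 D mD fD). Qed.

Lemma Rint2_le h k : bm D h -> bm D k -> (forall x, D x -> h x <= k x) ->
  \int[leb2]_(x in D) h x <= \int[leb2]_(x in D) k x.
Proof. by move=> bh bk; exact: (@Rint_le _ (measurableTypeR R * measurableTypeR R)%type R leb2 D mD fD). Qed.

Lemma Rint2_young (t : R) h k : 0 < t -> bm D h -> bm D k ->
  `|\int[leb2]_(x in D) (h x * k x)| <=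
  t * \int[leb2]_(x in D) (h x ^+ 2) + t^-1 * \int[leb2]_(x in D) (k x ^+ 2).
Proof. by move=> t0 bh bk; exact: (@Rint_young _ (measurableTypeR R * measurableTypeR R)%type R leb2 D mD fD). Qed.

End Plane_integral.

(** * Integrals over the unit interval *)

Section Unit_interval_integral.
Context {R : realType}.
Local Notation I := (`[0, 1]%classic : set R).
Implicit Types (h k : R -> R).

Lemma unit_itv_fin : (@lebesgue_measure R I < +oo)%E.
Proof. by rewrite lebesgue_measure_itv /= lte_fin ltr01 -EFinB ltry. Qed.

Let mI : measurable I. Proof. exact: measurable_itv. Qed.

Lemma bm_itv h : {within I, continuous h} -> bm I h.
Proof.
move=> ch; split; first exact: subspace_continuous_measurable_fun.
have [|c _ hc] := @EVT_max R (fun x => `|h x|) 0 1 ler01.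
  by move=> x; apply: continuous_comp; [exact: ch|exact: norm_continuous].
by exists `|h c| => x Ix; exact: hc.
Qed.

Lemma Rint1D h k : bm I h -> bm I k ->
  \int[leb1]_(x in I) (h x + k x) = \int[leb1]_(x in I) h x + \int[leb1]_(x in I) k x.
Proof. by move=> bh bk; exact: (@RintD _ (measurableTypeR R) R lebesgue_measure I mI unit_itv_fin). Qed.

Lemma Rint1B h k : bm I h -> bm I k ->
  \int[leb1]_(x in I) (h x - k x) = \int[leb1]_(x in I) h x - \int[leb1]_(x in I) k x.
Proof. by move=> bh bk; exact: (@RintB _ (measurableTypeR R) R lebesgue_measure I mI unit_itv_fin). Qed.

Lemma Rint1Z (a : R) h : bm I h ->
  \int[leb1]_(x in I) (a * h x) = a * \int[leb1]_(x in I) h x.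
Proof. by move=> bh; exact: (@RintZ _ (measurableTypeR R) R lebesgue_measure I mI unit_itv_fin). Qed.

Lemma Rint1_le h k : bm I h -> bm I k -> (forall x, 0 <= x <= 1 -> h x <= k x) ->
  \int[leb1]_(x in I) h x <= \int[leb1]_(x in I) k x.
Proof. by move=> bh bk hk; apply: (@Rint_le _ (measurableTypeR R) R lebesgue_measure I mI unit_itv_fin) => // x; rewrite /= in_itv /=; exact: hk. Qed.

Lemma Rint1_cst (a : R) : \int[@lebesgue_measure R]_(x in I) a = a.
Proof.
rewrite Rintegral_cst //= /fine; have := @lebesgue_measure_itv R `[0, 1]; rewrite /= => ->.
by rewrite lte_fin ltr01 /= subr0 mulr1.
Qed.

Lemma Rint1_young (t : R) h k : 0 < t -> bm I h -> bm I k ->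
  `|\int[leb1]_(x in I) (h x * k x)| <=
  t * \int[leb1]_(x in I) (h x ^+ 2) + t^-1 * \int[leb1]_(x in I) (k x ^+ 2).
Proof. by move=> t0 bh bk; exact: (@Rint_young _ (measurableTypeR R) R lebesgue_measure I mI unit_itv_fin). Qed.

Lemma Rint1_rev h : measurable_fun I h ->
  \int[leb1]_(x in I) h (1 - x) = \int[leb1]_(x in I) h x.
Proof.
move=> mh; rewrite [LHS]Rintegral_mkcond [RHS]Rintegral_mkcond.
have mF : measurable_fun setT (h \_ I) by apply/(measurable_restrictT h mI).
have a0 : (-1 : R) != 0 by rewrite oppr_eq0 oner_neq0.
have mE : measurable_fun setT (EFin \o (h \_ I)) by apply/measurable_EFinP.
rewrite /Rintegral; congr fine; rewrite integralE [RHS]integralE; congr (_ - _)%E.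
  rewrite -[RHS](mul1e) -(_ : (`|(-1 : R)|^-1)%:E = 1%E); last by rewrite normrN1 invr1.
  rewrite -(@ge0_integral_affine R (-1) 1 _ a0 (measurable_funepos mE) (fun=> funepos_ge0 _ _)).
  apply: eq_integral => x _; rewrite !funeposE /= /patch !mem_setE !in_itv /=.
  have -> : -1 * x + 1 = 1 - x by ring.
  have -> : (0 <= 1 - x <= 1) = (0 <= x <= 1) by apply/idP/idP => /andP[? ?]; apply/andP; split; lra.
  by [].
rewrite -[RHS](mul1e) -(_ : (`|(-1 : R)|^-1)%:E = 1%E); last by rewrite normrN1 invr1.
rewrite -(@ge0_integral_affine R (-1) 1 _ a0 (measurable_funeneg mE) (fun=> funeneg_ge0 _ _)).
apply: eq_integral => x _; rewrite !funenegE /= /patch !mem_setE !in_itv /=.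
have -> : -1 * x + 1 = 1 - x by ring.
have -> : (0 <= 1 - x <= 1) = (0 <= x <= 1) by apply/idP/idP => /andP[? ?]; apply/andP; split; lra.
by [].
Qed.

End Unit_interval_integral.

(** * Almost everywhere statements in the plane *)

Section Almost_everywhere.
Context {R : realType}.

Lemma leb2_ae_imp (P Q : R * R -> Prop) : (forall x, P x -> Q x) ->
  {ae leb2, forall x, P x} -> {ae leb2, forall x, Q x}.
Proof.
move=> PQ; apply: (@negligibleS _ (measurableTypeR R * measurableTypeR R)%type R leb2) => x nQ Px. exact/nQ/PQ. Qed.
Lemma leb2_ae_and (P Q : R * R -> Prop) : 
  {ae leb2, forall x, P x} -> {ae leb2, forall x, Q x} -> {ae leb2, forall x, P x /\ Q x}.
Proof.
move=> hP hQ. 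
have := (@negligibleU _ (measurableTypeR R * measurableTypeR R)%type R leb2) _ _ hP hQ.
apply: (@negligibleS _ (measurableTypeR R * measurableTypeR R)%type R leb2) => x /not_andP[h|h]; [by left|by right]. Qed.
End Almost_everywhere.

(** * Smooth functions that are flat at the origin *)

Section Flat_function.
Context {R : realType}.
Implicit Types (q : {poly R}) (x h : R).

(** The functions q(1/x) exp(-1/x), extended by zero to x <= 0. Carrying the polynomial [q] along
    makes the family closed under differentiation, which gives the derivatives of all orders at
    once. *)
Definition flat q x : R := if 0 < x then q.[x^-1] * expR (- x^-1) else 0.

(** The exponential series gives y^(n+2)/(n+2)! <= e^y, hence a decay of order y^(-2) that survives
    multiplication by any polynomial; with y = 1/x this is the quadratic bound that forces the
    derivative at 0 to vanish. *)
Lemma horner_expR_bound q : exists2 C : R, 0 <= C &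
  forall y : R, 1 <= y -> `|q.[y]| * expR (- y) <= C / y ^+ 2.
Proof.
have E (y : R) n : 1 <= y -> y ^+ n * expR (- y) <= (n.+2)`!%:R / y ^+ 2.
  move=> y1; have y0 : 0 < y by apply: lt_le_trans y1.
  have := expR_ge1Dxn n.+1 (ltW y0) => h.
  have {h} : y ^+ n.+2 / n.+2`!%:R <= expR y by apply: le_trans h; rewrite lerDr.
  rewrite ler_pdivrMr ?ltr0n ?fact_gt0 // => h.
  rewrite expRN ler_pdivlMr ?exprn_gt0 // mulrAC ler_pdivrMr ?expR_gt0 //.
  by rewrite -exprD addn2 mulrC.
elim/poly_ind: q => [|q c [C C0 IH]].
  by exists 0 => // y _; rewrite horner0 normr0 !mul0r.
have bnd : exists2 D : R, 0 <= D & forall y : R, 1 <= y -> `|(q * 'X).[y]| * expR (- y) <= D / y ^+ 2.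
  exists (\sum_(i < size (q * 'X)) `|(q * 'X)`_i| * (i.+2)`!%:R).
    by apply: sumr_ge0 => i _; rewrite mulr_ge0.
  move=> y y1; rewrite horner_coef.
  apply: (@le_trans _ _ (\sum_(i < size (q * 'X)) (`|(q * 'X)`_i| * y ^+ i) * expR (- y))).
    rewrite -mulr_suml ler_wpM2r ?expR_ge0 //.
    apply: (le_trans (ler_norm_sum _ _ _)); apply: ler_sum => i _.
    by rewrite normrM normrX (ger0_norm (le_trans ler01 y1)).
  rewrite mulr_suml; apply: ler_sum => i _.
  by rewrite -!mulrA ler_wpM2l // E.
case: bnd => D D0 hD; exists (D + `|c| * 2`!%:R).
  by rewrite addr_ge0 // mulr_ge0.
move=> y y1; rewrite hornerD hornerC.
apply: (@le_trans _ _ (`|(q * 'X).[y]| * expR (- y) + `|c| * expR (- y))).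
  by rewrite -mulrDl ler_wpM2r ?expR_ge0 // ler_normD.
rewrite mulrDl; apply: lerD; first exact: hD.
by rewrite -mulrA ler_wpM2l //; have := E y 0%N y1; rewrite expr0 mul1r.
Qed.

Lemma flat_bound q : exists2 C : R, 0 <= C & forall h, h <= 1 -> `|flat q h| <= C * h ^+ 2.
Proof.
have [C C0 hC] := horner_expR_bound q; exists C => // h h1.
rewrite /flat; case: ifPn => h0; last by rewrite normr0 mulr_ge0 // sqr_ge0.
rewrite normrM (ger0_norm (expR_ge0 _)).
have := hC h^-1; rewrite invf_ge1 // => /(_ h1).
by rewrite exprVn invrK.
Qed.

Lemma is_derive_quadratic (f : R -> R) x (C : R) : f x = 0 ->
  (forall h, `|h| <= 1 -> `|f (x + h)| <= C * h ^+ 2) -> is_derive x 1 f 0.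
Proof.
move=> f0 hf.
suff H : h^-1 *: ((f \o shift x) (h *: (1 : R)) - f x) @[h --> 0^'] --> (0 : R).
  by apply: DeriveDef; [apply/cvg_ex; exists 0|exact/cvg_lim].
apply/cvgrPdist_lt => e e0; near=> h.
have hn0 : h != 0 by near: h; exact: nbhs_dnbhs_neq.
rewrite sub0r normrN f0 subr0 /= -[h *: _]/(h * 1) mulr1 addrC normrM normfV.
rewrite mulrC ltr_pdivrMr ?normr_gt0 //.
have h1 : `|h| <= 1.
  by apply: ltW; near: h; apply: dnbhs0_lt.
apply: (le_lt_trans (hf _ h1)); rewrite -(real_normK (num_real h)) expr2 mulrA ltr_pM2r ?normr_gt0 //.
have hC : `|h| < e / (`|C| + 1).
  by near: h; apply: dnbhs0_lt; rewrite divr_gt0 // ltr_pwDr.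
apply: (@le_lt_trans _ _ ((`|C| + 1) * `|h|)).
  by rewrite ler_wpM2r // (le_trans (ler_norm _)) // lerDl.
by rewrite mulrC -ltr_pdivlMr // ltr_pwDr.
Unshelve. all: by end_near. Qed.

Lemma is_derive_flat q x : is_derive x 1 (flat q) (flat ('X^2 * (q - q^`())) x).
Proof.
have [x0|x0|->] := ltgtP x 0.
- rewrite /flat ltNge (ltW x0) /=.
  apply: (near_eq_is_derive (f := cst 0)).
  near=> y; rewrite ltNge ltW //.
  by near: y; apply: (open_nbhs_nbhs (conj (@open_lt _ 0) x0)).
- rewrite [X in is_derive _ _ _ X]/flat x0.
  apply: (near_eq_is_derive (f := (fun y => q.[y^-1]) * (fun y => expR (- y^-1)))).
    near=> y; rewrite /flat; have -> // : 0 < y.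
    by near: y; apply: (open_nbhs_nbhs (conj (@open_gt _ 0) x0)).
  have xn : x != 0 by rewrite gt_eqF.
  have d1 : is_derive x 1 (fun y : R => y^-1) (- x ^- 2).
    have := @is_deriveV R id x 1 1 xn (is_derive_id _ _) => h.
    by apply: is_derive_eq h _; rewrite /= -[_ *: _]/(_ * 1) mulr1.
  have d2 : is_derive x 1 (fun y : R => q.[y^-1]) (q^`().[x^-1] * - x ^- 2).
    exact: (@is_derive1_comp R (horner q) (fun y => y^-1)).
  have d3 : is_derive x 1 (fun y : R => expR (- y^-1)) (expR (- x^-1) * x ^- 2).
    apply: (@is_derive1_comp R expR (fun y => - y^-1)).
    have := is_deriveN d1; rewrite opprK; exact.
  apply: is_derive_eq (is_deriveM d2 d3) _.
  rewrite hornerM hornerXn hornerD hornerN exprVn.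
  by rewrite -[_ *: _]/(_ * _) -[X in _ + X]/(_ * _); ring.
have E0 p : flat p 0 = 0 by rewrite /flat ltxx.
rewrite E0; have [C C0 hC] := flat_bound q.
apply: (@is_derive_quadratic _ _ C) => // h h1.
by rewrite add0r; apply: hC; apply: le_trans (ler_norm h) h1.
Unshelve. all: by end_near. Qed.

Lemma continuous_flat q : continuous (flat q).
Proof.
move=> x; apply: differentiable_continuous; apply/derivable1_diffP.
by case: (is_derive_flat q x).
Qed.

End Flat_function.

(* A syntactic class of smooth functions that is closed under partial derivatives. *)
Section Smooth_expressions.
Context {R : realType}.

Inductive sexp :=
| SCst of R | SX1 | SX2 | SFlat of {poly R} & R & R & R | SAdd of sexp & sexp | SMul of sexp & sexp.

Fixpoint seval (s : sexp) : R * R -> R := match s with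
| SCst a => cst a
| SX1 => fst
| SX2 => snd
| SFlat q a b c => fun x => flat q (a * x.1 + b * x.2 + c)
| SAdd s t => (seval s \+ seval t)
| SMul s t => (seval s \* seval t)
end.

Fixpoint sderiv (v : R * R) (s : sexp) : sexp := match s with
| SCst _ => SCst 0
| SX1 => SCst v.1
| SX2 => SCst v.2
| SFlat q a b c => SMul (SCst (a * v.1 + b * v.2)) (SFlat ('X^2 * (q - q^`())) a b c)
| SAdd s t => SAdd (sderiv v s) (sderiv v t)
| SMul s t => SAdd (SMul (sderiv v s) t) (SMul s (sderiv v t))
end.

Lemma is_derive_dir (F : R * R -> R) (x v : R * R) (d : R) :
  is_derive (0 : R) 1 (fun h : R => F (x + h *: v)) d -> is_derive x v F d.
Proof.
have E : (fun h : R => h^-1 *: ((F \o shift x) (h *: v) - F x)) =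
  (fun h : R => h^-1 *: (((fun h : R => F (x + h *: v)) \o shift 0) (h *: (1 : R)) - F (x + 0 *: v))).
  apply/funext => h /=; rewrite scale0r addr0 addr0 (addrC x).
  by rewrite -[h *: (1 : R)]/(h * 1) mulr1.
by move=> [h1 h2]; apply: DeriveDef; rewrite /derivable /derive E.
Qed.

Lemma is_derive_affine1 (a b : R) (x : R) : is_derive x 1 (fun h : R => b + h * a) a.
Proof.
have := @is_deriveD R R R (cst b) (fun h => h * a) x 1 0 a (is_derive_cst _ _ _).
rewrite add0r; apply.
have := @is_deriveM R R id (cst a) x 1 1 0 (is_derive_id _ _) (is_derive_cst _ _ _).
rewrite scaler0 add0r => h; apply: is_derive_eq h _.
by rewrite -[_ *: _]/(_ * _) mulr1.
Qed.

Lemma is_derive_seval (s : sexp) (x v : R * R) :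
  is_derive x v (seval s) (seval (sderiv v s) x).
Proof.
elim: s => [a||| q a b c|s IHs t IHt|s IHs t IHt] /=.
- exact: is_derive_cst.
- by apply: is_derive_dir => /=; exact: is_derive_affine1.
- by apply: is_derive_dir => /=; exact: is_derive_affine1.
- apply: is_derive_dir => /=.
  have E : (fun h : R => flat q (a * (x.1 + h * v.1) + b * (x.2 + h * v.2) + c)) =
    (flat q) \o (fun h : R => (a * x.1 + b * x.2 + c) + h * (a * v.1 + b * v.2)).
    by apply/funext => h /=; congr flat; ring.
  have -> : (fun h : R => flat q (a * (x.1 + h *: v.1) + b * (x.2 + h *: v.2) + c)) = 
    (flat q) \o (fun h : R => (a * x.1 + b * x.2 + c) + h * (a * v.1 + b * v.2)) by exact: E.
  rewrite [X in is_derive _ _ _ X]mulrC; apply: (@is_derive1_comp R (flat q) _ 0 _ _ _ (is_derive_affine1 _ _ _)).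
  by rewrite mul0r addr0; exact: is_derive_flat.
- exact: is_deriveD.
- apply: is_derive_eq (is_deriveM IHs IHt) _.
  by rewrite -[_ *: _]/(_ * _) -[X in _ + X]/(_ * _) addrC [X in X + _]mulrC.
Qed.

Lemma continuous_seval (s : sexp) : continuous (seval s).
Proof.
elim: s => [a||| q a b c|s IHs t IHt|s IHs t IHt] x /=.
- exact: cvg_cst.
- exact: cvg_fst.
- exact: cvg_snd.
- apply: (@continuous_comp _ _ _ (fun x : R * R => a * x.1 + b * x.2 + c) (flat q)); last exact: continuous_flat.
  by apply: cvgD; [apply: cvgD; apply: cvgM; [exact: cvg_cst|exact: cvg_fst|exact: cvg_cst|exact: cvg_snd]|exact: cvg_cst].
- by apply: cvgD; [exact: IHs|exact: IHt].
- by apply: cvgM; [exact: IHs|exact: IHt].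
Qed.

Lemma iter_derive_seval (l : seq (R * R)) (s : sexp) :
  iter_derive l (seval s) = seval (foldr sderiv s l).
Proof.
elim: l => //= v l ->; apply/funext => x.
by case: (is_derive_seval (foldr sderiv s l) x v).
Qed.

Lemma smooth_seval (s : sexp) : smooth (seval s).
Proof.
move=> l _; rewrite iter_derive_seval; split; first exact: continuous_seval.
by move=> x; split; [case: (is_derive_seval (foldr sderiv s l) x e1)|case: (is_derive_seval (foldr sderiv s l) x e2)].
Qed.

End Smooth_expressions.

(** * Polynomials in two variables *)

Section Bivariate_polynomials.
Context {R : realType}.
Implicit Types (p q : {poly {poly R}}) (x v : R * R) (n m : nat).

Lemma evD p q x : ev (p + q) x = ev p x + ev q x.
Proof. by rewrite /ev !hornerD. Qed.
Lemma evN p x : ev (- p) x = - ev p x.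
Proof. by rewrite /ev !hornerN. Qed.
Lemma evB p q x : ev (p - q) x = ev p x - ev q x.
Proof. by rewrite evD evN. Qed.
Lemma evM p q x : ev (p * q) x = ev p x * ev q x.
Proof. by rewrite /ev !hornerM. Qed.
Lemma ev0 x : ev 0 x = 0.
Proof. by rewrite /ev !horner0. Qed.

Lemma ev_X1 x : ev 'X x = x.1.
Proof. by rewrite /ev hornerX hornerC. Qed.
Lemma ev_X2 x : ev ('X)%:P x = x.2.
Proof. by rewrite /ev hornerC hornerX. Qed.
Lemma ev_C (c : {poly R}) x : ev c%:P x = c.[x.2].
Proof. by rewrite /ev hornerC. Qed.
Lemma ev_CC (c : R) x : ev c%:P%:P x = c.
Proof. by rewrite ev_C hornerC. Qed.

Lemma d1D p q : d1 (p + q) = d1 p + d1 q. Proof. exact: derivD. Qed.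
Lemma d2D p q : d2 (p + q) = d2 p + d2 q.
Proof. by rewrite /d2 raddfD. Qed.

Lemma d2MX p : d2 (p * 'X) = d2 p * 'X.
Proof.
apply/polyP => i; rewrite /d2 coef_map coefMX coefMX coef_map.
by case: eqP => // _; rewrite raddf0.
Qed.

Lemma d2C (c : {poly R}) : d2 c%:P = (c^`())%:P.
Proof. by rewrite /d2 map_polyC. Qed.

Lemma ev_sexp p : exists s : @sexp R, seval s = ev p.
Proof.
have C (c : {poly R}) : exists s : @sexp R, seval s = ev c%:P.
  elim/poly_ind: c => [|c a [s hs]].
    by exists (SCst 0); apply/funext => x; rewrite ev_C horner0.
  exists (SAdd (SMul s SX2) (SCst a)); apply/funext => x /=.
  by rewrite hs !ev_C hornerD hornerM hornerX hornerC.
elim/poly_ind: p => [|p c [s hs]].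
  by exists (SCst 0); apply/funext => x; rewrite ev0.
have [t ht] := C c; exists (SAdd (SMul s SX1) t); apply/funext => x /=.
by rewrite hs ht evD evM ev_X1.
Qed.

Lemma continuous_ev p : continuous (ev p).
Proof. by have [s <-] := ev_sexp p; exact: continuous_seval. Qed.

Lemma is_derive_ev p x v :
  is_derive x v (ev p) (v.1 * ev (d1 p) x + v.2 * ev (d2 p) x).
Proof.
have C (c : {poly R}) : is_derive x v (ev c%:P) (v.2 * (c^`()).[x.2]).
  have -> : ev c%:P = (horner c \o snd) by apply/funext => y; rewrite ev_C.
  apply: is_derive_dir => /=.
  rewrite mulrC; apply: (@is_derive1_comp R (horner c) (fun h => x.2 + h * v.2) 0 _ _ _ (is_derive_affine1 _ _ _)).
  by rewrite mul0r addr0; exact: is_derive_poly.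
elim/poly_ind: p => [|p c IH].
  rewrite /d1 /d2 deriv0 map_poly0 !ev0 !mulr0 addr0.
  have -> : ev (0 : {poly {poly R}}) = cst 0 by apply/funext => y; rewrite ev0.
  exact: is_derive_cst.
have -> : ev (p * 'X + c%:P) = (ev p * fst) + ev c%:P.
  by apply/funext => y; rewrite evD evM ev_X1.
have d1' : is_derive x v (fst : R * R -> R) v.1.
  by apply: is_derive_dir => /=; exact: is_derive_affine1.
apply: is_derive_eq (is_deriveD (is_deriveM IH d1') (C c)) _.
rewrite d1D d2D d2MX d2C /d1 derivM derivX derivC addr0 mulr1 !evD !evM ev_X1 ev_C.
by rewrite -[_ *: _]/(_ * _) -[X in _ + X + _]/(_ * _); ring.
Qed.

Lemma derive_ev p v x : 'D_v (ev p) x = v.1 * ev (d1 p) x + v.2 * ev (d2 p) x.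
Proof. by case: (is_derive_ev p x v). Qed.

Lemma bm_ev (D : set (R * R)) p : compact D -> bm D (ev p).
Proof. by move=> cD; apply: bm_cont => //; apply: continuous_subspaceT; exact: continuous_ev. Qed.

(** Works with functions instead of coefficients, so that sums, products and affine substitutions
    need no manipulation of nested polynomials. *)
Definition polyf n (f : R * R -> R) := exists2 p, total_degree_le n p & forall x, f x = ev p x.

Lemma total_degreeD n p q : total_degree_le n p -> total_degree_le n q -> total_degree_le n (p + q).
Proof. by move=> hp hq i j ij; rewrite !coefD hp // hq // addr0. Qed.

Lemma total_degreeN n p : total_degree_le n p -> total_degree_le n (- p).
Proof. by move=> hp i j ij; rewrite !coefN hp // oppr0. Qed.

Lemma total_degree0 n : total_degree_le n (0 : {poly {poly R}}).
Proof. by move=> i j _; rewrite !coef0. Qed.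

Lemma total_degreeM n m p q : total_degree_le n p -> total_degree_le m q -> total_degree_le (n + m) (p * q).
Proof.
move=> hp hq i j ij; rewrite coefM coef_sum big1 // => k _.
rewrite coefM big1 // => l _.
have [h|h] := ltnP n (k + l); first by rewrite hp // mul0r.
rewrite (hq (i - k)%N) ?mulr0 //.
have := ltn_ord k; have := ltn_ord l; lia.
Qed.

Lemma total_degree_CC n (c : R) : total_degree_le n (c%:P%:P).
Proof.
move=> i j ij; rewrite coefC; case: i ij => [|i] ij /=; last by rewrite coef0.
by rewrite coefC; case: j ij.
Qed.

Lemma total_degree_d1 n p : total_degree_le n p -> total_degree_le n (d1 p).
Proof. by move=> hp i j ij; rewrite coef_deriv coefMn hp ?mul0rn //; lia. Qed.

Lemma total_degree_d2 n p : total_degree_le n p -> total_degree_le n (d2 p).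
Proof. by move=> hp i j ij; rewrite coef_map coef_deriv hp ?mul0rn //; lia. Qed.

Lemma polyfD n f g : polyf n f -> polyf n g -> polyf n (fun x => f x + g x).
Proof.
move=> [p hp ep] [q hq eq]; exists (p + q); first exact: total_degreeD.
by move=> x; rewrite evD ep eq.
Qed.

Lemma polyfM n m f g : polyf n f -> polyf m g -> polyf (n + m) (fun x => f x * g x).
Proof.
move=> [p hp ep] [q hq eq]; exists (p * q); first exact: total_degreeM.
by move=> x; rewrite evM ep eq.
Qed.

Lemma polyf_cst n (c : R) : polyf n (fun=> c).
Proof. by exists (c%:P%:P); [exact: total_degree_CC|move=> x; rewrite ev_CC]. Qed.

Lemma polyf_le n m f : (n <= m)%N -> polyf n f -> polyf m f.
Proof. by move=> nm [p hp ep]; exists p => // i j ij; apply: hp; exact: leq_ltn_trans ij. Qed.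

Lemma polyf_affine (a b c : R) : polyf 1 (fun x => a * x.1 + b * x.2 + c).
Proof.
have X1 : polyf 1 (fun x => x.1).
  exists 'X; last by move=> x; rewrite ev_X1.
  by move=> [|[|i]] j ij; rewrite coefX ?coef0 //= coef1; case: j ij.
have X2 : polyf 1 (fun x => x.2).
  exists ('X)%:P; last by move=> x; rewrite ev_X2.
  by move=> [|i] j ij; rewrite coefC /= ?coef0 // coefX; case: j ij => [|[|j]].
apply: polyfD (polyf_cst _ _); apply: polyfD.
  exact: (polyfM (polyf_cst 0 _) X1).
exact: (polyfM (polyf_cst 0 _) X2).
Qed.

Lemma polyf_exp f k : polyf 1 f -> polyf k (fun x => f x ^+ k).
Proof.
move=> hf; elim: k => [|k IH]; first by under eq_fun do rewrite expr0; exact: polyf_cst.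
by under eq_fun do rewrite exprS; exact: (polyfM hf IH).
Qed.

Lemma polyf_sum n (I : Type) (r : seq I) (P : pred I) (F : I -> R * R -> R) :
  (forall i, P i -> polyf n (F i)) -> polyf n (fun x => \sum_(i <- r | P i) F i x).
Proof.
move=> hF; elim: r => [|i r IH].
  by under eq_fun do rewrite big_nil; exact: polyf_cst.
under eq_fun do rewrite big_cons.
by case: (boolP (P i)) => // Pi; apply: polyfD => //; exact: hF.
Qed.

Lemma horner_coef_le (V : nzRingType) (p : {poly V}) (y : V) n :
  (forall i, (n < i)%N -> p`_i = 0) -> p.[y] = \sum_(i < n.+1) p`_i * y ^+ i.
Proof.
move=> h; apply: horner_coef_wide; apply/leq_sizeP => i hi; exact: h.
Qed.

Lemma evE n p x : total_degree_le n p ->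
  ev p x = \sum_(i < n.+1) \sum_(j < n.+1) p`_i`_j * (x.1 ^+ i * x.2 ^+ j).
Proof.
move=> hp; rewrite /ev (@horner_coef_le _ p _ n); last first.
  by move=> i hi; apply/polyP => j; rewrite coef0 hp // ltn_addr.
rewrite horner_sum; apply: eq_bigr => i _.
rewrite hornerM -rmorphXn hornerC (@horner_coef_le _ p`_i _ n); last first.
  by move=> j hj; rewrite hp // ltn_addl.
by rewrite mulr_suml; apply: eq_bigr => j _; ring.
Qed.

Lemma polyf_comp_affine n f (a b c a' b' c' : R) : polyf n f ->
  polyf n (fun x => f (a * x.1 + b * x.2 + c, a' * x.1 + b' * x.2 + c')).
Proof.
move=> [p hp ep].
have -> : (fun x : R * R => f (a * x.1 + b * x.2 + c, a' * x.1 + b' * x.2 + c')) =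
  fun x => \sum_(i < n.+1) \sum_(j < n.+1) p`_i`_j *
    ((a * x.1 + b * x.2 + c) ^+ i * (a' * x.1 + b' * x.2 + c') ^+ j).
  by apply/funext => x; rewrite ep (evE _ hp).
apply: polyf_sum => i _; apply: polyf_sum => j _.
have [h|h] := ltnP n (i + j).
  by rewrite hp //; under eq_fun do rewrite mul0r; exact: polyf_cst.
apply: (@polyf_le (0 + (i + j))) => //.
apply: (polyfM (polyf_cst 0 _)); apply: polyfM; exact: polyf_exp (polyf_affine _ _ _).
Qed.

End Bivariate_polynomials.

(** * A smooth cutoff on the line *)

Section Cutoff.
Context {R : realType}.

(** Equal to exp(-1/(t - 1)) for t > 1 and to 0 before; it tends to 1 without reaching it. Thus
    [cutoff (N * s)] approximates the indicator of s > 0 pointwise, and its derivative in s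
    concentrates at 0+ with mass 1, by [integral_cutoff']. *)
Definition cutoff (t : R) : R := flat 1 (t - 1).
Definition cutoff' (t : R) : R := flat 'X^2 (t - 1).

Lemma is_derive_cutoff (t : R) : is_derive t 1 cutoff (cutoff' t).
Proof.
have E : 'X^2 * (1 - (1 : {poly R})^`()) = 'X^2 by rewrite -(polyC1 R) derivC subr0 polyC1 mulr1.
have h := is_derive_flat 1 (t - 1); rewrite E in h.
have := @is_derive1_comp R (flat 1) (fun s => -1 + s * 1) t _ _ _ (is_derive_affine1 1 (-1) t).
rewrite mulr1 [-1 + t]addrC => /(_ _ h); congr is_derive; last by rewrite mulr1.
by apply/funext => s /=; rewrite /cutoff mulr1 addrC.
Qed.

Lemma continuous_cutoff : continuous cutoff.
Proof.
move=> t; apply: differentiable_continuous; apply/derivable1_diffP.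
by case: (is_derive_cutoff t).
Qed.

Lemma continuous_cutoff' : continuous cutoff'.
Proof.
move=> t; apply: (@continuous_comp _ _ _ (fun s : R => s - 1) (flat 'X^2)); last exact: continuous_flat.
by apply: cvgB; [exact: cvg_id|exact: cvg_cst].
Qed.

Lemma flat1E (x : R) : flat 1 x = if 0 < x then expR (- x^-1) else 0.
Proof. by rewrite /flat hornerC mul1r. Qed.

Lemma cutoff_ge0 t : 0 <= cutoff t.
Proof. by rewrite /cutoff flat1E; case: ifP => // _; exact: expR_ge0. Qed.

Lemma cutoff_le1 t : cutoff t <= 1.
Proof.
rewrite /cutoff flat1E; case: ifP => // h; rewrite -[X in _ <= X]expR0 ler_expR.
by rewrite oppr_le0 invr_ge0 ltW.
Qed.

Lemma cutoff_eq0 t : t <= 1 -> cutoff t = 0.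
Proof. by move=> h; rewrite /cutoff /flat subr_gt0 ltNge h. Qed.

Lemma cutoff'_ge0 t : 0 <= cutoff' t.
Proof.
rewrite /cutoff' /flat; case: ifP => // _; rewrite hornerXn.
by rewrite mulr_ge0 ?expR_ge0 ?sqr_ge0.
Qed.

Lemma cutoff'_eq0 t : t <= 1 -> cutoff' t = 0.
Proof. by move=> h; rewrite /cutoff' /flat subr_gt0 ltNge h. Qed.

Lemma cvg_cutoff : cutoff t @[t --> +oo] --> (1 : R).
Proof.
apply/cvgrPdist_le => e e0; near=> t.
have t1 : 1 < t by near: t; exact: nbhs_pinfty_gt.
rewrite /cutoff flat1E subr_gt0 t1 ger0_norm; last first.
  by rewrite subr_ge0 -[X in _ <= X]expR0 ler_expR oppr_le0 invr_ge0 subr_ge0 ltW.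
have := expR_ge1Dx (- (t - 1)^-1).
have : (t - 1)^-1 <= e.
  have h : e^-1 + 1 < t by near: t; apply: nbhs_pinfty_gt; exact: num_real.
  by rewrite invf_ple ?posrE ?subr_gt0 //; lra.
lra.
Unshelve. all: by end_near. Qed.

Lemma integral_cutoff' : (\int[lebesgue_measure]_x (cutoff' x)%:E = 1%:E :> \bar R)%E.
Proof.
transitivity (\int[lebesgue_measure]_(x in `[1%R, +oo[) (cutoff' x)%:E : \bar R)%E.
  rewrite [RHS]integral_mkcond; apply: eq_integral => x _; rewrite patchE.
  case: ifPn => // h; rewrite cutoff'_eq0 //.
  move: h; rewrite notin_setE /= in_itv /= andbT => /negP; rewrite -ltNge; exact: ltW.
rewrite (@ge0_continuous_FTC2y R cutoff' cutoff 1 1).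
- by rewrite (@cutoff_eq0 1) // sube0.
- by move=> x _; exact: cutoff'_ge0.
- by apply: continuous_subspaceT; exact: continuous_cutoff'.
- exact: cvg_cutoff.
- by move=> x _; case: (is_derive_cutoff x).
- by apply: cvg_at_right_filter; exact: continuous_cutoff.
- by move=> x _; rewrite derive1E; case: (is_derive_cutoff x).
Qed.

End Cutoff.

(** * Affine change of variables for signed integrands *)

Section Signed_change_of_variables.
Context {R : realType}.
Local Open Scope ereal_scope.

Lemma integral_affine2 (a b c d e f : R) (F : R * R -> \bar R) : (a * d - b * c != 0)%R ->
  leb2.-integrable setT F ->
  \int[leb2]_z F ((a * z.1 + b * z.2 + e)%R, (c * z.1 + d * z.2 + f)%R) =
  (`|a * d - b * c|^-1)%:E * \int[leb2]_z F z.
Proof.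
move=> det0 iF; have mF := measurable_int _ iF; rewrite integralE [X in _ = _ * X]integralE.
have mp : measurable_fun setT (F^\+) by exact: measurable_funepos.
have mn : measurable_fun setT (F^\-) by exact: measurable_funeneg.
have k0 : (0 < `|a * d - b * c|^-1)%R by rewrite invr_gt0 normr_gt0.
rewrite muleBr //; last by rewrite fin_num_adde_defr // (integrable_pos_fin_num measurableT iF).
congr (_ - _).
  by apply: etrans (ge0_integral_affine2 e f det0 mp (fun=> funepos_ge0 _ _)); apply: eq_integral => z _; rewrite !funeposE.
by apply: etrans (ge0_integral_affine2 e f det0 mn (fun=> funeneg_ge0 _ _)); apply: eq_integral => z _; rewrite !funenegE.
Qed.
End Signed_change_of_variables.

(** * Integration by parts on a triangle *)

Section Layer_limit.
Context {R : realType}.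
Local Notation RR := (measurableTypeR R * measurableTypeR R)%type.
Local Notation mu := (@lebesgue_measure R).
Implicit Types (p : 'I_3 -> R * R) (i : 'I_3).

Definition tri_int p : set (R * R) := [set x | forall i, 0 < bary p i x].

Lemma open_tri_int p : open (tri_int p).
Proof.
rewrite openE => x h.
have n i : \forall y \near x, 0 < bary p i y.
  exact: (continuous_bary (x := x) (open_nbhs_nbhs (conj (@open_gt _ 0) (h i)))).
rewrite /interior; near=> y => i; have [->|->|->] := I3P i; near: y; exact: n.
Unshelve. all: by end_near. Qed.

Lemma tri_int_sub p : tdet p != 0 -> tri_int p `<=` tri p.
Proof. by move=> d0 x hx; apply/(triP _ d0) => i; exact: ltW (hx i). Qed.

Lemma tri_measurable p : tdet p != 0 -> measurable (tri p).
Proof. by move=> d0; apply: closed_measurable2; exact: tri_closed. Qed.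

Lemma tri_int_measurable p : measurable (tri_int p).
Proof. by apply: open_measurable2; exact: open_tri_int. Qed.

Lemma tri_fin p : tdet p != 0 -> (leb2 (tri p) < +oo)%E.
Proof.
move=> d0; apply: (@leb2_fin _ _ (\sum_i enorm (p i))); first exact: tri_measurable.
move=> x /tri_bounded h; split; [exact: le_trans (coord1_le_enorm _) h|exact: le_trans (coord2_le_enorm _) h].
Qed.

Lemma tri_int_fin p : tdet p != 0 -> (leb2 (tri_int p) < +oo)%E.
Proof.
move=> d0; apply: le_lt_trans (tri_fin d0); apply: le_measure => //; rewrite ?inE.
- exact: tri_int_measurable.
- exact: tri_measurable.
- exact: tri_int_sub.
Qed.

Lemma measurable_comp_fst (f : R -> R) : measurable_fun setT f ->
  measurable_fun setT (fun z : R * R => f z.1).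
Proof. by move=> mf; exact: (measurableT_comp mf measurable_fst). Qed.

Lemma measurable_comp_snd (f : R -> R) : measurable_fun setT f ->
  measurable_fun setT (fun z : R * R => f z.2).
Proof. by move=> mf; exact: (measurableT_comp mf measurable_snd). Qed.

Section layer.
Context (p : 'I_3 -> R * R) (i : 'I_3) (F : R * R -> R).
Hypotheses (d0 : tdet p != 0) (cF : {within tri p, continuous F}).

(** Blow-up of the layer along edge [i]: the coordinate transversal to the edge is stretched by n +
    1. In the new variables the factor [cutoff'] no longer depends on [n]; only the two other
    cutoffs and the argument of [F] move. *)
Let F0 := F \_ (tri_int p).
Let A (s : R) (z : R * R) := tpt p i (s * z.1) z.2.
Let ct (N : R) (z : R * R) := cutoff' z.1 * (cutoff (N * z.2) * cutoff (N * (1 - z.2) - z.1)).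
Let K n (z : R * R) : R := F0 (A (n.+1%:R^-1) z) * ct n.+1%:R z.
Let hh n x := F x * (cutoff' (n.+1%:R * bary p i x) *
  (cutoff (n.+1%:R * bary p (i - 1) x) * cutoff (n.+1%:R * bary p (i + 1) x))).

Let bF : bm (tri_int p) F.
Proof.
apply: bm_sub (bm_cont (tri_compact d0) cF); first exact: tri_measurable.
exact: tri_int_sub.
Qed.

Let bcont (f : R -> R) (j : 'I_3) (N : R) : continuous f -> bm (tri_int p) (fun x => f (N * bary p j x)).
Proof.
move=> cf; apply: (@bm_sub _ _ _ (tri p)); first exact: tri_measurable.
  exact: tri_int_sub.
apply: bm_cont; first exact: tri_compact.
apply: continuous_subspaceT => x.
apply: (@continuous_comp _ _ _ (fun x => N * bary p j x) f); last exact: cf.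
by apply: cvgM; [exact: cvg_cst|exact: continuous_bary].
Qed.

Let bh n : bm (tri_int p) (hh n).
Proof.
apply: bmM => //; apply: bmM; first exact: bcont continuous_cutoff'.
by apply: bmM; apply: bcont; exact: continuous_cutoff.
Qed.

Let change n : \int[leb2]_(x in tri_int p) (n.+1%:R * hh n x) =
  `|tdet p| * \int[leb2]_z K n z.
Proof.
have mT := tri_int_measurable p.
have N0 : 0 < n.+1%:R :> R by rewrite ltr0n.
rewrite (Rint2Z mT (tri_int_fin d0)); last exact: bh.
have ih : leb2.-integrable setT (EFin \o ((hh n) \_ (tri_int p))).
  rewrite -restrict_EFin.
  apply: (@integrable_mkcond _ RR R leb2 _ _ mT).1.
  refine (integrable2 mT (tri_int_fin d0) (bh n)).
pose a := p i - p (i + 1); pose b := p (i - 1) - p (i + 1).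
have dE : a.1 / n.+1%:R * b.2 - b.1 * (a.2 / n.+1%:R) = - tdet p / n.+1%:R.
  by rewrite (tdetE p i) /a /b /cross !coordE; ring.
have D0 : a.1 / n.+1%:R * b.2 - b.1 * (a.2 / n.+1%:R) != 0.
  by rewrite dE mulf_neq0 ?oppr_eq0 // invr_neq0 // gt_eqF.
have H := integral_affine2 (p (i + 1)).1 (p (i + 1)).2 D0 ih.
have E : (\int[leb2]_z (K n z)%:E = (`|- tdet p / n.+1%:R|^-1)%:E * \int[leb2]_(x in tri_int p) (hh n x)%:E)%E.
  rewrite -dE [in RHS]integral_mkcond restrict_EFin -H; apply: eq_integral => z _ /=; congr EFin.
  rewrite /K /A; set y := (X in _ = (hh n \_ _) X).
  have -> : tpt p i (n.+1%:R^-1 * z.1) z.2 = y.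
    by rewrite /y /tpt; apply: pair_eqP; rewrite !coordE /a /b /=; ring.
  rewrite /F0 /patch; case: ifPn => _; last by rewrite mul0r.
  rewrite /hh; have -> : y = tpt p i (n.+1%:R^-1 * z.1) z.2.
    by rewrite /y /tpt; apply: pair_eqP; rewrite !coordE /a /b /=; ring.
  have [-> -> ->] := bary_tpt i (n.+1%:R^-1 * z.1) z.2 d0.
  have -> : n.+1%:R * (n.+1%:R^-1 * z.1) = z.1 by rewrite mulrA divff ?gt_eqF // mul1r.
  rewrite /ct; congr (_ * (_ * (_ * cutoff _))).
  by field; lra.
rewrite /Rintegral E fineM //; last first.
  by apply: (@integrable_fin_num _ RR R leb2 _ mT); refine (integrable2 mT (tri_int_fin d0) (bh n)).
rewrite /= normrM normrN normfV (ger0_norm (ltW N0)) invfM invrK.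
by rewrite !mulrA divff ?normr_eq0 // mul1r.
Qed.

(** At both ends of the edge one of the two tangential cutoffs vanishes for every [n], so the
    pointwise limit is 0 there; hence the open interval. *)
Let Kinf (z : R * R) : R := ((fun t => F (tpt p i 0 t)) \_ `]0, 1[) z.2 * cutoff' z.1.

Let seg_tri t : 0 <= t <= 1 -> tri p (tpt p i 0 t).
Proof.
move=> /andP[t0 t1]; apply/(triP _ d0) => j.
have [b1 b2 b3] := bary_tpt i 0 t d0.
have : [\/ j = i, j = i + 1 | j = i - 1].
  have [->|->|->] := I3P i; have [->|->|->] := I3P j; rewrite ?I3_succ;
  by [apply: Or31|apply: Or32|apply: Or33].
case=> ->; rewrite ?b1 ?b2 ?b3 //; lra.
Qed.

Let seg_cont : {within `[0, 1], continuous (fun t => F (tpt p i 0 t))}.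
Proof.
apply: (@within_comp _ _ _ _ (tri p) (tpt p i 0)) cF; last first.
  by move=> t; rewrite /= in_itv /=; exact: seg_tri.
apply: continuous_subspaceT => t; rewrite /tpt.
apply: cvgD; first exact: cvg_cst.
by apply: cvgZr_tmp; exact: cvg_id.
Qed.

Let mF0 : measurable_fun setT F0.
Proof.
have hF := bF.1; have mT := tri_int_measurable p.
exact/(measurable_restrictT F mT).
Qed.

Let mK n : measurable_fun setT (K n).
Proof.
apply: measurable_funM.
  have -> : (fun z => F0 (A n.+1%:R^-1 z)) = (fun z : R * R => F0
     (((p i - p (i + 1)).1 / n.+1%:R * z.1 + (p (i - 1) - p (i + 1)).1 * z.2 + (p (i + 1)).1),
      ((p i - p (i + 1)).2 / n.+1%:R * z.1 + (p (i - 1) - p (i + 1)).2 * z.2 + (p (i + 1)).2))).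
    by apply/funext => z; congr F0; apply: pair_eqP; rewrite /A /tpt !coordE /=; ring.
  exact: measurableT_comp mF0 (affine2_measurable _ _ _ _ _ _).
apply: cont_measurable2 => //; apply: continuous_subspaceT => z; rewrite /ct.
apply: cvgM; first by apply: (@continuous_comp _ _ _ fst cutoff'); [exact: cvg_fst|exact: continuous_cutoff'].
apply: cvgM.
  apply: (@continuous_comp _ _ _ (fun z : R * R => n.+1%:R * z.2) cutoff); last exact: continuous_cutoff.
  by apply: cvgM; [exact: cvg_cst|exact: cvg_snd].
apply: (@continuous_comp _ _ _ (fun z : R * R => n.+1%:R * (1 - z.2) - z.1) cutoff); last exact: continuous_cutoff.
by apply: cvgB; [apply: cvgM; [exact: cvg_cst|apply: cvgB; [exact: cvg_cst|exact: cvg_snd]]|exact: cvg_fst].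
Qed.

Let mKinf : measurable_fun setT Kinf.
Proof.
apply: measurable_funM; last first.
  exact: measurable_comp_fst (continuous_measurable_fun continuous_cutoff').
apply: measurable_comp_snd.
apply/(measurable_restrictT _ (measurable_itv _)).
have := subspace_continuous_measurable_fun (measurable_itv _) seg_cont.
by apply: measurable_funS; [exact: measurable_itv|exact: subset_itvW].
Qed.

Let Mb := (sval (cid bF.2)).
Let hMb : forall x, tri_int p x -> `|F x| <= Mb := svalP (cid bF.2).

Let F0_le x : `|F0 x| <= `|Mb|.
Proof.
rewrite /F0 /patch; case: ifPn => [/set_mem /hMb h|_]; last by rewrite normr0.
exact: le_trans h (ler_norm _).
Qed.

(** Where [cutoff'] is nonzero, the tangential cutoffs confine [z.2] to [0,1], so the majorant is a
    product of one-variable functions, integrable since [cutoff'] has mass 1. *)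
Let g (z : R * R) : R := `|Mb| * (cutoff' z.1 * \1_(`[0, 1] : set R) z.2).

Let K_le n z : `|K n z| <= g z.
Proof.
rewrite /K /g normrM ler_pM //.
rewrite /ct; have [h|h] := leP z.1 1; first by rewrite cutoff'_eq0 // !mul0r normr0.
rewrite normrM (ger0_norm (cutoff'_ge0 _)) ler_wpM2l ?cutoff'_ge0 //.
rewrite indicE; case: (boolP (z.2 \in _)) => hz /=.
  by rewrite ger0_norm ?mulr_ge0 ?cutoff_ge0 // mulr_ile1 ?cutoff_ge0 ?cutoff_le1.
have N0 : 0 < n.+1%:R :> R by rewrite ltr0n.
move: hz; rewrite notin_setE /= in_itv /= => /negP; rewrite negb_and -!ltNge => /orP[h2|h2].
  rewrite (@cutoff_eq0 _ (_ * z.2)) ?mul0r ?normr0 //.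
  by apply: le_trans ler01; rewrite pmulr_rle0 // ltW.
rewrite (@cutoff_eq0 _ (_ - _)) ?mulr0 ?normr0 //.
have : n.+1%:R * (1 - z.2) <= 0 by rewrite pmulr_rle0 // subr_le0 ltW.
lra.
Qed.

Let ig : leb2.-integrable setT (EFin \o g).
Proof.
have mg : measurable_fun setT g.
  apply: measurable_funM; first exact: measurable_cst.
  apply: measurable_funM.
    exact: measurable_comp_fst (continuous_measurable_fun continuous_cutoff').
  apply: measurable_comp_snd.
  by apply: measurable_indic; exact: measurable_itv.
have g0 z : 0 <= g z by rewrite /g !mulr_ge0 ?cutoff'_ge0 // indicE.
apply/integrableP; split; first exact/measurable_EFinP.
have mgE : measurable_fun setT (EFin \o g) by exact/measurable_EFinP.
rewrite (_ : (\int[leb2]_x `|(EFin \o g) x| = \int[leb2]_x (EFin \o g) x)%E); last first.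
  by apply: eq_integral => z _ /=; rewrite ger0_norm.
rewrite (tonelli mgE) /=; last by move=> z; rewrite lee_fin.
rewrite (_ : (\int[mu]_x \int[mu]_y (g (x, y))%:E = \int[mu]_x (`|Mb|%:E * (cutoff' x)%:E))%E); last first.
  apply: eq_integral => x _.
  transitivity (\int[mu]_y ((`|Mb| * cutoff' x)%:E * (\1_(`[0, 1] : set R) y)%:E))%E.
    by apply: eq_integral => y _; rewrite /g /= mulrA EFinM.
  rewrite ge0_integralZl_EFin //; first last.
  - by rewrite mulr_ge0 // cutoff'_ge0.
  - apply/measurable_EFinP; apply: measurable_indic; exact: measurable_itv.
  rewrite integral_indic //.
  rewrite setIT; have := @lebesgue_measure_itv R `[0, 1]; rewrite /= => ->.
  by rewrite lte_fin ltr01 -EFinB subr0 mule1 EFinM.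
rewrite ge0_integralZl_EFin //; first last.
- by apply/measurable_EFinP; exact: continuous_measurable_fun continuous_cutoff'.
- by move=> x _; rewrite lee_fin cutoff'_ge0.
by rewrite integral_cutoff' mule1 ltry.
Qed.

Let Npos n : 0 < n.+1%:R :> R. Proof. by rewrite ltr0n. Qed.

Let near_large (a : R) : \forall n \near \oo, a < n.+1%:R.
Proof.
apply: filterS (nbhs_infty_gtr a) => n h.
by apply: lt_le_trans h _; rewrite ler_nat.
Qed.

Let cvg_cutoff_affine (t s : R) : 0 < t ->
  cutoff (n.+1%:R * t - s) @[n --> \oo] --> (1 : R).
Proof.
move=> t0; apply: (@cvg_comp _ _ _ (fun n => n.+1%:R * t - s) cutoff _ (pinfty_nbhs R)); last exact: cvg_cutoff.
apply/cvgryPgt => a; apply: filterS (near_large ((a + s) / t)) => n.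
by rewrite ltr_pdivrMr // ltrBrDr.
Qed.

Let K_cvg z : K n z @[n --> \oo] --> Kinf z.
Proof.
have zero : (forall n, K n z = 0) -> Kinf z = 0 -> K n z @[n --> \oo] --> Kinf z.
  by move=> h ->; rewrite (_ : K ^~ z = fun=> 0); [exact: cvg_cst|apply/funext => n; exact: h].
have [z1|z1] := leP z.1 1.
  by apply: zero; [move=> n; rewrite /K /ct|rewrite /Kinf]; rewrite cutoff'_eq0 // ?mul0r mulr0.
have [hz|hz] := boolP (0 < z.2 < 1); last first.
  apply: zero; last by rewrite /Kinf /patch mem_setE in_itv /= (negbTE hz) mul0r.
  move=> n; rewrite /K /ct; move: hz; rewrite negb_and -!leNgt => /orP[h2|h2].
    rewrite (@cutoff_eq0 _ (_ * z.2)) ?mul0r ?mulr0 //.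
    by apply: le_trans ler01; rewrite pmulr_rle0.
  rewrite (@cutoff_eq0 _ (_ - _)) ?mulr0 //.
  have : n.+1%:R * (1 - z.2) <= 0 by rewrite pmulr_rle0 // subr_le0.
  lra.
move: (hz) => /andP[t0 t1].
have FA : F0 (A (n.+1%:R^-1) z) @[n --> \oo] --> F (tpt p i 0 z.2).
  apply/cvgrPdist_lt => e e0.
  have [|d dp hd] := within_dist cF (@seg_tri z.2 _) e0; first by rewrite !ltW.
  pose L := enorm (p i - p (i + 1)).
  near=> n.
  have N1 : z.1 / (1 - z.2) < n.+1%:R by near: n; exact: near_large.
  have N2 : z.1 * L / d < n.+1%:R by near: n; exact: near_large.
  have Tn : tri_int p (A n.+1%:R^-1 z).
    move=> j; have [b1 b2 b3] := bary_tpt i (n.+1%:R^-1 * z.1) z.2 d0.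
    have h1 : n.+1%:R^-1 * z.1 < 1 - z.2.
      by rewrite mulrC ltr_pdivrMr // mulrC -ltr_pdivrMr ?subr_gt0.
    have h2 : 0 < n.+1%:R^-1 * z.1 by rewrite mulr_gt0 ?invr_gt0 // (lt_trans ltr01).
    have : [\/ j = i, j = i + 1 | j = i - 1].
      have [->|->|->] := I3P i; have [->|->|->] := I3P j; rewrite ?I3_succ;
      by [apply: Or31|apply: Or32|apply: Or33].
    by case=> ->; rewrite ?b1 ?b2 ?b3 // addrAC subr_gt0.
  rewrite distrC /F0 /patch mem_set //; apply: hd; first exact: tri_int_sub.
  rewrite /dist /A /tpt.
  have -> : p (i + 1) + (n.+1%:R^-1 * z.1) *: (p i - p (i + 1)) + z.2 *: (p (i - 1) - p (i + 1)) -
    (p (i + 1) + 0 *: (p i - p (i + 1)) + z.2 *: (p (i - 1) - p (i + 1))) =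
    (n.+1%:R^-1 * z.1) *: (p i - p (i + 1)) by apply: pair_eqP; rewrite !coordE; ring.
  rewrite enormZ ger0_norm ?mulr_ge0 ?invr_ge0 ?ler0n ?(ltW (lt_trans ltr01 z1)) //.
  by rewrite -/L -mulrA mulrC ltr_pdivrMr // [_ * n.+1%:R]mulrC -ltr_pdivrMr.
rewrite /Kinf /patch mem_setE in_itv /= hz /K /ct.
have -> : F (tpt p i 0 z.2) * cutoff' z.1 = F (tpt p i 0 z.2) * (cutoff' z.1 * (1 * 1)).
  by rewrite !mulr1.
apply: cvgM FA _; apply: cvgM; first exact: cvg_cst.
apply: cvgM; last by apply: cvg_cutoff_affine; rewrite subr_gt0.
have := @cvg_cutoff_affine z.2 0 t0; by under eq_fun do rewrite subr0.
Unshelve. all: by end_near. Qed.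

(** The factor N cutoff'(N lambda_i) tends to the uniform measure on edge [i], and the two other
    cutoffs tend to 1 on the open edge; the determinant is the Jacobian of the coordinates [tpt].
    After the blow-up the limit is a dominated convergence. *)
Lemma layer_limit : \int[leb2]_(x in tri_int p) (n.+1%:R * (F x * (cutoff' (n.+1%:R * bary p i x) *
    (cutoff (n.+1%:R * bary p (i - 1) x) * cutoff (n.+1%:R * bary p (i + 1) x))))) @[n --> \oo]
  --> `|tdet p| * \int[leb1]_(t in `[0, 1]) F (tpt p i 0 t).
Proof.
under eq_fun do rewrite change.
apply: cvgM; first exact: cvg_cst.
have mE (f : R * R -> R) : measurable_fun setT f -> measurable_fun setT (EFin \o f) by move=> ?; exact/measurable_EFinP.
have ae1 : {ae leb2, forall z, (setT : set RR) z ->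
    (EFin \o K n) z @[n --> \oo] --> (EFin \o Kinf) z}%E.
  apply: aeW => z _; apply: cvg_EFin; first exact: nearW.
  exact: K_cvg.
have ae2 : {ae leb2, forall z, forall n, (setT : set RR) z -> (`|(EFin \o K n) z| <= (EFin \o g) z)%E}.
  by apply: aeW => z n _; rewrite lee_fin; exact: K_le.
have [iK _ cK] := @dominated_convergence _ RR R leb2 setT measurableT
  (fun n => EFin \o K n) (EFin \o Kinf) (EFin \o g) (fun n => mE _ (mK n)) (mE _ mKinf)
  ae1 ig ae2.
have mI : measurable (`]0, 1[%classic : set R) by exact: measurable_itv.
have sub01 : (`]0, 1[%classic : set R) `<=` `[0, 1]%classic by exact: subset_itvW.
have fI : (mu `]0%R, 1%R[%classic < +oo)%E.
  by rewrite lebesgue_measure_itv /= lte_fin ltr01 -EFinB ltry.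
have bG : bm (`]0, 1[%classic : set R) (fun t => F (tpt p i 0 t)).
  by apply: bm_sub (bm_itv seg_cont); [exact: measurable_itv|].
have iG : mu.-integrable (`]0, 1[%classic : set R) (EFin \o (fun t => F (tpt p i 0 t))).
  exact: (@bm_integrable _ (measurableTypeR R) R mu _ mI fI).
have iG1 : mu.-integrable (`]0, 1]%classic : set R) (EFin \o (fun t => F (tpt p i 0 t))).
  have fI1 : (mu `]0%R, 1%R]%classic < +oo)%E.
    by rewrite lebesgue_measure_itv /= lte_fin ltr01 -EFinB ltry.
  apply: (@bm_integrable _ (measurableTypeR R) R mu _ _ fI1); first exact: measurable_itv.
  apply: bm_sub (bm_itv seg_cont); first exact: measurable_itv.
  by move=> t /=; rewrite !in_itv /= => /andP[/ltW -> ->].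
pose I := \int[leb1]_(t in `[0, 1]) F (tpt p i 0 t).
have IE : (\int[mu]_y ((fun t => F (tpt p i 0 t)) \_ `]0, 1[ y)%:E = I%:E)%E.
  rewrite /I -Rintegral_itv_obnd_cbnd // -Rintegral_itv_bndo_bndc //.
  rewrite /Rintegral fineK; last exact: integrable_fin_num.
  by rewrite [RHS]integral_mkcond restrict_EFin.
have EK : (\int[leb2]_z (EFin \o Kinf) z = I%:E)%E.
  have := integral12_prod_meas1 iK => <-.
  transitivity (\int[mu]_x (I%:E * (cutoff' x)%:E))%E.
    apply: eq_integral => x _; rewrite /fubini_F.
    rewrite -IE -integralZr //; last first.
      have := (@integrable_mkcond _ (measurableTypeR R) R mu _ (EFin \o (fun t => F (tpt p i 0 t))) mI).1 iG.
      by rewrite restrict_EFin.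
  rewrite integralZl //; first by rewrite integral_cutoff' mule1.
  apply/integrableP; split.
    by apply/measurable_EFinP; exact: continuous_measurable_fun continuous_cutoff'.
  under eq_integral do rewrite gee0_abs ?lee_fin ?cutoff'_ge0 //.
  by rewrite integral_cutoff' ltry.
have := @fine_cvg R _ _ _ (fun n => \int[leb2]_z (EFin \o K n) z)%E I.
by apply; rewrite -EK.
Qed.

End layer.
Definition cutoffs p n (x : R * R) : R :=
  cutoff (n.+1%:R * bary p 0 x) * (cutoff (n.+1%:R * bary p 1 x) * cutoff (n.+1%:R * bary p 2 x)).

Lemma continuous_comp_bary p (j : 'I_3) (f : R -> R) (a : R) : continuous f ->
  continuous (fun x => f (a * bary p j x)).
Proof.
move=> cf x; apply: (@continuous_comp _ _ _ (fun x => a * bary p j x) f); last exact: cf.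
by apply: cvgM; [exact: cvg_cst|exact: continuous_bary].
Qed.

Lemma cutoff_cvg1 (s : R) : 0 < s -> cutoff (n.+1%:R * s) @[n --> \oo] --> (1 : R).
Proof.
move=> s0; apply: (@cvg_comp _ _ _ (fun n => n.+1%:R * s) cutoff _ (pinfty_nbhs R)); last exact: cvg_cutoff.
apply/cvgryPgt => a; apply: filterS (nbhs_infty_gtr (a / s)) => n.
rewrite ltr_pdivrMr // => h; apply: lt_le_trans h _.
by rewrite ler_pM2r // ler_nat.
Qed.

Lemma cutoffs_limit p (h : R * R -> R) : tdet p != 0 -> measurable_fun (tri_int p) h ->
  (exists M : R, {ae leb2, forall x, tri_int p x -> `|h x| <= M}) ->
  \int[leb2]_(x in tri_int p) (h x * cutoffs p n x) @[n --> \oo] --> \int[leb2]_(x in tri_int p) h x.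
Proof.
move=> d0 mh [M hM].
have mT := tri_int_measurable p.
have mW n : measurable_fun (tri_int p) (cutoffs p n).
  apply: cont_measurable2 => //; apply: continuous_subspaceT => x.
  by apply: cvgM; [|apply: cvgM]; apply: continuous_comp_bary; exact: continuous_cutoff.
have W01 n x : 0 <= cutoffs p n x <= 1.
  rewrite /cutoffs !mulr_ge0 ?cutoff_ge0 //=.
  by rewrite mulr_ile1 ?mulr_ge0 ?mulr_ile1 ?cutoff_ge0 ?cutoff_le1.
pose hw n x : R := h x * cutoffs p n x.
have mf n : measurable_fun (tri_int p) (EFin \o hw n).
  by apply/measurable_EFinP; apply: measurable_funM.
have mh' : measurable_fun (tri_int p) (EFin \o h) by exact/measurable_EFinP.
have ae1 : {ae leb2, forall x, tri_int p x ->
    (EFin \o hw n) x @[n --> \oo] --> (EFin \o h) x}%E.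
  apply: aeW => x hx; apply: cvg_EFin; first exact: nearW.
  rewrite -[X in _ --> X]mulr1; apply: cvgM; first exact: cvg_cst.
  have -> : 1 = 1 * (1 * 1) :> R by rewrite !mulr1.
  by apply: cvgM; [|apply: cvgM]; exact: cutoff_cvg1 (hx _).
have ae2 : {ae leb2, forall x, forall n, tri_int p x ->
    (`|(EFin \o hw n) x| <= (EFin \o cst M) x)%E}.
  apply: leb2_ae_imp hM => x hx n Tx /=; rewrite lee_fin normrM.
  have /andP[w0 w1] := W01 n x; rewrite (ger0_norm w0).
  by apply: le_trans (hx Tx); rewrite ler_piMr.
have ig : leb2.-integrable (tri_int p) (EFin \o cst M).
  by apply: integrable2 => //; [exact: tri_int_fin|exact: bm_cst].
have [iK _ cK] := @dominated_convergence _ RR R leb2 _ mT _ _ _ mf mh' ae1 ig ae2.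
have := @fine_cvg R _ _ _ (fun n => \int[leb2]_(x in tri_int p) (EFin \o hw n) x)%E
  (\int[leb2]_(x in tri_int p) h x).
apply; rewrite /Rintegral fineK //; exact: (@integrable_fin_num _ RR R leb2 _ mT _ iK).
Qed.

(** The linear part of [bary], that is, its constant derivative in direction [v]. *)
Definition dbary p (i : 'I_3) (v : R * R) : R := bary p i v - bary p i 0.

Lemma dbaryE p i v : dbary p i v = (p (i + 1) - p (i - 1)).2 / tdet p * v.1
    + (p (i - 1) - p (i + 1)).1 / tdet p * v.2.
Proof. by rewrite /dbary !bary_affine !coordE /=; ring. Qed.

Definition sbary p (N : R) (i : 'I_3) : @sexp R :=
  SFlat 1 (N * ((p (i + 1) - p (i - 1)).2 / tdet p)) (N * ((p (i - 1) - p (i + 1)).1 / tdet p))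
    (N * (cross (p (i + 1)) (p (i - 1)) / tdet p) - 1).

Lemma sbaryE p N i x : seval (sbary p N i) x = cutoff (N * bary p i x).
Proof. by rewrite /cutoff /=; congr flat; rewrite bary_affine; ring. Qed.

Lemma sbary_derivE p N i v x :
  seval (sderiv v (sbary p N i)) x = N * dbary p i v * cutoff' (N * bary p i x).
Proof.
rewrite /cutoff' /=; congr (_ * _); first by rewrite dbaryE; ring.
have -> : 'X^2 * (1 - (1 : {poly R})^`()) = 'X^2 by rewrite -(polyC1 R) derivC subr0 polyC1 mulr1.
by congr flat; rewrite bary_affine; ring.
Qed.

(** The divergence theorem for a function that has only a weak derivative. It is tested with [ev q]
    times the three cutoffs, which is supported in the open triangle; when the derivative falls on a
    cutoff, [layer_limit] turns the term into an integral over one edge. Continuity of [f] up to the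
    edges gives meaning to its edge values, and minus |det| times [dbary] is the edge length times
    the component of the outward normal. *)
Lemma triangle_ibp p (U : set (R * R)) (v : R * R) (f g : R * R -> R) (q : {poly {poly R}}) :
  tdet p != 0 -> tri_int p `<=` U -> {within tri p, continuous f} ->
  measurable_fun (tri_int p) g -> (exists M : R, {ae leb2, forall x, U x -> `|g x| <= M}) ->
  weak_derivative U v f g ->
  \int[leb2]_(x in tri_int p) (f x * 'D_v (ev q) x) + \int[leb2]_(x in tri_int p) (g x * ev q x) =
  - \sum_i dbary p i v * (`|tdet p| * \int[leb1]_(t in `[0, 1]) (f (tpt p i 0 t) * ev q (tpt p i 0 t))).
Proof.
move=> d0 TU cf mg [M hM] wd.
have mT := tri_int_measurable p; have fT := tri_int_fin d0.
have [s hs] := ev_sexp q.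
pose phi n := SMul s (SMul (sbary p n.+1%:R 0) (SMul (sbary p n.+1%:R 1) (sbary p n.+1%:R 2))).
have phiE n x : seval (phi n) x = ev q x * cutoffs p n x.
  by rewrite /cutoffs -!sbaryE -hs.
pose B n i x : R := n.+1%:R * ((f x * ev q x) * (cutoff' (n.+1%:R * bary p i x) *
    (cutoff (n.+1%:R * bary p (i - 1) x) * cutoff (n.+1%:R * bary p (i + 1) x)))).
have DqE x : 'D_v (ev q) x = seval (sderiv v s) x by have := is_derive_seval s x v; rewrite hs => -[_].
have Dphi n x : 'D_v (seval (phi n)) x = 'D_v (ev q) x * cutoffs p n x +
     ev q x * (n.+1%:R * dbary p 0 v * cutoff' (n.+1%:R * bary p 0 x) *
         (cutoff (n.+1%:R * bary p 1 x) * cutoff (n.+1%:R * bary p 2 x)) +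
       cutoff (n.+1%:R * bary p 0 x) * (n.+1%:R * dbary p 1 v * cutoff' (n.+1%:R * bary p 1 x) * cutoff (n.+1%:R * bary p 2 x) +
        cutoff (n.+1%:R * bary p 1 x) * (n.+1%:R * dbary p 2 v * cutoff' (n.+1%:R * bary p 2 x)))).
  have [_ ->] := is_derive_seval (phi n) x v.
  by rewrite DqE -hs /cutoffs -!sbary_derivE -!sbaryE.
have dphiE n x : f x * 'D_v (seval (phi n)) x =
    f x * 'D_v (ev q) x * cutoffs p n x + \sum_i dbary p i v * B n i x.
  by rewrite Dphi sum3 /B !I3_succ; ring.
have out n x : ~ tri_int p x -> seval (phi n) x = 0 /\ 'D_v (seval (phi n)) x = 0.
  move=> /existsNP[j /negP]; rewrite -leNgt => hj.
  have N0 : 0 < n.+1%:R :> R by rewrite ltr0n.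
  have hj1 : n.+1%:R * bary p j x <= 1 by apply: le_trans ler01; rewrite pmulr_rle0.
  have z1 := cutoff_eq0 hj1; have z2 := cutoff'_eq0 hj1.
  split; first by rewrite phiE /cutoffs; move: z1; have [->|->|->] := I3P j => ->; rewrite !(mul0r, mulr0).
  rewrite Dphi /cutoffs; move: z1 z2; have [->|->|->] := I3P j => -> ->;
  by rewrite !(mul0r, mulr0, addr0, add0r).
have tst n : test_function U (seval (phi n)).
  (* A cutoff at scale n + 1 vanishes where its barycentric coordinate is at most 1/(n + 1), so the
     support lies in this closed subset of the open triangle. *)
  pose C := \bigcap_(j in [set: 'I_3]) (bary p j @^-1` [set t | n.+1%:R^-1 <= t]).
  have N0 : 0 < n.+1%:R :> R by rewrite ltr0n.
  have cC : closed C.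
    apply: closed_bigI => j _; apply: preimage_closed; last exact: closed_ge.
    by move=> x _; exact: continuous_bary.
  have sC : closure [set x | seval (phi n) x != 0] `<=` C.
    rewrite closure_id in cC; rewrite cC; apply: closureS => x hx j _.
    have {}hx : ev q x * cutoffs p n x != 0 by rewrite -phiE.
    rewrite /cutoffs in hx; rewrite /preimage /mkset leNgt; apply/negP => hj.
    have : n.+1%:R * bary p j x <= 1.
      by rewrite mulrC -ler_pdivlMr // mul1r ltW.
    move=> /cutoff_eq0 z; move: hx; have [jE|jE|jE] := I3P j; rewrite jE in z;
    by rewrite z !(mul0r, mulr0) eqxx.
  have CT : C `<=` tri_int p by move=> x hx j; apply: lt_le_trans (hx j I); rewrite invr_gt0.
  split; first exact: smooth_seval.
  - apply: subclosed_compact (tri_compact d0) _; first exact: closed_closure.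
    by move=> x /sC /CT; exact: tri_int_sub.
  - by move=> x /sC /CT /TU.
have restr (h : R * R -> R) : (forall x, ~ tri_int p x -> h x = 0) ->
    \int[leb2]_(x in U) h x = \int[leb2]_(x in tri_int p) h x.
  move=> h0; rewrite Rintegral_mkcond [RHS]Rintegral_mkcond; apply: eq_Rintegral => x _.
  rewrite /patch; case: (boolP (x \in tri_int p)) => [/set_mem Tx|].
    by rewrite mem_set //; exact: TU.
  by rewrite notin_setE => /h0 ->; case: ifP.
have bf : bm (tri_int p) f.
  apply: bm_sub (bm_cont (tri_compact d0) cf); first exact: tri_measurable.
  exact: tri_int_sub.
have bmc (h : R * R -> R) : continuous h -> bm (tri_int p) h.
  move=> ch; apply: bm_sub (bm_cont (tri_compact d0) (continuous_subspaceT ch)); first exact: tri_measurable.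
  exact: tri_int_sub.
have bq : bm (tri_int p) (ev q) by apply: bmc; exact: continuous_ev.
have bDq : bm (tri_int p) ('D_v (ev q)).
  by apply: (@bm_ext _ _ _ _ (seval (sderiv v s))) => [x _|]; [rewrite DqE|apply: bmc; exact: continuous_seval].
have bW n : bm (tri_int p) (cutoffs p n).
  apply: bmc => x.
  by apply: cvgM; [|apply: cvgM]; apply: continuous_comp_bary; exact: continuous_cutoff.
have bB n i : bm (tri_int p) (B n i).
  apply: bmZ; apply: bmM; first exact: bmM.
  apply: bmM; first by apply: bmc; exact: continuous_comp_bary continuous_cutoff'.
  by apply: bmM; apply: bmc; exact: continuous_comp_bary continuous_cutoff.
(* The defining identity of the weak derivative for [phi n], split into the interior term and the
   three layers; each piece has its own limit below. *)
have key n : \int[leb2]_(x in tri_int p) (f x * 'D_v (ev q) x * cutoffs p n x) +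
    \sum_i dbary p i v * \int[leb2]_(x in tri_int p) B n i x =
    - \int[leb2]_(x in tri_int p) (g x * ev q x * cutoffs p n x).
  have E1 : \int[leb2]_(x in U) (f x * 'D_v (seval (phi n)) x) =
      \int[leb2]_(x in tri_int p) (f x * 'D_v (seval (phi n)) x).
    by apply: restr => x /(out n)[_ ->]; rewrite mulr0.
  have E2 : \int[leb2]_(x in U) (g x * seval (phi n) x) =
      \int[leb2]_(x in tri_int p) (g x * seval (phi n) x).
    by apply: restr => x /(out n)[-> _]; rewrite mulr0.
  have := wd _ (tst n); rewrite E1 E2.
  have -> : \int[leb2]_(x in tri_int p) (g x * seval (phi n) x) =
      \int[leb2]_(x in tri_int p) (g x * ev q x * cutoffs p n x).
    by apply: eq_Rintegral => x _; rewrite phiE mulrA.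
  move=> <-.
  have -> : \int[leb2]_(x in tri_int p) (f x * 'D_v (seval (phi n)) x) =
     \int[leb2]_(x in tri_int p) (f x * 'D_v (ev q) x * cutoffs p n x + \sum_i dbary p i v * B n i x).
    by apply: eq_Rintegral => x _; exact: dphiE.
  rewrite (Rint2D mT fT (h := fun x => f x * 'D_v (ev q) x * cutoffs p n x)
    (k := fun x => \sum_i dbary p i v * B n i x)); last 2 first.
  - by apply: bmM => //; exact: bmM.
  - by apply: bm_sum => i _; exact: bmZ.
  congr (_ + _); rewrite (Rint2_sum mT fT); last by move=> i _; exact: bmZ.
  by apply: eq_bigr => i _; rewrite (Rint2Z mT fT).
have L1 : \int[leb2]_(x in tri_int p) (f x * 'D_v (ev q) x * cutoffs p n x) @[n --> \oo] -->
    \int[leb2]_(x in tri_int p) (f x * 'D_v (ev q) x).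
  apply: (@cutoffs_limit p (fun x => f x * 'D_v (ev q) x) d0 (bmM bf bDq).1).
  have [M' hM'] := (bmM bf bDq).2; exists M'.
  exact: (@aeW _ _ _ (leb2 : {measure set RR -> \bar R})).
have L2 : \int[leb2]_(x in tri_int p) (g x * ev q x * cutoffs p n x) @[n --> \oo] -->
    \int[leb2]_(x in tri_int p) (g x * ev q x).
  apply: (@cutoffs_limit p (fun x => g x * ev q x) d0).
    by apply: measurable_funM => //; exact: bq.1.
  have [Q hQ] := bq.2; exists (`|M| * Q).
  apply: leb2_ae_imp hM => x hx Tx; rewrite normrM ler_pM // ?hQ //.
  by apply: le_trans (hx (TU _ Tx)) (ler_norm _).
have L3 i : \int[leb2]_(x in tri_int p) B n i x @[n --> \oo] -->
    `|tdet p| * \int[leb1]_(t in `[0, 1]) (f (tpt p i 0 t) * ev q (tpt p i 0 t)).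
  apply: (@layer_limit p i (fun x => f x * ev q x) d0) => x.
  by apply: cvgM; [exact: cf|exact: (continuous_subspaceT (@continuous_ev R q))].
have C1 : (- (\int[leb2]_(x in tri_int p) (g x * ev q x * cutoffs p n x))) @[n --> \oo] -->
    \int[leb2]_(x in tri_int p) (f x * 'D_v (ev q) x) +
    \sum_i dbary p i v * (`|tdet p| * \int[leb1]_(t in `[0, 1]) (f (tpt p i 0 t) * ev q (tpt p i 0 t))).
  rewrite (_ : (fun n => _) = (fun n => \int[leb2]_(x in tri_int p) (f x * 'D_v (ev q) x * cutoffs p n x) +
    \sum_i dbary p i v * \int[leb2]_(x in tri_int p) B n i x)); last by apply/funext => n; rewrite key.
  apply: cvgD L1 _; rewrite sum3; under eq_fun do rewrite sum3.
  by apply: cvgD; [apply: cvgD|]; apply: cvgM; [exact: cvg_cst|exact: L3|exact: cvg_cst|exact: L3|exact: cvg_cst|exact: L3].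
have C2 := @cvgN _ _ _ _ _ _ _ L2.
have E := cvg_unique (@norm_hausdorff _ R) C1 (C2 _).
by apply/eqP; rewrite -subr_eq0 opprK addrAC E addNr.
Qed.


End Layer_limit.

(** * Classical derivatives as weak derivatives *)

Section Classical_weak_derivative.
Context {R : realType}.
Local Notation mu := (@lebesgue_measure R).
Local Notation RR := (measurableTypeR R * measurableTypeR R)%type.

Lemma is_derive_line (F : R * R -> R) (x v : R * R) (d : R) (t : R) :
  is_derive (x + t *: v) v F d -> is_derive t 1 (fun h : R => F (x + h *: v)) d.
Proof.
have E : (fun h : R => h^-1 *: ((F \o shift (x + t *: v)) (h *: v) - F (x + t *: v))) =
  (fun h : R => h^-1 *: (((fun h : R => F (x + h *: v)) \o shift t) (h *: (1 : R)) - F (x + t *: v))).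
  apply/funext => h /=; rewrite -[h *: (1 : R)]/(h * 1) mulr1.
  congr (_ *: (F _ - _)).
  by apply: pair_eqP; rewrite !coordE; ring.
by move=> [h1 h2]; apply: DeriveDef; move: h1 h2; rewrite /derivable /derive E.
Qed.

Lemma continuous_line (x v : R * R) : continuous (fun t : R => x + t *: v).
Proof. by move=> t; apply: cvgD; [exact: cvg_cst|apply: cvgZr_tmp; exact: cvg_id]. Qed.

Lemma integral_derive_support (F f : R -> R) (r : R) : 0 < r ->
  (forall t : R, is_derive t 1 F (f t)) -> continuous f ->
  (forall t, r <= `|t| -> F t = 0 /\ f t = 0) ->
  (\int[mu]_t (f t)%:E = 0)%E.
Proof.
move=> r0 dF cf hs.
have cF : continuous F.
  by move=> t; apply: differentiable_continuous; apply/derivable1_diffP; case: (dF t).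
transitivity (\int[mu]_(t in `[(- r)%R, r]) (f t)%:E)%E.
  rewrite [RHS]integral_mkcond; apply: eq_integral => t _; rewrite patchE.
  case: ifPn => // h; rewrite (hs t _).2 //.
  move: h; rewrite notin_setE /= in_itv /= => /negP; rewrite -ler_norml -ltNge; exact: ltW.
have rr : - r < r by lra.
rewrite (@continuous_FTC2 R f F _ _ rr).
- by rewrite (hs r _).1 ?(hs (- r) _).1 ?sube0 ?normrN // gtr0_norm.
- exact: continuous_subspaceT.
- split; first by move=> t _; case: (dF t).
    by apply: cvg_at_right_filter; exact: cF.
  by apply: cvg_at_left_filter; exact: cF.
- by move=> t _; rewrite derive1E; case: (dF t).
Qed.

Lemma derive_out_support (phi : R * R -> R) (x v : R * R) :
  ~ closure [set x | phi x != 0] x -> phi x = 0 /\ 'D_v phi x = 0.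
Proof.
move=> hx; have o : open (~` closure [set x | phi x != 0]).
  by apply: closed_openC; exact: closed_closure.
have N : \forall y \near x, phi y = 0.
  apply: filterS (open_nbhs_nbhs (conj o hx)) => y hy.
  by apply/eqP; apply: contrapT => /negP h; apply: hy; exact: subset_closure.
split; first exact: nbhs_singleton N.
have h0 : is_derive x v (cst 0 : R * R -> R) 0 by exact: is_derive_cst.
have : is_derive x v phi 0.
  by apply: near_eq_is_derive h0; apply: filterS N => y ->.
by case.
Qed.

(** On every line parallel to [v] the derivative of the compactly supported product of [G] and the
    test function integrates to 0; Fubini does the rest. Differentiability is asked for along [v]
    only, because the functions of the boundary strip are built on Lipschitz graphs and may fail to
    be differentiable in the other direction. *)
Lemma weak_derivative_classical (v : R * R) (G g : R * R -> R) : v = e1 \/ v = e2 ->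
  (forall x, is_derive x v G (g x)) -> continuous G -> continuous g ->
  weak_derivative setT v G g.
Proof.
move=> hv dG cG cg phi [sphi kphi _].
have [r r0 hr] := compact_enorm_bounded kphi.
have vin : v \in [:: e1; e2 : R * R] by case: hv => ->; rewrite !inE eqxx ?orbT.
have nilS : {subset [::] <= [:: e1; e2 : R * R]} by [].
have cphi : continuous phi by have [] := sphi [::] nilS.
have cDphi : continuous ('D_v phi).
  have [|h _] := sphi [:: v]; last exact: h.
  by move=> w; rewrite inE => /eqP ->.
have dphi x : is_derive x v phi ('D_v phi x).
  apply: DeriveDef => //; have [_ /(_ x)[h1 h2]] := sphi [::] nilS.
  by case: hv => ->; [exact: h1|exact: h2].
(* The margin 1 puts every point with a coordinate of size [s] or more outside the support, where
   the test function and its derivative both vanish. *)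
pose s := r + 1; have s0 : 0 < s by rewrite /s; lra.
have out x : s <= `|x.1| \/ s <= `|x.2| -> phi x = 0 /\ 'D_v phi x = 0.
  move=> hx; apply: derive_out_support => /hr h.
  by case: hx => hx; have := le_trans (coord1_le_enorm x) h; have := le_trans (coord2_le_enorm x) h;
    move: hx; rewrite /s; lra.
pose h x := phi x * g x + G x * 'D_v phi x.
have ch : continuous h.
  by move=> x; apply: cvgD; apply: cvgM; [exact: cphi|exact: cg|exact: cG|exact: cDphi].
have dh x : is_derive x v (G * phi) (h x).
  apply: is_derive_eq (is_deriveM (dG x) (dphi x)) _.
  by rewrite -[_ *: _]/(_ * _) -[X in _ + X]/(_ * _) addrC.
have hout x : s <= `|x.1| \/ s <= `|x.2| -> (G * phi) x = 0 /\ h x = 0.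
  by move=> /out[h1 h2]; rewrite /h -[(G * phi) x]/(G x * phi x) h1 h2 !mulr0 mul0r addr0.
pose Bx : set (R * R) := `[- s, s]%classic `*` `[- s, s]%classic.
have inB x : ~ Bx x -> s <= `|x.1| \/ s <= `|x.2|.
  move=> nB; apply: contrapT => /not_orP[/negP + /negP].
  rewrite -!ltNge !ltr_norml => /andP[h1 h2] /andP[h3 h4].
  by apply: nB; split; rewrite /= in_itv /= !ltW.
have cB : compact Bx by apply: compact_setX; exact: segment_compact.
have mB : measurable Bx by apply: measurableX; exact: measurable_itv.
have fB : (leb2 Bx < +oo)%E.
  apply: (@leb2_fin _ _ s) => // x [/=]; rewrite !in_itv /= -!ler_norml.
  by move=> a b.
have patchB (k : R * R -> R) : (forall x, s <= `|x.1| \/ s <= `|x.2| -> k x = 0) -> k \_ Bx = k.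
  move=> k0; apply/funext => x; rewrite patchE; case: ifPn => //.
  by rewrite notin_setE => /inB /k0.
have toB (k : R * R -> R) : (forall x, s <= `|x.1| \/ s <= `|x.2| -> k x = 0) ->
    \int[leb2]_(x in setT) k x = \int[leb2]_(x in Bx) k x.
  by move=> k0; rewrite [RHS]Rintegral_mkcond patchB.
have bB (k : R * R -> R) : continuous k -> bm Bx k.
  by move=> ck; apply: bm_cont => //; exact: continuous_subspaceT.
rewrite (toB (fun x => G x * 'D_v phi x)); last by move=> x /out[_ ->]; rewrite mulr0.
rewrite (toB (fun x => g x * phi x)); last by move=> x /out[-> _]; rewrite mulr0.
apply/eqP; rewrite eq_sym -subr_eq0 -opprD oppr_eq0; apply/eqP.
rewrite -(Rint2D mB fB); last 2 first.
- by apply: bmM; exact: bB.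
- by apply: bmM; exact: bB.
transitivity (\int[leb2]_(x in setT) h x).
  rewrite toB; last by move=> x /hout[].
  by apply: eq_Rintegral => x _; rewrite /h mulrC.
have ih : leb2.-integrable setT (EFin \o h).
  have := (@integrable_mkcond _ RR R leb2 _ (EFin \o h) mB).1 (integrable2 mB fB (bB h ch)).
  by rewrite restrict_EFin patchB // => x /hout[].
rewrite /Rintegral; suff -> : (\int[leb2]_x (h x)%:E = 0)%E by [].
have slice (x : R * R) (k : R -> R) : (forall t, s <= `|t| -> s <= `|(x + t *: v).1| \/ s <= `|(x + t *: v).2|) ->
    (forall t, k t = h (x + t *: v)) -> (\int[mu]_t (k t)%:E = 0)%E.
  move=> xs kE; rewrite (_ : k = fun t => h (x + t *: v)); last by apply/funext.
  apply: (@integral_derive_support (fun t => (G * phi) (x + t *: v)) _ s) => //.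
  - by move=> t; apply: is_derive_line; exact: dh.
  - by move=> t; apply: (@continuous_comp _ _ _ (fun t : R => x + t *: v) h); [exact: continuous_line|exact: ch].
  - by move=> t ht; apply: hout; exact: xs.
case: hv => hv.
  have := integral21_prod_meas1 ih => <-.
  apply: integral0_eq => y _; rewrite /fubini_G.
  apply: (slice (0, y) (fun t => h (t, y))) => t; rewrite hv; first by rewrite !coordE /= mulr1 add0r; left.
  by congr h; apply: pair_eqP; rewrite !coordE /=; ring.
have := integral12_prod_meas1 ih => <-.
apply: integral0_eq => y _; rewrite /fubini_F.
apply: (slice (y, 0) (fun t => h (y, t))) => t; rewrite hv.
  by rewrite !coordE /= mulr1 add0r; right.
by congr h; apply: pair_eqP; rewrite !coordE /=; ring.
Qed.

End Classical_weak_derivative.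

(** * Positive definite Gram matrices *)

Section Gram.
Context {R : realType}.

Let discr (X Y Z : R) : 0 < Z -> 0 <= X + - (Y / Z) * Y + - (Y / Z) * (Y + - (Y / Z) * Z) ->
  Y ^+ 2 <= X * Z.
Proof.
move=> Z0; have -> : X + - (Y / Z) * Y + - (Y / Z) * (Y + - (Y / Z) * Z) = X - Y ^+ 2 / Z.
  by field; rewrite gt_eqF.
by rewrite subr_ge0 ler_pdivrMr.
Qed.

(** Equivalence of norms in finite dimension: coordinate [k] is the inner product with the k-th dual
    basis vector, and the Cauchy-Schwarz inequality for the form of [G] bounds it. *)
Lemma gram_bound n (G : 'M[R]_n) : G^T = G ->
  (forall c : 'rV_n, c != 0 -> 0 < (c *m G *m c^T) 0 0) ->
  exists2 C : R, 0 <= C & forall (c : 'rV_n) k, c 0 k ^+ 2 <= C * (c *m G *m c^T) 0 0.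
Proof.
move=> sG pG.
pose b (x y : 'rV[R]_n) : R := (x *m G *m y^T) 0 0.
have bC x y : b x y = b y x.
  by rewrite /b -[in LHS](trmxK (x *m G *m y^T)) mxE !trmx_mul trmxK sG mulmxA.
have bDZ x y z t : b (x + t *: y) z = b x z + t * b y z.
  by rewrite /b !mulmxDl -!scalemxAl !mxE.
have b0 x : 0 <= b x x.
  by have [->|/pG/ltW] := eqVneq x 0; rewrite // /b !mul0mx mxE.
have CS x y : b x y ^+ 2 <= b x x * b y y.
  have [->|y0] := eqVneq y 0.
    have bx0 u : b u 0 = 0 by rewrite /b trmx0 mulmx0 mxE.
    by rewrite !bx0 mulr0 expr0n.
  have byy := pG _ y0; rewrite -/(b y y) in byy.
  have := b0 (x + (- (b x y / b y y)) *: y).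
  rewrite !bDZ [b x (_ + _)]bC [b y (_ + _)]bC !bDZ [b y x]bC => h.
  exact: discr byy h.
have uG : G \in unitmx.
  rewrite -row_free_unit -kermx_eq0; apply: contraT => /rowV0Pn[v /sub_kermxP vG v0].
  by have := pG _ v0; rewrite vG mul0mx mxE ltxx.
(* The dual basis, read off from the inverse Gram matrix: pairing [c] with [z k] gives exactly the
   coordinate [c 0 k]. *)
pose z k : 'rV[R]_n := (invmx G *m (delta_mx k 0 : 'cV_n))^T.
exists (\sum_k b (z k) (z k)); first by apply: sumr_ge0.
move=> c k; have -> : c 0 k = b c (z k).
  rewrite /b /z trmxK -mulmxA mulKVmx // mxE (bigD1 k) //= mxE !eqxx mulr1.
  by rewrite big1 ?addr0 // => j jk; rewrite mxE (negbTE jk) mulr0.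
apply: (le_trans (CS _ _)); rewrite mulrC ler_wpM2r // (bigD1 k) //= lerDl.
by apply: sumr_ge0.
Qed.

End Gram.

(** * Polynomials vanishing on open sets *)

Section Polynomial_zero.
Context {R : realType}.

Lemma poly_zero_itv (p : {poly R}) (a e : R) : 0 < e ->
  (forall t, `|t - a| < e -> p.[t] = 0) -> p = 0.
Proof.
move=> e0 hp; apply: contraTeq isT => p0.
pose n := size p.
pose s := [seq a + e * (k%:R / n.+1%:R) | k <- iota 0 n].
have us : uniq s.
  have en : e != 0 by rewrite gt_eqF.
  rewrite map_inj_uniq ?iota_uniq // => i j /addrI /(mulfI en).
  have n0 : n.+1%:R^-1 != 0 :> R by rewrite invr_neq0 // pnatr_eq0.
  by move/(mulIf n0)/eqP; rewrite eqr_nat => /eqP.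
have rs : all (root p) s.
  apply/allP => t /mapP[k]; rewrite mem_iota add0n => /andP[_ kn] ->.
  apply/rootP/hp; rewrite addrC addKr ger0_norm ?mulr_ge0 ?divr_ge0 ?ler0n ?(ltW e0) //.
  by rewrite -[X in _ < X]mulr1 ltr_pM2l // ltr_pdivrMr ?ltr0n // mul1r ltr_nat ltnS ltnW.
by have := max_poly_roots p0 rs us; rewrite size_map size_iota ltnn.
Qed.

Lemma ev_zero_open (p : {poly {poly R}}) (x : R * R) (e : R) : 0 < e ->
  (forall y : R * R, `|y.1 - x.1| < e -> `|y.2 - x.2| < e -> ev p y = 0) -> p = 0.
Proof.
move=> e0 hp; apply/polyP => i; rewrite coef0.
apply: (@poly_zero_itv _ x.2 e e0) => b hb.
suff : map_poly (horner_eval b) p = 0.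
  by move=> /(congr1 (fun q : {poly R} => q`_i)); rewrite coef_map coef0.
apply: (@poly_zero_itv _ x.1 e e0) => a ha.
have := hp (a, b) ha hb; rewrite /ev /= => <-.
by have := horner_map (horner_eval b) p a%:P; rewrite /= {2}/horner_eval hornerC => ->.
Qed.

Lemma open_leb2_gt0 (A : set (R * R)) : open A -> A !=set0 -> (0 < leb2 A)%E.
Proof.
move=> oA [x Ax].
have [e e0 he] := nbhs_rect (open_nbhs_nbhs (conj oA Ax)).
pose B : set (R * R) := `]x.1 - e, x.1 + e[%classic `*` `]x.2 - e, x.2 + e[%classic.
have BA : B `<=` A.
  by move=> y [/=]; rewrite !in_itv /= => /andP[a b] /andP[c d]; apply: he; rewrite ltr_norml; apply/andP; split; lra.
have mB : measurable B by apply: measurableX; exact: measurable_itv.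
apply: (@lt_le_trans _ _ (leb2 B)); last first.
  by apply: le_measure => //; rewrite inE; [exact: mB|exact: open_measurable2].
rewrite product_measure1E; [|exact: measurable_itv..].
have L (a : R) : (0 < @lebesgue_measure R `](a - e)%R, (a + e)%R[%classic)%E.
  rewrite lebesgue_measure_itv /= lte_fin; have -> : a - e < a + e by lra.
  by rewrite -EFinB lte_fin; lra.
by apply: mule_gt0; [exact: (L x.1)|exact: (L x.2)].
Qed.

Lemma Rint_gt0 (p : 'I_3 -> R * R) (f : R * R -> R) (x : R * R) : tdet p != 0 -> continuous f ->
  (forall y, 0 <= f y) -> tri_int p x -> f x != 0 -> 0 < \int[leb2]_(y in tri p) f y.
Proof.
move=> d0 cf f0 Tx fx; have fx0 : 0 < f x by rewrite lt_neqAle eq_sym fx f0.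
have mT := tri_measurable d0; have fT := tri_fin d0.
have bf : bm (tri p) f by apply: bm_cont; [exact: tri_compact|exact: continuous_subspaceT].
pose A := tri_int p `&` (f @^-1` [set t | f x / 2 < t]).
have oA : open A.
  apply: openI; first exact: open_tri_int.
  by apply: open_comp; [move=> y _; exact: cf|exact: open_gt].
have Ax : A !=set0 by exists x; split => //=; lra.
have mA := open_measurable2 oA.
have AT : A `<=` tri p by move=> y [h _]; exact: tri_int_sub.
have finA : (leb2 A < +oo)%E.
  by apply: le_lt_trans fT; apply: le_measure => //; rewrite inE; [exact: mA|exact: mT].
have mu0 : 0 < fine (leb2 A).
  by apply: fine_gt0; rewrite open_leb2_gt0.
apply: (@lt_le_trans _ _ (f x / 2 * fine (leb2 A))); first by rewrite mulr_gt0 // divr_gt0.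
have bI : bm (tri p) (fun y => f x / 2 * \1_A y).
  apply: bmZ; split.
    by apply: measurable_indic; exact: mA.
  by exists 1 => y _; rewrite indicE; case: (_ \in _); rewrite ?normr1 ?normr0.
apply: (@le_trans _ _ (\int[leb2]_(y in tri p) (f x / 2 * \1_A y))); last first.
  apply: (Rint2_le mT fT) => // y Ty; rewrite indicE; case: (boolP (y \in A)) => [/set_mem[_ /=]|_].
    by rewrite mulr1 => /ltW.
  by rewrite mulr0.
rewrite (Rint2Z mT fT); last first.
  split; first by apply: measurable_indic; exact: mA.
  by exists 1 => y _; rewrite indicE; case: (_ \in _); rewrite ?normr1 ?normr0.
rewrite ler_pM2l ?divr_gt0 // /Rintegral integral_indic //.
by rewrite (setIidl AT).
Qed.

End Polynomial_zero.

(** * Coefficients controlled by the L^2 norm on the reference triangle *)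

Section Coefficient_bound.
Context {R : realType}.

Definition kref (i : 'I_3) : R * R := if i == 0 then (0, 0) else if i == 1 then (1, 0) else (0, 1).

Lemma tdet_kref : tdet kref = 1.
Proof. by rewrite /tdet /cross !coordE /kref /=; ring. Qed.

Lemma tdet_kref_neq0 : tdet kref != 0. Proof. by rewrite tdet_kref oner_neq0. Qed.

Lemma evE2 n (p : {poly {poly R}}) x :
  (forall i j : nat, ((n < i) || (n < j))%N -> p`_i`_j = 0) ->
  ev p x = \sum_(ij : 'I_n.+1 * 'I_n.+1) p`_ij.1`_ij.2 * (x.1 ^+ ij.1 * x.2 ^+ ij.2).
Proof.
move=> hp; rewrite -(pair_bigA _ (fun i j : 'I_n.+1 => p`_i`_j * (x.1 ^+ i * x.2 ^+ j))) /=.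
rewrite /ev (@horner_coef_le _ p _ n); last first.
  by move=> i hi; apply/polyP => j; rewrite coef0 hp // hi.
rewrite horner_sum; apply: eq_bigr => i _.
rewrite hornerM -rmorphXn hornerC (@horner_coef_le _ p`_i _ n); last first.
  by move=> j hj; rewrite hp // hj orbT.
by rewrite mulr_suml; apply: eq_bigr => j _; ring.
Qed.

Lemma coef_bound (n : nat) : exists2 C : R, 0 <= C & forall w : {poly {poly R}},
  (forall i j : nat, ((n < i) || (n < j))%N -> w`_i`_j = 0) ->
  forall i j, w`_i`_j ^+ 2 <= C * \int[leb2]_(x in tri kref) (ev w x ^+ 2).
Proof.
pose T : finType := ('I_n.+1 * 'I_n.+1)%type.
have cK := tri_compact tdet_kref_neq0.
have mK := tri_measurable tdet_kref_neq0; have fK := tri_fin tdet_kref_neq0.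
pose mono (k : T) (x : R * R) : R := x.1 ^+ k.1 * x.2 ^+ k.2.
have cmono k : continuous (mono k).
  move=> x; apply: cvgM.
    by apply: (@continuous_comp _ _ _ fst (fun t : R => t ^+ k.1)); [exact: cvg_fst|exact: exprn_continuous].
  by apply: (@continuous_comp _ _ _ snd (fun t : R => t ^+ k.2)); [exact: cvg_snd|exact: exprn_continuous].
have bmono k : bm (tri kref) (mono k) by apply: bm_cont => //; exact: continuous_subspaceT.
pose G : 'M[R]_#|T| := \matrix_(k, l) \int[leb2]_(x in tri kref) (mono (enum_val k) x * mono (enum_val l) x).
pose fc (c : 'rV[R]_#|T|) x := \sum_k c 0 k * mono (enum_val k) x.
have GE c : (c *m G *m c^T) 0 0 = \int[leb2]_(x in tri kref) (fc c x ^+ 2).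
  have -> : \int[leb2]_(x in tri kref) (fc c x ^+ 2) =
    \int[leb2]_(x in tri kref) (\sum_l \sum_k (c 0 l * c 0 k) * (mono (enum_val k) x * mono (enum_val l) x)).
    apply: eq_Rintegral => x _; rewrite expr2 /fc mulr_sumr; apply: eq_bigr => l _.
    by rewrite mulr_suml; apply: eq_bigr => k _; ring.
  rewrite (Rint2_sum mK fK); last first.
    by move=> l _; apply: bm_sum => k _; apply: bmZ; exact: bmM.
  rewrite !mxE; apply: eq_bigr => l _.
  rewrite (Rint2_sum mK fK); last by move=> k _; apply: bmZ; exact: bmM.
  rewrite !mxE mulr_suml; apply: eq_bigr => k _.
  rewrite (Rint2Z mK fK); last exact: bmM.
  by rewrite !mxE; ring.
pose pc (c : 'rV[R]_#|T|) : {poly {poly R}} :=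
  \poly_(i < n.+1) \poly_(j < n.+1) c 0 (enum_rank (inord i, inord j)).
have pcC c (i j : 'I_n.+1) : (pc c)`_i`_j = c 0 (enum_rank (i, j)).
  by rewrite /pc coef_poly ltn_ord coef_poly ltn_ord !inord_val.
have pc0 c (i j : nat) : ((n < i) || (n < j))%N -> (pc c)`_i`_j = 0.
  rewrite /pc coef_poly ltnS [(i <= n)%N]leqNgt; case: (n < i)%N => /= [_|nj]; first by rewrite coef0.
  by rewrite coef_poly ltnS leqNgt nj.
have sumE (F : T -> R) : \sum_(k < #|T|) F (enum_val k) = \sum_ij F ij.
  by rewrite -big_enum_val; apply: eq_bigl.
have fcE c x : fc c x = ev (pc c) x.
  rewrite (evE2 _ (pc0 c)) -sumE; apply: eq_bigr => k _.
  by rewrite pcC -surjective_pairing enum_valK.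
have sG : G^T = G.
  by apply/matrixP => k l; rewrite !mxE; apply: eq_Rintegral => x _; rewrite mulrC.
have pG (c : 'rV_#|T|) : c != 0 -> 0 < (c *m G *m c^T) 0 0.
  move=> c0; rewrite GE; have /eqP : pc c != 0.
    apply: contra c0 => /eqP h; apply/eqP/rowP => k; rewrite mxE -(enum_valK k).
    by case: (enum_val k) => i j; rewrite -pcC h !coef0.
  move=> hne; have [x Tx fx] : exists2 x, tri_int kref x & fc c x != 0.
    apply: contrapT => hn; apply: hne.
    pose x0 : R * R := (4^-1, 4^-1).
    have Tx0 : tri_int kref x0.
      move=> i; rewrite /bary tdet_kref divr1 /cross /x0.
      by have [->|->|->] := I3P i; rewrite !I3_succ !coordE /kref /=; lra.
    have [e e0 he] := nbhs_rect (open_nbhs_nbhs (conj (@open_tri_int R kref) Tx0)).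
    apply: (@ev_zero_open _ _ x0 e e0) => y h1 h2; rewrite -fcE.
    by apply: contrapT => /eqP hy; apply: hn; exists y => //; exact: he.
  apply: (@Rint_gt0 _ kref _ x) => //; first exact: tdet_kref_neq0.
  - have -> : fc c = ev (pc c) by apply/funext.
    move=> y; apply: (@continuous_comp _ _ _ (ev (pc c)) (fun t : R => t ^+ 2)).
      exact: continuous_ev.
    exact: exprn_continuous.
  - by move=> y; exact: sqr_ge0.
  - by rewrite sqrf_eq0.
have [C C0 hC] := gram_bound sG pG; exists C => // w hw i j.
pose wc (ij : T) : R := w`_ij.1`_ij.2.
pose c : 'rV[R]_#|T| := \row_k wc (enum_val k).
have wfc x : ev w x = fc c x.
  by rewrite (evE2 _ hw) -sumE; apply: eq_bigr => k _; rewrite mxE.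
have [h|h] := boolP ((n < i) || (n < j))%N.
  rewrite hw // expr0n /= mulr_ge0 //; apply: Rintegral_ge0 => x _; exact: sqr_ge0.
move: h; rewrite negb_or -!leqNgt -[(i <= n)%N]ltnS -[(j <= n)%N]ltnS => /andP[hi hj].
have := hC c (enum_rank (Ordinal hi, Ordinal hj)); rewrite mxE enum_rankK /= GE => h.
apply: le_trans h _; rewrite ler_wpM2l // le_eqVlt; apply/orP; left; apply/eqP.
by apply: eq_Rintegral => x _; rewrite wfc.
Qed.

End Coefficient_bound.

(** * Unisolvent point sets *)

Section Unisolvence.
Context {R : realType}.

Lemma card_total_degree N : #|[set ij : 'I_N.+1 * 'I_N.+1 | (ij.1 + ij.2 <= N)%N]%SET| = Np N.
Proof.
rewrite -sum1dep_card.
rewrite -(pair_big_dep xpredT (fun i j : 'I_N.+1 => (i + j <= N)%N) (fun _ _ => 1%N)) /=.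
have h (i : 'I_N.+1) : \sum_(j < N.+1 | (i + j <= N)%N) 1 = (N.+1 - i)%N.
  rewrite -(big_mkord (fun j => (i + j <= N)%N) (fun=> 1%N)) sum1_count.
  have -> : count (fun j => (i + j <= N)%N) (index_iota 0 N.+1) = count (fun j => (j < N.+1 - i)%N) (iota 0 N.+1).
    rewrite /index_iota subn0; apply: eq_count => j; have := ltn_ord i; lia.
  have := @filter_iota_ltn 0 _ _ (leq_subr i N.+1); rewrite add0n => h.
  by rewrite -size_filter h size_iota.
rewrite (eq_bigr _ (fun i _ => h i)) -(big_mkord xpredT (fun i => (N.+1 - i)%N)) big_nat_rev /= add0n.
rewrite (eq_big_nat _ _ (F2 := fun i => i.+1)); last by move=> i hi; lia.
rewrite /Np; have -> : \sum_(0 <= i < N.+1) i.+1 = \sum_(0 <= i < N.+2) i.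
  by rewrite [RHS]big_nat_recl // add0n.
by rewrite bin2_sum bin2 divn2 mulnC.
Qed.

(** The evaluation matrix of the monomials at the points is square by [card_total_degree], so
    unisolvence makes it invertible; its inverse yields both the bound on the coefficients and the
    interpolant. The points are arbitrary because the displaced boundary nodes are used as well. *)
Lemma unisolvent_interpolation (N : nat) (pts : 'I_(Np N) -> R * R) :
  (forall p, total_degree_le N p -> (forall n, ev p (pts n) = 0) -> p = 0) ->
  (exists2 C : R, 0 <= C & forall w, total_degree_le N w ->
     forall i j, w`_i`_j ^+ 2 <= C * \sum_n ev w (pts n) ^+ 2) /\
  (forall y : 'I_(Np N) -> R, exists2 w, total_degree_le N w & forall n, ev w (pts n) = y n).
Proof.
move=> uni.
pose S : {set 'I_N.+1 * 'I_N.+1} := [set ij : 'I_N.+1 * 'I_N.+1 | (ij.1 + ij.2 <= N)%N]%SET.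
have cS : #|S| = Np N := card_total_degree N.
pose mono (k : 'I_N.+1 * 'I_N.+1) (x : R * R) : R := x.1 ^+ k.1 * x.2 ^+ k.2.
pose A : 'M[R]_(#|S|, Np N) := \matrix_(k, n) mono (enum_val k) (pts n).
pose coef (w : {poly {poly R}}) (ij : 'I_N.+1 * 'I_N.+1) : R := w`_ij.1`_ij.2.
pose cf w : 'rV[R]_#|S| := \row_k coef w (enum_val k).
have evS w x : total_degree_le N w -> ev w x = \sum_(k < #|S|) coef w (enum_val k) * mono (enum_val k) x.
  move=> hw; rewrite (evE _ hw) (pair_bigA _ (fun i j : 'I_N.+1 => w`_i`_j * (x.1 ^+ i * x.2 ^+ j))) /=.
  rewrite -(big_enum_val (fun k => coef w k * mono k x)).
  rewrite [LHS](bigID (fun k => k \in S)) /= [X in _ + X]big1 ?addr0 // => k.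
  by rewrite inE -ltnNge => hk; rewrite hw ?mul0r.
have cfA w : total_degree_le N w -> cf w *m A = \row_n ev w (pts n).
  move=> hw; apply/rowP => n; rewrite !mxE evS //.
  by apply: eq_bigr => k _; rewrite !mxE.
have pc' (c : 'rV[R]_#|S|) : exists2 w, total_degree_le N w & cf w = c.
  pose ctot (i j : nat) : R := \sum_(k < #|S|) (if ((enum_val k).1 == i :> nat) && ((enum_val k).2 == j :> nat) then c 0 k else 0).
  exists (\poly_(i < N.+1) \poly_(j < N.+1) ctot i j).
    move=> i j hij; rewrite coef_poly; case: ifP => hi; last by rewrite coef0.
    rewrite coef_poly; case: ifP => hj //; rewrite /ctot big1 // => k _; case: ifP => // /andP[/eqP a /eqP b].
    have := enum_valP k; rewrite inE a b; lia.
  apply/rowP => k; rewrite mxE /coef coef_poly ltn_ord coef_poly ltn_ord /ctot (bigD1 k) //= !eqxx.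
  rewrite big1 ?addr0 // => l lk; case: ifP => // /andP[/eqP a /eqP b].
  case/eqP: lk; apply: enum_val_inj; move: a b; case: (enum_val l) => a1 a2; case: (enum_val k) => b1 b2 /=.
  by move=> /val_inj -> /val_inj ->.
have rfA : row_free A.
  rewrite -kermx_eq0; apply: contraT => /rowV0Pn[v /sub_kermxP vA /eqP v0]; case: v0.
  have [w hw wv] := pc' v; have w0 : w = 0.
    apply: uni => // n; have := cfA w hw; rewrite wv vA => /rowP/(_ n).
    by rewrite !mxE.
  by rewrite -wv w0; apply/rowP => k; rewrite !mxE /coef !coef0.
have rA : A *m pinvmx A = 1%:M := mulmxVp rfA.
have fA : row_full A by move: rfA; rewrite /row_free /row_full => /eqP ->; rewrite cS.
split; last first.
  move=> y; have [w hw wy] := pc' ((\row_n y n) *m pinvmx A); exists w => // n.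
  have := cfA w hw; rewrite wy -mulmxA (mulVpmx fA) mulmx1 => /rowP/(_ n).
  by rewrite !mxE.
pose K : R := \sum_k \sum_n (pinvmx A n k) ^+ 2.
have K0 : 0 <= K by apply: sumr_ge0 => k _; apply: sumr_ge0 => n _; exact: sqr_ge0.
have CS (I : finType) (a d : I -> R) : (\sum_i a i * d i) ^+ 2 <= (\sum_i a i ^+ 2) * (\sum_i d i ^+ 2).
  have h i : `|a i| * `|d i| <= Num.sqrt (\sum_i a i ^+ 2) * Num.sqrt (\sum_i d i ^+ 2).
    apply: ler_pM => //; rewrite -sqrtr_sqr ler_wsqrtr // (bigD1 i) //= lerDl sumr_ge0 // => j _; exact: sqr_ge0.
  set X := \sum_i a i ^+ 2; set Y := \sum_i d i ^+ 2; set Z := \sum_i a i * d i.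
  have X0 : 0 <= X by apply: sumr_ge0 => j _; exact: sqr_ge0.
  have q (t : R) : 0 <= X - 2 * t * Z + t ^+ 2 * Y.
    have -> : X - 2 * t * Z + t ^+ 2 * Y = \sum_i (a i - t * d i) ^+ 2.
      rewrite /X /Y /Z !mulr_sumr -sumrB -big_split /=; apply: eq_bigr => i _; ring.
    by apply: sumr_ge0 => j _; exact: sqr_ge0.
  have Y0 : 0 <= Y by apply: sumr_ge0 => j _; exact: sqr_ge0.
  have [Y00|Yn] := eqVneq Y 0.
    have d0 i : d i = 0.
      have := Y00; rewrite /Y => /eqP; rewrite psumr_eq0 => [/allP/(_ i (mem_index_enum _))|j _]; last exact: sqr_ge0.
      by rewrite sqrf_eq0 => /eqP.
    by rewrite /Z big1 ?expr0n ?mulr_ge0 // => i _; rewrite d0 mulr0.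
  have := q (Z / Y); have -> : X - 2 * (Z / Y) * Z + (Z / Y) ^+ 2 * Y = X - Z ^+ 2 / Y by field.
  by rewrite subr_ge0 ler_pdivrMr // lt_neqAle eq_sym Yn.
exists K => // w hw i j.
have [hij|hij] := ltnP N (i + j).
  rewrite hw // expr0n /= mulr_ge0 //; apply: sumr_ge0 => n _; exact: sqr_ge0.
have hi : (i < N.+1)%N by lia.
have hj : (j < N.+1)%N by lia.
have inS : (Ordinal hi, Ordinal hj) \in S by rewrite inE.
pose k := enum_rank_in inS (Ordinal hi, Ordinal hj).
have -> : w`_i`_j = cf w 0 k by rewrite mxE /k enum_rankK_in.
have -> : cf w = (\row_n ev w (pts n)) *m pinvmx A by rewrite -cfA // -mulmxA rA mulmx1.
rewrite mxE; apply: (le_trans (CS _ _ _)); rewrite mulrC.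
under [X in _ * X]eq_bigr do rewrite mxE.
apply: ler_wpM2r; first by apply: sumr_ge0 => n _; exact: sqr_ge0.
rewrite /K (bigD1 k) //= lerDl; apply: sumr_ge0 => l _; apply: sumr_ge0 => n _; exact: sqr_ge0.
Qed.

Lemma ev_le_coef n (q : {poly {poly R}}) (s r : R) x : total_degree_le n q -> 1 <= r -> 0 <= s ->
  (forall i j, `|q`_i`_j| <= s) -> `|x.1| <= r -> `|x.2| <= r ->
  `|ev q x| <= (n.+1%:R ^+ 2 * r ^+ (n + n)) * s.
Proof.
move=> hq r1 s0 hs h1 h2; rewrite (evE _ hq); apply: (le_trans (ler_norm_sum _ _ _)).
have -> : n.+1%:R ^+ 2 * r ^+ (n + n) * s = \sum_(i < n.+1) \sum_(j < n.+1) s * r ^+ (n + n).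
  rewrite (eq_bigr (fun=> n.+1%:R * (s * r ^+ (n + n)))) => [|i _]; last first.
    by rewrite sumr_const card_ord mulr_natl.
  by rewrite sumr_const card_ord -mulr_natl; ring.
apply: ler_sum => i _; apply: (le_trans (ler_norm_sum _ _ _)); apply: ler_sum => j _.
rewrite !normrM; apply: ler_pM => //.
have h (t : R) (k : 'I_n.+1) : `|t| <= r -> `|t ^+ k| <= r ^+ n.
  move=> ht; rewrite normrX; apply: (@le_trans _ _ (r ^+ k)).
    by apply: lerXn2r => //; rewrite nnegrE; lra.
  by rewrite ler_weXn2l // -ltnS.
by rewrite exprD; apply: ler_pM => //; apply: h.
Qed.

End Unisolvence.

(** * Scaled polynomial estimates on shape-regular triangles *)

Section Shape_regular_triangles.
Context {R : realType}.
Implicit Types (p : 'I_3 -> R * R).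
Local Notation RR := (measurableTypeR R * measurableTypeR R)%type.

Let norm3 (a b c : R) : 0 <= a -> 0 <= b -> 0 <= c -> `|a * b * c| = a * (b * c).
Proof. by move=> ha hb hc; rewrite mulrA ger0_norm // !mulr_ge0. Qed.

Let cauchy2 (a b c d : R) : (a * c + b * d) ^+ 2 <= (a ^+ 2 + b ^+ 2) * (c ^+ 2 + d ^+ 2).
Proof. have := sqr_ge0 (a * d - b * c); rewrite sqrrB sqrrD !exprMn; lra. Qed.

(** The box of radius [r >= 1] exceeds the reference triangle on purpose: polynomials are also
    evaluated at points of the curved boundary, which may lie outside the element. *)
Lemma reference_sup n (r : R) : 1 <= r -> exists2 C : R, 0 <= C & forall w : {poly {poly R}},
  total_degree_le n w -> forall x : R * R, `|x.1| <= r -> `|x.2| <= r ->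
  let S := \int[leb2]_(x in tri kref) (ev w x ^+ 2) in
  [/\ ev w x ^+ 2 <= C * S, ev (d1 w) x ^+ 2 <= C * S & ev (d2 w) x ^+ 2 <= C * S].
Proof.
move=> r1; have [C C0 hC] := @coef_bound R n.
pose K : R := (n.+1%:R ^+ 2 * r ^+ (n + n)).
have K0 : 0 <= K by rewrite /K mulr_ge0 ?exprn_ge0 //; lra.
exists ((K * n.+1%:R) ^+ 2 * C); first by rewrite mulr_ge0 // sqr_ge0.
move=> w hw x h1 h2 S.
have S0 : 0 <= S by apply: Rintegral_ge0 => y _; exact: sqr_ge0.
pose s : R := Num.sqrt (C * S).
have s0 : 0 <= s by exact: sqrtr_ge0.
have ss : s ^+ 2 = C * S by rewrite sqr_sqrtr // mulr_ge0.
have cw i j : `|w`_i`_j| <= s.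
  rewrite -sqrtr_sqr ler_wsqrtr //; apply: hC => i' j' h; apply: hw.
  by case/orP: h => ?; lia.
have n0 : 0 <= n.+1%:R :> R := ler0n _ _.
have main q : total_degree_le n q -> (forall i j, `|q`_i`_j| <= n.+1%:R * s) -> ev q x ^+ 2 <= (K * n.+1%:R) ^+ 2 * C * S.
  move=> hq hc; rewrite -mulrA -ss -exprMn -ler_sqrt ?sqr_ge0 // !sqrtr_sqr.
  rewrite (norm3 K0 n0 s0).
  by apply: ev_le_coef => //; rewrite mulr_ge0.
have hN k i j : (k <= n.+1)%N -> `|k%:R * w`_i`_j| <= n.+1%:R * s.
  move=> hk; rewrite normrM normr_nat; apply: ler_pM => //; by rewrite ler_nat.
split; apply: main => //.
- by move=> i j; rewrite -[w`_i`_j]mul1r; apply: (hN 1).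
- exact: total_degree_d1.
- move=> i j; rewrite coef_deriv coefMn.
  have [h|h] := ltnP n i.+1; last by rewrite -[X in `|X|]mulr_natl; apply: hN; lia.
  by rewrite hw ?mul0rn ?normr0 ?mulr_ge0 //; lia.
- exact: total_degree_d2.
- move=> i j; rewrite coef_map_id0 ?deriv0 // coef_deriv.
  have [h|h] := ltnP n j.+1; last by rewrite -[X in `|X|]mulr_natl; apply: hN; lia.
  by rewrite hw ?mul0rn ?normr0 ?mulr_ge0 //; lia.
Qed.

Definition refmap p (y : R * R) : R * R := p 0 + y.1 *: (p 1 - p 0) + y.2 *: (p 2 - p 0).

Lemma refmapE p y : refmap p y =
  ((p 1 - p 0).1 * y.1 + (p 2 - p 0).1 * y.2 + (p 0).1,
   (p 1 - p 0).2 * y.1 + (p 2 - p 0).2 * y.2 + (p 0).2).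
Proof. by apply: pair_eqP; rewrite /refmap !coordE /=; ring. Qed.

Lemma bary_refmap p i y : tdet p != 0 -> bary p i (refmap p y) = bary kref i y.
Proof.
move=> d0; have h : refmap p y = \sum_j bary kref j y *: p j.
  rewrite sum3 /bary tdet_kref !divr1 !I3_succ; apply: pair_eqP; rewrite /refmap /cross !coordE /kref /=; ring.
by rewrite h bary_of // bary_sum // tdet_kref_neq0.
Qed.

Lemma refmap_bary p x : tdet p != 0 -> x = refmap p (bary p 1 x, bary p 2 x).
Proof.
move=> d0; rewrite {1}(bary_comb x d0) sum3.
have := bary_sum x d0; rewrite sum3 => h; have -> : bary p 0 x = 1 - bary p 1 x - bary p 2 x by rewrite -h; ring.
by apply: pair_eqP; rewrite /refmap !coordE /=; ring.
Qed.

Lemma tri_refmap p y : tdet p != 0 -> tri p (refmap p y) <-> tri kref y.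
Proof.
move=> d0; rewrite (triP _ d0) (triP _ tdet_kref_neq0).
by split=> h i; have := h i; rewrite bary_refmap.
Qed.

Lemma Rint_refmap p (f : R * R -> R) : tdet p != 0 -> bm (tri p) f ->
  \int[leb2]_(x in tri p) f x = `|tdet p| * \int[leb2]_(y in tri kref) f (refmap p y).
Proof.
move=> d0 bf; have mT := tri_measurable d0; have fT := tri_fin d0.
have dE : tdet p = (p 1 - p 0).1 * (p 2 - p 0).2 - (p 2 - p 0).1 * (p 1 - p 0).2.
  by rewrite /tdet /cross; ring.
rewrite /Rintegral [X in fine X]integral_mkcond [X in _ = _ * fine X]integral_mkcond.
have := integrable2 mT fT bf.
move=> I0; have I := (@integrable_mkcond _ RR R leb2 _ (EFin \o f) mT).1 I0.
have d0' := d0; rewrite dE in d0'.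
have := @integral_affine2 R _ _ _ _ (p 0).1 (p 0).2 _ d0' I; rewrite -dE => h.
have -> : (\int[leb2]_z ((fun y => (f (refmap p y))%:E) \_ (tri kref)) z)%E =
  (\int[leb2]_z ((EFin \o f) \_ (tri p)) (refmap p z))%E.
  apply: eq_integral => z _; rewrite /patch.
  have -> : (refmap p z \in tri p) = (z \in tri kref).
    have [hA hB] := tri_refmap z d0.
  by apply/idP/idP => /set_mem h'; apply/mem_set; [exact: hA|exact: hB].
  by [].
have -> : (\int[leb2]_z ((EFin \o f) \_ (tri p)) (refmap p z))%E =
   ((`|tdet p|^-1)%:E * \int[leb2]_z ((EFin \o f) \_ (tri p)) z)%E.
  rewrite -h; apply: eq_integral => z _; by rewrite refmapE.
rewrite fineM //; last by refine (@integrable_fin_num _ RR R leb2 _ measurableT _ _); exact: I.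
by rewrite /= mulrA divff ?mul1r // normr_eq0.
Qed.

(** The part of shape regularity that the estimates use: sides of length at most [h] and twice the
    area at least h^2/kap. *)
Definition shape (kap h : R) p :=
  [/\ 0 < h, 0 < kap, forall i j, dist (p i) (p j) <= h & h ^+ 2 <= kap * `|tdet p| ].

Lemma bary_shift p i x y : tdet p != 0 -> bary p i x = bary p i y + dbary p i (x - y).
Proof. by move=> d0; rewrite /dbary !bary_affine !coordE; field. Qed.

Lemma dbaryE0 p i v : tdet p != 0 -> dbary p i v = cross v (p (i + 1) - p (i - 1)) / tdet p.
Proof. by move=> d0; rewrite dbaryE /cross !coordE; field. Qed.

Section Fixed.
Variables (kap h : R) (p : 'I_3 -> R * R).
Hypothesis sp : shape kap h p.

Lemma shape_tdet : tdet p != 0.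
Proof.
case: sp => h0 k0 _ hd; apply/eqP => d0; move: hd; rewrite d0 normr0 mulr0 leNgt.
by rewrite exprn_gt0.
Qed.
Let d0 := shape_tdet.

Lemma shape_tdet_gt0 : 0 < `|tdet p|. Proof. by rewrite normr_gt0. Qed.

Lemma shape_tdet_le : `|tdet p| <= h ^+ 2.
Proof.
case: sp => h0 _ hd _; rewrite /tdet; apply: (le_trans (cross_le _ _)).
rewrite expr2; apply: ler_pM; rewrite ?enorm_ge0 //; exact: hd.
Qed.

Lemma shape_dbary i v : `|dbary p i v| <= kap / h * enorm v.
Proof.
have [h0 k0 hd ht] := sp; have t0 := shape_tdet_gt0.
rewrite (dbaryE0 i v d0) normrM normfV; apply: (@le_trans _ _ (enorm v * h / `|tdet p|)).
  rewrite ler_pM2r ?invr_gt0 //; apply: (le_trans (cross_le _ _)).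
  by rewrite ler_wpM2l ?enorm_ge0 //; exact: hd.
rewrite ler_pdivrMr //.
have -> : kap / h * enorm v * `|tdet p| = enorm v * (kap * `|tdet p|) / h by ring.
by rewrite ler_pdivlMr // -mulrA -expr2 ler_wpM2l ?enorm_ge0.
Qed.


(** Makes 1 + kap the right radius for [reference_sup]: points within distance [h] of the triangle
    stay in a fixed box of reference coordinates. *)
Lemma shape_bary_near i x y : tri p y -> dist x y <= h -> `|bary p i x| <= 1 + kap.
Proof.
have [h0 k0 _ _] := sp; move=> Ty xy; rewrite (bary_shift i x y d0).
apply: (le_trans (ler_normD _ _)); apply: lerD.
  by rewrite ger0_norm ?(bary_le1 i d0 Ty) //; exact: (proj1 (triP y d0) Ty i).
apply: (le_trans (shape_dbary _ _)); rewrite -mulrA ger_pMr // ler_pdivrMl // mulr1; exact: xy.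
Qed.

End Fixed.


Lemma pullback n p w : tdet p != 0 -> total_degree_le n w -> exists2 W, total_degree_le n W &
  (forall y, ev W y = ev w (refmap p y)) /\
  (forall x v, 'D_v (ev w) x = dbary p 1 v * ev (d1 W) (bary p 1 x, bary p 2 x)
    + dbary p 2 v * ev (d2 W) (bary p 1 x, bary p 2 x)).
Proof.
move=> d0 hw.
have [W hW WE] : polyf n (fun y => ev w (refmap p y)).
  have := @polyf_comp_affine R n (ev w) (p 1 - p 0).1 (p 2 - p 0).1 (p 0).1 (p 1 - p 0).2 (p 2 - p 0).2 (p 0).2.
  case; first by exists w.
  by move=> W hW WE; exists W => // y; rewrite -WE refmapE.
exists W => //; split=> [y|x v]; first by rewrite -WE.
have B i t : bary p i (x + t *: v) = bary p i x + t * dbary p i v.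
  by rewrite (bary_shift i (x + t *: v) x d0) addrAC subrr add0r !dbaryE0 // /cross !coordE; field.
pose y : R * R := (bary p 1 x, bary p 2 x); pose u : R * R := (dbary p 1 v, dbary p 2 v).
have D1 : is_derive (0 : R) 1 (fun t : R => ev w (x + t *: v)) ('D_v (ev w) x).
  apply: is_derive_line; rewrite scale0r addr0 derive_ev; exact: is_derive_ev.
have D2 : is_derive (0 : R) 1 (fun t : R => ev W (y + t *: u)) (u.1 * ev (d1 W) y + u.2 * ev (d2 W) y).
  apply: is_derive_line; rewrite scale0r addr0; exact: is_derive_ev.
have E : (fun t : R => ev W (y + t *: u)) = (fun t : R => ev w (x + t *: v)).
  apply/funext => t; rewrite -WE; congr (ev w _).
  by rewrite [RHS](refmap_bary _ d0) !B; congr refmap; apply: pair_eqP; rewrite /y /u !coordE.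
by move: D2; rewrite E; case: D1 => _ <-; case=> _ <-.
Qed.

(** All four bounds come from [reference_sup] by scaling: a sup bound, two inverse inequalities and
    a mean value inequality. The first and the last reach points at distance [h] from the triangle,
    as the displaced nodes require. *)
Lemma local_estimates (n : nat) (kap : R) : 0 < kap -> exists2 C : R, 0 < C &
  forall h p, shape kap h p -> forall w, total_degree_le n w ->
  let S q := \int[leb2]_(x in tri p) (ev q x ^+ 2) in
  [/\ forall x y, tri p y -> dist x y <= h -> ev w x ^+ 2 <= C / h ^+ 2 * S w,
      h ^+ 2 * S (d1 w) <= C * S w, h ^+ 2 * S (d2 w) <= C * S w &
      forall x y, tri p y -> dist x y <= h ->
        (ev w x - ev w y) ^+ 2 <= C * (dist x y / h) ^+ 2 * (S (d1 w) + S (d2 w))].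
Proof.
move=> k0; have [C C0 hC] := @reference_sup n (1 + kap) ltac:(lra).
pose A : R := \int[leb2]_(y in tri kref) 1.
have A0 : 0 <= A by apply: Rintegral_ge0 => y _; exact: ler01.
(* [C * kap] serves the pointwise bounds, since 1/|det| <= kap/h^2; [4 * kap ^+ 2 * C * A] serves
   the inverse inequalities, [A] being the area of the reference triangle. *)
pose K := C * kap + 4 * kap ^+ 2 * C * A + 2 * C * kap.
have CA : 0 <= kap ^+ 2 * C * A := mulr_ge0 (mulr_ge0 (sqr_ge0 kap) C0) A0.
have Ck : 0 <= C * kap by rewrite mulr_ge0 // ltW.
have KL1 : C * kap <= 1 + K by rewrite /K; lra.
have KL2 : 4 * kap ^+ 2 * C * A <= 1 + K by rewrite /K; lra.
exists (1 + K); first by rewrite /K; lra.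
move=> h p sp w hw S; have d0 := shape_tdet sp; have t0 := shape_tdet_gt0 sp.
have [h0 _ hd ht] := sp.
have mT := tri_measurable d0; have fT := tri_fin d0.
have bE q : bm (tri p) (fun x => ev q x ^+ 2) by apply: bmX; apply: bm_ev; exact: tri_compact.
have S0 q : 0 <= S q by apply: Rintegral_ge0 => y _; exact: sqr_ge0.
have tle : `|tdet p|^-1 <= kap / h ^+ 2.
  rewrite -[_^-1]mul1r ler_pdivrMr // mulrAC ler_pdivlMr ?exprn_gt0 // mul1r; exact: ht.
have sup q x : total_degree_le n q -> `|bary p 1 x| <= 1 + kap -> `|bary p 2 x| <= 1 + kap ->
    ev q x ^+ 2 <= C * (S q / `|tdet p|) /\
    (forall v, ('D_v (ev q) x) ^+ 2 <= 4 * (kap / h * enorm v) ^+ 2 * (C * (S q / `|tdet p|))).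
  move=> hq b1 b2; have [W hW [WE DE]] := pullback d0 hq.
  have SE : S q / `|tdet p| = \int[leb2]_(y in tri kref) (ev W y ^+ 2).
    rewrite /S (Rint_refmap d0 (bE q)).
    rewrite mulrC mulrA mulVf ?mul1r; last by rewrite gt_eqF.
    by apply: eq_Rintegral => y _; rewrite WE.
  have [X1 X2 X3] := hC W hW (bary p 1 x, bary p 2 x) b1 b2.
  rewrite SE; split; first by rewrite {1}(refmap_bary x d0) -WE.
  move=> v; rewrite DE.
  have D1 := shape_dbary sp 1 v; have D2 := shape_dbary sp 2 v.
  have dle (d a k B : R) : `|d| <= k -> a ^+ 2 <= B -> (d * a) ^+ 2 <= k ^+ 2 * B.
    move=> hd' ha; rewrite exprMn; apply: ler_pM; rewrite ?sqr_ge0 //.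
    by rewrite -ler_sqrt ?sqr_ge0 // !sqrtr_sqr (le_trans hd') // ler_norm.
  have Y1 := dle _ _ _ _ D1 X2; have Y2 := dle _ _ _ _ D2 X3.
  have := sqr_ge0 (dbary p 1 v * ev (d1 W) (bary p 1 x, bary p 2 x) - dbary p 2 v * ev (d2 W) (bary p 1 x, bary p 2 x)).
  rewrite sqrrB; rewrite sqrrD; lra.
have supT q x y : total_degree_le n q -> tri p y -> dist x y <= h -> 
    ev q x ^+ 2 <= C * (S q / `|tdet p|) /\
    (forall v, ('D_v (ev q) x) ^+ 2 <= 4 * (kap / h * enorm v) ^+ 2 * (C * (S q / `|tdet p|))).
  by move=> hq Ty xy; apply: sup => //; exact: (shape_bary_near sp _ Ty xy).
have Sle q : S q / `|tdet p| <= kap / h ^+ 2 * S q by rewrite mulrC ler_wpM2r.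
have e11 : enorm (e1 : R * R) = 1 by rewrite /enorm /dot /= mulr1 mulr0 addr0 sqrtr1.
have e21 : enorm (e2 : R * R) = 1 by rewrite /enorm /dot /= mulr1 mulr0 add0r sqrtr1.
have inv (v : R * R) : enorm v = 1 -> h ^+ 2 * (\int[leb2]_(x in tri p) (('D_v (ev w) x) ^+ 2)) <= (1 + K) * S w.
  move=> v1; rewrite mulrC -ler_pdivlMr ?exprn_gt0 //.
  pose B := 4 * (kap / h) ^+ 2 * (C * (S w / `|tdet p|)).
  apply: (@le_trans _ _ (\int[leb2]_(x in tri p) B)).
    apply: (Rint2_le mT fT); [|exact: bm_cst|].
      have -> : (fun x => 'D_v (ev w) x ^+ 2) = (fun x => (v.1 * ev (d1 w) x + v.2 * ev (d2 w) x) ^+ 2).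
        by apply/funext => x; rewrite derive_ev.
      by apply: bmX; apply: bmD; apply: bmZ; apply: bm_ev; exact: tri_compact.
    move=> x Tx; have [_ /(_ v)] := supT w x x hw Tx ltac:(rewrite distxx; exact: ltW).
    by rewrite v1 mulr1.
  rewrite (Rint_refmap d0); last exact: bm_cst.
  have -> : \int[leb2]_(y in tri kref) B = B * A.
    rewrite -(Rint2Z (tri_measurable tdet_kref_neq0) (tri_fin tdet_kref_neq0)); last exact: bm_cst.
    by apply: eq_Rintegral => y _; rewrite mulr1.
  have -> : `|tdet p| * (B * A) = 4 * kap ^+ 2 * C * A * S w / h ^+ 2.
    by rewrite /B; field; rewrite !gt_eqF.
  by rewrite ler_pM2r ?invr_gt0 ?exprn_gt0 // ler_wpM2r.
have D1E : S (d1 w) = \int[leb2]_(x in tri p) (('D_e1 (ev w) x) ^+ 2).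
  by apply: eq_Rintegral => x _; rewrite derive_ev /= mul1r mul0r addr0.
have D2E : S (d2 w) = \int[leb2]_(x in tri p) (('D_e2 (ev w) x) ^+ 2).
  by apply: eq_Rintegral => x _; rewrite derive_ev /= mul1r mul0r add0r.
split.
- move=> x y Ty xy; have [X _] := supT w x y hw Ty xy; apply: (le_trans X).
  apply: (@le_trans _ _ (C * (kap / h ^+ 2 * S w))); first by rewrite ler_wpM2l.
  have -> : C * (kap / h ^+ 2 * S w) = (C * kap) * (S w / h ^+ 2) by ring.
  have -> : (1 + K) / h ^+ 2 * S w = (1 + K) * (S w / h ^+ 2) by ring.
  by apply: ler_wpM2r => //; rewrite divr_ge0 // exprn_ge0 // ltW.
- by rewrite D1E; exact: inv.
- by rewrite D2E; exact: inv.
- move=> x y Ty xy.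
  (* The increment is taken along the segment from [y] to [x], every point of which is still within
     [h] of the triangle. *)
  pose g (t : R) := ev w (y + t *: (x - y)).
  pose g' (t : R) := (x - y).1 * ev (d1 w) (y + t *: (x - y)) + (x - y).2 * ev (d2 w) (y + t *: (x - y)).
  have dg (t : R) : is_derive t 1 g (g' t) by apply: is_derive_line; exact: is_derive_ev.
  have [t] := @MVT R g g' 0 1 ltr01 (fun t _ => dg t) ltac:(apply: continuous_subspaceT => t; apply: differentiable_continuous; apply/derivable1_diffP; by case: (dg t)).
  rewrite in_itv /= => /andP[t0' t1'].
  have -> : g 1 = ev w x by rewrite /g scale1r addrCA subrr addr0.
  have -> : g 0 = ev w y by rewrite /g scale0r addr0.
  move=> ->; rewrite subr0 mulr1 /g'; set z := y + t *: (x - y).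
  have zy : dist z y <= h.
    rewrite /dist /z addrAC subrr add0r enormZ ger0_norm ?(ltW t0') //.
    by apply: le_trans xy; rewrite -[X in _ <= X]mul1r; apply: ler_wpM2r; rewrite ?dist_ge0 // ltW.
  have [Z1 _] := supT _ z y (total_degree_d1 hw) Ty zy.
  have [Z2 _] := supT _ z y (total_degree_d2 hw) Ty zy.
  have dd : (x - y).1 ^+ 2 + (x - y).2 ^+ 2 = dist x y ^+ 2 by rewrite /dist enorm_sqr /dot !expr2.
  apply: (@le_trans _ _ (dist x y ^+ 2 * (ev (d1 w) z ^+ 2 + ev (d2 w) z ^+ 2))).
    by rewrite -dd; exact: cauchy2.
  have -> : (1 + K) * (dist x y / h) ^+ 2 * (S (d1 w) + S (d2 w)) =
    dist x y ^+ 2 * ((1 + K) / h ^+ 2 * (S (d1 w) + S (d2 w))) by field; rewrite gt_eqF.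
  apply: ler_wpM2l; first exact: sqr_ge0.
  have L1 := Sle (d1 w); have L2 := Sle (d2 w).
  have M1 := ler_wpM2l C0 L1; have M2 := ler_wpM2l C0 L2.
  apply: (@le_trans _ _ (C * (kap / h ^+ 2 * S (d1 w)) + C * (kap / h ^+ 2 * S (d2 w)))).
    by apply: lerD; [exact: le_trans Z1 M1|exact: le_trans Z2 M2].
  have -> : C * (kap / h ^+ 2 * S (d1 w)) + C * (kap / h ^+ 2 * S (d2 w)) = (C * kap) / h ^+ 2 * (S (d1 w) + S (d2 w)) by ring.
  by apply: ler_wpM2r; rewrite ?addr_ge0 // ler_pM2r ?invr_gt0 ?exprn_gt0.
Qed.

(** The nodal values control the L^2 norm with the factor h^2 of the area. Only the upper bound of
    the determinant enters, hence a constant independent of [kap]. *)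
Lemma nodal_estimate (n : nat) (nd : 'I_(Np n) -> R * R) :
  (forall q, total_degree_le n q -> (forall m, ev q (nd m) = 0) -> q = 0) ->
  exists2 C : R, 0 < C & forall kap h p, shape kap h p -> forall w, total_degree_le n w ->
  \int[leb2]_(x in tri p) (ev w x ^+ 2) <= C * h ^+ 2 * \sum_m ev w (refmap p (nd m)) ^+ 2.
Proof.
move=> uni; have [[C C0 hC] _] := unisolvent_interpolation uni.
pose A : R := \int[leb2]_(y in tri kref) 1.
have A0 : 0 <= A by apply: Rintegral_ge0 => y _; exact: ler01.
pose K : R := n.+1%:R ^+ 2 * 1 ^+ (n + n).
exists (1 + K ^+ 2 * C * A); first by have := mulr_ge0 (mulr_ge0 (sqr_ge0 K) C0) A0; lra.
move=> kap h p sp w hw; have d0 := shape_tdet sp; have t0 := shape_tdet_gt0 sp.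
have [h0 _ hd ht] := sp.
have [W hW [WE _]] := pullback d0 hw.
have bK : bm (tri kref) (fun x => ev W x ^+ 2) by apply: bmX; apply: bm_ev; apply: tri_compact; exact: tdet_kref_neq0.
rewrite (Rint_refmap d0); last by apply: bmX; apply: bm_ev; exact: tri_compact.
have -> : \int[leb2]_(y in tri kref) ev w (refmap p y) ^+ 2 = \int[leb2]_(y in tri kref) ev W y ^+ 2.
  by apply: eq_Rintegral => y _; rewrite WE.
rewrite [X in _ <= _ * X](eq_bigr (fun m => ev W (nd m) ^+ 2)) => [|m _]; last by rewrite WE.
set Sn := \sum_m _; have Sn0 : 0 <= Sn by apply: sumr_ge0 => m _; exact: sqr_ge0.
pose s : R := Num.sqrt (C * Sn).
have ss : s ^+ 2 = C * Sn by rewrite sqr_sqrtr // mulr_ge0.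
have K0 : 0 <= K by rewrite /K expr1n mulr1 exprn_ge0.
have pt y : tri kref y -> ev W y ^+ 2 <= K ^+ 2 * C * Sn.
  move=> Ty; rewrite -mulrA -ss -exprMn -ler_sqrt ?sqr_ge0 // !sqrtr_sqr.
  rewrite [X in _ <= X]ger0_norm ?mulr_ge0 ?sqrtr_ge0 //.
  have b i : 0 <= bary kref i y <= 1.
    by rewrite (bary_le1 i tdet_kref_neq0 Ty) (proj1 (triP y tdet_kref_neq0) Ty i).
  have E1 : bary kref 1 y = y.1 by rewrite /bary tdet_kref divr1 !I3_succ /cross !coordE /kref /=; ring.
  have E2 : bary kref 2 y = y.2 by rewrite /bary tdet_kref divr1 !I3_succ /cross !coordE /kref /=; ring.
  apply: ev_le_coef => //.
  - exact: sqrtr_ge0.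
  - by move=> i j; rewrite -sqrtr_sqr ler_wsqrtr //; exact: hC.
  - by have := b 1; rewrite E1 => /andP[u1 u2]; rewrite ger0_norm.
  - by have := b 2; rewrite E2 => /andP[u1 u2]; rewrite ger0_norm.
apply: (@le_trans _ _ (`|tdet p| * \int[leb2]_(y in tri kref) (K ^+ 2 * C * Sn * 1))).
  rewrite ler_pM2l //; apply: (Rint2_le (tri_measurable tdet_kref_neq0) (tri_fin tdet_kref_neq0)) => //.
    exact: bm_cst.
  by move=> y Ty; rewrite mulr1; exact: pt.
rewrite (Rint2Z (tri_measurable tdet_kref_neq0) (tri_fin tdet_kref_neq0)); last exact: bm_cst.
rewrite -/A; have := shape_tdet_le sp => tl.
have Z0 : 0 <= K ^+ 2 * C * A * Sn := mulr_ge0 (mulr_ge0 (mulr_ge0 (sqr_ge0 K) C0) A0) Sn0.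
apply: (@le_trans _ _ (h ^+ 2 * (K ^+ 2 * C * A * Sn))).
  have -> : K ^+ 2 * C * Sn * A = K ^+ 2 * C * A * Sn by ring.
  by rewrite ler_wpM2r.
have -> : (1 + K ^+ 2 * C * A) * h ^+ 2 * Sn = h ^+ 2 * Sn + h ^+ 2 * (K ^+ 2 * C * A * Sn) by ring.
by rewrite lerDr mulr_ge0 // exprn_ge0 // ltW.
Qed.

End Shape_regular_triangles.

(** * Flatness of C^2 curves *)

Section Local_structure.
Context {R : realType}.
Implicit Types (Omega A : set (R * R)) (p x y z u : R * R) (g : R -> R * R).

Lemma fin_radius (T : finType) (P : T -> R -> Prop) :
  (forall i r r', r' <= r -> P i r -> P i r') ->
  (forall i, exists2 d : R, 0 < d & P i d) -> exists2 d : R, 0 < d & forall i, P i d.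
Proof.
move=> mono h; have /choice[d hd] : forall i, exists d : R, 0 < d /\ P i d.
  by move=> i; have [d d0 Pd] := h i; exists d.
exists (\big[Num.min/1]_i d i).
  by apply: lt_bigmin => // i _; case: (hd i).
by move=> i; apply: mono (proj2 (hd i)); exact: bigmin_inf.
Qed.

(** The Lebesgue number argument: [Q r z] is monotone in [r], so a radius valid near each point of
    [K] gives one radius for all of [K]. Statements on arcs, on sides of the boundary and on the
    size of [b] are all made uniform this way. *)
Lemma compact_uniform (K : set (R * R)) (Q : R -> R * R -> Prop) : compact K ->
  (forall r r' z, r' <= r -> Q r z -> Q r' z) ->
  (forall z, K z -> exists2 r : R, 0 < r & forall y, K y -> dist y z < r -> Q r y) ->
  exists2 r : R, 0 < r & forall z, K z -> Q r z.
Proof.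
move=> /compact_near_coveringP cK mono loc.
have H : \forall r \near (0 : R)^'+, K `<=` (fun x => K x -> Q r x).
  apply: (cK R (0 : R)^'+ (fun r x => K x -> Q r x)) => z Kz.
  have [r r0 hr] := loc z Kz.
  exists (eball z r, [set e : R | e <= r]) => /=.
    split; first exact: nbhs_eball.
    by near=> e; near: e; exact: nbhs_right_le.
  by move=> [y e] /= [yz er] Ky; apply: mono er _; exact: hr.
have : \forall r \near (0 : R)^'+, 0 < r by exact: nbhs_right_gt.
move=> /(filterI H) /(@filter_ex _ _ (at_right_proper_filter 0)) [r [hr r0]].
by exists r => // z Kz; exact: hr.
Unshelve. all: by end_near. Qed.

Lemma is_derive1_derivable (f : R -> R) (t : R) : derivable f t 1 -> is_derive t 1 f (derive1 f t).
Proof. by move=> h; rewrite derive1E; exact: derivableP. Qed.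

(** Continuity of the derivative controls all chords near [t0], not only those through [t0];
    flatness is about chords between two arbitrary points. *)
Lemma strict_diff (f : R -> R) (t0 e : R) : (forall t, derivable f t 1) ->
  {for t0, continuous (derive1 f)} -> 0 < e -> exists2 d : R, 0 < d &
  forall s t, `|s - t0| < d -> `|t - t0| < d ->
    `|f s - f t - (s - t) * derive1 f t0| <= e * `|s - t|.
Proof.
move=> df cf e0.
have /nbhs_ballP[d /= d0 hd] : nbhs t0 [set u | `|derive1 f t0 - derive1 f u| < e].
  by move/cvgrPdist_lt: cf => /(_ e e0).
exists d => // s t; wlog st : s t / t <= s.
  move=> W hs ht; have [h|h] := leP t s; first exact: W.
  have := W t s (ltW h) ht hs; rewrite (distrC s t) => h'.
  have -> : f s - f t - (s - t) * derive1 f t0 = - (f t - f s - (t - s) * derive1 f t0) by ring.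
  by rewrite normrN.
move=> hs ht.
have cont : {within `[t, s], continuous f}.
  apply: continuous_subspaceT => u; apply: differentiable_continuous; exact/derivable1_diffP.
have [c] := MVT_segment st (fun c _ => is_derive1_derivable (df c)) cont.
rewrite in_itv /= => /andP[tc cs] ->.
have -> : derive1 f c * (s - t) - (s - t) * derive1 f t0 = (derive1 f c - derive1 f t0) * (s - t) by ring.
rewrite normrM; apply: ler_wpM2r; first exact: normr_ge0.
apply: ltW; rewrite distrC; apply: hd; rewrite /ball /=.
by move: hs ht; rewrite !ltr_norml => /andP[? ?] /andP[? ?]; apply/andP; split; lra.
Qed.

Lemma derivable_coord g (t : R) : derivable g t 1 ->
  (derivable (fun s => (g s).1) t 1 /\ derive1 (fun s => (g s).1) t = (derive1 g t).1) /\
  (derivable (fun s => (g s).2) t 1 /\ derive1 (fun s => (g s).2) t = (derive1 g t).2).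
Proof.
move=> dg; rewrite !derive1E.
pose F (h : R) := h^-1 *: ((g \o shift t) (h *: (1 : R)) - g t).
have H : F @ 0^' --> 'D_1 g t by exact: dg.
have H1 : (fun h => (F h).1) @ 0^' --> ('D_1 g t).1 by apply: (cvg_comp _ fst H); exact: cvg_fst.
have H2 : (fun h => (F h).2) @ 0^' --> ('D_1 g t).2 by apply: (cvg_comp _ snd H); exact: cvg_snd.
by split; split; [exact: (cvgP _ H1)|exact: (cvg_lim _ H1)|exact: (cvgP _ H2)|exact: (cvg_lim _ H2)].
Qed.

Lemma class_C2_continuous (V : normedModType R) (g : R -> V) : class_C2 g -> continuous g.
Proof. by move=> [d _ _] t; apply: differentiable_continuous; exact/derivable1_diffP. Qed.

Lemma class_C2_continuous1 (V : normedModType R) (g : R -> V) : class_C2 g -> continuous (derive1 g).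
Proof. by move=> [_ d _] t; apply: differentiable_continuous; exact/derivable1_diffP. Qed.

Lemma curve_strict g (t0 e : R) : class_C2 g -> 0 < e -> exists2 d : R, 0 < d &
  forall s t, `|s - t0| < d -> `|t - t0| < d ->
    `|(g s - g t).1 - (s - t) * (derive1 g t0).1| <= e * `|s - t| /\
    `|(g s - g t).2 - (s - t) * (derive1 g t0).2| <= e * `|s - t|.
Proof.
move=> cg e0; have [dg _ _] := cg.
have E1 : derive1 (fun s => (g s).1) = (fun t => (derive1 g t).1).
  by apply/funext => t; case: (derivable_coord (dg t)) => [[]].
have E2 : derive1 (fun s => (g s).2) = (fun t => (derive1 g t).2).
  by apply/funext => t; case: (derivable_coord (dg t)) => [_ []].
have [||d1 d10 h1] := @strict_diff (fun s => (g s).1) t0 e _ _ e0.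
- by move=> t; case: (derivable_coord (dg t)) => [[]].
- rewrite E1; apply: (@continuous_comp _ _ _ (derive1 g) fst); first exact: class_C2_continuous1.
  exact: cvg_fst.
have [||d2 d20 h2] := @strict_diff (fun s => (g s).2) t0 e _ _ e0.
- by move=> t; case: (derivable_coord (dg t)) => [_ []].
- rewrite E2; apply: (@continuous_comp _ _ _ (derive1 g) snd); first exact: class_C2_continuous1.
  exact: cvg_snd.
exists (Num.min d1 d2); first by rewrite lt_min d10.
move=> s t; rewrite !lt_min => /andP[a b] /andP[c d].
by have := h1 s t a c; have := h2 s t b d; rewrite E1 E2.
Qed.

(** All chords of [A] lie in the double cone of slope [e] about the line of [u]. This form of being
    almost straight needs no parametrisation and passes to subsets. *)
Definition flatset (e : R) u A := forall x y, A x -> A y ->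
  `|dot (x - y) (rot90 u)| <= e * `|dot (x - y) u|.

Lemma curve_flat g (t0 e : R) : class_C2 g -> derive1 g t0 != 0 -> 0 < e ->
  exists2 d : R, 0 < d & exists2 u, enorm u = 1 & flatset e u (g @` [set t | `|t - t0| < d]).
Proof.
move=> cg D0 e0; pose D : R * R := derive1 g t0; have {}D0 : D != 0 := D0; pose m : R := enorm D.
have m0 : 0 < m.
  by rewrite lt_neqAle enorm_ge0 andbT eq_sym; apply: contra D0 => /eqP/enorm_eq0/eqP.
(* Chosen so that 2 n r m = e (r m^2 - 2 n r m): the deviation of the chord from the tangent, whose
   components contribute at most 2 n r m, then has slope at most [e]. *)
pose n := e * m / (2 * (1 + e)).
have n0 : 0 < n by rewrite /n divr_gt0 ?mulr_gt0 //; lra.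
have [d d0 hd] := curve_strict t0 cg n0.
exists d => //; exists (m^-1 *: D).
  by rewrite enormZ ger0_norm ?invr_ge0 ?(ltW m0) // mulVf // gt_eqF.
move=> _ _ [s hs <-] [t ht <-]; have [] := hd s t hs ht; rewrite -/D.
set r := s - t; set a := _ - r * D.1; set b := _ - r * D.2 => ha hb.
have E : g s - g t = (r * D.1 + a, r * D.2 + b).
  by apply: pair_eqP => /=; rewrite /a /b; ring.
have mm : D.1 ^+ 2 + D.2 ^+ 2 = m ^+ 2 by rewrite /m enorm_sqr /dot; ring.
have -> : dot (g s - g t) (rot90 (m^-1 *: D)) = m^-1 * (b * D.1 - a * D.2).
  by rewrite E /dot /rot90 !coordE /=; ring.
have -> : dot (g s - g t) (m^-1 *: D) = m^-1 * (r * m ^+ 2 + (a * D.1 + b * D.2)).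
  by rewrite E /dot -mm !coordE /=; ring.
rewrite !normrM mulrCA ler_pM2l ?normr_gt0 ?invr_eq0 ?gt_eqF //.
have D1 : `|D.1| <= m := coord1_le_enorm _.
have D2 : `|D.2| <= m := coord2_le_enorm _.
have bnd (x c k q : R) : `|x| <= k -> `|c| <= q -> `|x * c| <= k * q.
  by move=> h1 h2; rewrite normrM; exact: ler_pM.
have P1 := bnd _ _ _ _ hb D1. have P2 := bnd _ _ _ _ ha D2.
have P3 := bnd _ _ _ _ ha D1. have P4 := bnd _ _ _ _ hb D2.
have N1 := ler_normB (b * D.1) (a * D.2).
have N2 := ler_normD (a * D.1) (b * D.2).
have N3 := lerB_dist (r * m ^+ 2) (- (a * D.1 + b * D.2)).
rewrite opprK normrN normrM [`|m ^+ 2|]ger0_norm ?sqr_ge0 // in N3.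
have Q : 2 * (n * `|r| * m) <= e * (`|r| * m ^+ 2 - 2 * (n * `|r| * m)).
  have -> : 2 * (n * `|r| * m) = e / (1 + e) * (`|r| * m ^+ 2) by rewrite /n; field; lra.
  rewrite -subr_ge0 le_eqVlt; apply/orP; left; apply/eqP; field; lra.
apply: (@le_trans _ _ (2 * (n * `|r| * m))).
  by apply: (le_trans N1); rewrite mulr_natl mulr2n; exact: lerD.
apply: (le_trans Q); rewrite ler_pM2l //.
apply: le_trans N3; rewrite lerB // mulr_natl mulr2n; apply: (le_trans N2); exact: lerD.
Qed.

Lemma frame_norm u x : enorm u = 1 -> enorm x ^+ 2 = dot x u ^+ 2 + dot x (rot90 u) ^+ 2.
Proof.
move=> u1; have : enorm u ^+ 2 = 1 by rewrite u1 expr1n.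
rewrite !enorm_sqr /dot /rot90 /= => h.
have -> : x.1 * x.1 + x.2 * x.2 = (x.1 * x.1 + x.2 * x.2) * (u.1 * u.1 + u.2 * u.2) by rewrite h mulr1.
ring.
Qed.

Lemma frame_dec u x : enorm u = 1 -> x = dot x u *: u + dot x (rot90 u) *: rot90 u.
Proof.
move=> u1; have : enorm u ^+ 2 = 1 by rewrite u1 expr1n.
rewrite enorm_sqr /dot => h; apply: pair_eqP; rewrite /dot /rot90 !coordE /=.
  by rewrite -[LHS]mulr1 -h; ring.
by rewrite -[LHS]mulr1 -h; ring.
Qed.

Lemma dot_frame u (s t : R) : enorm u = 1 ->
  dot (s *: u + t *: rot90 u) u = s /\ dot (s *: u + t *: rot90 u) (rot90 u) = t.
Proof.
move=> u1; have : enorm u ^+ 2 = 1 by rewrite u1 expr1n.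
rewrite enorm_sqr /dot => h; rewrite /rot90 !coordE /=; split.
  by rewrite -[RHS]mulr1 -h; ring.
by rewrite -[RHS]mulr1 -h; ring.
Qed.

Lemma continuous_dot p u : continuous (fun x => dot (x - p) u).
Proof.
move=> x; apply: cvgD; (apply: cvgM; last exact: cvg_cst).
  by apply: (@continuous_comp _ _ _ (fun x => x - p) fst); [apply: cvgB; [exact: cvg_id|exact: cvg_cst]|exact: cvg_fst].
by apply: (@continuous_comp _ _ _ (fun x => x - p) snd); [apply: cvgB; [exact: cvg_id|exact: cvg_cst]|exact: cvg_snd].
Qed.

Definition chart Omega p (r : R) u (f : R -> R) :=
  [/\ 0 < r, enorm u = 1, class_C2 f &
    forall x, eball p r x -> (Omega x <-> f (dot (x - p) u) < dot (x - p) (rot90 u))].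

Lemma chart_bdry Omega p r u f : open Omega -> chart Omega p r u f -> forall x, eball p r x ->
  (bdry Omega x <-> dot (x - p) (rot90 u) = f (dot (x - p) u)).
Proof.
move=> oO [r0 u1 cf hO] x xr; set s := dot (x - p) u; set t := dot (x - p) (rot90 u).
have ox : nbhs x (eball p r) by apply: open_nbhs_nbhs; split => //; exact: open_eball.
have ch : continuous (fun y => f (dot (y - p) u) - dot (y - p) (rot90 u)).
  move=> y; apply: cvgB; last exact: continuous_dot.
  apply: (@continuous_comp _ _ _ (fun y => dot (y - p) u) f); first exact: continuous_dot.
  exact: class_C2_continuous cf _.
split=> [[cx ix]|E].
  apply/eqP; apply: contrapT => /negP; rewrite neq_lt => /orP[lt|lt]; last first.
    by apply: ix; apply: open_nbhs_nbhs; split => //; exact: (proj2 (hO x xr) lt).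
  have nb : nbhs x [set y | 0 < f (dot (y - p) u) - dot (y - p) (rot90 u)].
    have := open_nbhs_nbhs (conj (@open_gt R 0) _ : open_nbhs (f s - t) [set z : R | 0 < z]).
    by move=> hn; refine (ch x [set z : R | 0 < z] (hn _)); rewrite /= subr_gt0.
  have [y [Oy [/= yr ypos]]] := cx _ (filterI ox nb).
  have h := proj1 (hO y yr) Oy.
  by move: ypos; rewrite subr_gt0; apply/negP; rewrite -leNgt ltW.
split; last first.
  by move=> /interior_subset/(hO x xr); rewrite -/s -/t E ltxx.
move=> B /(filterI ox) /nbhs_eballP[e e0 he].
pose y := x + (e / 2) *: rot90 u.
have yx : eball x e y.
  rewrite /eball /= /dist /y addrAC subrr add0r enormZ enorm_rot90 u1 mulr1 ger0_norm; lra.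
have [yr yB] := he _ yx; exists y; split => //; apply: (proj2 (hO y yr)).
have du := dot_frame 0 (e / 2) u1; rewrite scale0r add0r in du.
have -> : dot (y - p) u = s.
  rewrite /s (_ : y - p = (x - p) + (e / 2) *: rot90 u); last by rewrite /y addrAC.
  by rewrite -[RHS]addr0 -(proj1 du) /dot !coordE; ring.
have -> : dot (y - p) (rot90 u) = t + e / 2.
  rewrite /t (_ : y - p = (x - p) + (e / 2) *: rot90 u); last by rewrite /y addrAC.
  by rewrite -{2}(proj2 du) /dot !coordE; ring.
by rewrite E; lra.
Qed.

Lemma chart_flat Omega p r u f (e : R) : open Omega -> chart Omega p r u f -> bdry Omega p -> 0 < e ->
  exists2 d : R, 0 < d & exists2 v, enorm v = 1 & flatset e v (bdry Omega `&` eball p d).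
Proof.
move=> oO cO bp e0; have [r0 u1 cf _] := cO.
set a := derive1 f 0; pose q := Num.sqrt (1 + a ^+ 2).
have a2 : 0 <= a ^+ 2 := sqr_ge0 a.
have q0 : 0 < q by rewrite sqrtr_gt0; lra.
have qq : q ^+ 2 = 1 + a ^+ 2 by rewrite sqr_sqrtr //; lra.
(* The first bound yields the slope [e]; the second makes n |a| at most 1/2, so that, up to the
   normalisation by [q], the tangential component of a chord is at least half its abscissa
   difference. *)
pose n := Num.min (e / 2) ((1 + `|a|)^-1 / 2).
have na0 : 0 <= `|a| := normr_ge0 a.
have n0 : 0 < n by rewrite lt_min !divr_gt0 // ?invr_gt0; lra.
have [df _ _] := cf.
have [d d0 hd] := strict_diff df (class_C2_continuous1 cf (x := 0)) n0.
exists (Num.min r d); first by rewrite lt_min r0.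
exists (q^-1 *: (u + a *: rot90 u)).
  have h : enorm (u + a *: rot90 u) ^+ 2 = q ^+ 2.
    have := dot_frame 1 a u1; rewrite scale1r => -[h1 h2].
    by rewrite (frame_norm _ u1) h1 h2 qq expr1n.
  have {}h : enorm (u + a *: rot90 u) = q.
    by apply/eqP; rewrite -(eqrXn2 (n := 2)) ?enorm_ge0 ?(ltW q0) //; apply/eqP.
  by rewrite enormZ h ger0_norm ?invr_ge0 ?(ltW q0) // mulVf // gt_eqF.
move=> x y [bx xr] [by_ yr].
have [xr' xd] : eball p r x /\ eball p d x by move: xr; rewrite /eball /= lt_min => /andP.
have [yr' yd] : eball p r y /\ eball p d y by move: yr; rewrite /eball /= lt_min => /andP.
have /(chart_bdry oO cO xr') Ex := bx; have /(chart_bdry oO cO yr') Ey := by_.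
have sm z : eball p d z -> `|dot (z - p) u - 0| < d.
  by move=> h; rewrite subr0; apply: le_lt_trans h; rewrite /dist; apply: (le_trans (norm_dot_le _ _)); rewrite u1 mulr1.
have := hd _ _ (sm _ xd) (sm _ yd); rewrite -Ex -Ey -/a.
set X := dot (x - p) u; set X' := dot (x - p) (rot90 u).
set Y := dot (y - p) u; set Y' := dot (y - p) (rot90 u).
have -> : dot (x - y) (rot90 (q^-1 *: (u + a *: rot90 u))) = q^-1 * ((X' - Y') - (X - Y) * a).
  by rewrite /X /X' /Y /Y' /dot /rot90 !coordE /=; ring.
have -> : dot (x - y) (q^-1 *: (u + a *: rot90 u)) = q^-1 * ((X - Y) + a * (X' - Y')).
  by rewrite /X /X' /Y /Y' /dot /rot90 !coordE /=; ring.
set S := X - Y; set T := X' - Y' => h.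
rewrite !normrM mulrCA ler_pM2l ?normr_gt0 ?invr_eq0 ?gt_eqF //.
have n1 : n <= e / 2 by rewrite /n ge_min lexx.
have n2 : n * `|a| <= 2^-1.
  apply: (@le_trans _ _ ((1 + `|a|)^-1 / 2 * `|a|)); first by rewrite ler_wpM2r // /n ge_min lexx orbT.
  rewrite mulrAC -[X in _ <= X]mul1r ler_pM2r ?invr_gt0 // mulrC ler_pdivrMr ?mul1r; lra.
have H : `|S| / 2 <= `|S + a * T|.
  have -> : S + a * T = S * (1 + a ^+ 2) - (a * (S * a - T)) by ring.
  apply: le_trans (lerB_dist _ _); rewrite !normrM (distrC _ T) [`|1 + _|]ger0_norm ?addr_ge0 //.
  have h3 : `|a| * `|T - S * a| <= `|S| / 2.
    apply: (@le_trans _ _ (`|a| * (n * `|S|))); first by rewrite ler_wpM2l.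
    by rewrite mulrA [`|a| * n]mulrC [n * _ * _]mulrC ler_wpM2l.
  have h4 : `|S| <= `|S| * (1 + a ^+ 2) by rewrite ler_peMr //; lra.
  lra.
apply: (le_trans h); apply: (@le_trans _ _ (e / 2 * `|S|)); first by rewrite ler_wpM2r.
by rewrite mulrAC -mulrA ler_pM2l // mulrC // [2^-1 * _]mulrC.
Qed.

End Local_structure.

(** * Boundary arcs near a point *)

Section Boundary_arcs.
Context {R : realType}.
Implicit Types (Omega A : set (R * R)) (p x y z u : R * R) (g : R -> R * R).

Lemma set_of_itv (a b t : R) : (t \in `[a, b]) = (a <= t <= b). Proof. by rewrite in_itv. Qed.

Lemma compact_curve g : continuous g -> compact (g @` `[0, 1]%classic).
Proof. by move=> cg; apply: continuous_compact; [exact: continuous_subspaceT|exact: segment_compact]. Qed.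

Lemma compact_closed2 (A : set (R * R)) : compact A -> closed A.
Proof. by apply: compact_closed; exact: norm_hausdorff. Qed.

Lemma away_from_closed (A : set (R * R)) z : closed A -> ~ A z ->
  exists2 d : R, 0 < d & forall x, A x -> d <= dist x z.
Proof.
move=> cA nz; have /nbhs_eballP[d d0 hd] : nbhs z (~` A).
  by apply: open_nbhs_nbhs; split => //; exact: closed_openC.
by exists d => // x Ax; rewrite leNgt; apply/negP => h; exact: (hd x h).
Qed.

(** By injectivity and compactness the parameters away from [t0] give points at a positive distance
    from [z], so near [z] the piece is a single short arc around [t0]. *)
Lemma piece_flat g z (e : R) : class_C2 g -> {in `[0, 1], forall t, derive1 g t != 0} ->
  {in `[0, 1] &, injective g} -> 0 < e ->
  exists2 d : R, 0 < d & exists2 u, enorm u = 1 & flatset e u (g @` `[0, 1]%classic `&` eball z d).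
Proof.
move=> cg D0 ig e0; have cK := compact_curve (class_C2_continuous cg).
have [|nz] := pselect ((g @` `[0, 1]%classic) z); last first.
  have [d d0 hd] := away_from_closed (compact_closed2 cK) nz.
  exists d => //; exists (1, 0); first by rewrite /enorm /dot /= mulr1 mulr0 addr0 sqrtr1.
  by move=> x y [/hd h1]; rewrite /eball /= ltNge h1.
move=> [t0 /= t01 gt0].
have [d d0 [u u1 fl]] := curve_flat cg (D0 _ t01) e0.
pose K := `[0, 1]%classic `&` ~` [set t : R | `|t - t0| < d].
have cK' : compact (g @` K).
  apply: continuous_compact; first by apply: continuous_subspaceT; exact: class_C2_continuous.
  apply: compact_closedI; first exact: segment_compact.
  apply: open_closedC; have -> : [set t : R | `|t - t0| < d] = ball t0 d.
    by apply/seteqP; split => t; rewrite /ball /= distrC.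
  exact: ball_open.
have [] := @away_from_closed (g @` K) z (compact_closed2 cK').
  move=> [t [/= tI /=]]; rewrite -gt0 => nt /(ig _ _ tI t01) tt0.
  by apply: nt; rewrite tt0 subrr normr0.
move=> r r0 hr; exists r => //; exists u => // x y [[s sI gs] xr] [[t tI gt] yr].
have near_ s' x' : `[0, 1]%classic s' -> g s' = x' -> eball z r x' -> `|s' - t0| < d.
  move=> sI' gs' xr'; apply: contrapT => h; have : r <= dist x' z by apply: hr; exists s'.
  by rewrite leNgt xr'.
by apply: fl; [exists s => //=; exact: near_ gs xr|exists t => //=; exact: near_ gt yr].
Qed.

Lemma closed_bigU_ord n (F : 'I_n -> set (R * R)) (P : pred 'I_n) :
  (forall i, closed (F i)) -> closed (\bigcup_(i in [set i | P i]) F i).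
Proof. by move=> cF; apply: closed_bigcup => //; exact: finite_finset. Qed.

Lemma connected_in_piece n (F : 'I_n -> set (R * R)) A x0 : connected A -> A x0 ->
  (forall i, closed (F i)) -> A `<=` \bigcup_i F i ->
  (forall i j x, i != j -> A x -> F i x -> F j x -> False) -> exists i, A `<=` F i.
Proof.
move=> cA Ax0 cF cov dis; have [i _ Fi] := cov _ Ax0; exists i.
suff <- : A `&` F i = A by move=> x [].
apply: cA; first by exists x0.
- exists (~` \bigcup_(j in [set j | j != i]) F j); first by apply: closed_openC; exact: closed_bigU_ord.
  apply/seteqP; split => x [Ax h]; split => //.
    by move=> [j /= ji Fj]; exact: dis ji Ax Fj h.
  have [j _ Fj] := cov _ Ax; have [<-//|ji] := eqVneq j i.
  by case: h; exists j.
- by exists (F i).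
Qed.

(** At a corner the boundary itself is not flat. But a connected set of C^2 points near the corner
    [z] cannot pass from one piece to another: pieces meet only at end points, and these are either
    far away or equal to [z], which is not a C^2 point. One piece alone is flat near [z], whatever
    the angle there. *)
Lemma local_flat Omega z (e : R) : open Omega -> piecewise_C2_boundary Omega -> bdry Omega z -> 0 < e ->
  exists2 d : R, 0 < d & forall A, connected A -> A `<=` bdry Omega `&` eball z d ->
    (forall x, A x -> C2_boundary_at Omega x) -> exists2 u, enorm u = 1 & flatset e u A.
Proof.
move=> oO [n [g [gC2 gdis bE gint]]] bz e0.
have [[_ [r [u [f [r0 u1 cf hO]]]]]|nC2] := pselect (C2_boundary_at Omega z).
  have cO : chart Omega z r u f by [].
  have [d d0 [v v1 fl]] := chart_flat oO cO bz e0.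
  by exists d => // A _ Ad _; exists v => // x y /Ad hx /Ad hy; exact: fl.
pose Q (i : 'I_n) (d : R) := exists2 u, enorm u = 1 & flatset e u (g i @` `[0, 1]%classic `&` eball z d).
have [d1 d10 hd1] : exists2 d : R, 0 < d & forall i, Q i d.
  apply: fin_radius => [i r r' rr [u u1 fl]|i].
    exists u => // x y [gx xr] [gy yr]; apply: fl; split=> //; exact: lt_le_trans rr.
  by have [c D0 ig] := gC2 i; exact: piece_flat.
pose Q2 (ib : 'I_n * bool) (d : R) := g ib.1 (if ib.2 then 0 else 1) = z \/ d <= dist (g ib.1 (if ib.2 then 0 else 1)) z.
have [d2 d20 hd2] : exists2 d : R, 0 < d & forall ib, Q2 ib d.
  apply: fin_radius => [ib r r' rr [|h]|ib]; [by left|by right; exact: le_trans rr h|].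
  have [h|h] := eqVneq (g ib.1 (if ib.2 then 0 else 1)) z; first by exists 1; [|left].
  exists (dist (g ib.1 (if ib.2 then 0 else 1)) z); last by right.
  by rewrite lt_neqAle dist_ge0 andbT eq_sym; apply: contra h => /eqP/dist_eq0 ->.
exists (Num.min d1 d2); first by rewrite lt_min d10.
move=> A cA Ad AC2; have [A0|/set0P[x0 Ax0]] := eqVneq A set0.
  by exists (1, 0); [rewrite /enorm /dot /= mulr1 mulr0 addr0 sqrtr1|move=> x y; rewrite A0].
have [i Ai] : exists i, A `<=` g i @` `[0, 1]%classic.
  apply: (connected_in_piece cA Ax0) => [i||i j x ij Ax [s sI gs] [t tI gt]].
  - by apply: compact_closed2; apply: compact_curve; apply: class_C2_continuous; case: (gC2 i).
  - by move=> x /Ad[]; rewrite bE.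
  - have [sE _] := gdis i j s t ij sI tI (etrans gs (esym gt)).
    have zx : x <> z by move=> E; apply: nC2; rewrite -E; exact: AC2.
    have [_] := Ad x Ax; rewrite /eball /= lt_min => /andP[_ xd].
    have [] := hd2 (i, s == 0); rewrite /=.
      case: sE => E; rewrite E ?eqxx ?(negbTE (oner_neq0 _)) => h; apply: zx; by rewrite -gs E.
    case: sE => E; rewrite E ?eqxx ?(negbTE (oner_neq0 _)) => h; by move: h; rewrite -E gs leNgt xd.
have [u u1 fl] := hd1 i; exists u => // x y Ax Ay.
have sub w : A w -> (g i @` `[0, 1]%classic `&` eball z d1) w.
  move=> Aw; split; first exact: Ai.
  by have [_] := Ad w Aw; rewrite /eball /= lt_min => /andP[].
by apply: fl; exact: sub.
Qed.

Lemma first_hit (h : R -> R) (a b c : R) : a <= b -> continuous h -> h a < c <= h b ->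
  exists t, [/\ a <= t <= b, h t = c & forall s, a <= s <= t -> h s <= c].
Proof.
move=> ab ch /andP[ha hb].
pose S := `[a, b]%classic `&` h @^-1` [set y | c <= y].
have cS : compact S.
  apply: compact_closedI; first exact: segment_compact.
  by apply: preimage_closed => //; exact: closed_ge.
have cid : {within S, continuous (fun x : R => x)} by apply: continuous_subspaceT => x; exact: cvg_id.
have [|t /set_mem[/= tI ct] tmin] := @compact_EVT_min _ R (fun x : R => x) S _ cS cid.
  by exists b; split; rewrite /= ?in_itv /= ?ab ?lexx.
have below s : a <= s < t -> h s < c.
  move=> /andP[as_ st]; rewrite ltNge; apply/negP => cs.
  suff : t <= s by rewrite leNgt st.
  apply: tmin; apply: mem_set; split => //=; move: tI; rewrite !in_itv /= => /andP[_ tb].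
  by rewrite as_ (le_trans (ltW st)).
move: tI; rewrite in_itv /= => /andP[at_ tb].
have E : h t = c.
  have [|s] := @IVT _ h a t c at_ (continuous_subspaceT ch).
    by rewrite ge_min le_max (ltW ha) ct orbT.
  rewrite in_itv /= => /andP[as_ st] hs; move: st; rewrite le_eqVlt => /orP[/eqP <-//|st].
  by have := below s; rewrite as_ st hs ltxx => /(_ isT).
exists t; split => //; first by rewrite at_.
move=> s /andP[as_]; rewrite le_eqVlt => /orP[/eqP ->|st]; first by rewrite E.
by apply: ltW; apply: below; rewrite as_.
Qed.

(** Clamping the parameter to [0,1] makes the parametrisation continuous on the whole line, so that
    relative continuity need not be carried along. *)
Lemma arc_param A p q : simple_arc A p q -> exists gam : R -> R * R,
  [/\ continuous gam, gam 0 = p, gam 1 = q, {in `[0, 1] &, injective gam} & A = gam @` `[0, 1]%classic].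
Proof.
move=> [gam [cg g0 g1 ig AE]].
pose cl (t : R) : R := Num.min 1 (Num.max 0 t).
have clI t : `[0, 1]%classic (cl t).
  by rewrite /= in_itv /= /cl le_min ler01 le_max lexx /= ge_min lexx.
have clid t : 0 <= t <= 1 -> cl t = t.
  by move=> /andP[h0 h1]; rewrite /cl max_r // min_r.
have ccl : continuous cl.
  have cm : continuous (fun t : R => Num.max 0 t).
    by move=> t; apply: continuous_max; [exact: cvg_cst|exact: cvg_id].
  by move=> t; apply: continuous_min; [exact: cvg_cst|exact: cm].
exists (fun t => gam (cl t)); split => /=.
- have W : {within setT, continuous (gam \o cl)}.
    by apply: (within_comp (proj1 (continuous_subspace_setT cl) ccl) _ cg).
  exact: (proj2 (continuous_subspace_setT _) W).
- by rewrite clid ?g0 // lexx ler01.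
- by rewrite clid ?g1 // lexx ler01.
- by move=> s t sI tI; rewrite !set_of_itv in sI tI; rewrite !clid //; apply: ig; rewrite in_itv.
- rewrite AE; apply/seteqP; split => x [t tI <-]; exists t => //=; rewrite ?clid //; move: tI; by rewrite /= in_itv.
Qed.

(** An arc in the boundary that passes close to [p] and ends far from it leaves the chart in both
    directions of the parameter. On the graph the abscissa determines the point, so by injectivity
    the two exits lie on opposite sides of [p], and the intermediate value theorem sweeps all
    abscissae in between: the arc contains the whole boundary near [p]. *)
Lemma chart_full Omega p r u f (r0 : R) : open Omega -> chart Omega p r u f -> bdry Omega p -> 0 < r0 ->
  exists2 d : R, 0 < d & forall A a b p', simple_arc A a b -> A `<=` bdry Omega -> A p' ->
    dist p' p < d -> r0 <= dist a p' -> r0 <= dist b p' -> bdry Omega `&` eball p d `<=` A.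
Proof.
move=> oO cO bp r00; have [rr0 u1 cf _] := cO.
pose r2 : R := Num.min r r0 / 2.
have m0 : 0 < Num.min r r0 by rewrite lt_min rr0.
have r2r : r2 + r2 <= r by rewrite /r2 -splitr ge_min lexx.
have r2r0 : r2 + r2 <= r0 by rewrite /r2 -splitr ge_min lexx orbT.
have r20 : 0 < r2 by rewrite /r2 divr_gt0.
have f0 : f 0 = 0.
  have pp : eball p r p by rewrite /eball /= distxx.
  by have := proj1 (chart_bdry oO cO pp) bp; rewrite subrr /dot !mul0r addr0 => <-.
have /nbhs_ballP[d1 /= d10 hd1] : nbhs (0 : R) [set t | `|f 0 - f t| < r2 / 2].
  have := class_C2_continuous cf (x := 0); move/cvgrPdist_lt => /(_ (r2 / 2)); apply; by rewrite divr_gt0.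
pose d : R := Num.min d1 (r2 / 2).
have d0 : 0 < d by rewrite lt_min d10 divr_gt0.
have dr2 : d <= r2 / 2 by rewrite ge_min lexx orbT.
(* A boundary point whose abscissa is below [d] has height below r2/2, hence lies within r2 of [p];
   an exit point, at distance r2, thus has abscissa at least [d]. *)
have far x : eball p r x -> bdry Omega x -> r2 <= dist x p -> d <= `|dot (x - p) u|.
  move=> xr bx xp; rewrite leNgt; apply/negP => h; have /(chart_bdry oO cO xr) E := bx.
  have hf : `|f (dot (x - p) u)| < r2 / 2.
    have : ball 0 d1 (dot (x - p) u) by rewrite /ball /= sub0r normrN; apply: lt_le_trans h _; rewrite ge_min lexx.
    by move/hd1 => /=; rewrite f0 sub0r normrN.
  suff : dist x p < r2 by rewrite ltNge xp.
  rewrite /dist {1}(frame_dec (x - p) u1); apply: le_lt_trans (ler_enormD _ _) _.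
  by rewrite !enormZ enorm_rot90 u1 !mulr1 E; lra.
exists d => // A a b p' sA AO Ap' p'd ap bp'.
have [gam [cg g0 g1 ig AE]] := arc_param sA.
have gA t : 0 <= t <= 1 -> A (gam t) by move=> tI; rewrite AE; exists t => //=; rewrite in_itv.
have [t' t'I gt'] : exists2 t', 0 <= t' <= 1 & gam t' = p'.
  by move: Ap'; rewrite AE => -[t' /=]; rewrite in_itv /= => t'I <-; exists t'.
have /andP[t'0 t'1] := t'I.
pose h (t : R) : R := dist (gam t) p.
have ch : continuous h by move=> t; apply: (@continuous_comp _ _ _ gam (fun x => dist x p)); [exact: cg|exact: continuous_dist].
have ht' : h t' < r2 by rewrite /h gt'; lra.
have end_ q : r0 <= dist q p' -> r2 <= dist q p by have := dist_tri q p p'; rewrite (dist_sym p p'); lra.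
have [tp [/andP[tp1 tp2] htp btp]] : exists t, [/\ t' <= t <= 1, h t = r2 & forall s, t' <= s <= t -> h s <= r2].
  by apply: first_hit => //; rewrite ht' /h g1 end_.
have [tm [/andP[tm1 tm2] htm btm]] : exists t, [/\ 0 <= t <= t', h t = r2 & forall s, t <= s <= t' -> h s <= r2].
  have [|||t [/andP[t1 t2] hE hb]] := @first_hit (fun t => h (- t)) (- t') 0 r2.
  - lra.
  - by move=> t; apply: (@continuous_comp _ _ _ (fun t : R => - t) h); [exact: opp_continuous|exact: ch].
  - by rewrite opprK oppr0 ht' /h g0 end_.
  exists (- t); split; [by apply/andP; split; lra|by []|].
  by move=> s /andP[s1 s2]; rewrite -[s]opprK; apply: hb; apply/andP; split; lra.
pose sg (t : R) : R := dot (gam t - p) u.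
have csg : continuous sg by move=> t; apply: (@continuous_comp _ _ _ gam (fun x => dot (x - p) u)); [exact: cg|exact: continuous_dot].
have inb t : tm <= t <= tp -> [/\ eball p r (gam t), bdry Omega (gam t) & 0 <= t <= 1].
  move=> /andP[t1 t2]; have tI : 0 <= t <= 1 by apply/andP; split; lra.
  split => //; last by apply: AO; exact: gA.
  rewrite /eball /= -/(h t); apply: (@le_lt_trans _ _ r2); last lra.
  by have [tt|tt] := leP t t'; [apply: btm; rewrite t1|apply: btp; rewrite t2 andbT ltW].
have onG t : tm <= t <= tp -> dot (gam t - p) (rot90 u) = f (sg t).
  by move=> /inb[h1 h2 _]; exact/(chart_bdry oO cO h1).
have isg s t : tm <= s <= tp -> tm <= t <= tp -> sg s = sg t -> s = t.
  move=> hs ht E; apply: ig; rewrite ?set_of_itv; [by case: (inb s hs)|by case: (inb t ht)|].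
  apply/eqP; rewrite -subr_eq0; apply/eqP.
  have -> : gam s - gam t = (gam s - p) - (gam t - p) by rewrite opprB addrA subrK.
  by rewrite (frame_dec (gam s - p) u1) (frame_dec (gam t - p) u1) !onG // -/(sg s) -/(sg t) E subrr.
have tmI : tm <= tm <= tp by rewrite lexx; lra.
have tpI : tm <= tp <= tp by rewrite lexx andbT; lra.
have t'I' : tm <= t' <= tp by rewrite tm2.
have Dm : d <= `|sg tm| by apply: far; [case: (inb tm tmI)|case: (inb tm tmI)|rewrite -/(h tm) htm].
have Dp : d <= `|sg tp| by apply: far; [case: (inb tp tpI)|case: (inb tp tpI)|rewrite -/(h tp) htp].
have D' : `|sg t'| < d.
  by apply: le_lt_trans p'd; rewrite /sg gt' /dist; apply: (le_trans (norm_dot_le _ _)); rewrite u1 mulr1.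
have ivt s t v : s <= t -> Num.min (sg s) (sg t) <= v <= Num.max (sg s) (sg t) -> exists2 w, s <= w <= t & sg w = v.
  move=> st hv; have [w] := IVT st (continuous_subspaceT csg) hv.
  by rewrite in_itv /=; exists w.
(* Two exits on the same side would make some abscissa [v] occur both before and after the parameter
   of [p']. *)
have nosame v : `|sg t'| < `|v| -> Num.min (sg tm) (sg t') <= v <= Num.max (sg tm) (sg t') ->
   Num.min (sg t') (sg tp) <= v <= Num.max (sg t') (sg tp) -> False.
  move=> v' v1 v2; have [s1 /andP[a1 b1] e1] := ivt _ _ _ tm2 v1.
  have [s2 /andP[a2 b2] e2] := ivt _ _ _ tp1 v2.
  have s12 : s1 = s2 by apply: isg; rewrite ?e1 ?e2 //; apply/andP; split; lra.
  by have E : s1 = t' by [lra]; move: v'; rewrite -e1 E ltxx.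
have mm v : `|v| < d -> Num.min (sg tm) (sg tp) <= v <= Num.max (sg tm) (sg tp).
  move=> hv; move: Dm Dp D' hv; rewrite !ler_normr !ltr_norml => Dm' Dp' /andP[D1 D2] /andP[v1 v2].
  have [M|M] := orP Dm'; have [P|P] := orP Dp'.
  - exfalso; apply: (nosame d); rewrite ?(gtr0_norm d0) ?ltr_norml ?D1 //.
      by rewrite ge_min le_max M (ltW D2) orbT.
    by rewrite ge_min le_max P (ltW D2) orbT.
  - rewrite ge_min le_max; apply/andP; split; apply/orP; [right|left]; lra.
  - rewrite ge_min le_max; apply/andP; split; apply/orP; [left|right]; lra.
  - exfalso; apply: (nosame (- d)); rewrite ?normrN ?(gtr0_norm d0) ?ltr_norml ?D1 //.
      by rewrite ge_min le_max (ltW D1) !orbT /= andbT; apply/orP; left; lra.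
    by rewrite ge_min le_max (ltW D1) /= andbT; apply/orP; right; lra.
move=> x [bx xd]; have xr : eball p r x by apply: lt_le_trans xd _; lra.
have xs : `|dot (x - p) u| < d.
  by apply: le_lt_trans xd; rewrite /dist; apply: (le_trans (norm_dot_le _ _)); rewrite u1 mulr1.
have [w wI we] := ivt tm tp _ ltac:(lra) (mm _ xs).
have -> : x = gam w; last by apply: gA; case: (inb w wI).
apply/eqP; rewrite -subr_eq0; apply/eqP.
have -> : x - gam w = (x - p) - (gam w - p) by rewrite opprB addrA subrK.
have /(chart_bdry oO cO xr) Ex := bx.
by rewrite (frame_dec (x - p) u1) (frame_dec (gam w - p) u1) onG // -/(sg w) we Ex subrr.
Qed.

End Boundary_arcs.

(** * Arcs between consecutive mesh vertices *)

Section Thin_arcs.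
Context {R : realType}.
Implicit Types (Omega A V : set (R * R)) (p x y z u a b : R * R).

(** Each listed point is avoided by passing to the outer third of the interval on the other side of
    the midpoint. This keeps an explicit distance, which mere counting would not give. *)
Lemma avoid_list (L : seq R) (a b : R) : a < b -> exists c, a < c < b /\
  forall x : R, x \in L -> (b - a) / (2 * 3 ^+ size L) <= `|c - x|.
Proof.
elim: L a b => [|x L IH] a b ab.
  by exists ((a + b) / 2); split => //; apply/andP; split; lra.
set w := b - a; have w0 : 0 < w by rewrite /w; lra.
have e3 : 1 <= 3 ^+ size L :> R by apply: exprn_ege1; lra.
have P : 0 < 3 ^+ size L :> R by lra.
have half : w / (2 * 3 ^+ size (x :: L)) <= w / 6.
  by rewrite /= exprS ler_pM2l // lef_pV2 ?posrE; lra.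
have [a' [b' [aa bb ab' wE hx]]] : exists a' b' : R, [/\ a <= a', b' <= b, a' < b', b' - a' = w / 3 &
    forall c, a' < c < b' -> w / 6 <= `|c - x|].
  have [xm|xm] := leP x ((a + b) / 2).
    exists (b - w / 3), b; split; rewrite /w in w0 *; try lra.
    by move=> c /andP[c1 c2]; rewrite ger0_norm; lra.
  exists a, (a + w / 3); split; rewrite /w in w0 *; try lra.
  by move=> c /andP[c1 c2]; rewrite ler0_norm; lra.
have [c [/andP[c1 c2] hc]] := IH a' b' ab'.
exists c; split; first by apply/andP; split; lra.
move=> y; rewrite inE => /orP[/eqP ->|yL]; first by apply: le_trans half _; apply: hx; rewrite c1.
apply: le_trans (hc y yL); rewrite wE le_eqVlt; apply/orP; left; apply/eqP.
by rewrite /= exprS; field; lra.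
Qed.

Lemma bounded_domain_enorm Omega : bounded_domain Omega ->
  exists2 r : R, 0 < r & forall x, closure Omega x -> enorm x <= r.
Proof.
move=> [_ _ _ [M [_ hM]]]; pose m := `|M| + 1.
have Mm : M < m by rewrite /m; have := ler_norm M; lra.
have m0 : 0 < m by rewrite /m; have := normr_ge0 M; lra.
exists (m + m); first lra.
have sub : Omega `<=` ecball 0 (m + m).
  move=> x /(hM m Mm) /=; rewrite prod_normE ge_max => /andP[h1 h2].
  rewrite /ecball /= /dist subr0; apply: le_trans (enorm_le_coords _) _; exact: lerD.
move=> x /(closure_subset sub)/closed_ecball.
by rewrite /ecball /= /dist subr0.
Qed.

Lemma bdry_closed (A : set (R * R)) : closed (bdry A).
Proof.
rewrite /bdry setDE; apply: closedI; first exact: closed_closure.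
apply: open_closedC; exact: open_interior.
Qed.

Lemma bdry_compact Omega : bounded_domain Omega -> compact (bdry Omega).
Proof.
move=> /bounded_domain_enorm[r _ hr]; apply: (@heine_borel2 _ _ r); first exact: bdry_closed.
by move=> x [/hr].
Qed.

(** If the arc reached distance [delta] from [a], it would contain a C^2 point [p] at an
    intermediate distance, away from both ends and from all corners. By [chart_full] the arc then
    contains the whole boundary near [p], in particular a point of [V], which is 2h-dense; but the
    arc meets [V] in its end points only. *)
Lemma arc_small Omega (delta : R) : bounded_domain Omega -> piecewise_C2_boundary Omega -> 0 < delta ->
  exists2 h0 : R, 0 < h0 & forall h V A a b, h < h0 -> V `<=` bdry Omega ->
    (forall x, bdry Omega x -> exists2 v, V v & dist v x <= 2 * h) ->
    simple_arc A a b -> A `<=` bdry Omega -> A `&` V = [set a; b] -> dist a b <= h ->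
    forall x, A x -> dist x a < delta.
Proof.
move=> bO pO de0; have [_ oO _ _] := bO; have [n [g [gC2 _ bE gint]]] := pO.
pose Zl : seq (R * R) := [seq g i 0 | i <- enum 'I_n] ++ [seq g i 1 | i <- enum 'I_n].
(* The margin that [avoid_list] guarantees between the distance of [p] from [a] and the distances of
   the end points of the pieces from [a]. *)
pose tau := (2 * delta / 3 - delta / 3) / (2 * 3 ^+ size Zl).
have tau0 : 0 < tau.
  by rewrite /tau divr_gt0 ?mulr_gt0 ?exprn_gt0 //; lra.
pose K := bdry Omega `&` \bigcap_(z in [set` Zl]) [set x | tau <= dist x z].
have cK : compact K.
  apply: compact_closedI; first exact: bdry_compact.
  apply: closed_bigI => z _.
  have -> : [set x | tau <= dist x z] = (fun x => dist x z) @^-1` [set y | tau <= y] by [].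
  by apply: preimage_closed; [move=> x *; exact: continuous_dist|exact: closed_ge].
have KC2 x : K x -> C2_boundary_at Omega x.
  move=> [bx hx]; move: (bx); rewrite bE => -[i _ [t /=]]; rewrite in_itv /= => /andP[t0 t1] gt.
  have nz z : z \in Zl -> x != z.
    by move=> zZ; apply/eqP => E; have := hx z zZ; rewrite /= E distxx leNgt tau0.
  rewrite -gt; apply: gint; rewrite in_itv /= !lt_neqAle t0 t1 !andbT.
  have i0 : g i 0 \in Zl by rewrite mem_cat map_f ?mem_enum.
  have i1 : g i 1 \in Zl by rewrite mem_cat (map_f (fun i => g i 1)) ?mem_enum ?orbT.
  by apply/andP; split; apply/eqP => E; [have := nz _ i0|have := nz _ i1]; rewrite -gt -E eqxx.
pose r0 := delta / 6; have r00 : 0 < r0 by rewrite /r0; lra.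
pose Q (r : R) z := forall A a b, simple_arc A a b -> A `<=` bdry Omega -> A z ->
    r0 <= dist a z -> r0 <= dist b z -> bdry Omega `&` eball z r `<=` A.
have [r rp hr] : exists2 r : R, 0 < r & forall z, K z -> Q r z.
  apply: compact_uniform cK _ _ => [r r' z rr hQ A a b h1 h2 h3 h4 h5 x [bx xr]|z Kz].
    by apply: (hQ A a b) => //; split => //; exact: lt_le_trans xr rr.
  have [bz [rc [u [f cO]]]] := KC2 z Kz.
  have [d d0 hd] := chart_full oO (cO : chart Omega z rc u f) bz r00.
  exists (d / 2); first lra.
  move=> y _ yz A a b h1 h2 h3 h4 h5 x [bx xr]; apply: (hd A a b y) => //; first lra.
  split => //; rewrite /eball /= in xr *; have := dist_tri x y z; lra.
(* With r/2 the ball around [p] contains a point of [V]; with delta/12 this point, at distance at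
   most 2h < delta/6 from [p], is neither [a] nor [b]. *)
exists (Num.min (r / 2) (delta / 12)); first by rewrite lt_min; apply/andP; split; lra.
move=> h V A a b; rewrite lt_min => /andP[hr2 hd] VO hV sA AO AV ab x Ax.
rewrite ltNge; apply/negP => xa.
have [gam [cg g0 g1 _ AE]] := arc_param sA.
move: (Ax); rewrite AE => -[t /=]; rewrite in_itv /= => /andP[t0 t1] gt.
have [c [/andP[c1 c2] hc]] := avoid_list [seq dist z a | z <- Zl] (ltac:(lra) : delta / 3 < 2 * delta / 3).
rewrite size_map -/tau in hc.
have [||s] := @IVT _ (fun s => dist (gam s) a) 0 t c t0.
- apply: continuous_subspaceT => s; apply: (@continuous_comp _ _ _ gam (fun x => dist x a)); [exact: cg|exact: continuous_dist].
- rewrite g0 distxx gt ge_min le_max; apply/andP; split; apply/orP; [left|right]; lra.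
rewrite in_itv /= => /andP[s0 st] hs; set p := gam s in hs.
have Ap : A p by rewrite AE; exists s => //=; rewrite in_itv /= s0 (le_trans st).
have Kp : K p.
  split; first exact: AO.
  move=> z /= zZ; have := hc (dist z a) (map_f (fun z => dist z a) zZ); rewrite -hs => /le_trans; apply.
  have := dist_tri p z a; have := dist_tri z p a; rewrite (dist_sym z p) ler_norml => *; apply/andP; split; lra.
have pa : r0 <= dist a p by rewrite dist_sym hs /r0; lra.
have pb : r0 <= dist b p by have := dist_tri p b a; rewrite (dist_sym p b) (dist_sym b a) hs /r0; lra.
have full := hr p Kp A a b sA AO Ap pa pb.
have [v Vv vp] := hV p (AO p Ap).
have Av : A v.
  by apply: full; split; [exact: VO|rewrite /eball /=; lra].
have : (A `&` V) v by [].
by rewrite AV => -[E|E]; rewrite E /r0 in vp pa pb; lra.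
Qed.

Lemma ge0_itv_closure (h : R -> R) (s : R) : continuous h -> (forall t, 0 < t < 1 -> 0 <= h t) ->
  0 <= s <= 1 -> 0 <= h s.
Proof.
move=> ch hp /andP[s0 s1]; rewrite leNgt; apply/negP => hs.
have /nbhs_ballP[d /= d0 hd] : nbhs s (h @^-1` [set y | y < 0]).
  by apply: (ch s); apply: open_nbhs_nbhs; split => //; exact: open_lt.
pose m : R := Num.min 1 d / 2.
have m0 : 0 < m by rewrite /m divr_gt0 // lt_min ltr01.
have n1 : Num.min 1 d <= d by rewrite ge_min lexx orbT.
have n2 : Num.min 1 d <= 1 by rewrite ge_min lexx.
have md : m < d by rewrite /m in m0 *; lra.
have m1 : m < 1 by rewrite /m in m0 *; lra.
pose t := s + m * (2^-1 - s).
have b : `|2^-1 - s| <= 1 by rewrite ler_norml; apply/andP; split; lra.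
have ht : ball s d t.
  rewrite /ball /= /t opprD addrA subrr add0r normrN normrM ger0_norm ?(ltW m0) //.
  apply: le_lt_trans md; rewrite -[X in _ <= X]mulr1 ler_wpM2l // ltW //.
have := hp t; have := hd t ht; rewrite /= => h1 h2.
suff /h2 : 0 < t < 1 by rewrite leNgt h1.
have ms := mulr_ge0 (ltW m0) s0; have ms1 : m * s <= m by rewrite ler_piMr // ltW.
have s1' : 0 <= (1 - m) * (1 - s) by rewrite mulr_ge0; lra.
have s0' : 0 <= (1 - m) * s by rewrite mulr_ge0; lra.
rewrite /t; apply/andP; split; lra.
Qed.

(** The open arc contains no point of [V], hence no corner, since corners belong to [V]. Being
    short, it lies in one of the balls of [local_flat] and is flat there; continuity extends the
    inequality to the end points. *)
Lemma arc_thin Omega (e : R) : bounded_domain Omega -> piecewise_C2_boundary Omega -> 0 < e ->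
  exists2 h0 : R, 0 < h0 & forall h V A a b, h < h0 -> V `<=` bdry Omega ->
    (forall x, bdry Omega x -> exists2 v, V v & dist v x <= 2 * h) ->
    (forall x, bdry Omega x -> ~ C2_boundary_at Omega x -> V x) ->
    simple_arc A a b -> A `<=` bdry Omega -> A `&` V = [set a; b] -> dist a b <= h ->
    exists2 u, enorm u = 1 & flatset e u A.
Proof.
move=> bO pO e0; have [_ oO _ _] := bO.
pose Q (r : R) z := forall A, connected A -> A `<=` bdry Omega `&` eball z r ->
    (forall x, A x -> C2_boundary_at Omega x) -> exists2 u, enorm u = 1 & flatset e u A.
have [r rp hr] : exists2 r : R, 0 < r & forall z, bdry Omega z -> Q r z.
  apply: (compact_uniform (bdry_compact bO)) => [r r' z rr hQ A h1 h2 h3|z bz].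
    by apply: hQ => // x /h2[bx xr]; split => //; exact: lt_le_trans xr rr.
  have [d d0 hd] := local_flat oO pO bz e0.
  exists (d / 2); first lra.
  move=> y _ yz A h1 h2 h3; apply: hd => // x /h2[bx xr]; split => //.
  by rewrite /eball /= in xr *; have := dist_tri x y z; lra.
have [h0 h00 hs] := arc_small bO pO rp.
exists h0 => // h V A a b hh VO hV hC sA AO AV ab.
have small := hs h V A a b hh VO hV sA AO AV ab.
have [gam [cg g0 g1 ig AE]] := arc_param sA.
have inA t : 0 <= t <= 1 -> A (gam t) by move=> tI; rewrite AE; exists t => //=; rewrite in_itv.
pose A' := gam @` `]0, 1[%classic.
have A'A : A' `<=` A by move=> _ [t /= tI <-]; apply: inA; move: tI; rewrite in_itv /= => /andP[? ?]; rewrite !ltW.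
have Va : bdry Omega a by apply: AO; rewrite -g0; apply: inA; rewrite lexx ler01.
have [||u u1 fl] := hr a Va A' _ (fun x Ax => conj (AO x (A'A x Ax)) (small x (A'A x Ax))).
- apply: connected_continuous_connected; last by apply: continuous_subspaceT; exact: cg.
  apply/connected_intervalP => x y; rewrite /= !in_itv /= => /andP[x0 x1] /andP[y0 y1] z /andP[xz zy].
  by rewrite in_itv /= (lt_le_trans x0 xz) (le_lt_trans zy y1).
- move=> x [t /= tI gt]; apply: contrapT => nC.
  have tI' : 0 < t < 1 by move: tI; rewrite in_itv.
  have I0 : (0 : R) \in `[0, 1] by rewrite in_itv /= lexx ler01.
  have I1 : (1 : R) \in `[0, 1] by rewrite in_itv /= lexx ler01.
  have t01 : t \in `[0, 1] by rewrite in_itv /=; case/andP: tI' => ? ?; rewrite !ltW.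
  have Ax : A x by apply: A'A; exists t.
  have : (A `&` V) x by split => //; apply: hC => //; exact: AO.
  case/andP: tI' => t0 t1; rewrite AV => -[E|E].
    have /(ig _ _ t01 I0) E' : gam t = gam 0 by rewrite gt g0.
    by move: t0; rewrite E' ltxx.
  have /(ig _ _ t01 I1) E' : gam t = gam 1 by rewrite gt g1.
  by move: t1; rewrite E' ltxx.
exists u => //.
pose F x y := e * `|dot (x - y) u| - `|dot (x - y) (rot90 u)|.
have cF y : continuous (fun t => F (gam t) y).
  have cd v : continuous (fun t => dot (gam t - y) v).
    by move=> t; apply: (@continuous_comp _ _ _ gam (fun x => dot (x - y) v)); [exact: cg|exact: continuous_dot].
  move=> t; apply: cvgB; first by apply: cvgM; [exact: cvg_cst|apply: cvg_norm; exact: cd].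
  apply: cvg_norm; exact: cd.
have Fs x y : F x y = F y x.
  rewrite /F -[x - y]opprB.
  have E v : dot (- (y - x)) v = - dot (y - x) v by rewrite /dot !coordE; ring.
  by rewrite !E !normrN.
have S1 s t : 0 <= s <= 1 -> 0 < t < 1 -> 0 <= F (gam s) (gam t).
  move=> sI tI; apply: (ge0_itv_closure (cF (gam t)) _ sI) => s' s'I.
  by rewrite /F subr_ge0; apply: fl; [exists s'|exists t]; rewrite /= ?in_itv.
have S2 s t : 0 <= s <= 1 -> 0 <= t <= 1 -> 0 <= F (gam s) (gam t).
  move=> sI tI; rewrite Fs; apply: (ge0_itv_closure (cF (gam s)) _ tI) => t' t'I.
  by rewrite Fs; exact: S1.
move=> x y; rewrite AE => -[s /=]; rewrite in_itv /= => sI <- [t /=]; rewrite in_itv /= => tI <-.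
by have := S2 s t sI tI; rewrite /F subr_ge0.
Qed.

Lemma flat_cross (e : R) u x y : enorm u = 1 -> 0 <= e ->
  `|dot x (rot90 u)| <= e * `|dot x u| -> `|dot y (rot90 u)| <= e * `|dot y u| ->
  `|cross x y| <= 2 * e * enorm x * enorm y.
Proof.
move=> u1 e0 hx hy.
have -> : cross x y = dot x u * dot y (rot90 u) - dot x (rot90 u) * dot y u.
  have : enorm u ^+ 2 = 1 by rewrite u1 expr1n.
  rewrite enorm_sqr /dot /rot90 /cross /= => h.
  by rewrite -[LHS]mulr1 -h; ring.
have nx : `|dot x u| <= enorm x by apply: (le_trans (norm_dot_le _ _)); rewrite u1 mulr1.
have ny : `|dot y u| <= enorm y by apply: (le_trans (norm_dot_le _ _)); rewrite u1 mulr1.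
apply: (le_trans (ler_normB _ _)); rewrite !normrM.
have h1 : `|dot x u| * `|dot y (rot90 u)| <= enorm x * (e * enorm y).
  by apply: ler_pM => //; apply: (le_trans hy); rewrite ler_wpM2l.
have h2 : `|dot x (rot90 u)| * `|dot y u| <= e * enorm x * enorm y.
  by apply: ler_pM => //; apply: (le_trans hx); rewrite ler_wpM2l.
have -> : 2 * e * enorm x * enorm y = enorm x * (e * enorm y) + e * enorm x * enorm y by ring.
exact: lerD.
Qed.

(** Write q = m + sg (m - o), where [m] is the point on the edge. The cross product of b - a and q -
    a is, up to sign, sg times twice the area, while flatness bounds it by 2 e times the two
    lengths. Shape regularity turns this into |sg| <= 2 e kap (1 + |sg|), and 4 e kap <= 1 absorbs
    the last term. *)
Lemma displacement (kap h e t : R) u A a b o q : enorm u = 1 -> flatset e u A -> A a -> A b -> A q ->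
  0 < h -> 0 < kap -> 0 <= e -> 4 * (e * kap) <= 1 -> 0 <= t <= 1 ->
  dist a b <= h -> dist o a <= h -> dist o b <= h -> h ^+ 2 <= kap * `|cross (b - a) (o - a)| ->
  line o (a + t *: (b - a)) q -> dist (a + t *: (b - a)) q <= 4 * (e * kap) * h.
Proof.
move=> u1 fl Aa Ab Aq h0 k0 e0 ek /andP[t0 t1] ab oa ob hd [s _ qE]; subst q.
set m := a + t *: (b - a); pose sg := s - 1.
have qm : o + s *: (m - o) - m = sg *: (m - o).
  by apply: pair_eqP; rewrite /sg !coordE; ring.
have mo : dist m o <= h.
  rewrite /dist /m; have -> : a + t *: (b - a) - o = (1 - t) *: (a - o) + t *: (b - o).
    by apply: pair_eqP; rewrite !coordE; ring.
  apply: (le_trans (ler_enormD _ _)); rewrite !enormZ !ger0_norm ?subr_ge0 //.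
  have x1 : (1 - t) * enorm (a - o) <= (1 - t) * h by rewrite ler_wpM2l ?subr_ge0 // -/(dist a o) dist_sym.
  have x2 : t * enorm (b - o) <= t * h by rewrite ler_wpM2l // -/(dist b o) dist_sym.
  lra.
have -> : dist m (o + s *: (m - o)) = `|sg| * dist m o.
  by rewrite dist_sym {1}/dist qm enormZ.
suff H : `|sg| <= 4 * (e * kap) by apply: ler_pM => //; exact: dist_ge0.
set q := o + s *: (m - o) in Aq qm *.
have := flat_cross u1 e0 (fl _ _ Ab Aa) (fl _ _ Aq Aa).
have -> : cross (b - a) (q - a) = - (sg * cross (b - a) (o - a)).
  rewrite /q /m /sg /cross !coordE; ring.
rewrite normrN normrM => hc.
have qa : enorm (q - a) <= (1 + `|sg|) * h.
  have -> : q - a = (m - a) + sg *: (m - o) by rewrite -qm; apply: pair_eqP; rewrite !coordE; ring.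
  apply: (le_trans (ler_enormD _ _)); rewrite mulrDl mul1r; apply: lerD.
    rewrite /m addrAC subrr add0r enormZ ger0_norm //.
    apply: (@le_trans _ _ (1 * enorm (b - a))); first by rewrite ler_wpM2r ?enorm_ge0.
    by rewrite mul1r -/(dist b a) dist_sym.
  by rewrite enormZ ler_wpM2l.
have ba : enorm (b - a) <= h by rewrite -/(dist b a) dist_sym.
have k1 : `|sg| * h ^+ 2 <= 2 * (e * kap) * ((1 + `|sg|) * h ^+ 2).
  apply: (@le_trans _ _ (kap * (`|sg| * `|cross (b - a) (o - a)|))).
    by rewrite [X in _ <= X]mulrCA ler_wpM2l.
  have -> : 2 * (e * kap) * ((1 + `|sg|) * h ^+ 2) = kap * (2 * e * h * ((1 + `|sg|) * h)) by ring.
  rewrite ler_wpM2l ?(ltW k0) //; apply: (le_trans hc).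
  apply: ler_pM; rewrite ?enorm_ge0 ?mulr_ge0 ?enorm_ge0 //.
  by rewrite ler_wpM2l // mulr_ge0.
have {k1} : `|sg| <= 2 * (e * kap) * (1 + `|sg|).
  rewrite -(ler_pM2r (exprn_gt0 2 h0)); apply: le_trans k1 _; rewrite le_eqVlt; apply/orP; left; apply/eqP; ring.
have ekp : 0 <= e * kap by rewrite mulr_ge0 // ltW.
have := mulr_ge0 (normr_ge0 sg) (ltac:(lra) : 0 <= 1 - 4 * (e * kap)).
have := normr_ge0 sg; lra.
Qed.

End Thin_arcs.

(** * Edges and neighbours in a conforming mesh *)

Section Mesh_geometry.
Context {R : realType}.
Variable M : mesh R.
Implicit Types (k l : 'I_(nel M)) (i j : 'I_3) (x y z : R * R).

Definition ept k i (t : R) : R * R := va k i + t *: (vb k i - va k i).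

Lemma eptE k i t : ept k i t = tpt (vtx k) i 0 t.
Proof. by rewrite /ept /tpt scale0r addr0. Qed.

Lemma tri_vtx (p : 'I_3 -> R * R) i : tri p (p i).
Proof.
exists (fun j => (j == i)%:R); split => [j||]; first by case: eqP.
  by rewrite (bigD1 i) //= eqxx big1 ?addr0 // => j /negbTE ->.
by rewrite (bigD1 i) //= eqxx scale1r big1 ?addr0 // => j /negbTE ->; rewrite scale0r.
Qed.

Section Nondegenerate.
Hypothesis d0 : forall k, tdet (vtx k) != 0.

Lemma has_sup_diam k : has_sup [set d | exists x y, [/\ elt k x, elt k y & d = dist x y]].
Proof.
split; first by exists (dist (vtx k 0) (vtx k 0)), (vtx k 0), (vtx k 0); split => //; exact: tri_vtx.
exists (\sum_i enorm (vtx k i) + \sum_i enorm (vtx k i)) => _ [x [y [Tx Ty ->]]].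
rewrite /dist; apply: (le_trans (ler_enormD _ _)); rewrite enormN.
by apply: lerD; exact: tri_bounded.
Qed.

Lemma dist_le_hk k x y : elt k x -> elt k y -> dist x y <= hk k.
Proof. by move=> Tx Ty; apply: ub_le_sup; [case: (has_sup_diam k)|exists x, y]. Qed.

Lemma len_le_hk k i : len k i <= hk k.
Proof. by apply: dist_le_hk; [exact: (tri_vtx (vtx k) (i + 1))|exact: (tri_vtx (vtx k) (i - 1))]. Qed.

Lemma len_gt0 k i : 0 < len k i.
Proof.
rewrite lt_neqAle dist_ge0 andbT eq_sym; apply: contra (d0 k) => /eqP/dist_eq0 E.
by rewrite (tdetE _ i) -/(va k i) -/(vb k i) E /cross; apply/eqP; ring.
Qed.

Lemma hk_gt0 k : 0 < hk k.
Proof. exact: lt_le_trans (len_gt0 k 0) (len_le_hk k 0). Qed.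

Lemma hk_le_hmax k : hk k <= hmax M.
Proof. exact: le_bigmax. Qed.

Lemma ept_elt k i t : 0 <= t <= 1 -> elt k (ept k i t).
Proof.
move=> /andP[t0 t1]; apply/(triP _ (d0 k)) => j; rewrite eptE.
have [b1 b2 b3] := bary_tpt i 0 t (d0 k).
have [->|->|->] : [\/ j = i, j = i + 1 | j = i - 1].
  have [->|->|->] := I3P i; rewrite !I3_succ; have [->|->|->] := I3P j; by [constructor 1|constructor 2|constructor 3].
- by rewrite b1.
- by rewrite b3 subr0 subr_ge0.
- by rewrite b2.
Qed.

Lemma other_index i j : i != j -> j = i + 1 \/ j = i - 1.
Proof. by have [->|->|->] := I3P i; rewrite !I3_succ; have [->|->|->] := I3P j => //; by [left|right]. Qed.

Lemma bary_ept k i t : bary (vtx k) i (ept k i t) = 0.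
Proof. by rewrite eptE; case: (bary_tpt i 0 t (d0 k)). Qed.

Lemma bary_ept_gt0 k i j t : 0 < t < 1 -> i != j -> 0 < bary (vtx k) j (ept k i t).
Proof.
move=> /andP[t0 t1] /other_index[|] ->; rewrite eptE; have [_ b2 b3] := bary_tpt i 0 t (d0 k).
  by rewrite b3 subr0 subr_gt0.
by rewrite b2.
Qed.

Lemma bary_zero_ept k i x : elt k x -> bary (vtx k) i x = 0 ->
  exists2 t, 0 <= t <= 1 & x = ept k i t.
Proof.
move=> Tx b0; have hb := proj1 (triP x (d0 k)) Tx; exists (bary (vtx k) (i - 1) x).
  by rewrite hb (bary_le1 _ (d0 k) Tx).
have := bary_sum x (d0 k); rewrite (sum3_at _ i) b0 add0r => E.
have {}E : bary (vtx k) (i + 1) x = 1 - bary (vtx k) (i - 1) x by rewrite -E addrK.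
rewrite {1}(bary_comb x (d0 k)) (sum3_at _ i) b0 scale0r add0r E /ept /va /vb.
by apply: pair_eqP; rewrite !coordE; ring.
Qed.

Lemma local_bary k i x : (forall j, i != j -> 0 < bary (vtx k) j x) ->
  exists2 d : R, 0 < d & forall y, dist y x < d -> forall j, i != j -> 0 < bary (vtx k) j y.
Proof.
move=> hx; have [d d0' hd] : exists2 d : R, 0 < d & forall j, forall y, dist y x < d -> i != j -> 0 < bary (vtx k) j y.
  apply: fin_radius => [j r r' rr h y yr|j]; first by apply: h; exact: lt_le_trans yr rr.
  have [ij|ij] := boolP (i != j); last by exists 1.
  have /nbhs_eballP[d dp hd] : nbhs x [set y | 0 < bary (vtx k) j y].
    exact: (continuous_bary (x := x) (open_nbhs_nbhs (conj (@open_gt _ 0) (hx j ij)))).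
  by exists d => // y yx _; exact: hd.
by exists d => // y yx j; exact: hd.
Qed.

Lemma elt_local k i y : (forall j, i != j -> 0 < bary (vtx k) j y) -> 0 <= bary (vtx k) i y -> elt k y.
Proof.
move=> h hi; apply/(triP _ (d0 k)) => j; have [<-//|ij] := eqVneq i j.
by apply: ltW; exact: h.
Qed.

Lemma vtx_bary k i j : bary (vtx k) j (vtx k i) = (j == i)%:R.
Proof.
have -> : vtx k i = \sum_l (l == i)%:R *: vtx k l.
  by rewrite (bigD1 i) //= eqxx scale1r big1 ?addr0 // => l /negbTE ->; rewrite scale0r.
by rewrite bary_of // (bigD1 i) //= eqxx big1 ?addr0 // => l /negbTE ->.
Qed.

Lemma bary_line k i (s : R) x : bary (vtx k) i (x + s *: (vtx k i - x)) = (1 - s) * bary (vtx k) i x + s.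
Proof.
have -> : (1 - s) * bary (vtx k) i x + s = (1 - s) * bary (vtx k) i x + s * bary (vtx k) i (vtx k i).
  by rewrite vtx_bary eqxx mulr1.
by rewrite !bary_affine !coordE; ring.
Qed.

Lemma point_near x z (d : R) : 0 < d -> exists2 s : R, 0 < s < 1 & dist (x + s *: (z - x)) x < d /\ dist (x + (- s) *: (z - x)) x < d.
Proof.
move=> dp; pose s := Num.min 1 (d / (1 + dist z x)) / 2.
have n0 := dist_ge0 z x.
have q0 : 0 < d / (1 + dist z x) by rewrite divr_gt0 //; lra.
have m0 : 0 < Num.min 1 (d / (1 + dist z x)) by rewrite lt_min ltr01.
have m1 : Num.min 1 (d / (1 + dist z x)) <= 1 by rewrite ge_min lexx.
have m2 : Num.min 1 (d / (1 + dist z x)) <= d / (1 + dist z x) by rewrite ge_min lexx orbT.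
have s0 : 0 < s by rewrite /s; lra.
have sd : s * dist z x < d.
  apply: (@le_lt_trans _ _ (s * (1 + dist z x))); first by rewrite ler_pM2l //; lra.
  by rewrite -ltr_pdivlMr /s //; lra.
exists s; first by rewrite s0 /s; lra.
by split; rewrite /dist addrAC subrr add0r enormZ ?normrN ger0_norm ?(ltW s0).
Qed.

(** Both coordinates are affine and vanish on the same line, hence proportional; the modulus of the
    ratio is that of the determinants, so the scaled gradients agree up to sign. *)
Lemma same_edge_bary k i l j : same_edge k i l j -> exists2 c : R, c != 0 &
  (forall y, bary (vtx l) j y = c * bary (vtx k) i y) /\
  (forall v, `|tdet (vtx l)| * dbary (vtx l) j v = Num.sg c * (`|tdet (vtx k)| * dbary (vtx k) i v)).
Proof.
have dk := d0 k; have dl := d0 l.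
have main c : c != 0 -> `|c| = `|tdet (vtx k)| / `|tdet (vtx l)| -> (forall y, bary (vtx l) j y = c * bary (vtx k) i y) ->
   exists2 c : R, c != 0 & (forall y, bary (vtx l) j y = c * bary (vtx k) i y) /\
  (forall v, `|tdet (vtx l)| * dbary (vtx l) j v = Num.sg c * (`|tdet (vtx k)| * dbary (vtx k) i v)).
  move=> c0 hc hb; exists c => //; split => // v; rewrite /dbary !hb -mulrBr.
  by rewrite {1}[c]numEsg hc; field; rewrite normr_eq0.
move=> /orP[/andP[/eqP ea /eqP eb]|/andP[/eqP ea /eqP eb]].
  apply: (main (tdet (vtx k) / tdet (vtx l))); rewrite ?mulf_neq0 ?invr_eq0 //.
    by rewrite normrM normfV.
  move=> y; rewrite /bary -/(va k i) -/(vb k i) -/(va l j) -/(vb l j) ea eb; field; exact/andP.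
apply: (main (- (tdet (vtx k) / tdet (vtx l)))); rewrite ?oppr_eq0 ?mulf_neq0 ?invr_eq0 //.
  by rewrite normrN normrM normfV.
move=> y; rewrite /bary -/(va k i) -/(vb k i) -/(va l j) -/(vb l j) ea eb /cross; field; exact/andP.
Qed.

Lemma same_edge_sym k i l j : same_edge k i l j = same_edge l j k i.
Proof.
rewrite /same_edge [va k i == _]eq_sym [vb k i == _]eq_sym [va k i == vb l j]eq_sym [vb k i == va l j]eq_sym.
by congr (_ || _); rewrite andbC.
Qed.

Lemma edge_ept k i x : edge k i x <-> exists2 t, 0 <= t <= 1 & x = ept k i t.
Proof.
split=> [[t]|[t tI ->]]; first by rewrite /= in_itv /= => tI <-; exists t.
by exists t; rewrite //= in_itv.
Qed.

Lemma same_edge_ept k i l j t : same_edge k i l j -> ept l j t = ept k i t \/ ept l j t = ept k i (1 - t).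
Proof.
move=> /orP[/andP[/eqP ea /eqP eb]|/andP[/eqP ea /eqP eb]]; rewrite /ept ea eb; [by left|right].
by apply: pair_eqP; rewrite !coordE; ring.
Qed.

Lemma same_edge_ept' k i l j t : same_edge k i l j -> exists2 s, ept k i t = ept l j s & s = t \/ s = 1 - t.
Proof.
rewrite same_edge_sym => /(same_edge_ept t)[->|->]; first by exists t => //; left.
by exists (1 - t) => //; right.
Qed.

Hypothesis conf : conforming M.

(* Elements sharing an edge lie on opposite sides of it: otherwise they would share an interior point. *)
Lemma neighbours_opposite k i l j : k != l -> same_edge k i l j -> exists2 c : R, 0 < c &
  (forall y, bary (vtx l) j y = - (c * bary (vtx k) i y)) /\
  (forall v, `|tdet (vtx l)| * dbary (vtx l) j v = - (`|tdet (vtx k)| * dbary (vtx k) i v)).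
Proof.
move=> kl se; have [c c0 [hb hd]] := same_edge_bary se.
have [cp|cn] := ltP 0 c; last first.
  have cn' : c < 0 by rewrite lt_neqAle c0.
  exists (- c); first lra; split => [y|v]; first by rewrite hb; ring.
  by rewrite hd ltr0_sg // mulN1r.
exfalso; have h2 : 0 < (2^-1 : R) < 1 by apply/andP; split; lra.
pose m := ept k i 2^-1.
have [d1 d10 hd1] := local_bary (fun j' => @bary_ept_gt0 k i j' _ h2).
have [s es hs] := same_edge_ept' 2^-1 se.
have s2 : 0 < s < 1 by case: hs => ->; apply/andP; split; lra.
have [d2 d20 hd2] := local_bary (fun j' => @bary_ept_gt0 l j j' _ s2).
have [r /andP[r0 r1] [rd _]] := point_near m (vtx k i) (ltac:(rewrite lt_min; exact/andP) : 0 < Num.min d1 d2).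
move: rd; set y := m + _; rewrite lt_min => /andP[y1 y2].
have by_ : 0 < bary (vtx k) i y by rewrite /y bary_line bary_ept; lra.
have yk j' : 0 < bary (vtx k) j' y by have [<-//|ij] := eqVneq i j'; exact: hd1.
have Ty : elt k y by apply/(triP _ (d0 k)) => j'; exact: ltW.
have Tl : elt l y.
  apply: (@elt_local l j); first by apply: hd2; rewrite -es.
  by rewrite hb mulr_ge0 // ltW.
have [h|[i' [j' [_ h]]]|[i' [j' [_ h]]]] := conf kl.
- have : (elt k `&` elt l) y by []. by rewrite h.
- have : (elt k `&` elt l) y by []. rewrite h => /= yE.
  have := yk (i' + 1); rewrite yE vtx_bary; have [->|->|->] := I3P i'; by rewrite ?I3_succ /= ltxx.
- have : (elt k `&` elt l) y by []. rewrite h => /edge_ept[t _ yE].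
  by have := yk i'; rewrite yE bary_ept ltxx.
Qed.

Lemma neighbour_interior k i l j t : k != l -> same_edge k i l j -> 0 < t < 1 -> (Omegah M)° (ept k i t).
Proof.
move=> kl se tI; have [c c0 [hb _]] := neighbours_opposite kl se.
have [d1 d10 hd1] := local_bary (fun j' => @bary_ept_gt0 k i j' _ tI).
have [s es hs] := same_edge_ept' t se.
have s2 : 0 < s < 1 by move/andP: tI => [? ?]; case: hs => ->; apply/andP; split; lra.
have [d2 d20 hd2] := local_bary (fun j' => @bary_ept_gt0 l j j' _ s2).
apply: (@filterS _ _ _ (eball (ept k i t) (Num.min d1 d2))); last by apply: nbhs_eball; rewrite lt_min d10.
move=> y; rewrite /eball /= lt_min => /andP[y1 y2].
have [h|h] := leP 0 (bary (vtx k) i y).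
  by exists k => //; apply: (elt_local _ h); exact: hd1.
exists l => //; apply: (@elt_local l j); first by apply: hd2; rewrite -es.
by rewrite hb oppr_ge0 pmulr_rle0 // ltW.
Qed.

Lemma bd_edge_no_neighbour k i l j : bd_edge k i -> k != l -> ~~ same_edge k i l j.
Proof.
move=> be kl; apply/negP => se; have h2 : 0 < (2^-1 : R) < 1 by apply/andP; split; lra.
have [_] : bdry (Omegah M) (ept k i 2^-1) by apply: be; apply/edge_ept; exists 2^-1 => //; case/andP: h2 => ? ?; rewrite !ltW.
by apply; exact: (neighbour_interior kl se h2).
Qed.

(** Conformity keeps every other element away from an inner point of the edge: a contact could only
    be a vertex or a common edge. *)
Lemma no_neighbour_local k i t : (forall l j, k != l -> ~~ same_edge k i l j) -> 0 < t < 1 ->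
  exists2 d : R, 0 < d & forall y, dist y (ept k i t) < d -> (Omegah M y <-> 0 <= bary (vtx k) i y).
Proof.
move=> nn tI; set x := ept k i t.
have xk : elt k x by apply: ept_elt; case/andP: tI => ? ?; rewrite !ltW.
have [d2 d20 hd2] := local_bary (fun j' => @bary_ept_gt0 k i j' _ tI).
have [d dp hd] : exists2 d : R, 0 < d & forall l, forall y, dist y x < d -> elt l y -> 0 <= bary (vtx k) i y.
  apply: fin_radius => [l r r' rr h y yr|l]; first by apply: h; exact: lt_le_trans yr rr.
  have [<-|kl] := eqVneq k l; first by exists 1 => // y _ /(triP _ (d0 k)).
  have nx : ~ elt l x.
    move=> xl; have xx : (elt k `&` elt l) x by [].
    have [h|[i' [j' [_ h]]]|[i' [j' [se h]]]] := conf kl; move: xx; rewrite h //.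
      move=> /= xE; have bp j : i != j -> j = i' by move=> /(bary_ept_gt0 k tI); rewrite -/x xE vtx_bary; case: eqP => //= _; rewrite ltxx.
      have [e1 e2] : i != i + 1 /\ i != i - 1 by have [->|->|->] := I3P i; rewrite !I3_succ.
      by have := bp _ e1; rewrite -(bp _ e2); have [->|->|->] := I3P i; rewrite !I3_succ.
    move=> /edge_ept[s _ xE]; have [ii|ii] := eqVneq i i'.
      by move: se; rewrite -ii (negbTE (nn l j' kl)).
    by have := bary_ept_gt0 k tI ii; rewrite -/x xE bary_ept ltxx.
  have [e e0 he] := away_from_closed (tri_closed (d0 l)) nx.
  by exists e => // y yx ly; have := he y ly; rewrite leNgt yx.
exists (Num.min d d2); first by rewrite lt_min dp.
move=> y; rewrite lt_min => /andP[y1 y2]; split=> [[l _ ly]|h]; first exact: hd y1 ly.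
by exists k => //; apply: (elt_local _ h); exact: hd2.
Qed.

Lemma bdry_ept_ends k i (t : R) : (forall s, 0 < s < 1 -> bdry (Omegah M) (ept k i s)) -> 0 <= t <= 1 ->
  bdry (Omegah M) (ept k i t).
Proof.
move=> h tI; apply: contrapT => nb.
have [d dp hd] := away_from_closed (@bdry_closed R (Omegah M)) nb.
have c : continuous (fun s => dist (ept k i s) (ept k i t) - d).
  move=> s; apply: cvgB; last exact: cvg_cst.
  apply: (@continuous_comp _ _ _ (ept k i) (fun y => dist y (ept k i t))); last exact: continuous_dist.
  by apply: cvgD; [exact: cvg_cst|apply: cvgZr_tmp; exact: cvg_id].
have c0 s : 0 < s < 1 -> 0 <= dist (ept k i s) (ept k i t) - d.
  by move=> sI; rewrite subr_ge0; apply: hd; exact: h.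
by have := ge0_itv_closure c c0 tI; rewrite distxx sub0r oppr_ge0 leNgt dp.
Qed.

(** Together with [bd_edge_no_neighbour] this makes the topological notion of boundary edge
    combinatorial, which the regrouping of edge sums relies on. *)
Lemma no_neighbour_bd_edge k i : (forall l j, k != l -> ~~ same_edge k i l j) -> bd_edge k i.
Proof.
move=> nn x /edge_ept[t tI ->]; apply: bdry_ept_ends tI => s sI.
have [d dp hd] := no_neighbour_local nn sI.
split.
  apply: subset_closure; exists k => //; apply: ept_elt; case/andP: sI => ? ?; by rewrite !ltW.
move=> /nbhs_eballP[e e0 he].
have [r /andP[r0 r1] [_ rd]] := point_near (ept k i s) (vtx k i) (ltac:(rewrite lt_min; exact/andP) : 0 < Num.min d e).
move: rd; rewrite lt_min => /andP[y1 y2].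
have := proj1 (hd _ y1) (he _ y2); rewrite bary_line bary_ept mulr0 add0r; lra.
Qed.

Lemma Omegah_closed : closed (Omegah M).
Proof.
have -> : Omegah M = \bigcup_(k in [set k : 'I_(nel M) | predT k]) elt k.
  by rewrite /Omegah; congr (bigcup _ _); apply/seteqP; split.
by apply: closed_bigU_ord => k; exact: tri_closed.
Qed.

Lemma bdry_Omegah_cases x : bdry (Omegah M) x -> (exists k i, x = vtx k i) \/
  (exists k i, bd_edge k i /\ exists2 t, 0 < t < 1 & x = ept k i t).
Proof.
move=> [/Omegah_closed[k _ Tx] ix].
have [i bi] : exists i, bary (vtx k) i x = 0.
  apply: contrapT => hn; apply: ix; have := proj1 (triP x (d0 k)) Tx => hb.
  have : (tri (vtx k))° x.
    apply: tri_interior => // i; rewrite lt_neqAle hb andbT eq_sym; apply/eqP => h; by apply: hn; exists i.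
  by apply: interiorS => y Ty; exists k.
have [t /andP[t0 t1] xE] := bary_zero_ept Tx bi.
have [tz|tn0] := eqVneq t 0; first by left; exists k, (i + 1); rewrite xE tz /ept scale0r addr0.
have [tz|tn1] := eqVneq t 1.
  by left; exists k, (i - 1); rewrite xE tz /ept scale1r addrCA subrr addr0.
have tI : 0 < t < 1 by rewrite !lt_neqAle eq_sym tn0 tn1 t0.
right; exists k, i; split; last by exists t.
apply: no_neighbour_bd_edge => l j kl; apply/negP => se; apply: ix; rewrite xE.
exact: neighbour_interior kl se tI.
Qed.

End Nondegenerate.
End Mesh_geometry.

(** * Hausdorff distance, and segments that meet a boundary *)

Section Hausdorff.
Context {R : realType}.
Implicit Types (A B : set (R * R)).

Lemma hausdorff_near A B (c c' : R) : (hausdorff A B <= c%:E)%E -> c < c' ->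
  (forall x, A x -> exists2 y, B y & dist x y < c') /\ (forall x, B x -> exists2 y, A y & dist x y < c').
Proof.
rewrite /hausdorff ge_max => /andP[h1 h2] cc.
have main A' B' : (ereal_sup [set ereal_inf [set (dist x y)%:E | y in B'] | x in A'] <= c%:E)%E ->
    forall x, A' x -> exists2 y, B' y & dist x y < c'.
  move=> h x Ax; have : (ereal_inf [set (dist x y)%:E | y in B'] < c'%:E)%E.
    apply: (@le_lt_trans _ _ c%:E); last by rewrite lte_fin.
    by apply: le_trans h; apply: ereal_sup_ubound; exists x.
  by move=> /ereal_inf_lt[_ [y By <-]]; rewrite lte_fin => ?; exists y.
by split; exact: main.
Qed.

(** The last point of the segment that belongs to [A] is a boundary point. *)
Lemma closed_segment_bdry A (p q : R * R) : closed A -> A p -> ~ A q ->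
  exists2 t : R, 0 <= t <= 1 & bdry A (p + t *: (q - p)).
Proof.
move=> cA Ap Aq; pose g (t : R) := p + t *: (q - p).
have cg : continuous g by move=> t; apply: cvgD; [exact: cvg_cst|apply: cvgZr_tmp; exact: cvg_id].
pose S := `[0, 1]%classic `&` g @^-1` A.
have cS : compact S.
  apply: compact_closedI; first exact: segment_compact.
  by apply: preimage_closed => // x _; exact: cg.
have cid : {within S, continuous (fun x : R => x)} by apply: continuous_subspaceT => x; exact: cvg_id.
have [|t /set_mem[/= tI At] tmax] := @compact_EVT_max _ R (fun x : R => x) S _ cS cid.
  by exists 0; split; rewrite /= ?in_itv /= ?lexx ?ler01 // /g scale0r addr0.
move: tI; rewrite in_itv /= => /andP[t0 t1].
exists t; first by rewrite t0.
split; first exact: subset_closure.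
move=> /nbhs_eballP[e e0 he].
have t1' : t < 1.
  rewrite lt_neqAle t1 andbT; apply/eqP => E; apply: Aq; move: At; rewrite E /g scale1r.
  by rewrite addrCA subrr addr0.
have n0 := dist_ge0 q p.
pose s := Num.min (1 - t) (e / (1 + dist q p)) / 2.
have m0 : 0 < Num.min (1 - t) (e / (1 + dist q p)) by rewrite lt_min subr_gt0 t1' divr_gt0 //; lra.
have m1 : Num.min (1 - t) (e / (1 + dist q p)) <= 1 - t by rewrite ge_min lexx.
have m2 : Num.min (1 - t) (e / (1 + dist q p)) <= e / (1 + dist q p) by rewrite ge_min lexx orbT.
have s0 : 0 < s by rewrite /s; lra.
have ts : A (g (t + s)).
  apply: he; rewrite /eball /= /dist /g.
  have -> : p + (t + s) *: (q - p) - (p + t *: (q - p)) = s *: (q - p).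
    by apply: pair_eqP; rewrite !coordE; ring.
  rewrite enormZ gtr0_norm //; apply: (@le_lt_trans _ _ (s * (1 + dist q p))).
    by rewrite ler_pM2l //; rewrite /dist; lra.
  by rewrite -ltr_pdivlMr /s //; lra.
have : t + s <= t.
  by apply: tmax; apply: mem_set; split => //=; rewrite in_itv /=; apply/andP; split; rewrite /s; lra.
lra.
Qed.

(* The target is moved transversally: each point of the list excludes at most one of its positions. *)
Lemma segment_avoid (L : seq (R * R)) (p q : R * R) (e : R) : p \notin L -> p != q -> 0 < e ->
  exists2 q', dist q' q < e & forall t : R, p + t *: (q' - p) \notin L.
Proof.
move=> pL pq e0; set d := q - p; pose w := rot90 d.
have dn : dot d d != 0.
  apply: contra pq => /eqP h; have : enorm d ^+ 2 = 0 by rewrite enorm_sqr.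
  by move=> /eqP; rewrite sqrf_eq0 => /eqP/enorm_eq0/eqP; rewrite subr_eq0 eq_sym.
have [c [/andP[c0 c1] hc]] := @avoid_list R [seq - cross (z - p) d / cross (z - p) w | z <- L] 0 (e / (1 + enorm d)) ltac:(by rewrite divr_gt0 // ltr_wpDr ?enorm_ge0).
exists (q + c *: w).
  rewrite /dist addrAC subrr add0r enormZ enorm_rot90 gtr0_norm //.
  apply: (@le_lt_trans _ _ (c * (1 + enorm d))); first by rewrite ler_pM2l //; lra.
  by rewrite -ltr_pdivlMr // ltr_wpDr ?enorm_ge0.
move=> t; apply/negP => zL; set z := p + _ in zL.
have cr : cross (z - p) d + c * cross (z - p) w = 0.
  by rewrite /z /d /cross !coordE; ring.
have zp : z != p by apply: contraNneq pL => <-.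
have [cw|cw] := eqVneq (cross (z - p) w) 0.
  have cd : cross (z - p) d = 0 by rewrite -cr cw; ring.
  have z1 : (z - p).1 * dot d d = d.2 * cross (z - p) d + d.1 * cross (z - p) w.
    by rewrite /cross /dot /w /rot90 /=; ring.
  have z2 : (z - p).2 * dot d d = - d.1 * cross (z - p) d + d.2 * cross (z - p) w.
    by rewrite /cross /dot /w /rot90 /=; ring.
  rewrite cd cw !mulr0 addr0 in z1 z2.
  move: z1 z2 => /eqP; rewrite mulf_eq0 (negbTE dn) orbF => /eqP z1 /eqP; rewrite mulf_eq0 (negbTE dn) orbF => /eqP z2.
  by move: zp; rewrite -subr_eq0 (pair_eqP (x := z - p) (y := 0) z1 z2) eqxx.
have ce : c = - cross (z - p) d / cross (z - p) w.
  by apply: (mulIf cw); rewrite divfK //; apply/eqP; rewrite -subr_eq0 opprK addrC cr.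
have := hc _ (map_f (fun z => - cross (z - p) d / cross (z - p) w) zL); rewrite /= -ce subrr normr0.
apply/negP; rewrite -ltNge; apply: divr_gt0; first by rewrite subr0; exact: lt_trans c0 c1.
by rewrite mulr_gt0 ?exprn_gt0.
Qed.

End Hausdorff.

(** * Consequences of the mesh conditions *)

Section Admissible.
Context {R : realType}.
Variables (M : mesh R) (Omega : set (R * R)) (rho mu C : R).
Hypothesis adm : admissible_mesh M Omega rho mu C.
Hypotheses (rho0 : 0 < rho) (mu0 : 0 < mu) (C0 : 0 < C).
Implicit Types (k l : 'I_(nel M)) (i j : 'I_3) (x y z : R * R).

Lemma adm_tdet k : tdet (vtx k) != 0.
Proof.
apply: contra (mesh_nondegenerate adm k); rewrite /tdet /dot /rot90 /cross /= => /eqP h.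
by rewrite -oppr_eq0; apply/eqP; rewrite -[RHS]h; ring.
Qed.
Let d0 := adm_tdet.

Let conf : conforming M := mesh_conforming adm.

(** Along the diameter of an inscribed disc orthogonal to a side [e], the opposite barycentric
    coordinate changes by 2 r |e| / |det|, which is at most 1. So |det| >= 2 r |e|, with [r] bounded
    below through [rho] and |e| through [mu]. *)
Lemma adm_shape k : shape (rho / mu) (hk k) (vtx k).
Proof.
have h0 := hk_gt0 d0 k; split => //; first exact: divr_gt0.
  by move=> i j; apply: dist_le_hk; exact: tri_vtx.
set S := [set r : R | 0 <= r /\ exists p, ecball p r `<=` elt k].
have diam2 r p : 0 <= r -> ecball p r `<=` elt k -> 2 * r <= hk k.
  move=> r0 h; have e11 : enorm (e1 : R * R) = 1 by rewrite /enorm /dot /= mulr1 mulr0 addr0 sqrtr1.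
  have -> : 2 * r = dist (p + r *: e1) (p - r *: e1).
    rewrite /dist; have -> : p + r *: e1 - (p - r *: e1) = (2 * r) *: e1 by apply: pair_eqP; rewrite !coordE; ring.
    by rewrite enormZ e11 mulr1 ger0_norm // mulr_ge0.
  apply: dist_le_hk; apply: h; rewrite /ecball /= /dist addrAC subrr add0r ?enormN enormZ e11 mulr1 ger0_norm //.
have [r1 r10 Sr1] : exists2 r, 0 < r & S r.
  pose c := \sum_i (3^-1 : R) *: vtx k i.
  have : (tri (vtx k))° c.
    apply: tri_interior => // i; rewrite bary_of ?invr_gt0 //; by rewrite sum3; field.
  move=> /nbhs_eballP[e e0 he]; exists (e / 2); first lra.
  split; first lra.
  by exists c => x h; apply: he; rewrite /ecball /eball /= in h *; lra.
have hS : has_sup S.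
  split; first by exists r1.
  by exists (hk k) => r [r0 [p hp]]; have := diam2 r p r0 hp; lra.
have ir : r1 <= inradius (elt k) by apply: ub_le_sup => //; case: hS.
have ir0 : 0 < inradius (elt k) by lra.
(* The inradius is a supremum, so an inscribed disc of more than half that radius is used; the lost
   factor 2 is regained from the diameter 2 r. *)
have [r [r0 [p hp]] hr] := sup_adherent (ltac:(lra) : 0 < inradius (elt k) / 2) hS.
rewrite -/S -/(inradius (elt k)) in hr.
have hrho : hk k <= rho * inradius (elt k) by rewrite -ler_pdivrMr //; exact: (mesh_shape adm k).
pose e := vtx k (0 + 1) - vtx k (0 - 1).
have le : enorm e = len k 0 by [].
have l0 := len_gt0 d0 k 0; rewrite -le in l0.
have hl := mesh_edge_length adm k 0; rewrite -le in hl.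
pose v := (r / enorm e) *: rot90 e.
have nv : enorm v = r.
  by rewrite /v enormZ enorm_rot90 ger0_norm ?divr_ge0 ?enorm_ge0 // divfK // gt_eqF.
have Tp : elt k (p + v) by apply: hp; rewrite /ecball /= /dist addrAC subrr add0r nv.
have Tm : elt k (p - v) by apply: hp; rewrite /ecball /= /dist addrAC subrr add0r enormN nv.
have bp := bary_le1 0 (d0 k) Tp; have bp' := proj1 (triP _ (d0 k)) Tp 0.
have bm := bary_le1 0 (d0 k) Tm; have bm' := proj1 (triP _ (d0 k)) Tm 0.
have sh := bary_shift 0 (p + v) (p - v) (d0 k).
have E : dbary (vtx k) 0 (p + v - (p - v)) = - (2 * r * enorm e) / tdet (vtx k).
  rewrite dbaryE0 // -/e /v; have -> : cross (p + (r / enorm e) *: rot90 e - (p - (r / enorm e) *: rot90 e)) e = - (2 * (r / enorm e) * enorm e ^+ 2).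
    by rewrite enorm_sqr /cross /dot /rot90 !coordE /=; ring.
  by field; rewrite d0 gt_eqF.
have B : 2 * r * enorm e <= `|tdet (vtx k)|.
  have : `|dbary (vtx k) 0 (p + v - (p - v))| <= 1 by rewrite ler_norml; apply/andP; split; lra.
  rewrite E normrM normrN normfV ler_pdivrMr ?normr_gt0 // mul1r ger0_norm // !mulr_ge0 ?enorm_ge0 //.
have h1 : hk k <= rho * (2 * r) by apply: (le_trans hrho); rewrite ler_pM2l //; lra.
have h2 : hk k <= enorm e / mu by rewrite ler_pdivlMr // mulrC.
rewrite expr2; apply: (@le_trans _ _ (rho * (2 * r) * (enorm e / mu))).
  by apply: ler_pM => //; exact: ltW.
have -> : rho * (2 * r) * (enorm e / mu) = rho / mu * (2 * r * enorm e) by ring.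
by rewrite ler_pM2l // divr_gt0.
Qed.

Lemma vertex_interior k l i : ~ tri_int (vtx k) (vtx l i).
Proof.
move=> h; have Tk : elt k (vtx l i) := tri_int_sub (d0 k) h.
have Tl : elt l (vtx l i) := tri_vtx _ _.
have novtx j : vtx l i = vtx k j -> False.
  move=> E; have := h (j + 1); rewrite E vtx_bary //; by have [->|->|->] := I3P j; rewrite ?I3_succ /= ltxx.
have [E|kl] := eqVneq k l; first by subst l; exact: (novtx i erefl).
have : (elt k `&` elt l) (vtx l i) by [].
have [->//|[i' [j' [_ ->]]]|[i' [j' [_ ->]]]] := conf kl; first by move=> /= /novtx.
by move=> /edge_ept[t _ E]; have := h i'; rewrite E bary_ept // ltxx.
Qed.

(** A boundary point of the polygon can be a mesh vertex of which it is not known that a boundary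
    edge ends there. A segment from inside an adjacent element to a nearby exterior point, chosen to
    miss all mesh vertices, crosses the polygon boundary inside a boundary edge close by. *)
Lemma bdry_near_bd_vertex y (e : R) : 0 < e -> bdry (Omegah M) y -> exists2 v, bd_vertex M v & dist v y < hmax M + e.
Proof.
move=> e0 by_.
have main z : (exists k i, bd_edge k i /\ exists2 t, 0 < t < 1 & z = ept k i t) -> dist z y < e ->
    exists2 v, bd_vertex M v & dist v y < hmax M + e.
  move=> [k [i [be [t /andP[t0 t1] zE]]]] zy; exists (va k i); first by exists k, i; split => //; left.
  have : dist (va k i) z <= hmax M.
    rewrite zE; apply: le_trans (hk_le_hmax k); apply: dist_le_hk; first exact: (tri_vtx (vtx k) (i + 1)).
    by apply: ept_elt => //; rewrite !ltW.
  by have := dist_tri (va k i) z y; lra.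
have [[k [i yE]]|h] := bdry_Omegah_cases d0 conf by_; last by apply: (main y) => //; rewrite distxx.
pose L := [seq vtx a.1 a.2 | a <- enum (prod 'I_(nel M) 'I_3 : finType)].
have LP z : (forall k i, z <> vtx k i) -> z \notin L.
  by move=> hz; apply/negP => /mapP[[k' i'] _ /= E]; exact: hz E.
have PL k' i' : vtx k' i' \in L by apply/mapP; exists (k', i') => //; rewrite mem_enum.
have [cy iy] := by_.
have [q nq qy] : exists2 q, ~ Omegah M q & dist q y < e / 2.
  apply: contrapT => hn; apply: iy; apply: (@filterS _ _ _ (eball y (e / 2))); last by apply: nbhs_eball; lra.
  by move=> q qy; apply: contrapT => nq; apply: hn; exists q.
have [q1 q10 hq1] := away_from_closed (Omegah_closed d0 (M := M)) nq.
pose c := \sum_j (3^-1 : R) *: vtx k j.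
have bc j : bary (vtx k) j c = 3^-1 by rewrite bary_of //; rewrite sum3; field.
have [s /andP[s0 s1] [sd _]] := point_near y c (ltac:(lra) : 0 < e / 2).
set p := y + s *: (c - y) in sd.
have pint : tri_int (vtx k) p.
  move=> j; have -> : bary (vtx k) j p = (1 - s) * bary (vtx k) j y + s * bary (vtx k) j c.
    by rewrite /p !bary_affine !coordE; ring.
  have : 0 <= bary (vtx k) j y by rewrite yE vtx_bary // ler0n.
  rewrite bc => hb; have := mulr_ge0 (ltW (ltac:(lra) : 0 < 1 - s)) hb; lra.
have Op : Omegah M p by exists k => //; exact: tri_int_sub.
have pL : p \notin L by apply: LP => k' i' E; apply: (@vertex_interior k k' i'); rewrite -E.
have pq : p != q by apply/eqP => E; apply: nq; rewrite -E.
have [q' q'q hav] := segment_avoid pL pq (ltac:(by rewrite lt_min q10 subr_gt0) : 0 < Num.min q1 (e / 2 - dist q y)).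
move: q'q; rewrite lt_min => /andP[q'1 q'2].
have nq' : ~ Omegah M q' by move=> /hq1; rewrite leNgt q'1.
have [t /andP[t0 t1] bz] := closed_segment_bdry (Omegah_closed d0 (M := M)) Op nq'.
set z := p + t *: (q' - p) in bz.
have zy : dist z y < e.
  have q'y : dist q' y < e / 2 by have := dist_tri q' q y; lra.
  rewrite /dist /z; have -> : p + t *: (q' - p) - y = (1 - t) *: (p - y) + t *: (q' - y) by apply: pair_eqP; rewrite !coordE; ring.
  apply: (le_lt_trans (ler_enormD _ _)); rewrite !enormZ !ger0_norm ?subr_ge0 //.
  have x1 : (1 - t) * enorm (p - y) <= (1 - t) * (e / 2) by rewrite ler_wpM2l ?subr_ge0 // ltW.
  have x2 : t * enorm (q' - y) <= t * (e / 2) by rewrite ler_wpM2l // ltW.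
  lra.
apply: (main z) zy; have [[k' [i' E]]|//] := bdry_Omegah_cases d0 conf bz.
by have := hav t; rewrite -/z E PL.
Qed.

Lemma bdry_near_vertex k : C * hmax M < 2^-1 -> forall x, bdry Omega x ->
  exists2 v, bd_vertex M v & dist v x <= 2 * hmax M.
Proof.
move=> hs x bx; have h0 : 0 < hmax M := lt_le_trans (hk_gt0 d0 k) (hk_le_hmax k).
have cc : C * hmax M ^+ 2 < hmax M / 2.
  by rewrite expr2 mulrA [hmax M / 2]mulrC ltr_pM2r.
have [h1 _] := hausdorff_near (mesh_hausdorff adm) cc.
have [y by_ xy] := h1 x bx.
have [v Vv vy] := bdry_near_bd_vertex (ltac:(lra) : 0 < hmax M / 2) by_.
by exists v => //; have := dist_tri v y x; rewrite (dist_sym y x); lra.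
Qed.

(** A point of Omega_h farthest from the origin lies on the boundary of Omega_h, hence near the
    boundary of Omega. *)
Lemma Omegah_bounded (r : R) : (forall x, bdry Omega x -> enorm x <= r) -> C * hmax M ^+ 2 < 1 ->
  forall x, Omegah M x -> enorm x <= r + 1.
Proof.
move=> hr hs x0 Ox0.
have cO : compact (Omegah M).
  apply: (@heine_borel2 _ _ (\sum_(k < nel M) \sum_i enorm (vtx k i))); first exact: (Omegah_closed d0).
  move=> x [k _ Tx]; apply: (le_trans (@tri_bounded _ (vtx k) x Tx)); rewrite [X in _ <= X](bigD1 k) //= lerDl.
  by apply: sumr_ge0 => l _; apply: sumr_ge0 => i _; exact: enorm_ge0.
have [||x /set_mem Ox xmax] := @compact_EVT_max _ R (fun x => dist x 0) (Omegah M) _ cO.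
- by exists x0.
- by apply: continuous_subspaceT; exact: continuous_dist.
have bx : bdry (Omegah M) x.
  split; first exact: subset_closure.
  move=> /nbhs_eballP[e e0 he].
  (* Of two opposite displacements one increases the norm: the mean of the two squared norms is the
     old one plus a positive term. *)
  have near (s : R) : `|s| = 1 -> enorm (x + (s * (e / 2)) *: e1) <= enorm x.
    move=> s1; have := xmax (x + (s * (e / 2)) *: e1); rewrite /dist !subr0; apply; apply: mem_set; apply: he.
    rewrite /eball /= /dist addrAC subrr add0r enormZ normrM s1 mul1r.
    by rewrite /enorm /dot /= mulr1 mulr0 addr0 sqrtr1 mulr1 gtr0_norm; lra.
  have sq (a b : R * R) : enorm a <= enorm b -> enorm a ^+ 2 <= enorm b ^+ 2.
    by move=> h; apply: lerXn2r; rewrite ?nnegrE ?enorm_ge0.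
  have := sq _ _ (near 1 (normr1 _)); have := sq _ _ (near (-1) (normrN1 _)).
  rewrite !enorm_sqr /dot !coordE /= => h1 h2.
  have : 0 < (e / 2) * (e / 2) by rewrite mulr_gt0; lra.
  lra.
have [_ h2] := hausdorff_near (mesh_hausdorff adm) hs.
have [y by_ xy] := h2 x bx.
have := xmax x0 (mem_set Ox0); rewrite /dist !subr0 => h.
have := ler_enormD (x - y) y; rewrite subrK -/(dist x y); have := hr y by_; lra.
Qed.

Definition has_nb (ki : 'I_(nel M) * 'I_3) : bool :=
  [exists lj : 'I_(nel M) * 'I_3, (ki.1 != lj.1) && same_edge ki.1 ki.2 lj.1 lj.2].

Definition inner (ki lj : 'I_(nel M) * 'I_3) : bool := (ki.1 < lj.1)%N && same_edge ki.1 ki.2 lj.1 lj.2.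

Lemma has_nbP k i : bd_edge k i <-> ~~ has_nb (k, i).
Proof.
split=> [be|nn].
  by apply/existsPn => -[l j] /=; rewrite negb_and negbK; have [//|kl] := eqVneq k l; exact: (bd_edge_no_neighbour d0 conf).
apply: (no_neighbour_bd_edge d0 conf) => l j kl; apply/negP => se.
by move/existsPn: nn => /(_ (l, j)); rewrite /= kl se.
Qed.

Lemma neighbour_unique k i l j l' j' : k != l -> k != l' -> same_edge k i l j -> same_edge k i l' j' -> (l, j) = (l', j').
Proof.
move=> kl kl' s1 s2.
have [c c0 [hc _]] := neighbours_opposite d0 conf kl s1.
have [c' c0' [hc' _]] := neighbours_opposite d0 conf kl' s2.
have [E|ll] := eqVneq l l'.
  subst l'; have [->//|jj] := eqVneq j j'.
  have := hc (vtx l j); have := hc' (vtx l j); rewrite !vtx_bary // eqxx eq_sym (negbTE jj) => /eqP.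
  rewrite eq_sym oppr_eq0 mulf_eq0 (gt_eqF c0') /= => /eqP ->; rewrite mulr0 oppr0 => /eqP; by rewrite oner_eq0.
have s3 : same_edge l j l' j'.
  by move: s1 s2 => /orP[/andP[/eqP a /eqP b]|/andP[/eqP a /eqP b]] /orP[/andP[/eqP a' /eqP b']|/andP[/eqP a' /eqP b']];
    rewrite /same_edge -?a -?b a' b' !eqxx ?orbT.
have [c2 c20 [h2 _]] := neighbours_opposite d0 conf ll s3.
have := h2 (vtx k i); rewrite hc hc' vtx_bary // eqxx !mulr1 mulrN opprK => E.
by have := mulr_gt0 c20 c0; rewrite -E oppr_gt0 ltNge (ltW c0').
Qed.

(** Every side of an element either has no neighbour or belongs to exactly one pair with k < l, by
    [neighbour_unique]. *)
Lemma sum_edges (F : 'I_(nel M) * 'I_3 -> R) :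
  \sum_ki F ki = \sum_(ki | ~~ has_nb ki) F ki + \sum_ki \sum_(lj | inner ki lj) (F ki + F lj).
Proof.
rewrite (bigID has_nb) /= addrC; congr (_ + _).
have -> : \sum_(ki | has_nb ki) F ki = \sum_ki \sum_(lj | (ki.1 != lj.1) && same_edge ki.1 ki.2 lj.1 lj.2) F ki.
  rewrite [RHS](bigID has_nb) /= [X in _ = _ + X]big1 ?addr0 => [|ki nn]; last first.
    by rewrite big1 // => lj h; move/existsPn: nn => /(_ lj); rewrite h.
  apply: eq_bigr => -[k i] /existsP[[l j] /= /andP[kl s1]].
  rewrite (big_pred1 (l, j)) // => -[l' j'] /=; apply/andP/eqP => [[kl' s2]|[-> ->]] //.
  exact/esym/(neighbour_unique kl kl' s1 s2).
have -> : \sum_ki \sum_(lj | inner ki lj) (F ki + F lj) =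
   \sum_ki \sum_(lj | inner ki lj) F ki + \sum_ki \sum_(lj | inner lj ki) F ki.
  rewrite [X in _ = _ + X](exchange_big_dep xpredT) //= -big_split /=.
  by apply: eq_bigr => ki _; rewrite -big_split.
rewrite -big_split /=; apply: eq_bigr => -[k i] _.
rewrite (bigID (fun lj : 'I_(nel M) * 'I_3 => (k < lj.1)%N)) /=; congr (_ + _); apply: eq_bigl => -[l j] /=.
  by rewrite /inner /= -val_eqE /=; case: ltngtP => //=; rewrite ?andbT ?andbF.
by rewrite /inner /= -val_eqE /= (same_edge_sym l j k i); case: ltngtP => //=; rewrite ?andbT ?andbF.
Qed.

Lemma sum_Gamma0 (G : mesh_edge M -> R) :
  \sum_(e | Gamma0 e) G e = \sum_ki \sum_(lj | inner ki lj) G (ki, Some lj.1).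
Proof.
have -> : \sum_(e | Gamma0 e) G e =
    \sum_(ki : 'I_(nel M) * 'I_3) \sum_(o : option 'I_(nel M) | Gamma0 (ki, o)) G (ki, o).
  by rewrite pair_big_dep; apply: eq_big => -[ki o].
apply: eq_bigr => -[k i] _.
rewrite (reindex_omap (@Some _) id) /=; last by case.
rewrite (eq_bigl (fun l => (k < l)%N && [exists j, same_edge k i l j])); last by move=> l; rewrite eqxx andbT.
rewrite -(pair_big_dep (fun l => (k < l)%N) (fun l j => same_edge k i l j) (fun l j => G (k, i, Some l))) /=.
rewrite [LHS]big_mkcondr /=; apply: eq_bigr => l kl.
have kl' : k != l by rewrite -val_eqE /= neq_ltn kl.
case: existsP => [[j sj]|nn]; last by rewrite big1 // => j sj; case: nn; exists j.
rewrite (big_pred1 j) // => j'; apply/idP/eqP => [s'|-> //].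
by have [] := neighbour_unique kl' kl' s' sj.
Qed.

Lemma sum_GammaB (G : mesh_edge M -> R) :
  \sum_(e | GammaB e) G e = \sum_(ki | ~~ has_nb ki) G (ki, None).
Proof.
have -> : \sum_(e | GammaB e) G e =
    \sum_(ki : 'I_(nel M) * 'I_3) \sum_(o : option 'I_(nel M) | GammaB (ki, o)) G (ki, o).
  by rewrite pair_big_dep; apply: eq_big => -[ki o].
rewrite [RHS]big_mkcond /=.
apply: eq_bigr => -[k i] _; rewrite big_mkcond /= (bigD1 None) //= big1 ?addr0; last by case.
by congr (if _ then _ else _); apply/asboolP/idP => [/has_nbP|h]; [|exact/has_nbP].
Qed.

Lemma sum_Eh (G : mesh_edge M -> R) :
  \sum_(e | Eh e) G e = \sum_(e | Gamma0 e) G e + \sum_(e | GammaB e) G e.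
Proof.
rewrite (bigID (fun e => Gamma0 e)) /=; congr (_ + _); apply: eq_bigl => -[[k i] [l|]];
  by rewrite /Eh /= /in_mem /= ?orbF ?andbT ?andbb ?andbN //= ?andbF.
Qed.

Lemma edge_reverse k i l j (f : R * R -> R) : same_edge k i l j ->
  measurable_fun (`[0, 1]%classic : set R) (fun t : R => f (ept k i t)) ->
  \int[leb1]_(t in `[0, 1]) f (ept l j t) = \int[leb1]_(t in `[0, 1]) f (ept k i t).
Proof.
move=> se mf; have [h|h] : (forall t, ept l j t = ept k i t) \/ (forall t, ept l j t = ept k i (1 - t)).
  move: se => /orP[/andP[/eqP ea /eqP eb]|/andP[/eqP ea /eqP eb]]; rewrite /ept ea eb; [by left|right=> t].
  by apply: pair_eqP; rewrite !coordE; ring.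
  by apply: eq_Rintegral => t _; rewrite h.
rewrite -[RHS](Rint1_rev mf); by apply: eq_Rintegral => t _; rewrite h.
Qed.

(** Identifies the edge weights of [triangle_ibp], sign included, with edge length times outward
    normal. *)
Lemma unit_normal_dbary k i nb v :
  len k i * dot (unit_normal (k, i, nb)) v = - (`|tdet (vtx k)| * dbary (vtx k) i v).
Proof.
have l0 := len_gt0 d0 k i; have t0 := d0 k.
have dE : dbary (vtx k) i v = cross v (va k i - vb k i) / tdet (vtx k) by exact: dbaryE0.
have tE : tdet (vtx k) = - cross (vb k i - va k i) (va k i - vtx k i).
  rewrite (tdetE _ i) /va /vb /cross !coordE; ring.
have nE w : dot ((len k i)^-1 *: rot90 (vb k i - va k i)) w = (len k i)^-1 * cross (vb k i - va k i) w.
  by rewrite /dot /cross /rot90 !coordE /=; ring.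
rewrite /unit_normal nE sgrM gtr0_sg ?invr_gt0 // mul1r.
have -> : Num.sg (cross (vb k i - va k i) (va k i - vtx k i)) = - Num.sg (tdet (vtx k)).
  by rewrite tE sgrN opprK.
have -> : dot (- Num.sg (tdet (vtx k)) *: ((len k i)^-1 *: rot90 (vb k i - va k i))) v =
   - Num.sg (tdet (vtx k)) * ((len k i)^-1 * cross (vb k i - va k i) v) by rewrite -nE /dot !coordE; ring.
rewrite dE; have -> : cross (vb k i - va k i) v = cross v (va k i - vb k i) by rewrite /cross !coordE; ring.
set X := cross _ _; rewrite (normrEsg (tdet (vtx k))); field; by rewrite t0 gt_eqF.
Qed.

Lemma unit_normal_sqr (e : mesh_edge M) : dot (unit_normal e) (unit_normal e) = 1.
Proof.
case: e => [[k i] nb]; have l0 := len_gt0 d0 k i.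
have tE : tdet (vtx k) = - cross (vb k i - va k i) (va k i - vtx k i).
  rewrite (tdetE _ i) /va /vb /cross !coordE; ring.
rewrite /unit_normal; set s := Num.sg _.
have ss : s ^+ 2 = 1.
  rewrite sqr_sg; set q := dot _ _; suff -> : q != 0 by [].
  have -> : q = (len k i)^-1 * cross (vb k i - va k i) (va k i - vtx k i).
    by rewrite /q /dot /cross /rot90 !coordE /=; ring.
  by apply: mulf_neq0; [rewrite invr_eq0 gt_eqF|rewrite -oppr_eq0 -tE; exact: d0].
have -> : dot (s *: ((len k i)^-1 *: rot90 (vb k i - va k i))) (s *: ((len k i)^-1 *: rot90 (vb k i - va k i))) =
  s ^+ 2 * ((len k i)^-1 ^+ 2 * dot (vb k i - va k i) (vb k i - va k i)) by rewrite /dot /rot90 !coordE /=; ring.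
rewrite ss mul1r -enorm_sqr -/(dist _ _) dist_sym -exprMn mulVf ?expr1n // gt_eqF //.
Qed.

End Admissible.

(** * Integrals over sets that differ by a null set *)

Section Null_set.
Local Open Scope ereal_scope.
Context d (T : measurableType d) (R : realType) (mu : {measure set T -> \bar R}).
Variables (A D : set T).
Hypotheses (mA : measurable A) (mD : measurable D) (DA : D `<=` A) (AD0 : mu (A `\` D) = 0).
Import HBNNSimple.

(** The integrand may fail to be measurable, so the equality is proved on the defining supremum: a
    simple function below [f] on [A] is cut down to [D], and each of its positive level sets loses
    only a null set. *)
Let ge0_integral_null (f : T -> \bar R) : (forall x, 0 <= f x) ->
  \int[mu]_(x in A) f x = \int[mu]_(x in D) f x.
Proof.
move=> f0; rewrite !ge0_integralE //; apply/eqP; rewrite eq_le; apply/andP; split; last first.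
  apply: le_ereal_sup => _ [h hf <-]; exists h => // x; apply: le_trans (hf x) _.
  rewrite /patch; case: ifP => [/set_mem/DA/mem_set -> //|_]; by case: ifP.
apply: ge_ereal_sup => _ [h hf <-].
have h0 x : ~ A x -> h x = 0%R.
  move=> nA; have := hf x; rewrite /patch memNset // => hx.
  by apply/eqP; rewrite eq_le fun_ge0 andbT -lee_fin.
apply: (@le_trans _ _ (sintegral mu (proj_nnsfun h mD))); last first.
  apply: ereal_sup_ubound; exists (proj_nnsfun h mD) => // x /=.
  rewrite /proj_nnsfun /= mindicE /patch; case: (boolP (x \in D)) => xD; rewrite ?mulr1 ?mulr0 //.
  by have := hf x; rewrite /patch (mem_set (DA (set_mem xD))).
rewrite !sintegralEnnsfun le_eqVlt; apply/orP; left; apply/eqP; apply: eq_fsbigr => r; rewrite inE /= => r0.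
congr (_ * _).
have E : proj_nnsfun h mD @^-1` [set r] = h @^-1` [set r] `&` D.
  apply/seteqP; split => x /=; rewrite mindicE.
    case: (boolP (x \in D)) => [/set_mem xD|_]; rewrite ?mulr1 ?mulr0 // => rE.
    by move: r0; rewrite -rE ltxx.
  by move=> [hr xD]; rewrite (mem_set xD) mulr1.
rewrite E -[in LHS](setUIDK (h @^-1` [set r]) D) measureU.
- rewrite [X in _ + X = _](_ : _ = 0) ?adde0 //.
  apply/eqP; rewrite eq_le measure_ge0 andbT -AD0; apply: le_measure; rewrite ?inE.
  + by apply: measurableD.
  + exact: measurableD.
  + move=> x [/= hx nD]; split => //; apply: contrapT => nA; move: r0; by rewrite -hx (h0 _ nA) ltxx.
- exact: measurableI.
- exact: measurableD.
- by apply/seteqP; split => x // -[[_ ?] []].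
Qed.

Lemma integral_null (f : T -> \bar R) : \int[mu]_(x in A) f x = \int[mu]_(x in D) f x.
Proof.
rewrite [LHS]integralE [RHS]integralE; congr (_ - _); apply: ge0_integral_null => x.
  exact: funepos_ge0.
exact: funeneg_ge0.
Qed.

End Null_set.

(** * The boundary of a triangle is a null set *)

Section Triangle_interior.
Context {R : realType}.
Local Notation RR := (measurableTypeR R * measurableTypeR R)%type.
Implicit Types (p : 'I_3 -> R * R).

Lemma tri_measure p : tdet p != 0 -> fine (leb2 (tri p)) = `|tdet p| * fine (leb2 (tri kref)).
Proof.
move=> d0; have E (q : 'I_3 -> R * R) : tdet q != 0 -> \int[leb2]_(x in tri q) 1 = fine (leb2 (tri q)).
  move=> q0; rewrite /Rintegral; congr fine.
  have := @integral_cst _ RR R leb2 (tri q) (tri_measurable q0) 1; rewrite mul1e => <-.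
  by [].
by rewrite -(E p d0) (Rint_refmap d0 (bm_cst _ _)) E // tdet_kref_neq0.
Qed.

(** Shrinking the triangle towards its centroid by a factor s < 1 puts it into the interior and
    multiplies its measure by s^2; let s tend to 1. *)
Lemma tri_boundary_null p : tdet p != 0 -> leb2 (tri p `\` tri_int p) = 0%E.
Proof.
move=> d0; have mT := tri_measurable d0; have fT := tri_fin d0.
have mI := @tri_int_measurable R p; have sub := tri_int_sub d0; have fI := tri_int_fin d0.
pose c : R * R := \sum_i (3^-1 : R) *: p i.
pose q (s : R) (i : 'I_3) : R * R := s *: p i + (1 - s) *: c.
have qd s : tdet (q s) = s ^+ 2 * tdet p by rewrite /tdet /q /cross !coordE; ring.
have bc j : bary p j c = 3^-1 by rewrite bary_of // sum3; field.
have le s : 0 < s < 1 -> s ^+ 2 * fine (leb2 (tri p)) <= fine (leb2 (tri_int p)).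
  move=> /andP[s0 s1]; have dq : tdet (q s) != 0 by rewrite qd; apply: mulf_neq0 => //; rewrite expf_neq0 // gt_eqF.
  have -> : s ^+ 2 * fine (leb2 (tri p)) = fine (leb2 (tri (q s))).
    rewrite (tri_measure dq) (tri_measure d0) qd normrM (ger0_norm (sqr_ge0 s)); exact: mulrA.
  apply: fine_le.
  - by rewrite (ge0_fin_numE (measure_ge0 _ _)); exact: (tri_fin dq).
  - by rewrite ge0_fin_numE ?measure_ge0.
  - apply: le_measure; rewrite ?inE; [exact: (tri_measurable dq)|exact: mI|].
    move=> x Tx j; have := proj1 (triP x dq) Tx => hb; have hs := bary_sum x dq.
    have xE : x = s *: (\sum_i bary (q s) i x *: p i) + (1 - s) *: c.
      rewrite {1}(bary_comb x dq) -[(1 - s) *: c]scale1r -[X in _ + X *: _]hs scaler_suml scaler_sumr -big_split /=.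
      by apply: eq_bigr => i _; rewrite /q scalerDr !scalerA [_ * s]mulrC.
    have aff (a a' : R * R) : bary p j (s *: a + (1 - s) *: a') = s * bary p j a + (1 - s) * bary p j a'.
      by rewrite !bary_affine !coordE; ring.
    rewrite xE aff bary_of // bc.
    have := mulr_ge0 (ltW s0) (hb j); lra.
have E : leb2 (tri p) = leb2 (tri_int p).
  have f1 : leb2 (tri p) \is a fin_num by rewrite (ge0_fin_numE (measure_ge0 _ _)).
  have f2 : leb2 (tri_int p) \is a fin_num by rewrite (ge0_fin_numE (measure_ge0 _ _)).
  apply/eqP; rewrite eq_le; apply/andP; split; last by apply: le_measure; rewrite ?inE; [exact: mI|exact: mT|exact: sub].
  rewrite -(fineK f1) -(fineK f2) lee_fin; set a := fine _ in le *; set a' := fine _ in le *.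
  have H1 : continuous (fun s : R => a' - s ^+ 2 * a).
    by move=> s; apply: cvgB; [exact: cvg_cst|apply: cvgM; [exact: exprn_continuous|exact: cvg_cst]].
  have H2 t : 0 < t < 1 -> 0 <= a' - t ^+ 2 * a by move=> /le /=; rewrite subr_ge0.
  have H3 : 0 <= (1 : R) <= 1 by rewrite ler01 lexx.
  by have := ge0_itv_closure H1 H2 H3; rewrite expr1n mul1r; lra.
have := @measureD _ RR R leb2 (tri p) (tri_int p) mT mI fT.
move=> H; transitivity (leb2 (tri p) - leb2 (tri p `&` tri_int p))%E; first exact: H.
by rewrite (setIidr sub) E subee // (ge0_fin_numE (measure_ge0 _ _)).
Qed.

Lemma Rint_tri_int p (f : R * R -> R) : tdet p != 0 ->
  \int[leb2]_(x in tri p) f x = \int[leb2]_(x in tri_int p) f x.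
Proof.
move=> d0; rewrite /Rintegral; congr fine.
exact: (@integral_null _ RR R leb2 _ _ (tri_measurable d0) (@tri_int_measurable R p) (tri_int_sub d0) (tri_boundary_null d0)).
Qed.

End Triangle_interior.

(** * Energy, mass and the Poincare inequality for broken polynomials *)

Section Broken_polynomials.
Context {R : realType}.
Variables (M : mesh R) (Omega : set (R * R)) (rho mu C : R) (N : nat).
Hypothesis adm : admissible_mesh M Omega rho mu C.
Hypotheses (rho0 : 0 < rho) (mu0 : 0 < mu) (hm1 : hmax M <= 1).
Local Notation I := (`[0, 1]%classic : set R).
Local Notation SS := ('I_(nel M) * 'I_3)%type.
Implicit Types (k l : 'I_(nel M)) (i j : 'I_3) (ki lj : SS) (u w v : broken M) (q : {poly {poly R}}).

Variable Ce : R.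
Hypothesis Ce0 : 0 < Ce.
Hypothesis LE : forall h (p : 'I_3 -> R * R), shape (rho / mu) h p -> forall w : {poly {poly R}}, total_degree_le N w ->
  let S q := \int[leb2]_(x in tri p) (ev q x ^+ 2) in
  [/\ forall x y, tri p y -> dist x y <= h -> ev w x ^+ 2 <= Ce / h ^+ 2 * S w,
      h ^+ 2 * S (d1 w) <= Ce * S w, h ^+ 2 * S (d2 w) <= Ce * S w &
      forall x y, tri p y -> dist x y <= h ->
        (ev w x - ev w y) ^+ 2 <= Ce * (dist x y / h) ^+ 2 * (S (d1 w) + S (d2 w))].

Let d0 k : tdet (vtx k) != 0 := adm_tdet adm k.
Let conf : conforming M := mesh_conforming adm.
Let shp k : shape (rho / mu) (hk k) (vtx k) := adm_shape adm rho0 mu0 k.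

Definition deg_le u := forall k, total_degree_le N (u k).

(** Edge integrals are taken in the unit parameter, without the edge length: they equal 1/h_e times
    the squared L^2 norm on the edge, which is exactly the weight of the jumps in the DG norm. *)
Definition trace k i q : R := \int[leb1]_(t in I) ev q (ept k i t) ^+ 2.
Definition ijump u ki lj : R := \int[leb1]_(t in I) (ev (u ki.1) (ept ki.1 ki.2 t) - ev (u lj.1) (ept ki.1 ki.2 t)) ^+ 2.
Definition Jump u : R := \sum_ki \sum_(lj | inner ki lj) ijump u ki lj +
  \sum_(ki | ~~ has_nb ki) trace ki.1 ki.2 (u ki.1).
Definition Gradient u : R := \sum_k (L2_elt k (d1 (u k)) + L2_elt k (d2 (u k))).
Definition Mass u : R := \sum_k L2_elt k (u k).
Definition Energy u : R := Gradient u + Jump u.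
(** The unit normal ignores the third component of a mesh edge, so [None] stands for inner and
    boundary edges alike. *)
Definition nrm ki : R * R := unit_normal (ki, None : option 'I_(nel M)).

Lemma L2_elt_ge0 k q : 0 <= L2_elt k q.
Proof. by apply: Rintegral_ge0 => x _; exact: sqr_ge0. Qed.

Lemma trace_ge0 k i q : 0 <= trace k i q.
Proof. by apply: Rintegral_ge0 => x _; exact: sqr_ge0. Qed.

Lemma ijump_ge0 u ki lj : 0 <= ijump u ki lj.
Proof. by apply: Rintegral_ge0 => x _; exact: sqr_ge0. Qed.

Lemma Jump_ge0 u : 0 <= Jump u.
Proof.
apply: addr_ge0; first by apply: sumr_ge0 => ki _; apply: sumr_ge0 => lj _; exact: ijump_ge0.
by apply: sumr_ge0 => ki _; exact: trace_ge0.
Qed.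

Lemma Gradient_ge0 u : 0 <= Gradient u.
Proof. by apply: sumr_ge0 => k _; rewrite addr_ge0 ?L2_elt_ge0. Qed.

Lemma Mass_ge0 u : 0 <= Mass u.
Proof. by apply: sumr_ge0 => k _; rewrite L2_elt_ge0. Qed.

Lemma continuous_ept k i : continuous (ept k i : R -> R * R).
Proof. by move=> t; apply: cvgD; [exact: cvg_cst|apply: cvgZr_tmp; exact: cvg_id]. Qed.

Lemma bm_trace k i q : bm I (fun t => ev q (ept k i t)).
Proof.
apply: bm_itv; apply: continuous_subspaceT => t.
by apply: (@continuous_comp _ _ _ (ept k i) (ev q)); [exact: continuous_ept|exact: continuous_ev].
Qed.

Lemma bm_trace_comp k i (f : R * R -> R) : {within elt k, continuous f} -> bm I (fun t => f (ept k i t)).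
Proof.
move=> cf; apply: bm_itv; apply: (within_comp (B := elt k) (g := ept k i : R -> R * R) _ _ cf).
  by apply: continuous_subspaceT; exact: continuous_ept.
by move=> t /=; rewrite in_itv /= => tI; exact: ept_elt.
Qed.

(** One factor of the length compensates the unit parameter, the other is the usual scaling of the
    discrete trace inequality. *)
Lemma trace_le k i q : total_degree_le N q -> len k i ^+ 2 * trace k i q <= Ce * L2_elt k q.
Proof.
move=> hq; have [h0 _ _ _] := shp k; have [P _ _ _] := LE (shp k) hq.
have T : trace k i q <= Ce / hk k ^+ 2 * L2_elt k q.
  rewrite -[X in _ <= X]Rint1_cst; apply: Rint1_le; [by apply: bmX; exact: bm_trace|exact: bm_cst|].
  move=> t tI; have Te := ept_elt d0 k i tI.
  by apply: (P _ (ept k i t)) => //; rewrite distxx ltW.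
apply: (@le_trans _ _ (hk k ^+ 2 * (Ce / hk k ^+ 2 * L2_elt k q))).
  apply: ler_pM => //; [exact: sqr_ge0|exact: trace_ge0|].
  by apply: lerXn2r; rewrite ?nnegrE ?(ltW (len_gt0 d0 k i)) ?(ltW h0) //; exact: len_le_hk.
by rewrite le_eqVlt; apply/orP; left; apply/eqP; field; rewrite gt_eqF.
Qed.

Lemma inner_len ki lj : inner ki lj -> len ki.1 ki.2 = len lj.1 lj.2.
Proof.
by move=> /andP[_ /orP[/andP[/eqP a /eqP b]|/andP[/eqP a /eqP b]]]; rewrite /len a b // dist_sym.
Qed.

Lemma nb_trace ki lj q : inner ki lj ->
  \int[leb1]_(t in I) ev q (ept ki.1 ki.2 t) ^+ 2 = trace lj.1 lj.2 q.
Proof.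
move=> /andP[_ se]; rewrite same_edge_sym in se.
apply: (@edge_reverse _ M lj.1 lj.2 ki.1 ki.2 (fun x => ev q x ^+ 2) se).
by case: (bmX 2 (bm_trace lj.1 lj.2 q)).
Qed.

Lemma nb_trace_le ki lj q : inner ki lj -> total_degree_le N q ->
  len ki.1 ki.2 ^+ 2 * \int[leb1]_(t in I) ev q (ept ki.1 ki.2 t) ^+ 2 <= Ce * L2_elt lj.1 q.
Proof. by move=> il hq; rewrite (nb_trace _ il) (inner_len il); exact: trace_le. Qed.

Lemma nrm_unit ki : dot (nrm ki) (nrm ki) = 1.
Proof. exact: (unit_normal_sqr adm). Qed.

Lemma nrm_dot_le ki (x : R * R) : `|dot x (nrm ki)| <= enorm x.
Proof.
apply: (le_trans (norm_dot_le _ _)).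
by rewrite [enorm (nrm ki)](_ : _ = 1) ?mulr1 // /enorm nrm_unit sqrtr1.
Qed.

Lemma len_le1 k i : len k i <= 1.
Proof. exact: le_trans (len_le_hk _ _) (le_trans (hk_le_hmax k) hm1). Qed.

(** Each element has three sides, whence the factor 3 in front of the element contributions. *)
Lemma sum_inner_le (X P : SS -> SS -> R) (A : 'I_(nel M) -> R) : (forall k, 0 <= A k) ->
  (forall ki lj, inner ki lj -> `|X ki lj| <= P ki lj + (A ki.1 + A lj.1)) ->
  `|\sum_ki \sum_(lj | inner ki lj) X ki lj| <= \sum_ki \sum_(lj | inner ki lj) P ki lj + 3 * \sum_k A k.
Proof.
move=> A0 h; apply: (le_trans (ler_norm_sum _ _ _)).
apply: (@le_trans _ _ (\sum_ki \sum_(lj | inner ki lj) (P ki lj + (A ki.1 + A lj.1)))).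
  by apply: ler_sum => ki _; apply: (le_trans (ler_norm_sum _ _ _)); apply: ler_sum => lj; exact: h.
have -> : \sum_ki \sum_(lj | inner ki lj) (P ki lj + (A ki.1 + A lj.1)) =
  \sum_ki \sum_(lj | inner ki lj) P ki lj + \sum_ki \sum_(lj | inner ki lj) (A ki.1 + A lj.1).
  by rewrite -big_split; apply: eq_bigr => ki _; rewrite -big_split.
apply: lerD => //; have := sum_edges adm (fun ki => A ki.1).
have -> : \sum_(ki : SS) A ki.1 = 3 * \sum_k A k.
  rewrite -(pair_bigA _ (fun k (i : 'I_3) => A k)) /= mulr_sumr; apply: eq_bigr => k _.
  by rewrite sum3; ring.
move=> ->; rewrite lerDr; exact: sumr_ge0.
Qed.

Lemma sum_bd_le (X P : SS -> R) : (forall ki, ~~ has_nb ki -> `|X ki| <= P ki) ->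
  `|\sum_(ki | ~~ has_nb ki) X ki| <= \sum_(ki | ~~ has_nb ki) P ki.
Proof. by move=> h; apply: (le_trans (ler_norm_sum _ _ _)); exact: ler_sum. Qed.

Lemma nrm_dbary ki (v : R * R) :
  len ki.1 ki.2 * dot (nrm ki) v = - (`|tdet (vtx ki.1)| * dbary (vtx ki.1) ki.2 v).
Proof. by case: ki => k i; exact: (unit_normal_dbary adm). Qed.

(** [triangle_ibp] applied to the square of [u] and summed over the elements; the opposite normals
    of two neighbours turn inner edges into differences of squares. *)
Lemma ibp_sum (U : set (R * R)) (v : R * R) (f g : R * R -> R) u :
  (forall k, tri_int (vtx k) `<=` U) -> (forall k, {within elt k, continuous f}) ->
  (forall k, measurable_fun (tri_int (vtx k)) g) -> (exists B : R, {ae leb2, forall x, U x -> `|g x| <= B}) ->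
  weak_derivative U v f g ->
  \sum_k (\int[leb2]_(x in tri_int (vtx k)) (f x * 'D_v (ev (u k * u k)) x) +
          \int[leb2]_(x in tri_int (vtx k)) (g x * ev (u k * u k) x)) =
  \sum_(ki | ~~ has_nb ki) len ki.1 ki.2 * dot (nrm ki) v *
     \int[leb1]_(t in I) (f (ept ki.1 ki.2 t) * ev (u ki.1) (ept ki.1 ki.2 t) ^+ 2) +
  \sum_ki \sum_(lj | inner ki lj) len ki.1 ki.2 * dot (nrm ki) v *
     \int[leb1]_(t in I) (f (ept ki.1 ki.2 t) *
        (ev (u ki.1) (ept ki.1 ki.2 t) ^+ 2 - ev (u lj.1) (ept ki.1 ki.2 t) ^+ 2)).
Proof.
move=> TU cf mg bg wd.
pose E ki : R := len ki.1 ki.2 * dot (nrm ki) v *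
     \int[leb1]_(t in I) (f (ept ki.1 ki.2 t) * ev (u ki.1) (ept ki.1 ki.2 t) ^+ 2).
transitivity (\sum_k \sum_i E (k, i)).
  apply: eq_bigr => k _; rewrite (triangle_ibp _ (d0 k) (TU k) (cf k) (mg k) bg wd) -sumrN.
  apply: eq_bigr => i _; rewrite /E nrm_dbary /= mulNr mulrCA mulrA; congr (- (_ * _)).
  apply: eq_Rintegral => t _; rewrite -eptE evM expr2 //.
rewrite pair_bigA /= (eq_bigr E) => [|[] //]; rewrite (sum_edges adm E); congr (_ + _).
apply: eq_bigr => ki _; apply: eq_bigr => lj il; have /andP[kl se] := il.
have kl' : ki.1 != lj.1 by rewrite -val_eqE /= neq_ltn kl.
have [c c0 [_ hd]] := neighbours_opposite d0 conf kl' se.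
have bf := bm_trace_comp ki.2 (cf ki.1).
have Elj : E lj = - (len ki.1 ki.2 * dot (nrm ki) v *
   \int[leb1]_(t in I) (f (ept ki.1 ki.2 t) * ev (u lj.1) (ept ki.1 ki.2 t) ^+ 2)).
  rewrite /E !nrm_dbary hd opprK mulNr opprK; congr (_ * _).
  apply: (@edge_reverse _ M ki.1 ki.2 lj.1 lj.2 (fun x => f x * ev (u lj.1) x ^+ 2) se).
  by case: (bmM bf (bmX 2 (bm_trace ki.1 ki.2 (u lj.1)))).
rewrite Elj /E -mulrBr; congr (_ * _); rewrite -Rint1B.
- by apply: eq_Rintegral => t _; rewrite mulrBr.
- by apply: bmM bf _; apply: bmX; exact: bm_trace.
- by apply: bmM bf _; apply: bmX; exact: bm_trace.
Qed.

Lemma nrm_axis ki (v : R * R) : v = e1 \/ v = e2 -> `|dot (nrm ki) v| <= 1.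
Proof.
move=> hv; have -> : dot (nrm ki) v = dot v (nrm ki) by rewrite /dot; ring.
apply: (le_trans (nrm_dot_le _ _)).
by case: hv => ->; rewrite /enorm /dot /= !(mulr1, mulr0, addr0, add0r) sqrtr1.
Qed.

(** The integral of g u^2, with [g] a derivative of [f], is controlled by the size [F] of [f],
    however large [g] may be. A small [t] serves the Poincare inequality, where the mass has to be
    absorbed; [t = 1] serves the boundary strip, where [F] itself is small. In 4 + 6 Ce, the 4 comes
    from the gradient of the square, the 6 from three sides and the squared sum of two traces. *)
Lemma ibp_bound (U : set (R * R)) (v : R * R) (f g : R * R -> R) u (F t : R) : v = e1 \/ v = e2 -> deg_le u ->
  (forall k, tri_int (vtx k) `<=` U) -> (forall k, {within elt k, continuous f}) ->
  (forall k, measurable_fun (tri_int (vtx k)) g) -> (exists B : R, {ae leb2, forall x, U x -> `|g x| <= B}) ->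
  weak_derivative U v f g -> 0 < F -> (forall k x, elt k x -> `|f x| <= F) -> 0 < t <= 1 ->
  `|\sum_k \int[leb2]_(x in tri_int (vtx k)) (g x * ev (u k) x ^+ 2)| <=
    F * (t * ((4 + 6 * Ce) * Mass u) + t^-1 * ((4 + 6 * Ce) * Energy u)).
Proof.
move=> hv hu TU cf mg bg wd F0 hF /andP[t0 t1].
have := ibp_sum u TU cf mg bg wd.
rewrite big_split /= => /(canRL (addKr _)); rewrite addrC => H.
have -> : \sum_k \int[leb2]_(x in tri_int (vtx k)) (g x * ev (u k) x ^+ 2) =
   \sum_k \int[leb2]_(x in tri_int (vtx k)) (g x * ev (u k * u k) x).
  by apply: eq_bigr => k _; apply: eq_Rintegral => x _; rewrite evM expr2.
rewrite {}H; set X0 := (X in _ - X); set X1 := (X in X + _ - _); set X2 := (X in _ + X - _).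
have ti1 : 1 <= t^-1 by rewrite invf_ge1.
have tt : t <= t^-1 by lra.
have sq1 (a b : R) : `|a| <= b -> a ^+ 2 <= b ^+ 2.
  move=> h; rewrite -[a ^+ 2]ger0_norm ?sqr_ge0 // normrX; apply: lerXn2r; rewrite ?nnegrE //.
  exact: le_trans h.
have B0 : `|X0| <= \sum_k (F * (t * L2_elt k (u k)) + F * (t^-1 * (4 * (L2_elt k (d1 (u k)) + L2_elt k (d2 (u k)))))).
  apply: (le_trans (ler_norm_sum _ _ _)); apply: ler_sum => k _; rewrite -(Rint_tri_int _ (d0 k)).
  have mT := tri_measurable (d0 k); have fT := tri_fin (d0 k); have cT := tri_compact (d0 k).
  have bf : bm (tri (vtx k)) f by apply: bm_cont => //; exact: cf.
  pose D x := v.1 * ev (d1 (u k)) x + v.2 * ev (d2 (u k)) x.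
  have bD : bm (tri (vtx k)) D by apply: bmD; apply: bmZ; exact: bm_ev.
  have -> : \int[leb2]_(x in tri (vtx k)) (f x * 'D_v (ev (u k * u k)) x) =
    \int[leb2]_(x in tri (vtx k)) (ev (u k) x * (2 * (f x * D x))).
    apply: eq_Rintegral => x _; rewrite /D.
    have H : is_derive x v (ev (u k) * ev (u k)) (ev (u k) x *: D x + ev (u k) x *: D x).
      by apply: is_deriveM; exact: is_derive_ev.
    have -> : ev (u k * u k) = ev (u k) * ev (u k) by apply/funext => y; rewrite evM.
    by case: H => _ ->; rewrite /GRing.scale /= -/(D x); ring.
  have Ft : 0 < F * t by rewrite mulr_gt0.
  have bfD : bm (tri (vtx k)) (fun x => 2 * (f x * D x)) by apply: bmZ; exact: bmM.
  have := Rint2_young mT fT Ft (bm_ev (u k) cT) bfD; move/le_trans; apply.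
  rewrite -/(L2_elt k (u k)) [F * (t * _)]mulrA lerD2l.
  have -> : F * (t^-1 * (4 * (L2_elt k (d1 (u k)) + L2_elt k (d2 (u k))))) = (F * t)^-1 * (4 * F ^+ 2 * (L2_elt k (d1 (u k)) + L2_elt k (d2 (u k)))).
    by field; rewrite !gt_eqF.
  rewrite ler_pM2l ?invr_gt0 //.
  have -> : L2_elt k (d1 (u k)) + L2_elt k (d2 (u k)) = \int[leb2]_(x in tri (vtx k)) (ev (d1 (u k)) x ^+ 2 + ev (d2 (u k)) x ^+ 2).
    by rewrite (Rint2D mT fT) //; apply: bmX; exact: bm_ev.
  rewrite -(Rint2Z mT fT); last by apply: bmD; apply: bmX; exact: bm_ev.
  apply: (Rint2_le mT fT); [exact: bmX|apply: bmZ; apply: bmD; apply: bmX; exact: bm_ev|].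
  move=> x Tx; have -> : (2 * (f x * D x)) ^+ 2 = 4 * (f x ^+ 2 * D x ^+ 2) by ring.
  rewrite -[4 * F ^+ 2 * _]mulrA ler_pM2l //.
  apply: ler_pM; [exact: sqr_ge0|exact: sqr_ge0|by apply: sq1; exact: hF Tx|].
  by rewrite /D; case: hv => -> /=; rewrite !(mul1r, mul0r, addr0, add0r) ?lerDl ?lerDr sqr_ge0.
have B1 : `|X1| <= \sum_(ki | ~~ has_nb ki) F * (t^-1 * (2 * trace ki.1 ki.2 (u ki.1))).
  apply: sum_bd_le => ki _; have bf := bm_trace_comp ki.2 (cf ki.1).
  have bu := bm_trace ki.1 ki.2 (u ki.1); set c := len _ _ * _.
  have hc : `|c| <= 1.
    rewrite normrM -[X in _ <= X]mulr1; apply: ler_pM => //; last exact: nrm_axis.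
    by rewrite ger0_norm ?len_le1 // ltW // len_gt0.
  have -> : c * \int[leb1]_(t0 in I) (f (ept ki.1 ki.2 t0) * ev (u ki.1) (ept ki.1 ki.2 t0) ^+ 2) =
    \int[leb1]_(t0 in I) (ev (u ki.1) (ept ki.1 ki.2 t0) * (c * (f (ept ki.1 ki.2 t0) * ev (u ki.1) (ept ki.1 ki.2 t0)))).
    rewrite -Rint1Z; last by apply: bmM => //; exact: bmX.
    by apply: eq_Rintegral => s _; ring.
  have bk : bm I (fun s => c * (f (ept ki.1 ki.2 s) * ev (u ki.1) (ept ki.1 ki.2 s))) by apply: bmZ; exact: bmM.
  apply: (le_trans (Rint1_young F0 bu bk)); rewrite -/(trace ki.1 ki.2 (u ki.1)).
  apply: (@le_trans _ _ (F * trace ki.1 ki.2 (u ki.1) + F^-1 * (F ^+ 2 * trace ki.1 ki.2 (u ki.1)))).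
    rewrite lerD2l ler_pM2l ?invr_gt0 // -Rint1Z; last exact: bmX.
    apply: Rint1_le; [exact: bmX|apply: bmZ; exact: bmX|].
    move=> s sI; rewrite mulrA exprMn; apply: ler_wpM2r; first exact: sqr_ge0.
    apply: sq1; rewrite normrM -[F]mul1r; apply: ler_pM => //; apply: hF; exact: ept_elt.
  have -> : F * trace ki.1 ki.2 (u ki.1) + F^-1 * (F ^+ 2 * trace ki.1 ki.2 (u ki.1)) = F * (2 * trace ki.1 ki.2 (u ki.1)).
    by field; rewrite gt_eqF.
  rewrite ler_pM2l // ler_peMl // mulr_ge0 // trace_ge0 //.
have B2 : `|X2| <= \sum_ki \sum_(lj | inner ki lj) F * (t^-1 * ijump u ki lj) + 3 * \sum_k F * (t * (2 * (Ce * L2_elt k (u k)))).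
  apply: sum_inner_le => [k|ki lj il].
    by rewrite !mulr_ge0 ?L2_elt_ge0 // ltW.
  have bf := bm_trace_comp ki.2 (cf ki.1).
  have bu := bm_trace ki.1 ki.2 (u ki.1); have bl := bm_trace ki.1 ki.2 (u lj.1); set c := len _ _ * _.
  have hc : `|c| <= len ki.1 ki.2.
    have lp : 0 <= len ki.1 ki.2 by rewrite ltW // len_gt0.
    rewrite normrM ger0_norm // -[X in _ <= X]mulr1; apply: ler_pM => //; exact: nrm_axis.
  (* The difference of squares is the jump times the sum of the traces; the sum goes to the mass by
     the trace inequality, which uses the edge length contained in [c]. *)
  pose a s := ev (u ki.1) (ept ki.1 ki.2 s); pose a' s := ev (u lj.1) (ept ki.1 ki.2 s).
  have bs : bm I (fun s => a s - a' s) by exact: bmB.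
  have -> : c * \int[leb1]_(s in I) (f (ept ki.1 ki.2 s) * (ev (u ki.1) (ept ki.1 ki.2 s) ^+ 2 - ev (u lj.1) (ept ki.1 ki.2 s) ^+ 2)) =
    \int[leb1]_(s in I) ((a s - a' s) * (c * (f (ept ki.1 ki.2 s) * (a s + a' s)))).
    rewrite -Rint1Z; last by apply: bmM => //; apply: bmB; exact: bmX.
    by apply: eq_Rintegral => s _; rewrite /a /a'; ring.
  have bk : bm I (fun s => c * (f (ept ki.1 ki.2 s) * (a s + a' s))) by apply: bmZ; apply: bmM => //; exact: bmD.
  have Ft : 0 < F * t^-1 by rewrite mulr_gt0 ?invr_gt0.
  apply: (le_trans (Rint1_young Ft bs bk)); rewrite -/(ijump u ki lj) [F * (t^-1 * ijump _ _ _)]mulrA lerD2l.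
  rewrite invf_div.
  have T1 := trace_le ki.1 ki.2 (hu ki.1); have T2 := nb_trace_le il (hu lj.1).
  apply: (@le_trans _ _ (t / F * (F ^+ 2 * (2 * (len ki.1 ki.2 ^+ 2 * trace ki.1 ki.2 (u ki.1)) + 2 * (len ki.1 ki.2 ^+ 2 * \int[leb1]_(s in I) a' s ^+ 2))))); last first.
    have -> : F * (t * (2 * (Ce * L2_elt ki.1 (u ki.1)))) + F * (t * (2 * (Ce * L2_elt lj.1 (u lj.1)))) =
       t / F * (F ^+ 2 * (2 * (Ce * L2_elt ki.1 (u ki.1)) + 2 * (Ce * L2_elt lj.1 (u lj.1)))) by field; rewrite gt_eqF.
    by rewrite ler_pM2l ?divr_gt0 // ler_pM2l ?exprn_gt0 // lerD // ler_pM2l.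
  rewrite ler_pM2l ?divr_gt0 //.
  have -> : F ^+ 2 * (2 * (len ki.1 ki.2 ^+ 2 * trace ki.1 ki.2 (u ki.1)) + 2 * (len ki.1 ki.2 ^+ 2 * \int[leb1]_(s in I) a' s ^+ 2)) =
    \int[leb1]_(s in I) ((F ^+ 2 * len ki.1 ki.2 ^+ 2 * 2) * (a s ^+ 2 + a' s ^+ 2)).
    rewrite Rint1Z; last by apply: bmD; exact: bmX.
    by rewrite Rint1D /trace; [ring|exact: bmX|exact: bmX].
  apply: Rint1_le; [exact: bmX|by apply: bmZ; apply: bmD; exact: bmX|].
  move=> s sI; rewrite exprMn [(f _ * _) ^+ 2]exprMn.
  have f2 : f (ept ki.1 ki.2 s) ^+ 2 <= F ^+ 2 by apply: sq1; apply: hF; exact: ept_elt.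
  have c2 : c ^+ 2 <= len ki.1 ki.2 ^+ 2 by exact: sq1.
  have s2 : (a s + a' s) ^+ 2 <= 2 * (a s ^+ 2 + a' s ^+ 2).
    rewrite -subr_ge0 (_ : _ - _ = (a s - a' s) ^+ 2) ?sqr_ge0 //; ring.
  have -> : F ^+ 2 * len ki.1 ki.2 ^+ 2 * 2 * (a s ^+ 2 + a' s ^+ 2) = len ki.1 ki.2 ^+ 2 * (F ^+ 2 * (2 * (a s ^+ 2 + a' s ^+ 2))) by ring.
  apply: ler_pM; [exact: sqr_ge0|exact: mulr_ge0 (sqr_ge0 _) (sqr_ge0 _)|exact: c2|].
  by apply: ler_pM; [exact: sqr_ge0|exact: sqr_ge0|exact: f2|exact: s2].
rewrite -!mulr_sumr in B1 *; rewrite big_split /= -!mulr_sumr in B0.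
have {}B2 : `|X2| <= F * (t^-1 * \sum_ki \sum_(lj | inner ki lj) ijump u ki lj) + 3 * (F * (t * (2 * (Ce * Mass u)))).
  apply: (le_trans B2); rewrite -!mulr_sumr lerD2r le_eqVlt; apply/orP; left; apply/eqP.
  by rewrite !mulr_sumr; apply: eq_bigr => ki _; rewrite !mulr_sumr.
apply: (le_trans (ler_normB _ _)).
apply: (@le_trans _ _ (`|X0| + (`|X1| + `|X2|))); first by rewrite addrC lerD2l ler_normD.
have J0 : 0 <= \sum_ki \sum_(lj | inner ki lj) ijump u ki lj by apply: sumr_ge0 => ki _; apply: sumr_ge0 => lj _; exact: ijump_ge0.
have Jb0 : 0 <= \sum_(ki | ~~ has_nb ki) trace ki.1 ki.2 (u ki.1) by apply: sumr_ge0 => ki _; exact: trace_ge0.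
have m0 := Mass_ge0 u; have g0 := Gradient_ge0 u.
have fin (a b c d : R) : 0 <= a -> 0 <= b -> 0 <= c -> 0 <= d ->
  F * (t * a) + F * (t^-1 * (4 * b)) + (F * (t^-1 * (2 * c)) + (F * (t^-1 * d) + 3 * (F * (t * (2 * (Ce * a)))))) <=
  F * (t * ((4 + 6 * Ce) * a) + t^-1 * ((4 + 6 * Ce) * (b + (d + c)))).
  move=> a0 b0 c0 dd0; rewrite -subr_ge0.
  have -> : F * (t * ((4 + 6 * Ce) * a) + t^-1 * ((4 + 6 * Ce) * (b + (d + c)))) -
   (F * (t * a) + F * (t^-1 * (4 * b)) + (F * (t^-1 * (2 * c)) + (F * (t^-1 * d) + 3 * (F * (t * (2 * (Ce * a))))))) =
   F * (t * (3 * a) + t^-1 * (6 * (Ce * b) + (2 + 6 * Ce) * c + (3 + 6 * Ce) * d)) by ring.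
  have [Cn Fn tn tin] : [/\ 0 <= Ce, 0 <= F, 0 <= t & 0 <= t^-1] by rewrite invr_ge0 !ltW.
  apply: mulr_ge0 => //; apply: addr_ge0; apply: mulr_ge0 => //; first exact: mulr_ge0.
  by apply: addr_ge0; [apply: addr_ge0|]; apply: mulr_ge0 => //; [exact: mulr_ge0|apply: addr_ge0|apply: addr_ge0] => //; exact: mulr_ge0.
exact: le_trans (lerD B0 (lerD B1 B2)) (fin _ _ _ _ m0 g0 Jb0 J0).
Qed.

Lemma poincare (X : R) u : deg_le u -> 1 <= X -> (forall x, Omegah M x -> `|x.1| <= X) ->
  Mass u <= 4 * (X * (4 + 6 * Ce)) ^+ 2 * Energy u.
Proof.
move=> hu X1 hX; set K := 4 + 6 * Ce.
have K4 : 4 <= K by rewrite /K lerDl mulr_ge0 // ltW.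
have X0 : 0 < X := lt_le_trans ltr01 X1.
have XK : 4 <= X * K by rewrite -[4]mul1r; apply: ler_pM => //; lra.
(* This weight gives the mass on the right-hand side the factor 1/2, so that it can be absorbed. *)
pose t := (2 * (X * K))^-1.
have t0 : 0 < t by rewrite /t invr_gt0; lra.
have t1 : t <= 1 by rewrite /t invf_le1; lra.
have fE : (fun x : R * R => x.1) = ev 'X by apply/funext => x; rewrite ev_X1.
have := @ibp_bound setT e1 (fun x => x.1) (fun=> 1) u X t (or_introl erefl) hu (fun k x _ => Logic.I).
move=> /(_ (fun k => ltac:(rewrite fE; apply: continuous_subspaceT; exact: continuous_ev))
  (fun k => measurable_cst _)) H.
have {}H : `|\sum_k \int[leb2]_(x in tri_int (vtx k)) (1 * ev (u k) x ^+ 2)| <= X * (t * (K * Mass u) + t^-1 * (K * Energy u)).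
  apply: H; rewrite ?t0 //.
  - by exists 1; apply: aeW => x _; rewrite normr1.
  - apply: weak_derivative_classical; [by left| |rewrite fE; exact: continuous_ev|exact: cst_continuous].
    move=> x; rewrite fE; have := is_derive_ev 'X x (e1 : R * R).
    by rewrite /d1 derivX /= mul1r mul0r addr0 -[1]/(1%:P)%R ev_CC.
  - by move=> k x Tx; apply: hX; exists k.
have ME : \sum_k \int[leb2]_(x in tri_int (vtx k)) (1 * ev (u k) x ^+ 2) = Mass u.
  apply: eq_bigr => k _; rewrite -(Rint_tri_int _ (d0 k)); apply: eq_Rintegral => x _; by rewrite mul1r.
rewrite ME ger0_norm ?Mass_ge0 // in H.
have E : X * (t * (K * Mass u) + t^-1 * (K * Energy u)) = Mass u / 2 + 2 * (X * K) ^+ 2 * Energy u.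
  by rewrite /t; field; lra.
rewrite E in H; rewrite -mulrA; set Z := (X * K) ^+ 2 * _; rewrite -mulrA -/Z in H; lra.
Qed.

End Broken_polynomials.


(** * Truncation of essentially bounded functions *)

Section Clamp.
Context {R : realType}.
Local Notation RR := (measurableTypeR R * measurableTypeR R)%type.

(** [c] and the weak derivatives of [b] are bounded only almost everywhere. Clamping changes no
    integral and gives a representative bounded everywhere, so that the calculus of [bm] applies. *)
Definition clamp (m : R) (f : R * R -> R) (x : R * R) : R := Num.max (- m) (Num.min m (f x)).

Lemma clamp_le (m : R) f x : 0 <= m -> `|clamp m f x| <= m.
Proof.
move=> m0; rewrite /clamp ler_norml le_max lexx /= ge_max ge_min lexx /= andbT; lra.
Qed.

Lemma clamp_id (m : R) f x : `|f x| <= m -> clamp m f x = f x.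
Proof.
rewrite ler_norml => /andP[h1 h2]; rewrite /clamp min_r // max_r //.
Qed.

Lemma bm_clamp (m : R) f (D : set (R * R)) : 0 <= m -> measurable_fun D f -> bm D (clamp m f).
Proof.
move=> m0 mf; split; last by exists m => x _; exact: clamp_le.
by apply: measurable_maxr; [exact: measurable_cst|apply: measurable_minr; [exact: measurable_cst|exact: mf]].
Qed.

Lemma Rint2_ae_eq (D : set (R * R)) (f h : R * R -> R) : measurable D -> measurable_fun D f -> measurable_fun D h ->
  {ae leb2, forall x, D x -> f x = h x} -> \int[leb2]_(x in D) f x = \int[leb2]_(x in D) h x.
Proof.
move=> mD mf mh fh; rewrite /Rintegral; congr fine.
apply: (@ae_eq_integral _ RR R leb2 D (EFin \o h) (EFin \o f) mD).
- by apply/measurable_EFinP; exact: mf.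
- by apply/measurable_EFinP; exact: mh.
- by apply: leb2_ae_imp fh => x hx Dx; rewrite /= hx.
Qed.

Lemma Rint_clamp (D U : set (R * R)) (m : R) (f h : R * R -> R) : measurable D -> D `<=` U -> 0 <= m -> measurable_fun D f ->
  {ae leb2, forall x, U x -> `|f x| <= m} -> bm D h ->
  \int[leb2]_(x in D) (f x * h x) = \int[leb2]_(x in D) (clamp m f x * h x).
Proof.
move=> mD DU m0 mf hf [mh _]; apply: Rint2_ae_eq => //.
- by apply: measurable_funM.
- by apply: measurable_funM => //; case: (bm_clamp m0 mf).
- by apply: leb2_ae_imp hf => x hx /DU Ux; rewrite clamp_id //; exact: hx.
Qed.

Lemma Rint2_ae_le (D : set (R * R)) (f h : R * R -> R) : measurable D -> (leb2 D < +oo)%E -> bm D f -> bm D h ->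
  {ae leb2, forall x, D x -> f x <= h x} -> \int[leb2]_(x in D) f x <= \int[leb2]_(x in D) h x.
Proof.
move=> mD fD [mf [Mf hf]] bh fh; have [mh [Mh hh]] := bh.
have mm : measurable_fun D (fun x => Num.min (f x) (h x)) by apply: measurable_minr.
have bb : bm D (fun x => Num.min (f x) (h x)).
  split => //; exists (Num.max Mf Mh) => x Dx; rewrite le_max.
  by case: (leP (f x) (h x)) => _; rewrite ?hf ?hh // orbT.
rewrite (@Rint2_ae_eq D f (fun x => Num.min (f x) (h x))) //.
  by apply: (Rint2_le mD fD) => // x _; rewrite ge_min lexx orbT.
by apply: leb2_ae_imp fh => x hx Dx; rewrite min_l //; exact: hx.
Qed.

End Clamp.

(** * Continuity and coercivity of the bilinear form *)

Section Bilinear_form.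
Context {R : realType}.
Variables (M : mesh R) (Omega : set (R * R)) (rho mu C : R) (N : nat).
Hypothesis adm : admissible_mesh M Omega rho mu C.
Hypotheses (rho0 : 0 < rho) (mu0 : 0 < mu) (hm1 : hmax M <= 1).
Local Notation I := (`[0, 1]%classic : set R).
Local Notation SS := ('I_(nel M) * 'I_3)%type.
Implicit Types (k l : 'I_(nel M)) (i j : 'I_3) (ki lj : SS) (u w v : broken M) (q : {poly {poly R}}).

Variable Ce : R.
Hypothesis Ce0 : 0 < Ce.
Hypothesis LE : forall h (p : 'I_3 -> R * R), shape (rho / mu) h p -> forall w : {poly {poly R}}, total_degree_le N w ->
  let S q := \int[leb2]_(x in tri p) (ev q x ^+ 2) in
  [/\ forall x y, tri p y -> dist x y <= h -> ev w x ^+ 2 <= Ce / h ^+ 2 * S w,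
      h ^+ 2 * S (d1 w) <= Ce * S w, h ^+ 2 * S (d2 w) <= Ce * S w &
      forall x y, tri p y -> dist x y <= h ->
        (ev w x - ev w y) ^+ 2 <= Ce * (dist x y / h) ^+ 2 * (S (d1 w) + S (d2 w))].

Let d0 k : tdet (vtx k) != 0 := adm_tdet adm k.

Variables (U : set (R * R)) (b : R * R -> R * R) (c : R * R -> R) (M0 Bb eta : R).
Hypotheses (M00 : 0 <= M0) (Bb0 : 0 <= Bb) (eta0 : 0 <= eta).
Hypothesis TU : forall k, tri_int (vtx k) `<=` U.
Hypothesis cb1 : forall k, {within elt k, continuous (fun x => (b x).1)}.
Hypothesis cb2 : forall k, {within elt k, continuous (fun x => (b x).2)}.
Hypothesis bB : forall k x, elt k x -> enorm (b x) <= Bb.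
Hypothesis mc : forall k, measurable_fun (tri_int (vtx k)) c.
Hypothesis cB : {ae leb2, forall x, U x -> `|c x| <= M0}.

Definition ip (f g : R -> R) : R := \int[leb1]_(t in I) (f t * g t).

Lemma ipDl f f' g : bm I f -> bm I f' -> bm I g -> ip (fun t => f t + f' t) g = ip f g + ip f' g.
Proof.
by move=> bf bf' bg; rewrite /ip -Rint1D; [apply: eq_Rintegral => t _; rewrite mulrDl|exact: bmM|exact: bmM].
Qed.

Lemma ipC f g : ip f g = ip g f.
Proof. by apply: eq_Rintegral => t _; rewrite mulrC. Qed.

Lemma ip_young (t : R) f g : 0 < t -> bm I f -> bm I g -> `|ip f g| <= t * ip f f + t^-1 * ip g g.
Proof. by move=> t0 bf bg; apply: (le_trans (Rint1_young t0 bf bg)); rewrite le_eqVlt; apply/orP; left; apply/eqP; congr (_ * _ + _ * _); apply: eq_Rintegral => s _; rewrite expr2. Qed.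

(** Edge integrands in the unit parameter. The edge length is put into one factor of each product
    ([Gn], [Hb], [kp]), where the trace inequality needs it; the penalty eta/h_e loses its weight
    altogether. *)
Definition sj u ki lj (t : R) : R := ev (u ki.1) (ept ki.1 ki.2 t) - ev (u lj.1) (ept ki.1 ki.2 t).
Definition dn ki q (t : R) : R := (nrm ki).1 * ev (d1 q) (ept ki.1 ki.2 t) + (nrm ki).2 * ev (d2 q) (ept ki.1 ki.2 t).
Definition Gn u ki lj (t : R) : R := (len ki.1 ki.2 / 2) * (dn ki (u ki.1) t + dn ki (u lj.1) t).
Definition bn ki (t : R) : R := (nrm ki).1 * (b (ept ki.1 ki.2 t)).1 + (nrm ki).2 * (b (ept ki.1 ki.2 t)).2.
Definition Hb u ki lj (t : R) : R := (len ki.1 ki.2 / 2) * bn ki t * (ev (u ki.1) (ept ki.1 ki.2 t) + ev (u lj.1) (ept ki.1 ki.2 t)).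
Definition kp ki (t : R) : R := (len ki.1 ki.2 / 2) * `|bn ki t|.
Definition tc u ki (t : R) : R := ev (u ki.1) (ept ki.1 ki.2 t).

Lemma bnE k i t : dot (b (ept k i t)) (nrm (k, i)) = bn (k, i) t.
Proof. by rewrite /dot /bn /=; ring. Qed.

Lemma bm_sj u ki lj : bm I (sj u ki lj). Proof. by apply: bmB; exact: bm_trace. Qed.
Lemma bm_dn ki q : bm I (dn ki q). Proof. by apply: bmD; apply: bmZ; exact: bm_trace. Qed.
Lemma bm_Gn u ki lj : bm I (Gn u ki lj). Proof. by apply: bmZ; apply: bmD; exact: bm_dn. Qed.
Lemma bm_bn ki : bm I (bn ki).
Proof. by apply: bmD; apply: bmZ; [exact: (bm_trace_comp adm ki.2 (@cb1 ki.1))|exact: (bm_trace_comp adm ki.2 (@cb2 ki.1))]. Qed.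
Lemma bm_Hb u ki lj : bm I (Hb u ki lj).
Proof. by apply: bmM; [apply: bmZ; exact: bm_bn|apply: bmD; exact: bm_trace]. Qed.
Lemma bm_kp ki : bm I (kp ki). Proof. by apply: bmZ; apply: bm_norm; exact: bm_bn. Qed.
Lemma bm_tc u ki : bm I (tc u ki). Proof. exact: bm_trace. Qed.
Local Hint Resolve bm_sj bm_Gn bm_Hb bm_kp bm_tc bmM : core.

Definition VK k q q' : R :=
  \int[leb2]_(x in tri_int (vtx k)) (ev (d1 q) x * ev (d1 q') x) +
  \int[leb2]_(x in tri_int (vtx k)) (ev (d2 q) x * ev (d2 q') x) -
  \int[leb2]_(x in tri_int (vtx k)) (ev q x * ((b x).1 * ev (d1 q') x + (b x).2 * ev (d2 q') x)) +
  \int[leb2]_(x in tri_int (vtx k)) (ev q x * (clamp M0 c x * ev q' x)).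

Definition EI ki lj w v : R :=
  - ip (sj w ki lj) (Gn v ki lj) - ip (Gn w ki lj) (sj v ki lj) + eta * ip (sj w ki lj) (sj v ki lj)
  + ip (Hb w ki lj) (sj v ki lj) + ip (sj w ki lj) (fun t => kp ki t * sj v ki lj t).

Definition EB ki w v : R := eta * ip (tc w ki) (tc v ki) + ip (tc w ki) (fun t => kp ki t * tc v ki t).

Lemma edge_ip ki o f g F : (forall t, f t * g t = len ki.1 ki.2 * F (ept ki.1 ki.2 t)) -> bm I f -> bm I g ->
  edge_integral (ki, o) F = ip f g.
Proof.
case: ki => k i h bf bg; have l0 := len_gt0 d0 k i.
rewrite /edge_integral /ip -Rint1Z; first by apply: eq_Rintegral => t _; rewrite h.
apply: (bm_ext (f := fun t => (len k i)^-1 * (f t * g t))); last by apply: bmZ; exact: bmM.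
by move=> t _; rewrite h /= mulKf // gt_eqF.
Qed.

Let Tm k := @tri_int_measurable R (vtx k).
Let Tf k := tri_int_fin (d0 k).
Lemma bm_int k (f : R * R -> R) : bm (tri (vtx k)) f -> bm (tri_int (vtx k)) f.
Proof. by apply: bm_sub; [exact: (tri_measurable (d0 k))|exact: (tri_int_sub (d0 k))]. Qed.
Lemma bm_ev_int k q : bm (tri_int (vtx k)) (ev q).
Proof. by apply: bm_int; apply: bm_ev; exact: (tri_compact (d0 k)). Qed.
Lemma bm_b1 k : bm (tri_int (vtx k)) (fun x => (b x).1).
Proof. by apply: bm_int; apply: bm_cont; [exact: (tri_compact (d0 k))|exact: (@cb1 k)]. Qed.
Lemma bm_b2 k : bm (tri_int (vtx k)) (fun x => (b x).2).
Proof. by apply: bm_int; apply: bm_cont; [exact: (tri_compact (d0 k))|exact: (@cb2 k)]. Qed.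
Lemma bm_bgrad k q : bm (tri_int (vtx k)) (fun x => (b x).1 * ev (d1 q) x + (b x).2 * ev (d2 q) x).
Proof. by apply: bmD; apply: bmM; rewrite ?bm_b1 ?bm_b2 //; [exact: bm_b1|exact: bm_ev_int|exact: bm_b2|exact: bm_ev_int]. Qed.
Lemma bm_c k : bm (tri_int (vtx k)) (clamp M0 c).
Proof. exact: bm_clamp. Qed.
Local Hint Resolve bm_ev_int bm_bgrad bm_c : core.

Lemma VK_E k q q' : VK k q q' =
  \int[leb2]_(x in elt k) dot (grad q x) (grad q' x) - \int[leb2]_(x in elt k) dot (ev q x *: b x) (grad q' x) +
  \int[leb2]_(x in elt k) (c x * ev q x * ev q' x).
Proof.
rewrite /VK !(Rint_tri_int _ (d0 k)) -(Rint2D (Tm k) (Tf k) (bmM (bm_ev_int k (d1 q)) (bm_ev_int k (d1 q'))) (bmM (bm_ev_int k (d2 q)) (bm_ev_int k (d2 q')))).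
congr (_ - _ + _).
  by apply: eq_Rintegral => x _; rewrite /dot /grad !coordE /=; ring.
rewrite [RHS](_ : _ = \int[leb2]_(x in tri_int (vtx k)) (c x * (ev q x * ev q' x))); last first.
  by apply: eq_Rintegral => x _; rewrite mulrA.
rewrite (Rint_clamp (Tm k) (@TU k) M00 (@mc k) cB) //; last exact: bmM.
by apply: eq_Rintegral => x _; ring.
Qed.

Lemma BDG_expand w v : BDG b c eta w v =
  \sum_k VK k (w k) (v k) + (\sum_ki \sum_(lj | inner ki lj) EI ki lj w v + \sum_(ki | ~~ has_nb ki) EB ki w v).
Proof.
rewrite /BDG !(sum_Eh _) !(sum_Gamma0 adm) !(sum_GammaB adm).
have n1 ki : (nrm ki).1 * (nrm ki).1 + (nrm ki).2 * (nrm ki).2 = 1 by exact: (nrm_unit adm ki).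
have -> : \sum_k VK k (w k) (v k) = \sum_k \int[leb2]_(x in elt k) dot (grad (w k) x) (grad (v k) x)
  - \sum_k \int[leb2]_(x in elt k) dot (ev (w k) x *: b x) (grad (v k) x)
  + \sum_k \int[leb2]_(x in elt k) (c x * ev (w k) x * ev (v k) x).
  by rewrite -sumrB -big_split; apply: eq_bigr => k _; rewrite VK_E.
have dotn ki (a a' : R) : dot (a *: nrm ki) (a' *: nrm ki) = a * a'.
  rewrite -[RHS]mulr1 -(n1 ki) /dot !coordE; ring.
have dotid (a L m1 m2 p1 p2 q1 q2 : R) : a * (L / 2 * ((m1 * p1 + m2 * p2) + (m1 * q1 + m2 * q2))) =
    L * (a * m1 * (2^-1 * (p1 + q1)) + a * m2 * (2^-1 * (p2 + q2))) by field.
have dotid2 (a L m1 m2 p1 p2 q : R) : L / 2 * (m1 * p1 + m2 * p2) * q * a =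
    L * ((p1 * (a * m1) + p2 * (a * m2)) * (q / 2)) by field.
have S1 : \sum_ki \sum_(lj | inner ki lj) edge_integral (ki, Some lj.1) (fun x => dot (jump w (ki, Some lj.1) x) (avg_grad v (ki, Some lj.1) x)) =
  \sum_ki \sum_(lj | inner ki lj) ip (sj w ki lj) (Gn v ki lj).
  apply: eq_bigr => -[k i] _; apply: eq_bigr => -[l j] _; apply: edge_ip => // t.
  change (sj w (k, i) (l, j) t * Gn v (k, i) (l, j) t = len k i * dot ((ev (w k) (ept k i t) - ev (w l) (ept k i t)) *: nrm (k, i))
    (2^-1 *: (grad (v k) (ept k i t) + grad (v l) (ept k i t)))).
  by rewrite /dot !coordE; exact: (dotid (ev (w k) (ept k i t) - ev (w l) (ept k i t)) (len k i) (nrm (k, i)).1 (nrm (k, i)).2 (ev (d1 (v k)) (ept k i t)) (ev (d2 (v k)) (ept k i t)) (ev (d1 (v l)) (ept k i t)) (ev (d2 (v l)) (ept k i t))).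
have S2 : \sum_ki \sum_(lj | inner ki lj) edge_integral (ki, Some lj.1) (fun x => dot (jump v (ki, Some lj.1) x) (avg_grad w (ki, Some lj.1) x)) =
  \sum_ki \sum_(lj | inner ki lj) ip (Gn w ki lj) (sj v ki lj).
  apply: eq_bigr => -[k i] _; apply: eq_bigr => -[l j] _; apply: edge_ip => // t.
  change (Gn w (k, i) (l, j) t * sj v (k, i) (l, j) t = len k i * dot ((ev (v k) (ept k i t) - ev (v l) (ept k i t)) *: nrm (k, i))
    (2^-1 *: (grad (w k) (ept k i t) + grad (w l) (ept k i t)))).
  by rewrite mulrC /dot !coordE; exact: (dotid (ev (v k) (ept k i t) - ev (v l) (ept k i t)) (len k i) (nrm (k, i)).1 (nrm (k, i)).2 (ev (d1 (w k)) (ept k i t)) (ev (d2 (w k)) (ept k i t)) (ev (d1 (w l)) (ept k i t)) (ev (d2 (w l)) (ept k i t))).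
have S3 : \sum_ki \sum_(lj | inner ki lj) edge_integral (ki, Some lj.1) (fun x => eta / elen (ki, Some lj.1) * dot (jump v (ki, Some lj.1) x) (jump w (ki, Some lj.1) x)) =
  \sum_ki \sum_(lj | inner ki lj) eta * ip (sj w ki lj) (sj v ki lj).
  apply: eq_bigr => -[k i] _; apply: eq_bigr => -[l j] _; have l0 := len_gt0 d0 k i.
  rewrite -[RHS](_ : ip (fun t => eta * sj w (k, i) (l, j) t) (sj v (k, i) (l, j)) = _); last first.
    by rewrite /ip -Rint1Z; [apply: eq_Rintegral => t _; rewrite mulrA|exact: bmM].
  apply: edge_ip => //; last exact: bmZ.
  move=> t; change (eta * sj w (k, i) (l, j) t * sj v (k, i) (l, j) t = len k i * (eta / len k i * dot (sj v (k, i) (l, j) t *: nrm (k, i)) (sj w (k, i) (l, j) t *: nrm (k, i)))).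
  by rewrite dotn; field; rewrite gt_eqF.
have S4 : \sum_(ki | ~~ has_nb ki) edge_integral (ki, None) (fun x => eta / elen (ki, None : option 'I_(nel M)) * dot (jump v (ki, None) x) (jump w (ki, None) x)) =
  \sum_(ki | ~~ has_nb ki) eta * ip (tc w ki) (tc v ki).
  apply: eq_bigr => -[k i] _; have l0 := len_gt0 d0 k i.
  rewrite -[RHS](_ : ip (fun t => eta * tc w (k, i) t) (tc v (k, i)) = _); last first.
    by rewrite /ip -Rint1Z; [apply: eq_Rintegral => t _; rewrite mulrA|exact: bmM].
  apply: edge_ip => //; last exact: bmZ.
  move=> t; change (eta * tc w (k, i) t * tc v (k, i) t = len k i * (eta / len k i * dot (tc v (k, i) t *: nrm (k, i)) (tc w (k, i) t *: nrm (k, i)))).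
  by rewrite dotn; field; rewrite gt_eqF.
have S5 : \sum_ki \sum_(lj | inner ki lj) edge_integral (ki, Some lj.1) (fun x => dot (b x) (jump v (ki, Some lj.1) x) * avg w (ki, Some lj.1) x) =
  \sum_ki \sum_(lj | inner ki lj) ip (Hb w ki lj) (sj v ki lj).
  apply: eq_bigr => -[k i] _; apply: eq_bigr => -[l j] _; apply: edge_ip => // t.
  change (Hb w (k, i) (l, j) t * sj v (k, i) (l, j) t = len k i * (dot (b (ept k i t)) (sj v (k, i) (l, j) t *: nrm (k, i)) * ((ev (w k) (ept k i t) + ev (w l) (ept k i t)) / 2))).
  by rewrite /dot !coordE; exact: (dotid2 (sj v (k, i) (l, j) t) (len k i) (nrm (k, i)).1 (nrm (k, i)).2 (b (ept k i t)).1 (b (ept k i t)).2 (ev (w k) (ept k i t) + ev (w l) (ept k i t))).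
have S6 : \sum_ki \sum_(lj | inner ki lj) edge_integral (ki, Some lj.1) (fun x => `|dot (b x) (unit_normal (ki, Some lj.1))| / 2 * dot (jump v (ki, Some lj.1) x) (jump w (ki, Some lj.1) x)) =
  \sum_ki \sum_(lj | inner ki lj) ip (sj w ki lj) (fun t => kp ki t * sj v ki lj t).
  apply: eq_bigr => -[k i] _; apply: eq_bigr => -[l j] _; apply: edge_ip => // [t|]; last exact: bmM.
  change (sj w (k, i) (l, j) t * (kp (k, i) t * sj v (k, i) (l, j) t) = len k i * (`|dot (b (ept k i t)) (nrm (k, i))| / 2 * dot (sj v (k, i) (l, j) t *: nrm (k, i)) (sj w (k, i) (l, j) t *: nrm (k, i)))).
  by rewrite dotn bnE /kp /=; ring.
have S7 : \sum_(ki | ~~ has_nb ki) edge_integral (ki, None) (fun x => `|dot (b x) (unit_normal (ki, None : option 'I_(nel M)))| / 2 * dot (jump v (ki, None) x) (jump w (ki, None) x)) =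
  \sum_(ki | ~~ has_nb ki) ip (tc w ki) (fun t => kp ki t * tc v ki t).
  apply: eq_bigr => -[k i] _; apply: edge_ip => // [t|]; last exact: bmM.
  change (tc w (k, i) t * (kp (k, i) t * tc v (k, i) t) = len k i * (`|dot (b (ept k i t)) (nrm (k, i))| / 2 * dot (tc v (k, i) t *: nrm (k, i)) (tc w (k, i) t *: nrm (k, i)))).
  by rewrite dotn bnE /kp /=; ring.
have eq7 (X a1 a2 a3 a4 a5 a6 a7 c1 c2 c3 c4 c5 c6 c7 : R) : a1 = c1 -> a2 = c2 -> a3 = c3 -> a4 = c4 -> a5 = c5 ->
    a6 = c6 -> a7 = c7 -> X - a1 - a2 + (a3 + a4) + a5 + (a6 + a7) = X - c1 - c2 + (c3 + c4) + c5 + (c6 + c7).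
  by move=> -> -> -> -> -> -> ->.
rewrite (eq7 _ _ _ _ _ _ _ _ _ _ _ _ _ _ _ S1 S2 S3 S4 S5 S6 S7).
have -> : \sum_ki \sum_(lj | inner ki lj) EI ki lj w v =
  - \sum_ki \sum_(lj | inner ki lj) ip (sj w ki lj) (Gn v ki lj) - \sum_ki \sum_(lj | inner ki lj) ip (Gn w ki lj) (sj v ki lj)
  + \sum_ki \sum_(lj | inner ki lj) eta * ip (sj w ki lj) (sj v ki lj) + \sum_ki \sum_(lj | inner ki lj) ip (Hb w ki lj) (sj v ki lj)
  + \sum_ki \sum_(lj | inner ki lj) ip (sj w ki lj) (fun t => kp ki t * sj v ki lj t).
  rewrite -!sumrN -!big_split /=; apply: eq_bigr => ki _; rewrite -!sumrN -!big_split /=; exact: eq_bigr.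
have -> : \sum_(ki | ~~ has_nb ki) EB ki w v = \sum_(ki | ~~ has_nb ki) eta * ip (tc w ki) (tc v ki) +
   \sum_(ki | ~~ has_nb ki) ip (tc w ki) (fun t => kp ki t * tc v ki t) by rewrite -big_split.
ring.
Qed.

Lemma BDG_addl w w' v : BDG b c eta (w + w') v = BDG b c eta w v + BDG b c eta w' v.
Proof.
rewrite !BDG_expand.
have VKD k : VK k ((w + w') k) (v k) = VK k (w k) (v k) + VK k (w' k) (v k).
  have D (q q' : {poly {poly R}}) (h : R * R -> R) : bm (tri_int (vtx k)) h ->
     \int[leb2]_(x in tri_int (vtx k)) (ev (q + q') x * h x) =
     \int[leb2]_(x in tri_int (vtx k)) (ev q x * h x) + \int[leb2]_(x in tri_int (vtx k)) (ev q' x * h x).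
    move=> bh; rewrite -(Rint2D (Tm k) (Tf k) (bmM (bm_ev_int k q) bh) (bmM (bm_ev_int k q') bh)).
    by apply: eq_Rintegral => x _; rewrite evD mulrDl.
  rewrite /VK ffunE d1D d2D !(D _ _ (ev _) (bm_ev_int k _)) D // D; [ring|exact: bmM].
have sjD ki lj : sj (w + w') ki lj = (fun t => sj w ki lj t + sj w' ki lj t).
  by apply/funext => t; rewrite /sj !ffunE !evD; ring.
have GnD ki lj : Gn (w + w') ki lj = (fun t => Gn w ki lj t + Gn w' ki lj t).
  by apply/funext => t; rewrite /Gn /dn !ffunE !d1D !d2D !evD; ring.
have HbD ki lj : Hb (w + w') ki lj = (fun t => Hb w ki lj t + Hb w' ki lj t).
  by apply/funext => t; rewrite /Hb !ffunE !evD; ring.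
have tcD ki : tc (w + w') ki = (fun t => tc w ki t + tc w' ki t).
  by apply/funext => t; rewrite /tc !ffunE !evD.
have EID ki lj : EI ki lj (w + w') v = EI ki lj w v + EI ki lj w' v.
  rewrite /EI sjD GnD HbD (ipDl (bm_sj w ki lj) (bm_sj w' ki lj) (bm_Gn v ki lj)) (ipDl (bm_Gn w ki lj) (bm_Gn w' ki lj) (bm_sj v ki lj)).
  rewrite (ipDl (bm_sj w ki lj) (bm_sj w' ki lj) (bm_sj v ki lj)) (ipDl (bm_Hb w ki lj) (bm_Hb w' ki lj) (bm_sj v ki lj)).
  by rewrite (ipDl (bm_sj w ki lj) (bm_sj w' ki lj) (bmM (bm_kp ki) (bm_sj v ki lj))); ring.
have EBD ki : EB ki (w + w') v = EB ki w v + EB ki w' v.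
  rewrite /EB tcD (ipDl (bm_tc w ki) (bm_tc w' ki) (bm_tc v ki)) (ipDl (bm_tc w ki) (bm_tc w' ki) (bmM (bm_kp ki) (bm_tc v ki))); ring.
have A1 : \sum_k VK k ((w + w') k) (v k) = \sum_k VK k (w k) (v k) + \sum_k VK k (w' k) (v k).
  by rewrite -big_split; apply: eq_bigr => k _; exact: VKD.
have A2 : \sum_ki \sum_(lj | inner ki lj) EI ki lj (w + w') v = \sum_ki \sum_(lj | inner ki lj) EI ki lj w v + \sum_ki \sum_(lj | inner ki lj) EI ki lj w' v.
  by rewrite -big_split; apply: eq_bigr => ki _; rewrite -big_split; apply: eq_bigr => lj _; exact: EID.
have A3 : \sum_(ki | ~~ has_nb ki) EB ki (w + w') v = \sum_(ki | ~~ has_nb ki) EB ki w v + \sum_(ki | ~~ has_nb ki) EB ki w' v.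
  by rewrite -big_split; apply: eq_bigr => ki _; exact: EBD.
by rewrite A1 A2 A3; ring.
Qed.

Definition Gk k q : R := L2_elt k (d1 q) + L2_elt k (d2 q).

Lemma sj_ijump u ki lj : ip (sj u ki lj) (sj u ki lj) = ijump u ki lj.
Proof. by apply: eq_Rintegral => t _; rewrite expr2. Qed.
Lemma tc_trace u ki : ip (tc u ki) (tc u ki) = trace ki.1 ki.2 (u ki.1).
Proof. by apply: eq_Rintegral => t _; rewrite expr2. Qed.

Lemma lenp ki : 0 <= len ki.1 ki.2. Proof. by rewrite ltW // len_gt0. Qed.
Lemma CS2 (n1 n2 x y : R) : n1 * n1 + n2 * n2 = 1 -> (n1 * x + n2 * y) ^+ 2 <= x ^+ 2 + y ^+ 2.
Proof.
move=> h; rewrite -subr_ge0.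
have -> : x ^+ 2 + y ^+ 2 - (n1 * x + n2 * y) ^+ 2 = (n1 * y - n2 * x) ^+ 2 + (1 - (n1 * n1 + n2 * n2)) * (x ^+ 2 + y ^+ 2) by ring.
by rewrite h subrr mul0r addr0 sqr_ge0.
Qed.

Lemma Gn_le u ki lj : deg_le N u -> inner ki lj ->
  ip (Gn u ki lj) (Gn u ki lj) <= Ce / 2 * Gk ki.1 (u ki.1) + Ce / 2 * Gk lj.1 (u lj.1).
Proof.
move=> hu il; set L := len ki.1 ki.2.
have n1 : (nrm ki).1 * (nrm ki).1 + (nrm ki).2 * (nrm ki).2 = 1 by exact: (nrm_unit adm ki).
pose e q t := ev q (ept ki.1 ki.2 t) ^+ 2.
have be q : bm I (e q) by apply: bmX; exact: bm_trace.
apply: (@le_trans _ _ (\int[leb1]_(t in I) (L ^+ 2 / 2 * ((e (d1 (u ki.1)) t + e (d2 (u ki.1)) t) + (e (d1 (u lj.1)) t + e (d2 (u lj.1)) t))))).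
  apply: Rint1_le; [exact: bmM|by apply: bmZ; apply: bmD; apply: bmD|].
  move=> t _; rewrite -expr2 /Gn exprMn -/L.
  have -> : L ^+ 2 / 2 * (e (d1 (u ki.1)) t + e (d2 (u ki.1)) t + (e (d1 (u lj.1)) t + e (d2 (u lj.1)) t)) =
    (L / 2) ^+ 2 * (2 * (e (d1 (u ki.1)) t + e (d2 (u ki.1)) t + (e (d1 (u lj.1)) t + e (d2 (u lj.1)) t))) by field.
  apply: ler_wpM2l; first exact: sqr_ge0.
  have a1 := CS2 (ev (d1 (u ki.1)) (ept ki.1 ki.2 t)) (ev (d2 (u ki.1)) (ept ki.1 ki.2 t)) n1.
  have a2 := CS2 (ev (d1 (u lj.1)) (ept ki.1 ki.2 t)) (ev (d2 (u lj.1)) (ept ki.1 ki.2 t)) n1.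
  have young (x y A B : R) : x ^+ 2 <= A -> y ^+ 2 <= B -> (x + y) ^+ 2 <= 2 * (A + B).
    by move=> h1 h2; have := sqr_ge0 (x - y); rewrite sqrrB sqrrD; lra.
  exact: young a1 a2.
rewrite Rint1Z; last by apply: bmD; apply: bmD.
rewrite Rint1D; [|exact: bmD|exact: bmD]; rewrite !Rint1D //.
have T1 := trace_le adm rho0 mu0 LE ki.1 ki.2 (total_degree_d1 (hu ki.1)).
have T2 := trace_le adm rho0 mu0 LE ki.1 ki.2 (total_degree_d2 (hu ki.1)).
have T3 := nb_trace_le adm rho0 mu0 LE il (total_degree_d1 (hu lj.1)).
have T4 := nb_trace_le adm rho0 mu0 LE il (total_degree_d2 (hu lj.1)).
rewrite /trace -/L in T1 T2 T3 T4.
have -> (x y z z' : R) : L ^+ 2 / 2 * (x + y + (z + z')) = 2^-1 * (L ^+ 2 * x + L ^+ 2 * y + (L ^+ 2 * z + L ^+ 2 * z')) by ring.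
have -> : Ce / 2 * Gk ki.1 (u ki.1) + Ce / 2 * Gk lj.1 (u lj.1) = 2^-1 * (Ce * L2_elt ki.1 (d1 (u ki.1)) + Ce * L2_elt ki.1 (d2 (u ki.1)) + (Ce * L2_elt lj.1 (d1 (u lj.1)) + Ce * L2_elt lj.1 (d2 (u lj.1)))) by rewrite /Gk; ring.
rewrite ler_pM2l ?invr_gt0 //; apply: lerD; exact: lerD.
Qed.

Lemma bn_le ki t : 0 <= t <= 1 -> `|bn ki t| <= Bb.
Proof.
move=> tI; have -> : bn ki t = dot (b (ept ki.1 ki.2 t)) (nrm ki) by rewrite /bn /dot; ring.
apply: (le_trans (nrm_dot_le adm _ _)); apply: bB; exact: ept_elt.
Qed.

Lemma Hb_le u ki lj : deg_le N u -> inner ki lj ->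
  ip (Hb u ki lj) (Hb u ki lj) <= Bb ^+ 2 * Ce / 2 * L2_elt ki.1 (u ki.1) + Bb ^+ 2 * Ce / 2 * L2_elt lj.1 (u lj.1).
Proof.
move=> hu il; set L := len ki.1 ki.2.
pose e q t := ev q (ept ki.1 ki.2 t) ^+ 2.
have be q : bm I (e q) by apply: bmX; exact: bm_trace.
apply: (@le_trans _ _ (\int[leb1]_(t in I) (Bb ^+ 2 * L ^+ 2 / 2 * (e (u ki.1) t + e (u lj.1) t)))).
  apply: Rint1_le; [exact: bmM|by apply: bmZ; apply: bmD|].
  move=> t tI; rewrite -expr2 /Hb -/L.
  set x := ev _ _; set y := ev _ _.
  have -> : (L / 2 * bn ki t * (x + y)) ^+ 2 = (L ^+ 2 / 2) * (bn ki t ^+ 2 * ((x + y) ^+ 2 / 2)) by field.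
  have -> : Bb ^+ 2 * L ^+ 2 / 2 * (e (u ki.1) t + e (u lj.1) t) = (L ^+ 2 / 2) * (Bb ^+ 2 * (x ^+ 2 + y ^+ 2)) by rewrite /e -/x -/y; ring.
  apply: ler_wpM2l; first by apply: divr_ge0 => //; exact: sqr_ge0.
  apply: ler_pM; [exact: sqr_ge0|by apply: divr_ge0 => //; exact: sqr_ge0| |].
    rewrite -[bn ki t ^+ 2]ger0_norm ?sqr_ge0 // normrX; apply: lerXn2r; rewrite ?nnegrE //; exact: bn_le.
  by have := sqr_ge0 (x - y); rewrite sqrrB sqrrD; lra.
rewrite Rint1Z; last exact: bmD.
rewrite Rint1D //.
have T1 := trace_le adm rho0 mu0 LE ki.1 ki.2 (hu ki.1).
have T3 := nb_trace_le adm rho0 mu0 LE il (hu lj.1).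
rewrite /trace -/L in T1 T3.
have -> (x y : R) : Bb ^+ 2 * L ^+ 2 / 2 * (x + y) = Bb ^+ 2 / 2 * (L ^+ 2 * x + L ^+ 2 * y) by ring.
have -> (x y : R) : Bb ^+ 2 * Ce / 2 * x + Bb ^+ 2 * Ce / 2 * y = Bb ^+ 2 / 2 * (Ce * x + Ce * y) by ring.
apply: ler_wpM2l; first by apply: divr_ge0 => //; exact: sqr_ge0.
exact: lerD.
Qed.

Lemma kp_le ki f : bm I f -> ip (fun t => kp ki t * f t) (fun t => kp ki t * f t) <= Bb ^+ 2 * ip f f.
Proof.
move=> bf; rewrite /ip -Rint1Z; last exact: bmM.
apply: Rint1_le; [by apply: bmM; exact: bmM|by apply: bmZ; exact: bmM|].
move=> t tI; rewrite -!expr2 exprMn; apply: ler_wpM2r; first exact: sqr_ge0.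
rewrite -[kp ki t ^+ 2]ger0_norm ?sqr_ge0 // normrX; apply: lerXn2r; rewrite ?nnegrE //.
rewrite /kp normrM normr_id -[Bb]mul1r; apply: ler_pM => //; last exact: bn_le.
have := len_le1 hm1 ki.1 ki.2; have := lenp ki => h1 h2; rewrite ger0_norm; lra.
Qed.

Lemma sq_le (x y : R) : `|x| <= y -> x ^+ 2 <= y ^+ 2.
Proof.
move=> h; rewrite -[x ^+ 2]ger0_norm ?sqr_ge0 // normrX; apply: lerXn2r; rewrite ?nnegrE //.
exact: le_trans h.
Qed.

Lemma L2_int k q : \int[leb2]_(x in tri_int (vtx k)) (ev q x ^+ 2) = L2_elt k q.
Proof. by rewrite -(Rint_tri_int _ (d0 k)). Qed.

Lemma VK_arith (t s a1 a2 a3 a4 p1 p2 p0 q1 q2 q0 i3 i4 B m : R) : 0 <= s ->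
  `|a1| <= t * p1 + s * q1 -> `|a2| <= t * p2 + s * q2 -> `|a3| <= t * p0 + s * i3 -> `|a4| <= t * p0 + s * i4 ->
  i3 <= B * (q1 + q2) -> i4 <= m * q0 ->
  `|a1 + a2 - a3 + a4| <= t * ((p1 + p2) + 2 * p0) + s * ((1 + B) * (q1 + q2) + m * q0).
Proof.
move=> s0 h1 h2 h3 h4 h5 h6.
have h5' := ler_wpM2l s0 h5; have h6' := ler_wpM2l s0 h6.
have := ler_normD (a1 + a2 - a3) a4; have := ler_normB (a1 + a2) a3; have := ler_normD a1 a2; lra.
Qed.

Lemma VK_le (t : R) k q q' : 0 < t -> `|VK k q q'| <=
  t * (Gk k q + 2 * L2_elt k q) + t^-1 * ((1 + Bb ^+ 2) * Gk k q' + M0 ^+ 2 * L2_elt k q').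
Proof.
move=> t0; have mT := @Tm k; have fT := Tf k.
have y1 := Rint2_young mT fT t0 (bm_ev_int k (d1 q)) (bm_ev_int k (d1 q')).
have y2 := Rint2_young mT fT t0 (bm_ev_int k (d2 q)) (bm_ev_int k (d2 q')).
have y3 := Rint2_young mT fT t0 (bm_ev_int k q) (bm_bgrad k q').
have y4 := Rint2_young mT fT t0 (bm_ev_int k q) (bmM (bm_c k) (bm_ev_int k q')).
rewrite !L2_int in y1 y2 y3 y4.
apply: (VK_arith _ y1 y2 y3 y4); first by rewrite invr_ge0 ltW.
  rewrite -!L2_int -(Rint2D mT fT (bmX 2 (bm_ev_int k (d1 q'))) (bmX 2 (bm_ev_int k (d2 q')))).
  have bs : bm (tri_int (vtx k)) (fun x => ev (d1 q') x ^+ 2 + ev (d2 q') x ^+ 2) by apply: bmD; apply: bmX.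
  rewrite -(Rint2Z mT fT _ bs); apply: (Rint2_le mT fT); [exact: bmX|exact: bmZ|].
  move=> x Tx; have hb : (b x).1 ^+ 2 + (b x).2 ^+ 2 <= Bb ^+ 2.
    have := @sq_le (enorm (b x)) Bb; rewrite enorm_sqr /dot -!expr2; apply; rewrite ger0_norm ?enorm_ge0 //.
    by apply: (@bB k); apply: (tri_int_sub (d0 k)).
  apply: (@le_trans _ _ (((b x).1 ^+ 2 + (b x).2 ^+ 2) * (ev (d1 q') x ^+ 2 + ev (d2 q') x ^+ 2))).
    rewrite -subr_ge0 (_ : _ - _ = ((b x).1 * ev (d2 q') x - (b x).2 * ev (d1 q') x) ^+ 2) ?sqr_ge0 //; ring.
  by apply: ler_wpM2r => //; apply: addr_ge0; exact: sqr_ge0.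
rewrite -L2_int -(Rint2Z mT fT _ (bmX 2 (bm_ev_int k q'))).
apply: (Rint2_le mT fT); [by apply: bmX; exact: bmM|by apply: bmZ; exact: bmX|].
by move=> x _; rewrite exprMn; apply: ler_wpM2r; [exact: sqr_ge0|apply: sq_le; exact: clamp_le].
Qed.

Lemma continuity_constant (et B M2 ce BC K : R) : 0 <= et -> 0 <= B -> 0 <= M2 -> 0 <= ce -> 0 <= BC ->
  K = 3 + et + B + M2 + 2 * ce + 2 * BC ->
  [/\ 0 <= K - 1 - 3 * ce / 2, 0 <= K - 2 - 3 * BC / 2, 0 <= K - 2 - et, 0 <= K - 1 - B - 3 * ce / 2 &
    0 <= K - M2 /\ 0 <= K - 2 - et - B].
Proof.
move=> et0 B0 M20 ce0 BC0 ->; split.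
- have -> : 3 + et + B + M2 + 2 * ce + 2 * BC - 1 - 3 * ce / 2 = 2 + et + B + M2 + ce / 2 + 2 * BC by field.
  by rewrite !addr_ge0 // ?divr_ge0 ?mulr_ge0.
- have -> : 3 + et + B + M2 + 2 * ce + 2 * BC - 2 - 3 * BC / 2 = 1 + et + B + M2 + 2 * ce + BC / 2 by field.
  by rewrite !addr_ge0 // ?divr_ge0 ?mulr_ge0.
- have -> : 3 + et + B + M2 + 2 * ce + 2 * BC - 2 - et = 1 + B + M2 + 2 * ce + 2 * BC by ring.
  by rewrite !addr_ge0 // ?mulr_ge0.
- have -> : 3 + et + B + M2 + 2 * ce + 2 * BC - 1 - B - 3 * ce / 2 = 2 + et + M2 + ce / 2 + 2 * BC by field.
  by rewrite !addr_ge0 // ?divr_ge0 ?mulr_ge0.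
have -> : 3 + et + B + M2 + 2 * ce + 2 * BC - M2 = 3 + et + B + 2 * ce + 2 * BC by ring.
have -> : 3 + et + B + M2 + 2 * ce + 2 * BC - 2 - et - B = 1 + M2 + 2 * ce + 2 * BC by ring.
by split; rewrite !addr_ge0 // ?mulr_ge0.
Qed.

Lemma EI_arith (t s a a' d e f Jw Jv ga gb hd ke A1 A2 A3 A4 A5 A6 B : R) : 0 <= t -> 0 <= s ->
  `|a| <= t * Jw + s * ga -> `|a'| <= t * gb + s * Jv -> `|d| <= t * Jw + s * Jv ->
  `|e| <= t * hd + s * Jv -> `|f| <= t * Jw + s * ke ->
  ga <= A1 + A4 -> gb <= A2 + A5 -> hd <= A3 + A6 -> ke <= B * Jv ->
  `|- a - a' + eta * d + e + f| <= t * ((2 + eta) * Jw) + s * ((2 + eta + B) * Jv) +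
    ((s * A1 + t * A2 + t * A3) + (s * A4 + t * A5 + t * A6)).
Proof.
move=> t0 s0 h1 h2 h3 h4 h5 g1 g2 g3 g4.
have g1' := ler_wpM2l s0 g1; have g2' := ler_wpM2l t0 g2; have g3' := ler_wpM2l t0 g3; have g4' := ler_wpM2l s0 g4.
have h3' := ler_wpM2l eta0 h3.
have := ler_normD (- a - a' + eta * d + e) f; have := ler_normD (- a - a' + eta * d) e.
have := ler_normD (- a - a') (eta * d); have := ler_normB (- a) a'; rewrite normrN normrM (ger0_norm eta0).
lra.
Qed.

Definition Kcont : R := 3 + eta + Bb ^+ 2 + M0 ^+ 2 + 2 * Ce + 2 * (Bb ^+ 2 * Ce).

(** Continuity in additive form: the weight [t] stays free until the stability argument, and no
    square roots of energies appear. *)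
Lemma BDG_le (t : R) w v : deg_le N w -> deg_le N v -> 0 < t ->
  `|BDG b c eta w v| <= t * (Kcont * (Energy w + Mass w)) + t^-1 * (Kcont * (Energy v + Mass v)).
Proof.
move=> hw hv t0; rewrite BDG_expand; set s := t^-1; have s0 : 0 < s by rewrite invr_gt0.
have [tn sn] : 0 <= t /\ 0 <= s by rewrite !ltW.
have V : `|\sum_k VK k (w k) (v k)| <= t * (Gradient w + 2 * Mass w) + s * ((1 + Bb ^+ 2) * Gradient v + M0 ^+ 2 * Mass v).
  apply: (le_trans (ler_norm_sum _ _ _)).
  apply: (@le_trans _ _ (\sum_k (t * (Gk k (w k) + 2 * L2_elt k (w k)) + s * ((1 + Bb ^+ 2) * Gk k (v k) + M0 ^+ 2 * L2_elt k (v k))))).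
    by apply: ler_sum => k _; exact: VK_le.
  rewrite le_eqVlt; apply/orP; left; apply/eqP; rewrite /Gradient /Mass !mulrDr !mulr_sumr -!big_split /=.
  by apply: eq_bigr => k _; rewrite /Gk; ring.
pose A k : R := s * (Ce / 2 * Gk k (v k)) + t * (Ce / 2 * Gk k (w k)) + t * (Bb ^+ 2 * Ce / 2 * L2_elt k (w k)).
have Gk0 k q : 0 <= Gk k q by rewrite addr_ge0 ?L2_elt_ge0.
have [C2 BC2] : 0 <= Ce / 2 /\ 0 <= Bb ^+ 2 * Ce / 2.
  by rewrite !divr_ge0 // ?mulr_ge0 ?sqr_ge0 // ltW.
have E : `|\sum_ki \sum_(lj | inner ki lj) EI ki lj w v| <=
  \sum_ki \sum_(lj | inner ki lj) (t * ((2 + eta) * ijump w ki lj) + s * ((2 + eta + Bb ^+ 2) * ijump v ki lj)) + 3 * \sum_k A k.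
  apply: (sum_inner_le adm) => [k|ki lj il].
    by apply: addr_ge0; [apply: addr_ge0|]; apply: mulr_ge0 => //; apply: mulr_ge0; rewrite ?L2_elt_ge0.
  have y1 := ip_young t0 (bm_sj w ki lj) (bm_Gn v ki lj).
  have y2 := ip_young t0 (bm_Gn w ki lj) (bm_sj v ki lj).
  have y3 := ip_young t0 (bm_sj w ki lj) (bm_sj v ki lj).
  have y4 := ip_young t0 (bm_Hb w ki lj) (bm_sj v ki lj).
  have y5 := ip_young t0 (bm_sj w ki lj) (bmM (bm_kp ki) (bm_sj v ki lj)).
  rewrite !sj_ijump in y1 y2 y3 y4 y5.
  have kl := kp_le ki (bm_sj v ki lj); rewrite sj_ijump in kl.
  exact: (EI_arith tn sn y1 y2 y3 y4 y5 (Gn_le hv il) (Gn_le hw il) (Hb_le hw il) kl).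
have D : `|\sum_(ki | ~~ has_nb ki) EB ki w v| <=
  \sum_(ki | ~~ has_nb ki) (t * ((2 + eta) * trace ki.1 ki.2 (w ki.1)) + s * ((2 + eta + Bb ^+ 2) * trace ki.1 ki.2 (v ki.1))).
  apply: sum_bd_le => ki _; rewrite /EB -!tc_trace.
  have y1 := ip_young t0 (bm_tc w ki) (bm_tc v ki).
  have y2 := ip_young t0 (bm_tc w ki) (bmM (bm_kp ki) (bm_tc v ki)).
  have kl := ler_wpM2l sn (kp_le ki (bm_tc v ki)).
  have p1 : 0 <= t * ip (tc w ki) (tc w ki) by rewrite tc_trace mulr_ge0 // trace_ge0.
  have p2 : 0 <= s * ip (tc v ki) (tc v ki) by rewrite tc_trace mulr_ge0 // trace_ge0.
  have y1' := ler_wpM2l eta0 y1.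
  apply: (le_trans (ler_normD _ _)); rewrite normrM (ger0_norm eta0).
  rewrite -/s in y1' y2; move: kl p1 p2 y1' y2; set p := ip (tc w ki) (tc w ki); set q := ip (tc v ki) (tc v ki).
  set r := ip _ (fun t0 => kp ki t0 * tc v ki t0); set z := ip _ (fun t0 => kp ki t0 * tc v ki t0).
  move=> *; lra.
have E1 (al be : R) (f g : SS -> SS -> R) : \sum_ki \sum_(lj | inner ki lj) (t * (al * f ki lj) + s * (be * g ki lj)) =
   t * (al * \sum_ki \sum_(lj | inner ki lj) f ki lj) + s * (be * \sum_ki \sum_(lj | inner ki lj) g ki lj).
  by rewrite !mulr_sumr -big_split; apply: eq_bigr => ki _; rewrite !mulr_sumr -big_split.
have E2 (al be : R) (f g : SS -> R) : \sum_(ki | ~~ has_nb ki) (t * (al * f ki) + s * (be * g ki)) =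
   t * (al * \sum_(ki | ~~ has_nb ki) f ki) + s * (be * \sum_(ki | ~~ has_nb ki) g ki).
  by rewrite !mulr_sumr -big_split.
have E3 : \sum_k A k = s * (Ce / 2 * Gradient v) + t * (Ce / 2 * Gradient w) + t * (Bb ^+ 2 * Ce / 2 * Mass w).
  by rewrite /Gradient /Mass !mulr_sumr -!big_split.
rewrite E1 E3 in E; rewrite E2 in D.
have fin (g m j l g' m' j' l' B K : R) : 0 <= g -> 0 <= m -> 0 <= j -> 0 <= l -> 0 <= g' -> 0 <= m' -> 0 <= j' -> 0 <= l' -> 0 <= B ->
  K = 3 + eta + B + M0 ^+ 2 + 2 * Ce + 2 * (B * Ce) ->
  (t * (g + 2 * m) + s * ((1 + B) * g' + M0 ^+ 2 * m')) +
  ((t * ((2 + eta) * j) + s * ((2 + eta + B) * j') + 3 * (s * (Ce / 2 * g') + t * (Ce / 2 * g) + t * (B * Ce / 2 * m))) +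
   (t * ((2 + eta) * l) + s * ((2 + eta + B) * l'))) <=
  t * (K * ((g + (j + l)) + m)) + s * (K * ((g' + (j' + l')) + m')).
  move=> g0 m0 j0 l0 g'0 m'0 j'0 l'0 B0 hK; rewrite -subr_ge0.
  have -> : t * (K * (g + (j + l) + m)) + s * (K * (g' + (j' + l') + m')) -
    ((t * (g + 2 * m) + s * ((1 + B) * g' + M0 ^+ 2 * m')) +
    ((t * ((2 + eta) * j) + s * ((2 + eta + B) * j') + 3 * (s * (Ce / 2 * g') + t * (Ce / 2 * g) + t * (B * Ce / 2 * m))) +
     (t * ((2 + eta) * l) + s * ((2 + eta + B) * l')))) =
    t * ((K - 1 - 3 * Ce / 2) * g + (K - 2 - 3 * (B * Ce) / 2) * m + (K - 2 - eta) * (j + l)) +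
    s * ((K - 1 - B - 3 * Ce / 2) * g' + (K - M0 ^+ 2) * m' + (K - 2 - eta - B) * (j' + l')) by field.
  have BC0 : 0 <= B * Ce by rewrite mulr_ge0 // ltW.
  have MM : 0 <= M0 ^+ 2 := sqr_ge0 _; have Cn := ltW Ce0; have en := eta0.
  have [c1 c2 c3 c4 [c5 c6]] := continuity_constant en B0 MM Cn BC0 hK.
  by apply: addr_ge0; apply: mulr_ge0 => //; apply: addr_ge0; [apply: addr_ge0| |apply: addr_ge0|]; apply: mulr_ge0 => //; exact: addr_ge0.
have Ji u : 0 <= \sum_ki \sum_(lj | inner ki lj) ijump u ki lj by apply: sumr_ge0 => ki _; apply: sumr_ge0 => lj _; exact: ijump_ge0.
have Jb u : 0 <= \sum_(ki | ~~ has_nb ki) trace ki.1 ki.2 (u ki.1) by apply: sumr_ge0 => ki _; exact: trace_ge0.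
have F := fin _ _ _ _ _ _ _ _ _ Kcont (Gradient_ge0 w) (Mass_ge0 w) (Ji w) (Jb w) (Gradient_ge0 v) (Mass_ge0 v) (Ji v) (Jb v) (sqr_ge0 Bb) erefl.
apply: (le_trans (ler_normD _ _)); apply: (le_trans (lerD V (le_trans (ler_normD _ _) (lerD E D)))).
rewrite /Energy /Jump; apply: F.
Qed.

Lemma derive_square q x (a : R * R) :
  'D_a (ev (q * q)) x = 2 * (ev q x * (a.1 * ev (d1 q) x + a.2 * ev (d2 q) x)).
Proof.
have H : is_derive x a (ev q * ev q) (ev q x *: (a.1 * ev (d1 q) x + a.2 * ev (d2 q) x) + ev q x *: (a.1 * ev (d1 q) x + a.2 * ev (d2 q) x)).
  by apply: is_deriveM; exact: is_derive_ev.
have -> : ev (q * q) = ev q * ev q by apply/funext => y; rewrite evM.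
by case: H => _ ->; rewrite /GRing.scale /=; ring.
Qed.

Definition vanishing v := forall ki, ~~ has_nb ki -> forall t, 0 <= t <= 1 -> ev (v ki.1) (ept ki.1 ki.2 t) = 0.

Definition cv v k : R := \int[leb2]_(x in tri_int (vtx k)) (ev (v k) x * ((b x).1 * ev (d1 (v k)) x + (b x).2 * ev (d2 (v k)) x)).

(** Integration by parts of the derivative of v^2 along [b]: the boundary terms vanish, and on inner
    edges the jump of v^2 is twice jump times average, so the edge terms are exactly the central
    convection term [Hb] of the form. Volume and edge convection together leave only div b / 2. *)
Lemma convection v (g1 g2 : R * R -> R) : vanishing v ->
  (forall k, measurable_fun (tri_int (vtx k)) g1) -> (forall k, measurable_fun (tri_int (vtx k)) g2) ->
  (exists B : R, {ae leb2, forall x, U x -> `|g1 x| <= B}) -> (exists B : R, {ae leb2, forall x, U x -> `|g2 x| <= B}) ->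
  weak_derivative U e1 (fun x => (b x).1) g1 -> weak_derivative U e2 (fun x => (b x).2) g2 ->
  2 * \sum_k cv v k + \sum_k (\int[leb2]_(x in tri_int (vtx k)) (g1 x * ev (v k) x ^+ 2) + \int[leb2]_(x in tri_int (vtx k)) (g2 x * ev (v k) x ^+ 2)) =
  2 * \sum_ki \sum_(lj | inner ki lj) ip (Hb v ki lj) (sj v ki lj).
Proof.
move=> hz m1 m2 B1 B2 w1 w2.
have I1 := ibp_sum adm v TU cb1 m1 B1 w1; have I2 := ibp_sum adm v TU cb2 m2 B2 w2.
have Z (f : R * R -> R) (a : R * R) : \sum_(ki | ~~ has_nb ki) len ki.1 ki.2 * dot (nrm ki) a *
     \int[leb1]_(t in I) (f (ept ki.1 ki.2 t) * ev (v ki.1) (ept ki.1 ki.2 t) ^+ 2) = 0.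
  apply: big1 => ki hn; rewrite [X in _ * X](_ : _ = 0) ?mulr0 //.
  rewrite -[RHS](@Rint1_cst R 0); apply: eq_Rintegral => t; rewrite inE /= in_itv /= => tI.
  by rewrite (hz ki hn t tI) expr0n mulr0.
have Z1 := Z (fun x => (b x).1) e1; have Z2 := Z (fun x => (b x).2) e2; cbv beta in Z1, Z2.
rewrite Z1 add0r in I1; rewrite Z2 add0r in I2.
have -> : 2 * \sum_ki \sum_(lj | inner ki lj) ip (Hb v ki lj) (sj v ki lj) =
  \sum_ki \sum_(lj | inner ki lj) len ki.1 ki.2 * dot (nrm ki) e1 *
     \int[leb1]_(t in I) ((b (ept ki.1 ki.2 t)).1 * (ev (v ki.1) (ept ki.1 ki.2 t) ^+ 2 - ev (v lj.1) (ept ki.1 ki.2 t) ^+ 2)) +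
  \sum_ki \sum_(lj | inner ki lj) len ki.1 ki.2 * dot (nrm ki) e2 *
     \int[leb1]_(t in I) ((b (ept ki.1 ki.2 t)).2 * (ev (v ki.1) (ept ki.1 ki.2 t) ^+ 2 - ev (v lj.1) (ept ki.1 ki.2 t) ^+ 2)).
  rewrite mulr_sumr -big_split; apply: eq_bigr => ki _; rewrite mulr_sumr -big_split; apply: eq_bigr => lj _ /=.
  have bs : bm I (fun t => ev (v ki.1) (ept ki.1 ki.2 t) ^+ 2 - ev (v lj.1) (ept ki.1 ki.2 t) ^+ 2) by apply: bmB; apply: bmX; exact: bm_trace.
  have bb1 := bmM (bm_trace_comp adm ki.2 (@cb1 ki.1)) bs; have bb2 := bmM (bm_trace_comp adm ki.2 (@cb2 ki.1)) bs.
  rewrite -(Rint1Z _ bb1) -(Rint1Z _ bb2) -(Rint1D (bmZ _ bb1) (bmZ _ bb2)) /ip -Rint1Z; last exact: bmM.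
  by apply: eq_Rintegral => t _; rewrite /Hb /sj /bn /dot /e1 /e2 /=; field.
rewrite -I1 -I2 mulr_sumr -!big_split; apply: eq_bigr => k _ /=.
have bb1 := bmM (bm_b1 k) (bmM (bm_ev_int k (v k)) (bm_ev_int k (d1 (v k)))).
have bb2 := bmM (bm_b2 k) (bmM (bm_ev_int k (v k)) (bm_ev_int k (d2 (v k)))).
have -> : cv v k = \int[leb2]_(x in tri_int (vtx k)) ((b x).1 * (ev (v k) x * ev (d1 (v k)) x)) +
   \int[leb2]_(x in tri_int (vtx k)) ((b x).2 * (ev (v k) x * ev (d2 (v k)) x)).
  by rewrite -(Rint2D (@Tm k) (Tf k) bb1 bb2); apply: eq_Rintegral => x _; ring.
have H1 : \int[leb2]_(x in tri_int (vtx k)) ((b x).1 * 'D_e1 (ev (v k * v k)) x) = 2 * \int[leb2]_(x in tri_int (vtx k)) ((b x).1 * (ev (v k) x * ev (d1 (v k)) x)).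
  by rewrite -(Rint2Z (@Tm k) (Tf k) _ bb1); apply: eq_Rintegral => x _; rewrite derive_square /e1 /=; ring.
have H2 : \int[leb2]_(x in tri_int (vtx k)) ((b x).2 * 'D_e2 (ev (v k * v k)) x) = 2 * \int[leb2]_(x in tri_int (vtx k)) ((b x).2 * (ev (v k) x * ev (d2 (v k)) x)).
  by rewrite -(Rint2Z (@Tm k) (Tf k) _ bb2); apply: eq_Rintegral => x _; rewrite derive_square /e2 /=; ring.
have H3 (g : R * R -> R) : \int[leb2]_(x in tri_int (vtx k)) (g x * ev (v k) x ^+ 2) = \int[leb2]_(x in tri_int (vtx k)) (g x * ev (v k * v k) x).
  by apply: eq_Rintegral => x _; rewrite evM expr2.
rewrite H1 H2 !H3; ring.
Qed.

Definition rc v k : R := \int[leb2]_(x in tri_int (vtx k)) (ev (v k) x * (clamp M0 c x * ev (v k) x)).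

Lemma kp_ge0 ki t : 0 <= kp ki t.
Proof. by rewrite mulr_ge0 // divr_ge0 // lenp. Qed.

Lemma coer_arith (G J X H W Y Rr S : R) : 0 <= G -> 0 <= J -> 24 * Ce + 1 <= eta -> 2 * X + W = 2 * H ->
  - ((G + J) / 4) <= Rr + W / 2 -> Y <= 12 * Ce * J + 8^-1 * G -> - 2 * Y + eta * J + H <= S ->
  (G + J) / 4 <= G - X + Rr + S.
Proof.
move=> G0 J0 he h1 h2 h3 h4; have h5 : (24 * Ce + 1) * J <= eta * J by apply: ler_wpM2r.
lra.
Qed.

(** The consistency term [Y] is bounded by 12 Ce J + G/8. It occurs twice and costs 24 Ce J, paid by
    the penalty, and G/4; the indefinite reaction costs another (G + J)/4. Hence eta >= 24 Ce + 1
    leaves at least a quarter of the energy. The upwind term has a sign and is dropped. *)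
Lemma BDG_coercive v (g1 g2 : R * R -> R) : deg_le N v -> vanishing v ->
  (forall k, measurable_fun (tri_int (vtx k)) g1) -> (forall k, measurable_fun (tri_int (vtx k)) g2) ->
  (exists B : R, {ae leb2, forall x, U x -> `|g1 x| <= B}) -> (exists B : R, {ae leb2, forall x, U x -> `|g2 x| <= B}) ->
  weak_derivative U e1 (fun x => (b x).1) g1 -> weak_derivative U e2 (fun x => (b x).2) g2 ->
  24 * Ce + 1 <= eta ->
  - (Energy v / 4) <= \sum_k rc v k + (\sum_k (\int[leb2]_(x in tri_int (vtx k)) (g1 x * ev (v k) x ^+ 2) +
     \int[leb2]_(x in tri_int (vtx k)) (g2 x * ev (v k) x ^+ 2))) / 2 ->
  Energy v / 4 <= BDG b c eta v v.
Proof.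
move=> hv hz m1 m2 B1 B2 w1 w2 he HR; have cvE := convection hz m1 m2 B1 B2 w1 w2.
have tc0 ki : ~~ has_nb ki -> forall f, ip (tc v ki) f = 0.
  move=> hn f; rewrite -[RHS](@Rint1_cst R 0); apply: eq_Rintegral => t; rewrite inE /= in_itv /= => tI.
  by rewrite /tc (hz ki hn t tI) mul0r.
have EB0 : \sum_(ki | ~~ has_nb ki) EB ki v v = 0 by apply: big1 => ki hn; rewrite /EB !tc0 // mulr0 addr0.
have Jb0 : \sum_(ki | ~~ has_nb ki) trace ki.1 ki.2 (v ki.1) = 0 by apply: big1 => ki hn; rewrite -tc_trace tc0.
rewrite BDG_expand EB0 addr0.
have VE : \sum_k VK k (v k) (v k) = Gradient v - \sum_k cv v k + \sum_k rc v k.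
  rewrite -sumrB -big_split; apply: eq_bigr => k _ /=; congr (_ - _ + _).
  by congr (_ + _); rewrite -L2_int; apply: eq_Rintegral => x _; rewrite expr2.
rewrite VE; pose J : R := \sum_ki \sum_(lj | inner ki lj) ijump v ki lj.
pose Y : R := \sum_ki \sum_(lj | inner ki lj) ip (sj v ki lj) (Gn v ki lj).
pose H : R := \sum_ki \sum_(lj | inner ki lj) ip (Hb v ki lj) (sj v ki lj).
have J0 : 0 <= J by apply: sumr_ge0 => ki _; apply: sumr_ge0 => lj _; exact: ijump_ge0.
have EJ : Energy v = Gradient v + J by rewrite /Energy /Jump Jb0 addr0.
rewrite EJ in HR *.
have HY : Y <= 12 * Ce * J + 8^-1 * Gradient v.
  (* With this weight, three sides times Ce/2 divided by 12 Ce is the 1/8 in front of the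
     gradient. *)
  have t0 : 0 < 12 * Ce by rewrite mulr_gt0.
  have Gk0 k q : 0 <= Gk k q by rewrite addr_ge0 ?L2_elt_ge0.
  pose A k : R := (12 * Ce)^-1 * (Ce / 2 * Gk k (v k)).
  have h : `|Y| <= \sum_ki \sum_(lj | inner ki lj) (12 * Ce * ijump v ki lj) + 3 * \sum_k A k.
    apply: (sum_inner_le adm) => [k|ki lj il].
      by rewrite /A mulr_ge0 ?invr_ge0 ?(ltW t0) // mulr_ge0 // divr_ge0 // ltW.
    have := ip_young t0 (bm_sj v ki lj) (bm_Gn v ki lj); rewrite sj_ijump => /le_trans; apply.
    by rewrite lerD2l /A -mulrDr ler_pM2l ?invr_gt0 //; exact: Gn_le.
  apply: (le_trans (ler_norm _)); apply: (le_trans h); rewrite le_eqVlt; apply/orP; left; apply/eqP; congr (_ + _).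
    by rewrite /J mulr_sumr; apply: eq_bigr => ki _; rewrite mulr_sumr.
  rewrite /Gradient !mulr_sumr; apply: eq_bigr => k _; rewrite /A /Gk; field; rewrite gt_eqF //.
apply: (coer_arith (Gradient_ge0 v) J0 he cvE HR HY).
rewrite /Y /J /H !mulr_sumr -!big_split; apply: ler_sum => ki _ /=.
rewrite !mulr_sumr -!big_split; apply: ler_sum => lj _ /=; rewrite /EI sj_ijump [ip (Gn _ _ _) _]ipC.
have k0 : 0 <= ip (sj v ki lj) (fun t => kp ki t * sj v ki lj t).
  by apply: Rintegral_ge0 => t _; rewrite mulrCA -expr2 mulr_ge0 ?sqr_ge0 // kp_ge0.
lra.
Qed.

(** On Omega, c + div b / 2 is nonnegative. Elsewhere it is at least -2 M0, which 4 M0 times the sum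
    of the [g m] compensates because that sum is at least 1/2 there. This correction is then
    estimated by [ibp_bound] through the primitives [G m] of size [F]. *)
Lemma reaction v (g1 g2 : R * R -> R) (T : eqType) (s : seq T) (G g : T -> R * R -> R) (a : T -> R * R) (F : R) :
  deg_le N v ->
  (forall k, measurable_fun (tri_int (vtx k)) g1) -> (forall k, measurable_fun (tri_int (vtx k)) g2) ->
  {ae leb2, forall x, U x -> `|g1 x| <= M0} -> {ae leb2, forall x, U x -> `|g2 x| <= M0} ->
  {ae leb2, forall x, Omega x -> 0 <= c x + (g1 x + g2 x) / 2} -> 0 < F ->
  (forall m, [/\ a m = e1 \/ a m = e2, weak_derivative setT (a m) (G m) (g m), continuous (G m), continuous (g m) &
        forall x, `|G m x| <= F /\ 0 <= g m x <= 1]) ->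
  (forall k x, tri_int (vtx k) x -> ~ Omega x -> 2^-1 <= \sum_(m <- s) g m x) ->
  - (4 * M0 * ((size s)%:R * (F * ((4 + 6 * Ce) * (Mass v + Energy v))))) <=
  \sum_k rc v k + (\sum_k (\int[leb2]_(x in tri_int (vtx k)) (g1 x * ev (v k) x ^+ 2) +
     \int[leb2]_(x in tri_int (vtx k)) (g2 x * ev (v k) x ^+ 2))) / 2.
Proof.
move=> hv m1 m2 B1 B2 Oc F0 hG hS.
pose S (x : R * R) : R := \sum_(m <- s) g m x.
have g0 m x : 0 <= g m x by case: (hG m) => _ _ _ _ /(_ x)[_ /andP[]].
have S0 x : 0 <= S x by apply: sumr_ge0.
have bq k : bm (tri_int (vtx k)) (fun x => ev (v k) x ^+ 2) by apply: bmX.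
have bg k m : bm (tri_int (vtx k)) (g m).
  apply: bm_int; apply: bm_cont; [exact: (tri_compact (d0 k))|].
  by apply: continuous_subspaceT; case: (hG m).
have bS k : bm (tri_int (vtx k)) S by apply: bm_sum.
have X k : - (4 * M0) * \sum_(m <- s) \int[leb2]_(x in tri_int (vtx k)) (g m x * ev (v k) x ^+ 2) <=
   rc v k + 2^-1 * (\int[leb2]_(x in tri_int (vtx k)) (g1 x * ev (v k) x ^+ 2) + \int[leb2]_(x in tri_int (vtx k)) (g2 x * ev (v k) x ^+ 2)).
  have mT := @Tm k; have fT := Tf k.
  rewrite (Rint_clamp mT (@TU k) M00 (m1 k) B1 (bq k)) (Rint_clamp mT (@TU k) M00 (m2 k) B2 (bq k)).
  have -> : \sum_(m <- s) \int[leb2]_(x in tri_int (vtx k)) (g m x * ev (v k) x ^+ 2) = \int[leb2]_(x in tri_int (vtx k)) (S x * ev (v k) x ^+ 2).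
    rewrite -(Rint2_sum mT fT) => [|m _]; last exact: bmM.
    by apply: eq_Rintegral => x _; rewrite /S mulr_suml.
  rewrite -(Rint2Z mT fT _ (bmM (bS k) (bq k))).
  have b0 := bmM (bm_c k) (bq k); have b1 := bmM (bm_clamp M00 (m1 k)) (bq k); have b2 := bmM (bm_clamp M00 (m2 k)) (bq k).
  have -> : rc v k = \int[leb2]_(x in tri_int (vtx k)) (clamp M0 c x * ev (v k) x ^+ 2).
    by apply: eq_Rintegral => x _; ring.
  rewrite -(Rint2D mT fT b1 b2) -(Rint2Z mT fT _ (bmD b1 b2)) -(Rint2D mT fT b0 (bmZ _ (bmD b1 b2))).
  apply: (Rint2_ae_le mT fT); [by apply: bmZ; exact: bmM|by apply: bmD => //; apply: bmZ; exact: bmD|].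
  apply: leb2_ae_imp (leb2_ae_and cB (leb2_ae_and B1 (leb2_ae_and B2 Oc))) => x [h1 [h2 [h3 h4]]] Tx.
  have Ux : U x := TU Tx.
  rewrite -subr_ge0 (_ : _ - _ = ev (v k) x ^+ 2 * (clamp M0 c x + (clamp M0 g1 x + clamp M0 g2 x) / 2 + 4 * (M0 * S x))); last by field.
  apply: mulr_ge0; first exact: sqr_ge0.
  have MS : 0 <= M0 * S x by rewrite mulr_ge0.
  case: (pselect (Omega x)) => Ox.
    by rewrite !clamp_id ?h1 ?h2 ?h3 //; have := h4 Ox; lra.
  have := clamp_le c x M00; have := clamp_le g1 x M00; have := clamp_le g2 x M00; rewrite !ler_norml.
  have : M0 * 2^-1 <= M0 * S x by apply: ler_wpM2l => //; exact: hS Tx Ox.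
  by move=> ? /andP[? _] /andP[? _] /andP[? _]; lra.
apply: (@le_trans _ _ (\sum_k (- (4 * M0) * \sum_(m <- s) \int[leb2]_(x in tri_int (vtx k)) (g m x * ev (v k) x ^+ 2)))); last first.
  by rewrite [_ / 2]mulrC mulr_sumr -big_split; apply: ler_sum => k _; exact: X.
rewrite -mulr_sumr mulNr lerN2; apply: ler_wpM2l; first by rewrite mulr_ge0.
rewrite exchange_big /=.
have H m : \sum_k \int[leb2]_(x in tri_int (vtx k)) (g m x * ev (v k) x ^+ 2) <= F * ((4 + 6 * Ce) * (Mass v + Energy v)).
  have [ha wd cG cg hb] := hG m.
  have t1 : (0 : R) < (1 : R) <= (1 : R) by apply/andP; split; lra.
  have ex : exists B : R, {ae leb2, forall x, setT x -> `|g m x| <= B}.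
    by exists 1; apply: aeW => x _; case: (hb x) => _ /andP[h1 h2]; rewrite ger0_norm.
  have := ibp_bound adm rho0 mu0 hm1 Ce0 LE ha hv (fun k x _ => Logic.I) (fun k => continuous_subspaceT cG)
    (fun k => (bg k m).1) ex wd F0 (fun k x _ => (hb x).1) t1.
  by move=> /(le_trans (ler_norm _)); rewrite invr1 !mul1r -mulrDr.
have cst (z : R) (l : seq T) : \sum_(m <- l) z = (size l)%:R * z.
  by elim: l => [|m l IH]; rewrite ?big_nil ?mul0r // big_cons IH /= -natr1 mulrDl mul1r addrC.
by rewrite -cst; apply: ler_sum => m _; exact: H.
Qed.

Lemma jsq ki (r : R) : enorm (r *: nrm ki) ^+ 2 = r ^+ 2.
Proof.
by rewrite enormZ [enorm (nrm ki)](_ : _ = 1) ?mulr1 ?real_normK ?num_real // /enorm (nrm_unit adm) sqrtr1.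
Qed.

Lemma jump_term ki o (F : R * R -> R) (f : R -> R) : (forall t, F (ept ki.1 ki.2 t) = f t ^+ 2) ->
  (elen (ki, o))^-1 * edge_integral (ki, o) F = \int[leb1]_(t in I) f t ^+ 2.
Proof.
case: ki => k i /= hF; have l0 := len_gt0 d0 k i.
rewrite /edge_integral /elen /= mulrA mulVf ?gt_eqF // mul1r.
by apply: eq_Rintegral => t _; exact: hF.
Qed.

Lemma kappa_term ki o (F : R * R -> R) (f : R -> R) : bm I f -> (forall t, F (ept ki.1 ki.2 t) = `|bn ki t| * f t ^+ 2) ->
  0 <= 2^-1 * edge_integral (ki, o) F <= Bb * \int[leb1]_(t in I) f t ^+ 2.
Proof.
case: ki => k i bf hF; have l0 := lenp (k, i); have l1 := len_le1 hm1 k i; rewrite /= in l0.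
have E : edge_integral (k, i, o) F = len k i * \int[leb1]_(t in I) (`|bn (k, i) t| * f t ^+ 2).
  by rewrite /edge_integral; congr (_ * _); apply: eq_Rintegral => t _; exact: hF.
have i0 : 0 <= \int[leb1]_(t in I) (`|bn (k, i) t| * f t ^+ 2).
  by apply: Rintegral_ge0 => t _; rewrite mulr_ge0 // sqr_ge0.
have i1 : \int[leb1]_(t in I) (`|bn (k, i) t| * f t ^+ 2) <= Bb * \int[leb1]_(t in I) f t ^+ 2.
  rewrite -Rint1Z; last exact: bmX.
  apply: Rint1_le; [by apply: bmM; [apply: bm_norm; exact: bm_bn|exact: bmX]|by apply: bmZ; exact: bmX|].
  by move=> t tI; apply: ler_wpM2r; [exact: sqr_ge0|exact: bn_le].
rewrite E; apply/andP; split; first by rewrite !mulr_ge0.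
apply: le_trans i1; rewrite mulrA ler_piMl //; lra.
Qed.

(** Second derivatives go to the gradient by inverse estimates and the convection part to the jumps
    by [Bb]; the lower bound by the mass provides definiteness. *)
Lemma DGnorm_le u : deg_le N u ->
  DGnorm b u ^+ 2 <= Mass u + (1 + 2 * Ce) * Gradient u + (1 + Bb) * Jump u /\ Mass u <= DGnorm b u ^+ 2.
Proof.
move=> hu; rewrite /DGnorm; set X := (X in Num.sqrt X).
pose T k : R := hk k ^+ 2 * (L2_elt k (d1 (d1 (u k))) + L2_elt k (d1 (d2 (u k))) + L2_elt k (d2 (d2 (u k)))).
pose KI : R := \sum_ki \sum_(lj | inner ki lj) 2^-1 * edge_integral (ki, Some lj.1) (fun x => enorm (Num.sqrt `|dot (b x) (unit_normal (ki, Some lj.1))| *: jump u (ki, Some lj.1) x) ^+ 2).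
pose KB : R := \sum_(ki | ~~ has_nb ki) 2^-1 * edge_integral (ki, None) (fun x => enorm (Num.sqrt `|dot (b x) (unit_normal (ki, None : option 'I_(nel M)))| *: jump u (ki, None) x) ^+ 2).
have XE : X = Mass u + Gradient u + \sum_k T k + Jump u + (KI + KB).
  rewrite /X !(sum_Eh _) !(sum_Gamma0 adm) !(sum_GammaB adm) -/KI -/KB; congr (_ + _ + _).
    by rewrite /Mass /Gradient -!big_split.
  congr (_ + _).
    by apply: eq_bigr => -[k i] _; apply: eq_bigr => -[l j] _; apply: (jump_term (ki := (k, i))) => t; exact: (jsq (k, i)).
  by apply: eq_bigr => -[k i] _; apply: (jump_term (ki := (k, i))) => t; exact: (jsq (k, i)).
have sq (z y : R) ki t : enorm (Num.sqrt `|dot (b (ept ki.1 ki.2 t)) (nrm ki)| *: (y *: nrm ki)) ^+ 2 = `|bn ki t| * y ^+ 2.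
  by rewrite scalerA jsq exprMn sqr_sqrtr //; case: ki => k i; rewrite bnE.
have KIb ki lj : 0 <= 2^-1 * edge_integral (ki, Some lj.1) (fun x => enorm (Num.sqrt `|dot (b x) (unit_normal (ki, Some lj.1))| *: jump u (ki, Some lj.1) x) ^+ 2) <= Bb * ijump u ki lj.
  case: ki lj => k i [l j]; apply: (kappa_term (ki := (k, i)) _ (bm_sj u (k, i) (l, j))) => t; exact: (sq 0 _ (k, i)).
have KBb ki : 0 <= 2^-1 * edge_integral (ki, None) (fun x => enorm (Num.sqrt `|dot (b x) (unit_normal (ki, None : option 'I_(nel M)))| *: jump u (ki, None) x) ^+ 2) <= Bb * trace ki.1 ki.2 (u ki.1).
  case: ki => k i; apply: (kappa_term (ki := (k, i)) _ (bm_tc u (k, i))) => t; exact: (sq 0 _ (k, i)).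
have K0 : 0 <= KI + KB.
  apply: addr_ge0; first by apply: sumr_ge0 => ki _; apply: sumr_ge0 => lj _; case/andP: (KIb ki lj).
  by apply: sumr_ge0 => ki _; case/andP: (KBb ki).
have K1 : KI + KB <= Bb * Jump u.
  rewrite /Jump mulrDr; apply: lerD.
    rewrite mulr_sumr; apply: ler_sum => ki _; rewrite mulr_sumr; apply: ler_sum => lj _; by case/andP: (KIb ki lj).
  by rewrite mulr_sumr; apply: ler_sum => ki _; case/andP: (KBb ki).
have T0 : 0 <= \sum_k T k by apply: sumr_ge0 => k _; rewrite mulr_ge0 ?sqr_ge0 // !addr_ge0 // L2_elt_ge0.
have T1 : \sum_k T k <= 2 * Ce * Gradient u.
  rewrite /Gradient mulr_sumr; apply: ler_sum => k _; have sh := adm_shape adm rho0 mu0 k.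
  have [_ p1 _ _] := LE sh (total_degree_d1 (hu k)); have [_ p2 p3 _] := LE sh (total_degree_d2 (hu k)).
  have q1 := L2_elt_ge0 k (d1 (u k)); have Cq : 0 <= Ce * L2_elt k (d1 (u k)) by rewrite mulr_ge0 // ltW.
  have {}p1 : hk k ^+ 2 * L2_elt k (d1 (d1 (u k))) <= Ce * L2_elt k (d1 (u k)) := p1.
  have {}p2 : hk k ^+ 2 * L2_elt k (d1 (d2 (u k))) <= Ce * L2_elt k (d2 (u k)) := p2.
  have {}p3 : hk k ^+ 2 * L2_elt k (d2 (d2 (u k))) <= Ce * L2_elt k (d2 (u k)) := p3.
  rewrite /T !mulrDr; apply: (le_trans (lerD (lerD p1 p2) p3)).
  move: Cq; set p := L2_elt k (d1 (u k)); set q := L2_elt k (d2 (u k)) => Cq.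
  have -> : 2 * Ce * p + 2 * Ce * q = Ce * p + Ce * q + Ce * q + Ce * p by ring.
  by rewrite lerDl.
have [m0 g0 j0] := And3 (Mass_ge0 u) (Gradient_ge0 u) (Jump_ge0 u).
rewrite sqr_sqrtr; last by rewrite XE; lra.
rewrite XE; split; lra.
Qed.

End Bilinear_form.

(** * Comparison of W_h and V_h through nodal values *)

Section Interpolation.
Context {R : realType}.
Variables (M : mesh R) (Omega : set (R * R)) (rho mu C : R) (N : nat) (nd : 'I_(Np N) -> R * R).
Hypothesis adm : admissible_mesh M Omega rho mu C.
Hypotheses (rho0 : 0 < rho) (mu0 : 0 < mu).
Hypothesis hnd : reference_nodes nd.
Implicit Types (k l : 'I_(nel M)) (i j : 'I_3) (n : 'I_(Np N)) (u w v : broken M) (q r : {poly {poly R}}).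

Variable Ce : R.
Hypothesis Ce0 : 0 < Ce.
Hypothesis LE : forall h (p : 'I_3 -> R * R), shape (rho / mu) h p -> forall w : {poly {poly R}}, total_degree_le N w ->
  let S q := \int[leb2]_(x in tri p) (ev q x ^+ 2) in
  [/\ forall x y, tri p y -> dist x y <= h -> ev w x ^+ 2 <= Ce / h ^+ 2 * S w,
      h ^+ 2 * S (d1 w) <= Ce * S w, h ^+ 2 * S (d2 w) <= Ce * S w &
      forall x y, tri p y -> dist x y <= h ->
        (ev w x - ev w y) ^+ 2 <= Ce * (dist x y / h) ^+ 2 * (S (d1 w) + S (d2 w))].

Variables (Cn e : R) (P : 'I_(nel M) -> 'I_(Np N) -> R * R).
Hypothesis Cn0 : 0 < Cn.
Hypothesis NE : forall kap h (p : 'I_3 -> R * R), shape kap h p -> forall w : {poly {poly R}}, total_degree_le N w ->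
  \int[leb2]_(x in tri p) (ev w x ^+ 2) <= Cn * h ^+ 2 * \sum_m ev w (refmap p (nd m)) ^+ 2.
Hypothesis e01 : 0 <= e <= 1.
Hypothesis DP : forall k i n, bd_edge k i -> inner_edge_node nd k i n -> dist (node nd k n) (P k n) <= e * hk k.

Let d0 k : tdet (vtx k) != 0 := adm_tdet adm k.
Let h0 k : 0 < hk k := hk_gt0 d0 k.

Lemma bary_kref (y : R * R) : [/\ bary kref 0 y = 1 - y.1 - y.2, bary kref 1 y = y.1 & bary kref 2 y = y.2].
Proof.
rewrite /bary tdet_kref !divr1 !I3_succ /cross /kref /=; split; ring.
Qed.

Lemma node_bary k i n : bary (vtx k) i (node nd k n) = bary kref i (nd n).
Proof. exact: (bary_refmap i (nd n) (d0 k)). Qed.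

Lemma node_elt k n : elt k (node nd k n).
Proof.
apply/(triP _ (d0 k)) => i; rewrite node_bary; have [b0 b1 b2] := bary_kref (nd n).
have [n1 n2 n3] := nodes_inside hnd n.
by have [->|->|->] := I3P i; rewrite ?b0 ?b1 ?b2 //; lra.
Qed.

Lemma edge_node k i n : edge k i (node nd k n) <-> bary kref i (nd n) = 0.
Proof.
rewrite -(node_bary k); split => [/edge_ept[t _ ->]|h]; first exact: (bary_ept d0).
by have [t tI ->] := bary_zero_ept d0 (node_elt k n) h; apply/edge_ept; exists t.
Qed.

Lemma nodes_injective : injective nd.
Proof.
move=> n m nm; have [_ /(_ (fun m => (m == n)%:R))[w _ hw]] := unisolvent_interpolation (nodes_unisolvent hnd).
have := hw n; rewrite nm hw eqxx; case: eqP => [//|_] /esym/eqP; by rewrite oner_eq0.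
Qed.

Lemma edge_card i : #|[set n | bary kref i (nd n) == 0]%SET| = N.+1.
Proof.
have [E|E|E] := I3P i; rewrite E.
- rewrite -(nodes_edge0 hnd); apply: eq_card => n; rewrite !inE; have [-> _ _] := bary_kref (nd n).
  by rewrite -addrA -opprD subr_eq0 eq_sym.
- by rewrite -(nodes_edge1 hnd); apply: eq_card => n; rewrite !inE; have [_ -> _] := bary_kref (nd n).
- by rewrite -(nodes_edge2 hnd); apply: eq_card => n; rewrite !inE; have [_ _ ->] := bary_kref (nd n).
Qed.

Lemma edge_poly k i q : total_degree_le N q ->
  exists2 p : {poly R}, (size p <= N.+1)%N & forall t, p.[t] = ev q (ept k i t).
Proof.
move=> hq; have pq : polyf N (ev q) by exists q.
have [p2 h2 E] := polyf_comp_affine (vb k i - va k i).1 0 (va k i).1 (vb k i - va k i).2 0 (va k i).2 pq.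
exists (\poly_(j < N.+1) p2`_j`_0); first exact: size_poly.
move=> t; rewrite horner_poly; have -> : ept k i t = ((vb k i - va k i).1 * (t, 0 : R).1 + 0 * (t, 0 : R).2 + (va k i).1,
   (vb k i - va k i).2 * (t, 0 : R).1 + 0 * (t, 0 : R).2 + (va k i).2).
  by apply: pair_eqP; rewrite /ept !coordE /=; ring.
rewrite E (evE _ h2); apply: eq_bigr => j _; rewrite big_ord_recl big1 => [|m _] /=.
  by rewrite expr0 mulr1 addr0.
by rewrite /bump /= add1n exprS mul0r !mulr0.
Qed.

(** Along an edge the polynomial has degree at most N in the parameter and N + 1 distinct zeros. *)
Lemma edge_vanish k i q : total_degree_le N q -> (forall n, edge k i (node nd k n) -> ev q (node nd k n) = 0) ->
  forall x, edge k i x -> ev q x = 0.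
Proof.
move=> hq hz; have [p sp hp] := edge_poly k i hq.
pose t n : R := bary kref (i - 1) (nd n).
pose E := [set n | bary kref i (nd n) == 0]%SET.
have nodeE n : n \in E -> node nd k n = ept k i (t n).
  rewrite inE => /eqP h; have hb : bary (vtx k) i (node nd k n) = 0 by rewrite node_bary.
  have [s sI hs] := bary_zero_ept d0 (node_elt k n) hb; rewrite hs; congr ept.
  rewrite /t -(node_bary k) hs eptE; by have [_ -> _] := bary_tpt i 0 s (d0 k).
have p0 : p = 0.
  apply/eqP; apply: contraT => pn; have := @max_poly_roots _ p [seq t n | n <- enum E] pn.
  rewrite size_map -cardE (edge_card i) => H; suff : (N.+1 < size p)%N by rewrite ltnNge sp.
  apply: H.
    apply/allP => s /mapP[n]; rewrite mem_enum => nE ->; rewrite /root hp -nodeE // hz //.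
    by apply/edge_node; move: nE; rewrite inE => /eqP.
  rewrite map_inj_in_uniq ?enum_uniq // => n m; rewrite !mem_enum => nE mE tnm.
  apply: nodes_injective; move: nE mE; rewrite !inE => /eqP bn /eqP bm'.
  have sn := bary_sum (nd n) tdet_kref_neq0; have sm := bary_sum (nd m) tdet_kref_neq0.
  rewrite (sum3_at _ i) in sn; rewrite (sum3_at _ i) in sm.
  rewrite (bary_comb (nd n) tdet_kref_neq0) (bary_comb (nd m) tdet_kref_neq0) !(sum3_at _ i) bn bm'.
  rewrite -/(t n) -/(t m) tnm; congr (_ + _ *: _ + _).
  by move: sn sm; rewrite bn bm' -/(t n) -/(t m) tnm; lra.
by move=> x /edge_ept[s _ ->]; rewrite -hp p0 horner0.
Qed.

Lemma L2_elt_eq0 k q : L2_elt k q <= 0 -> q = 0.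
Proof.
move=> h; pose x0 := \sum_i (3^-1 : R) *: vtx k i.
have Tx0 : tri_int (vtx k) x0.
  by move=> i; rewrite /x0 (bary_of i (d0 k) (lam := fun=> 3^-1)) // sum3; field.
have [s s0 hs] := nbhs_rect (open_nbhs_nbhs (conj (@open_tri_int _ (vtx k)) Tx0)).
apply: (@ev_zero_open _ q x0 s s0) => y y1 y2; apply: contrapT => /eqP yn.
have := @Rint_gt0 _ (vtx k) (fun x => ev q x ^+ 2) y (d0 k).
have cq : continuous (fun x => ev q x ^+ 2).
  by rewrite (_ : (fun x => ev q x ^+ 2) = ev (q * q)); [exact: continuous_ev|apply/funext => z; rewrite evM expr2].
move=> /(_ cq (fun x => sqr_ge0 _) (hs _ y1 y2)); rewrite expf_eq0 /= yn => /(_ isT).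
by rewrite ltNge -/(L2_elt k q) h.
Qed.

Definition onbd k n := exists i, bd_edge k i /\ edge k i (node nd k n).
(** The relative error of [nodal_small]: nodal estimate, number of nodes, and mean value bound for a
    displacement of at most [e * hk k]. *)
Definition defect : R := Cn * ((Np N)%:R * (Ce * e ^+ 2)).

(** The difference can be nonzero only at nodes inside boundary edges, where it equals the value of
    [q] at the node minus its value 0 at the displaced point; a displacement of at most e h_k makes
    this small relative to the gradient. *)
Lemma nodal_small k q r : total_degree_le N q -> total_degree_le N r ->
  (forall i n, bd_edge k i -> inner_edge_node nd k i n -> ev q (P k n) = 0) ->
  (forall i n, bd_edge k i -> edge k i (node nd k n) -> ~ inner_edge_node nd k i n -> ev q (node nd k n) = 0) ->
  (forall n, onbd k n -> ev r (node nd k n) = 0) ->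
  (forall n, ~ onbd k n -> ev r (node nd k n) = ev q (node nd k n)) ->
  L2_elt k (q - r) <= defect * hk k ^+ 2 * (L2_elt k (d1 q) + L2_elt k (d2 q)).
Proof.
move=> hq hr hP hv r0 rq; have sh := adm_shape adm rho0 mu0 k.
have [e0 e1'] := andP e01; have hn := ltW (h0 k).
have G0 : 0 <= L2_elt k (d1 q) + L2_elt k (d2 q) by rewrite addr_ge0 // L2_elt_ge0.
have E0 : 0 <= Ce * e ^+ 2 by rewrite mulr_ge0 ?sqr_ge0 // ltW.
apply: (le_trans (NE sh (total_degreeD hq (total_degreeN hr)))).
have -> : defect * hk k ^+ 2 * (L2_elt k (d1 q) + L2_elt k (d2 q)) =
   Cn * hk k ^+ 2 * \sum_(n < Np N) (Ce * e ^+ 2 * (L2_elt k (d1 q) + L2_elt k (d2 q))).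
  by rewrite sumr_const card_ord -mulr_natl /defect; ring.
apply: ler_wpM2l; first by rewrite mulr_ge0 ?sqr_ge0 // ltW.
apply: ler_sum => n _; rewrite -/(node nd k n) evB.
have R0 : 0 <= Ce * e ^+ 2 * (L2_elt k (d1 q) + L2_elt k (d2 q)) by rewrite mulr_ge0.
have [ob|nb] := pselect (onbd k n); last by rewrite rq // subrr expr0n.
rewrite (r0 n ob) subr0; case: ob => i [bi ei].
have [inn|ninn] := pselect (inner_edge_node nd k i n); last by rewrite (hv i) // expr0n.
have D := DP bi inn; have [_ _ _ L4] := LE sh hq.
have Dh : dist (P k n) (node nd k n) <= hk k by rewrite dist_sym; apply: (le_trans D); rewrite ler_piMl.
have := L4 _ _ (node_elt k n) Dh; rewrite (hP i) // sub0r sqrrN => /le_trans; apply.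
apply: ler_wpM2r => //; apply: ler_wpM2l; first exact: ltW.
apply: lerXn2r; rewrite ?nnegrE ?divr_ge0 ?enorm_ge0 // ler_pdivrMr //.
by rewrite dist_sym.
Qed.

Lemma node_unisolvent k q : total_degree_le N q -> (forall n, ev q (node nd k n) = 0) -> q = 0.
Proof.
move=> hq hz; apply: (@L2_elt_eq0 k); apply: (le_trans (NE (adm_shape adm rho0 mu0 k) hq)).
by rewrite big1 ?mulr0 // => n _; rewrite -/(node nd k n) hz expr0n.
Qed.

(** The error is measured by the gradient of [w] in both constructions, so one estimate serves the
    passage from W_h to V_h and back. *)
Definition related w v := forall k,
  L2_elt k (w k - v k) <= defect * hk k ^+ 2 * (L2_elt k (d1 (w k)) + L2_elt k (d2 (w k))).

Lemma Wh_nodes w : Wh nd P w -> forall k,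
  (forall i n, bd_edge k i -> inner_edge_node nd k i n -> ev (w k) (P k n) = 0) /\
  (forall i n, bd_edge k i -> edge k i (node nd k n) -> ~ inner_edge_node nd k i n -> ev (w k) (node nd k n) = 0).
Proof.
move=> [hw hz] k; split => i n bi; first by case: (hz k i bi) => _ _; apply.
move=> ei ni; have [za zb _] := hz k i bi.
have [->//|na] := pselect (node nd k n = va k i); have [->//|nb] := pselect (node nd k n = vb k i).
by case: ni.
Qed.

Lemma interp_V w : Wh nd P w -> exists2 v, Vh N v & related w v.
Proof.
move=> Ww; have hw := Ww.1.
pose y k n : R := if `[< onbd k n >] then 0 else ev (w k) (node nd k n).
have H k : exists q, total_degree_le N q /\ forall n, ev q (node nd k n) = y k n.
  have [_ /(_ (y k))[q hq E]] := unisolvent_interpolation (@node_unisolvent k).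
  by exists q.
have [f hf] := choice H.
have f0 k n : onbd k n -> ev (f k) (node nd k n) = 0.
  by move=> o; rewrite (hf k).2 /y; case: asboolP.
have f1 k n : ~ onbd k n -> ev (f k) (node nd k n) = ev (w k) (node nd k n).
  by move=> o; rewrite (hf k).2 /y; case: asboolP.
exists [ffun k => f k].
  split=> k; first by rewrite ffunE; exact: (hf k).1.
  move=> i bi x ex; rewrite ffunE; apply: (edge_vanish (hf k).1 _ ex) => n en.
  by apply: f0; exists i.
move=> k; rewrite ffunE; have [w1 w2] := Wh_nodes Ww k.
by apply: nodal_small => //; [exact: (hf k).1|exact: f0|exact: f1].
Qed.

(** The displaced nodes are still unisolvent: a polynomial vanishing at them is compared with 0 by
    [nodal_small], and the inverse inequality bounds its squared norm by 2 Ce [defect] < 1 times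
    itself. *)
Lemma interp_W v : 2 * Ce * defect < 1 -> Vh N v -> exists2 w, Wh nd P w & related w v.
Proof.
move=> small [hv zv].
pose cutn k n := exists i, bd_edge k i /\ inner_edge_node nd k i n.
pose pt k n := if `[< cutn k n >] then P k n else node nd k n.
pose y k n : R := if `[< cutn k n >] then 0 else ev (v k) (node nd k n).
have zbd k n : onbd k n -> ev (v k) (node nd k n) = 0 by move=> [i [bi ei]]; exact: zv bi _ ei.
(* Since an element has at most one boundary edge, a node not interior to that edge is never
   displaced on account of another one. *)
have cutN k i n : bd_edge k i -> ~ inner_edge_node nd k i n -> ~ cutn k n.
  by move=> bi ni [j [bj ij]]; apply: ni; rewrite (mesh_one_bd_edge adm bi bj).
have main k q r : total_degree_le N q -> total_degree_le N r -> (forall n, onbd k n -> ev r (node nd k n) = 0) ->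
    (forall n, ev q (pt k n) = if `[< cutn k n >] then 0 else ev r (node nd k n)) ->
    [/\ forall i n, bd_edge k i -> inner_edge_node nd k i n -> ev q (P k n) = 0,
      forall i n, bd_edge k i -> edge k i (node nd k n) -> ~ inner_edge_node nd k i n -> ev q (node nd k n) = 0 &
      L2_elt k (q - r) <= defect * hk k ^+ 2 * (L2_elt k (d1 q) + L2_elt k (d2 q))].
  move=> hq hr r0 E.
  have c1 n : cutn k n -> ev q (P k n) = 0 by move=> cn; have := E n; rewrite /pt; case: asboolP.
  have c2 n : ~ cutn k n -> ev q (node nd k n) = ev r (node nd k n) by move=> cn; have := E n; rewrite /pt; case: asboolP.
  have p1 i n : bd_edge k i -> inner_edge_node nd k i n -> ev q (P k n) = 0 by move=> bi ii; apply: c1; exists i.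
  have p2 i n : bd_edge k i -> edge k i (node nd k n) -> ~ inner_edge_node nd k i n -> ev q (node nd k n) = 0.
    by move=> bi ei ni; rewrite c2; [apply: r0; exists i|exact: cutN bi ni].
  split => //; apply: nodal_small => // n no; rewrite c2 // => -[i [bi [ei _ _]]].
  by apply: no; exists i.
have uni k q : total_degree_le N q -> (forall n, ev q (pt k n) = 0) -> q = 0.
  move=> hq hz; have [n _|n|_ _ L] := main k q 0 hq (@total_degree0 R N).
  - by rewrite ev0.
  - by rewrite hz ev0; case: ifP.
  rewrite subr0 in L; apply: (@L2_elt_eq0 k); have L0 := L2_elt_ge0 k q.
  have [_ p1 p2 _] := LE (adm_shape adm rho0 mu0 k) hq.
  have df0 : 0 <= defect by apply: mulr_ge0; [exact: ltW|apply: mulr_ge0; [exact: ler0n|apply: mulr_ge0; [exact: ltW|exact: sqr_ge0]]].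
  have : L2_elt k q <= 2 * Ce * defect * L2_elt k q.
    apply: (le_trans L); rewrite -mulrA mulrDr.
    have -> : 2 * Ce * defect * L2_elt k q = defect * (Ce * L2_elt k q + Ce * L2_elt k q) by ring.
    by apply: ler_wpM2l => //; exact: lerD.
  rewrite -subr_ge0 -{2}[L2_elt k q]mul1r -mulrBl => hh.
  by rewrite leNgt; apply/negP => Lp; move: hh; rewrite pmulr_lge0 // subr_ge0 leNgt small.
have H k : exists q, total_degree_le N q /\ forall n, ev q (pt k n) = y k n.
  have [_ /(_ (y k))[q hq E]] := unisolvent_interpolation (@uni k).
  by exists q.
have [f hf] := choice H.
have X k := main k (f k) (v k) (hf k).1 (hv k) (zbd k) (hf k).2.
exists [ffun k => f k].
  split=> k; first by rewrite ffunE; exact: (hf k).1.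
  move=> i bi; rewrite !ffunE; have [x1 x2 _] := X k.
  have vert j : exists n, node nd k n = vtx k j.
    have nv : @kref R j \in [:: (0, 0); (1, 0); (0, 1)].
      by rewrite /kref; have [->|->|->] := I3P j; rewrite /= !inE !eqxx ?orbT.
    have [n hn] := nodes_vertices hnd nv; exists n.
    by rewrite /node hn /kref; have [->|->|->] := I3P j; rewrite /= ?scale0r ?scale1r ?addr0 // [_ + (_ - _)]addrC subrK.
  have ea : edge k i (va k i) by apply/edge_ept; exists 0; rewrite ?lexx ?ler01 // /ept scale0r addr0.
  have eb : edge k i (vb k i) by apply/edge_ept; exists 1; rewrite ?lexx ?ler01 // /ept scale1r addrC subrK.
  split; last by move=> n; exact: x1.
    have [n hn] := vert (i + 1); rewrite /va -hn; apply: (x2 i); [by []|by rewrite hn|by move=> [_ + _]; apply; rewrite hn].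
  have [n hn] := vert (i - 1); rewrite /vb -hn; apply: (x2 i); [by []|by rewrite hn|by move=> [_ _ +]; apply; rewrite hn].
by move=> k; rewrite ffunE; case: (X k).
Qed.

(** For the gradients the inverse inequality removes the factor h_k^2; on edges mu h_k <= h_e does
    so. The 6 is three sides times the 2 from splitting a jump into two traces. *)
Lemma Energy_small w v : deg_le N w -> deg_le N v -> related w v ->
  Energy (w - v) <= (2 * Ce + 6 * (Ce / mu ^+ 2)) * defect * Gradient w.
Proof.
move=> hw hv hr; set u := w - v.
have uE k : u k = w k - v k by rewrite /u !ffunE.
have hu : deg_le N u by move=> k; rewrite uE; exact: total_degreeD (hw k) (total_degreeN (hv k)).
pose g k : R := L2_elt k (d1 (w k)) + L2_elt k (d2 (w k)).
have hL k : L2_elt k (u k) <= defect * hk k ^+ 2 * g k by rewrite uE; exact: hr.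
have hp k : 0 < hk k ^+ 2 by rewrite exprn_gt0.
have G1 k : L2_elt k (d1 (u k)) + L2_elt k (d2 (u k)) <= 2 * Ce * defect * g k.
  have [_ p1 p2 _] := LE (adm_shape adm rho0 mu0 k) (hu k).
  rewrite -(ler_pM2l (hp k)) mulrDr; apply: (le_trans (lerD p1 p2)).
  have -> : hk k ^+ 2 * (2 * Ce * defect * g k) = Ce * (defect * hk k ^+ 2 * g k) + Ce * (defect * hk k ^+ 2 * g k) by ring.
  by apply: lerD; rewrite ler_pM2l //; exact: hL.
have T1 k i : trace k i (u k) <= Ce / mu ^+ 2 * defect * g k.
  have := trace_le adm rho0 mu0 LE k i (hu k) => tl.
  have ml : (mu * hk k) ^+ 2 <= len k i ^+ 2.
    by apply: lerXn2r; rewrite ?nnegrE ?mulr_ge0 ?(ltW mu0) ?(ltW (h0 k)) ?(ltW (len_gt0 d0 k i)) //; exact: (mesh_edge_length adm).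
  have mp : 0 < (mu * hk k) ^+ 2 by rewrite exprn_gt0 // mulr_gt0.
  rewrite -(ler_pM2l mp); apply: (le_trans (ler_wpM2r (trace_ge0 k i (u k)) ml)); apply: (le_trans tl).
  have -> : (mu * hk k) ^+ 2 * (Ce / mu ^+ 2 * defect * g k) = Ce * (defect * hk k ^+ 2 * g k) by field; rewrite gt_eqF.
  by rewrite ler_pM2l //; exact: hL.
have J1 : Jump u <= \sum_ki (2 * trace ki.1 ki.2 (u ki.1)).
  rewrite (sum_edges adm (fun ki => 2 * trace ki.1 ki.2 (u ki.1))) /Jump addrC; apply: lerD.
    by apply: ler_sum => ki _; have := trace_ge0 ki.1 ki.2 (u ki.1); lra.
  apply: ler_sum => ki _; apply: ler_sum => lj il.
  rewrite -(nb_trace (u lj.1) il) -mulrDr /trace -Rint1D; [|by apply: bmX; exact: bm_trace|by apply: bmX; exact: bm_trace].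
  rewrite -Rint1Z; last by apply: bmD; apply: bmX; exact: bm_trace.
  apply: Rint1_le; [by apply: bmX; apply: bmB; exact: bm_trace|by apply: bmZ; apply: bmD; apply: bmX; exact: bm_trace|].
  move=> t _; set a := ev _ _; set a' := ev _ _.
  rewrite -subr_ge0 (_ : _ - _ = (a + a') ^+ 2) ?sqr_ge0 //; ring.
have J2 : \sum_(ki : 'I_(nel M) * 'I_3) (2 * trace ki.1 ki.2 (u ki.1)) <= 6 * (Ce / mu ^+ 2) * defect * Gradient w.
  rewrite -(pair_bigA _ (fun k (i : 'I_3) => 2 * trace k i (u k))) /= /Gradient mulr_sumr.
  apply: ler_sum => k _; rewrite sum3 -/(g k); have := T1 k 0; have := T1 k 1; have := T1 k 2; lra.
have -> : (2 * Ce + 6 * (Ce / mu ^+ 2)) * defect * Gradient w = 2 * Ce * defect * Gradient w + 6 * (Ce / mu ^+ 2) * defect * Gradient w by ring.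
apply: lerD; last exact: le_trans J1 J2.
by rewrite /Gradient mulr_sumr; apply: ler_sum => k _; exact: G1.
Qed.

Lemma sq_add (x y : R) : (x + y) ^+ 2 <= 2 * (x ^+ 2 + y ^+ 2).
Proof. rewrite -subr_ge0 (_ : _ - _ = (x - y) ^+ 2) ?sqr_ge0 //; ring. Qed.

Lemma L2_elt_add k q r : L2_elt k (q + r) <= 2 * L2_elt k q + 2 * L2_elt k r.
Proof.
have mT := tri_measurable (d0 k); have fT := tri_fin (d0 k); have cT := tri_compact (d0 k).
have bq := bmX 2 (bm_ev q cT); have br := bmX 2 (bm_ev r cT).
rewrite -mulrDr /L2_elt -(Rint2D mT fT bq br) -(Rint2Z mT fT _ (bmD bq br)).
apply: (Rint2_le mT fT); [by apply: bmX; exact: bm_ev|by apply: bmZ; exact: bmD|].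
by move=> x _; rewrite evD; exact: sq_add.
Qed.

Lemma Energy_add u v : Energy (u + v) <= 2 * Energy u + 2 * Energy v.
Proof.
have I1 (f g h : R -> R) : bm (`[0, 1]%classic : set R) f -> bm (`[0, 1]%classic : set R) g -> (forall t, h t = f t + g t) ->
    \int[leb1]_(t in `[0, 1]) h t ^+ 2 <= 2 * \int[leb1]_(t in `[0, 1]) f t ^+ 2 + 2 * \int[leb1]_(t in `[0, 1]) g t ^+ 2.
  move=> bf bg E; have -> : h = (fun t => f t + g t) by apply/funext.
  rewrite -mulrDr -(Rint1D (bmX 2 bf) (bmX 2 bg)) -(Rint1Z _ (bmD (bmX 2 bf) (bmX 2 bg))).
  apply: Rint1_le; [by apply: bmX; exact: bmD|by apply: bmZ; apply: bmD; exact: bmX|].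
  by move=> t _; exact: sq_add.
have G1 : Gradient (u + v) <= 2 * Gradient u + 2 * Gradient v.
  rewrite /Gradient !mulr_sumr -big_split; apply: ler_sum => k _ /=; rewrite ffunE d1D d2D.
  by rewrite !(mulrDr 2) addrACA; apply: lerD; exact: L2_elt_add.
have J1 : Jump (u + v) <= 2 * Jump u + 2 * Jump v.
  rewrite /Jump !(mulrDr 2) addrACA; apply: lerD.
    rewrite !mulr_sumr -big_split; apply: ler_sum => ki _ /=; rewrite !mulr_sumr -big_split; apply: ler_sum => lj _ /=.
    apply: I1; [by apply: bmB; exact: bm_trace|by apply: bmB; exact: bm_trace|].
    by move=> t; rewrite !ffunE !evD; ring.
  rewrite !mulr_sumr -big_split; apply: ler_sum => ki _ /=.
  by apply: I1; [exact: bm_trace|exact: bm_trace|move=> t; rewrite !ffunE !evD].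
have -> : 2 * Energy u + 2 * Energy v = (2 * Gradient u + 2 * Gradient v) + (2 * Jump u + 2 * Jump v) by rewrite /Energy; ring.
exact: (lerD G1 J1).
Qed.

End Interpolation.

(** * Functions that dominate a neighbourhood of the boundary *)

Section Boundary_strip.
Context {R : realType}.
Implicit Types (Omega A : set (R * R)) (phi : R -> R) (u v x y z : R * R).

Definition lip2 phi := forall s t : R, `|phi s - phi t| <= 2 * `|s - t|.

(** The McShane extension: the infimum of the cones with vertices on the data. *)
Lemma lip2_extension A : (forall x y, A x -> A y -> `|x.2 - y.2| <= 2 * `|x.1 - y.1|) ->
  exists2 phi, lip2 phi & forall x, A x -> phi x.1 = x.2.
Proof.
move=> hA; have [A0|/set0P[x0 Ax0]] := eqVneq A set0.
  by exists (fun=> 0) => [s t|x]; [rewrite subrr normr0 mulr_ge0|rewrite A0].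
pose E (s : R) : set R := [set x.2 + 2 * `|s - x.1| | x in A].
have lb s : has_lbound (E s).
  exists (x0.2 - 2 * `|s - x0.1|) => _ [x Ax <-].
  have := hA _ _ Ax0 Ax; rewrite ler_norml => /andP[_ h].
  have := ler_distD s x0.1 x.1; rewrite (distrC x0.1 s); lra.
pose phi (s : R) : R := inf (E s).
have le s x : A x -> phi s <= x.2 + 2 * `|s - x.1|.
  by move=> Ax; apply: ge_inf; [exact: lb|exists x].
have ge s (a : R) : (forall x, A x -> a <= x.2 + 2 * `|s - x.1|) -> a <= phi s.
  by move=> h; apply: lb_le_inf; [exists (x0.2 + 2 * `|s - x0.1|); exists x0|move=> _ [x Ax <-]; exact: h].
have half s t : phi s - phi t <= 2 * `|s - t|.
  have : phi s - 2 * `|s - t| <= phi t.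
    by apply: ge => x Ax; have := le s x Ax; have := ler_distD t s x.1; lra.
  lra.
exists phi.
  by move=> s t; rewrite ler_norml; have := half s t; have := half t s; rewrite (distrC t s); lra.
move=> x Ax; apply/eqP; rewrite eq_le; apply/andP; split.
  by have := le x.1 x Ax; rewrite subrr normr0 mulr0 addr0.
apply: ge => y Ay; have := hA _ _ Ax Ay; rewrite ler_norml => /andP[_]; lra.
Qed.

Lemma tilt_le (s t a e : R) : `|t| <= 4^-1 * `|s| -> `|e| <= `|a| ->
  `|s * e + t * a| <= 2 * `|s * a - t * e| /\ `|s * e - t * a| <= 2 * `|s * a + t * e|.
Proof.
move=> hts hea; pose p : R := `|s| * `|a|.
have p0 : 0 <= p by rewrite mulr_ge0.
have h1 : `|s * e| <= p by rewrite normrM ler_pM.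
have h2 : `|t * a| <= 4^-1 * p by rewrite normrM mulrA ler_pM.
have h3 : `|t * e| <= 4^-1 * p by rewrite normrM mulrA ler_pM // mulr_ge0.
have h4 : `|s * a| = p by rewrite normrM.
have a1 := ler_normD (s * e) (t * a); have a2 := ler_normB (s * e) (t * a).
have b1 := lerB_dist (s * a) (t * e).
have b2 : `|s * a| - `|t * e| <= `|s * a + t * e|.
  by have := lerB_dist (s * a) (- (t * e)); rewrite normrN opprK.
split; lra.
Qed.

(** A cone of slope 1/4 about [u] is contained in the cone of slope 2 about the coordinate axis
    nearest to [u]. Flat pieces thus become graphs over an axis, and derivatives along the axes
    suffice. *)
Lemma flat_lip u A : enorm u = 1 -> flatset 4^-1 u A ->
  (forall x y, A x -> A y -> `|x.2 - y.2| <= 2 * `|x.1 - y.1|) \/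
  (forall x y, A x -> A y -> `|x.1 - y.1| <= 2 * `|x.2 - y.2|).
Proof.
move=> u1 hA.
have E x y : x.1 - y.1 = dot (x - y) u * u.1 - dot (x - y) (rot90 u) * u.2 /\
    x.2 - y.2 = dot (x - y) u * u.2 + dot (x - y) (rot90 u) * u.1.
  have h := frame_dec (x - y) u1; have h1 := congr1 fst h; have h2 := congr1 snd h.
  move: h1 h2; rewrite !coordE /= => h1 h2; split.
    by rewrite [LHS]h1 mulrN.
  exact: h2.
have [h|h] := leP `|u.2| `|u.1|; [left|right] => x y Ax Ay; have [-> ->] := E x y.
  by case: (tilt_le (hA _ _ Ax Ay) h).
by case: (tilt_le (hA _ _ Ax Ay) (ltW h)).
Qed.

Definition ongraph (phi : R -> R) (sw : bool) y : Prop := if sw then phi y.2 = y.1 else phi y.1 = y.2.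

Lemma flat_graph u A : enorm u = 1 -> flatset 4^-1 u A ->
  exists fs : (R -> R) * bool, lip2 fs.1 /\ forall y, A y -> ongraph fs.1 fs.2 y.
Proof.
move=> u1 hA; have [h|h] := flat_lip u1 hA.
  by have [phi lp hp] := lip2_extension h; exists (phi, false).
have [x y [x' Ax' <-] [y' Ay' <-]|phi lp hp] := @lip2_extension [set (x.2, x.1) | x in A].
  exact: h.
by exists (phi, true); split => // y Ay; apply: (hp (y.2, y.1)); exists y.
Qed.

Lemma curve_graphs (g : R -> R * R) : class_C2 g -> {in `[0, 1], forall t, derive1 g t != 0} ->
  {in `[0, 1] &, injective g} ->
  exists (D : seq (nat * nat)) (F : nat * nat -> (R -> R) * bool), (forall m, lip2 (F m).1) /\
    forall y, (g @` `[0, 1]) y -> exists2 m, m \in D & ongraph (F m).1 (F m).2 y.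
Proof.
move=> cg dg ig; set K := g @` _; have cK : compact K := compact_curve (class_C2_continuous cg).
pose Q (r : R) z := exists fs : (R -> R) * bool, lip2 fs.1 /\ forall y, K y -> dist y z < r -> ongraph fs.1 fs.2 y.
have [|z Kz|r r0 hr] := @compact_uniform R K Q cK.
- by move=> r r' z rr [fs [l1 l2]]; exists fs; split => // y Ky h; apply: l2 => //; exact: lt_le_trans h rr.
- have e0 : (0 : R) < 4^-1 by [].
  have [d dp [u u1 hu]] := piece_flat z cg dg ig e0; have [fs [l1 l2]] := flat_graph u1 hu.
  exists (d / 2); first by rewrite divr_gt0.
  move=> y Ky hy; exists fs; split => // y' Ky' hy'; apply: l2; split => //.
  by have := dist_tri y' y z; rewrite /eball /=; lra.
have [B B0 hB] := compact_enorm_bounded cK.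
(* Cells of side r/4 have diameter less than [r], so one graph serves all curve points in a cell,
   and finitely many cells cover the bounded curve. *)
pose h := r / 4; have hp : 0 < h by rewrite divr_gt0.
pose cell (m : nat * nat) (x : R * R) := (m.1%:R <= (x.1 + B) / h < m.1.+1%:R) && (m.2%:R <= (x.2 + B) / h < m.2.+1%:R).
have near m x z : cell m x -> cell m z -> dist x z < r.
  have aux (a c : R) n : n%:R <= (a + B) / h < n.+1%:R -> n%:R <= (c + B) / h < n.+1%:R -> `|a - c| < h.
    rewrite !ler_pdivlMr // !ltr_pdivrMr // -natr1 mulrDl mul1r => /andP[a1 a2] /andP[c1 c2].
    by rewrite ltr_norml; apply/andP; split; lra.
  move=> /andP[x1 x2] /andP[z1 z2]; apply: (le_lt_trans (enorm_le_coords _)); rewrite !coordE.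
  have := aux _ _ _ x1 z1; have := aux _ _ _ x2 z2; rewrite /h; lra.
have H m : exists fs : (R -> R) * bool, lip2 fs.1 /\ forall y, K y -> cell m y -> ongraph fs.1 fs.2 y.
  have [[z [Kz mz]]|no] := pselect (exists z, K z /\ cell m z).
    by have [fs [l1 l2]] := hr z Kz; exists fs; split => // y Ky my; apply: l2 => //; exact: near my mz.
  exists (fun=> 0, true); split => [s t|y Ky my]; first by rewrite subrr normr0 mulr_ge0.
  by case: no; exists y.
have [F hF] := choice H.
pose m0 := (Num.truncn (2 * B / h)).+1.
exists [seq (a, b) | a <- iota 0 m0, b <- iota 0 m0], F; split; first by move=> m; case: (hF m).
move=> y Ky; have hy := hB y Ky.
have co (a : R) : `|a| <= enorm y -> exists2 n : nat, n \in iota 0 m0 & n%:R <= (a + B) / h < n.+1%:R.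
  move=> ha; have /andP[l1 l2] : - B <= a <= B by rewrite -ler_norml; exact: le_trans ha hy.
  have p0 : 0 <= (a + B) / h by rewrite divr_ge0 ?(ltW hp) //; lra.
  have /andP[t1 t2] := truncn_itv p0; exists (Num.truncn ((a + B) / h)); last by rewrite t1.
  rewrite mem_iota add0n /= -(ltr_nat R); apply: (le_lt_trans t1).
  have q0 : 0 <= 2 * B / h by rewrite divr_ge0 ?(ltW hp) // mulr_ge0.
  have /andP[_] := truncn_itv q0; apply: le_lt_trans; rewrite ler_pM2r ?invr_gt0 //; lra.
have [n1 i1 c1] := co _ (coord1_le_enorm y); have [n2 i2 c2] := co _ (coord2_le_enorm y).
exists (n1, n2); first by apply/allpairsPdep; exists n1, n2.
by apply: (hF _).2 => //; rewrite /cell c1.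
Qed.

Lemma boundary_graphs Omega : piecewise_C2_boundary Omega ->
  exists (T : eqType) (s : seq T) (F : T -> (R -> R) * bool), (forall m, lip2 (F m).1) /\
    forall y, bdry Omega y -> exists2 m, m \in s & ongraph (F m).1 (F m).2 y.
Proof.
move=> [n [g [hg _ hb _]]].
have H i : exists DF : seq (nat * nat) * (nat * nat -> (R -> R) * bool), (forall m, lip2 (DF.2 m).1) /\
    forall y, (g i @` `[0, 1]) y -> exists2 m, m \in DF.1 & ongraph (DF.2 m).1 (DF.2 m).2 y.
  by have [c1 c2 c3] := hg i; have [D [F hF]] := curve_graphs c1 c2 c3; exists (D, F).
have [f hf] := choice H.
exists ('I_n * (nat * nat))%type, [seq (i, m) | i <- enum 'I_n, m <- (f i).1], (fun m => (f m.1).2 m.2).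
split; first by move=> m; case: (hf m.1).
move=> y; rewrite hb => -[i _ hy]; have [m mD hm] := (hf i).2 y hy.
by exists (i, m) => //; apply/allpairsPdep; exists i, m; rewrite mem_enum.
Qed.

(** Signed distance to the graph measured along a coordinate axis, hence of derivative 1 in that
    direction. *)
Definition height phi (sw : bool) x : R := if sw then x.1 - phi x.2 else x.2 - phi x.1.
Definition axis (sw : bool) : R * R := if sw then e1 else e2.

Lemma height_shift phi sw x (t : R) : height phi sw (x + t *: axis sw) = height phi sw x + t.
Proof.
rewrite /height /axis; case: sw; rewrite !coordE /= mulr1 mulr0 addr0; ring.
Qed.

Lemma continuous_lip2 phi : lip2 phi -> continuous phi.
Proof.
move=> lp t; apply/cvgrPdist_lt => e e0; apply/nbhs_ballP; exists (e / 2) => /=; first by rewrite divr_gt0.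
by move=> s; rewrite /ball /= => hs; apply: (le_lt_trans (lp _ _)); lra.
Qed.

Lemma continuous_height phi sw : lip2 phi -> continuous (height phi sw).
Proof.
move=> /continuous_lip2 cp x; rewrite /height; case: sw.
  apply: cvgB; first exact: cvg_fst.
  by apply: (@continuous_comp _ _ _ snd phi); [exact: cvg_snd|exact: cp].
apply: cvgB; first exact: cvg_snd.
by apply: (@continuous_comp _ _ _ fst phi); [exact: cvg_fst|exact: cp].
Qed.

Lemma height_near phi sw x y : lip2 phi -> ongraph phi sw y -> `|height phi sw x| <= 3 * dist x y.
Proof.
move=> lp; have := coord1_le_enorm (x - y); have := coord2_le_enorm (x - y); rewrite /dist !coordE => h2 h1.
rewrite /ongraph /height; case: sw => E.
  have -> : x.1 - phi x.2 = (x.1 - y.1) + (phi y.2 - phi x.2) by rewrite E; ring.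
  have := lp y.2 x.2; have := ler_normD (x.1 - y.1) (phi y.2 - phi x.2); rewrite (distrC y.2); lra.
have -> : x.2 - phi x.1 = (x.2 - y.2) + (phi y.1 - phi x.1) by rewrite E; ring.
have := lp y.1 x.1; have := ler_normD (x.2 - y.2) (phi y.1 - phi x.1); rewrite (distrC y.1); lra.
Qed.

Implicit Types (w : R) (sw : bool).

(** The derivative along the axis of [primitive], that is, of w atan(height/w): the bump is at least
    1/2 where |height| <= w, while the primitive is only of size [w]. No differentiability of the
    graph function is involved. *)
Definition bump (w : R) phi sw x : R := (1 + (height phi sw x / w) ^+ 2)^-1.
Definition primitive (w : R) phi sw x : R := w * atan (height phi sw x / w).

Lemma bump_den (t : R) : 0 < 1 + t ^+ 2. Proof. by rewrite ltr_pwDl // sqr_ge0. Qed.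

Lemma bump_ge0 w phi sw x : 0 <= bump w phi sw x.
Proof. by rewrite invr_ge0 ltW // bump_den. Qed.

Lemma bump_le1 w phi sw x : bump w phi sw x <= 1.
Proof. by rewrite invf_le1 ?bump_den // lerDl sqr_ge0. Qed.

Lemma bump_near w phi sw x : 0 < w -> `|height phi sw x| <= w -> 2^-1 <= bump w phi sw x.
Proof.
move=> w0 h; rewrite lef_pV2 ?posrE ?bump_den // -[X in _ <= X](_ : 1 + 1 = 2) // lerD2l.
rewrite expr_div_n ler_pdivrMr ?exprn_gt0 // mul1r -[height _ _ _ ^+ 2]ger0_norm ?sqr_ge0 // normrX.
by apply: lerXn2r; rewrite ?nnegrE // ltW.
Qed.

Lemma primitive_le w phi sw x : 0 < w -> `|primitive w phi sw x| <= 2 * w.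
Proof.
move=> w0; rewrite normrM gtr0_norm // mulrC ler_pM2r // ler_norml.
have := atan_gtNpi2 (height phi sw x / w); have := atan_ltpi2 (height phi sw x / w).
have /andP[_] := @pihalf_02 R; lra.
Qed.

Lemma is_derive_primitive w phi sw x : 0 < w -> is_derive x (axis sw) (primitive w phi sw) (bump w phi sw x).
Proof.
move=> w0; apply: is_derive_dir; pose a : R := height phi sw x / w.
have -> : (fun h : R => primitive w phi sw (x + h *: axis sw)) = (fun h : R => w *: atan (a + h * w^-1)).
  by apply/funext => h; rewrite /primitive height_shift mulrDl.
have h1 := is_derive_affine1 w^-1 a (0 : R).
have h2 := is_derive1_atan (a + 0 * w^-1).
have h3 := @is_derive1_comp R atan (fun h : R => a + h * w^-1) 0 _ _ h2 h1.
apply: (is_derive_eq (@is_deriveZ R R R _ w 0 1 _ h3)).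
by rewrite mul0r addr0 /bump -/a /GRing.scale /= mulrCA divff ?gt_eqF // mulr1.
Qed.

Lemma continuous_bump w phi sw : lip2 phi -> continuous (bump w phi sw).
Proof.
move=> lp x; apply: cvgV; first by rewrite gt_eqF // bump_den.
apply: cvgD; first exact: cvg_cst.
have c : height phi sw y / w @[y --> x] --> height phi sw x / w.
  by apply: cvgM; [exact: continuous_height|exact: cvg_cst].
exact: (cvgM c c).
Qed.

Lemma continuous_primitive w phi sw : lip2 phi -> continuous (primitive w phi sw).
Proof.
move=> lp x; apply: cvgM; first exact: cvg_cst.
apply: (@continuous_comp _ _ _ (fun y => height phi sw y / w) atan); last exact: continuous_atan.
by apply: cvgM; [exact: continuous_height|exact: cvg_cst].
Qed.

(* The indicator of a neighbourhood of the boundary is dominated by derivatives of uniformly small functions. *)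
Lemma strip_family Omega (e : R) : piecewise_C2_boundary Omega -> 0 < e ->
  exists (T : eqType) (s : seq T) (G g : T -> R * R -> R) (v : T -> R * R) (F d : R),
  [/\ 0 < F, (size s)%:R * F <= e, 0 < d,
      forall m, [/\ v m = e1 \/ v m = e2, weak_derivative setT (v m) (G m) (g m), continuous (G m), continuous (g m) &
        forall x, `|G m x| <= F /\ 0 <= g m x <= 1] &
      forall x y, bdry Omega y -> dist x y < d -> 2^-1 <= \sum_(m <- s) g m x].
Proof.
move=> pC e0; have [T [s [F [lF hF]]]] := boundary_graphs pC.
(* Makes the number of graphs times the bound 2w at most [e]; the width w/3 of the neighbourhood
   comes from |height| <= 3 dist. *)
pose w : R := e / (2 * (size s).+1%:R).
have n0 : (0 : R) < (size s).+1%:R by [].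
have w0 : 0 < w by rewrite divr_gt0 // mulr_gt0.
exists T, s, (fun m => primitive w (F m).1 (F m).2), (fun m => bump w (F m).1 (F m).2), (fun m => axis (F m).2), (2 * w), (w / 3).
split.
- by rewrite mulr_gt0.
- have -> : (size s)%:R * (2 * w) = e * ((size s)%:R / (size s).+1%:R) by rewrite /w; field; rewrite gt_eqF.
  by rewrite ler_piMr ?(ltW e0) // ler_pdivrMr // mul1r ler_nat.
- by rewrite divr_gt0.
- move=> m; have lp := lF m.
  have ax : axis (F m).2 = e1 \/ axis (F m).2 = e2 by rewrite /axis; case: (F m).2; [left|right].
  split => //; [|exact: continuous_primitive|exact: continuous_bump|].
    apply: weak_derivative_classical => //; [|exact: continuous_primitive|exact: continuous_bump].
    by move=> x; exact: is_derive_primitive.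
  by move=> x; rewrite primitive_le // bump_ge0 bump_le1.
- move=> x y hy hxy; have [m ms hm] := hF y hy.
  rewrite (big_rem m) //=; apply: (@le_trans _ _ (bump w (F m).1 (F m).2 x)).
    by apply: bump_near => //; have := height_near x (lF m) hm; lra.
  by rewrite lerDl; apply: sumr_ge0 => i _; exact: bump_ge0.
Qed.

End Boundary_strip.

(** * Sides of the boundary as seen by fine meshes *)

Section Sides.
Context {R : realType}.
Variables (Omega : set (R * R)) (rho mu C : R).
Hypotheses (bO : bounded_domain Omega) (pO : piecewise_C2_boundary Omega).
Hypotheses (rho0 : 0 < rho) (mu0 : 0 < mu) (C0 : 0 < C).
Implicit Types (x y z p q u : R * R) (M : mesh R).

(** Truth on all sufficiently fine admissible meshes; the threshold may depend on [Q], in particular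
    on the points it speaks of. *)
Definition finely (Q : mesh R -> Prop) := exists2 r : R, 0 < r &
  forall M, admissible_mesh M Omega rho mu C -> hmax M < r -> Q M.

Lemma finely_and (Q Q' : mesh R -> Prop) : finely Q -> finely Q' -> finely (fun M => Q M /\ Q' M).
Proof.
move=> [r r0 h] [r' r'0 h']; exists (Num.min r r'); first by rewrite lt_min r0.
by move=> M aM; rewrite lt_min => /andP[h1 h2]; split; [exact: h|exact: h'].
Qed.

Lemma finely_imp (Q Q' : mesh R -> Prop) : (forall M, admissible_mesh M Omega rho mu C -> Q M -> Q' M) -> finely Q -> finely Q'.
Proof. by move=> h [r r0 hr]; exists r => // M aM hM; apply: h => //; exact: hr. Qed.

Lemma hmax_ge0 M : 0 <= hmax M.
Proof. by rewrite /hmax; elim/big_rec: _ => // i x _ x0; rewrite le_max x0 orbT. Qed.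

Lemma finely_small (e : R) : 0 < e -> finely (fun M => hmax M < e /\ C * hmax M ^+ 2 < e).
Proof.
move=> e0; exists (Num.min e (Num.min 1 (e / C))); first by rewrite !lt_min e0 ltr01 divr_gt0.
move=> M _; rewrite !lt_min => /and3P[h1 h2 h3]; split => //.
have := hmax_ge0 M; set h := hmax M => h0.
apply: (@le_lt_trans _ _ (C * h)); last by rewrite mulrC -ltr_pdivlMr.
by rewrite ler_pM2l // expr2 ler_piMl // ltW.
Qed.

(** Only the relation between two points is recorded, because nothing says beforehand which of them
    Omega_h contains; a far point decides in the end. *)
Definition same_side x y := finely (fun M => Omegah M x <-> Omegah M y).
Definition opposite_side x y := finely (fun M => Omegah M x <-> ~ Omegah M y).

Lemma same_sym x y : same_side x y -> same_side y x.
Proof. by apply: finely_imp => M _; tauto. Qed.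

Lemma same_trans x y z : same_side x y -> same_side y z -> same_side x z.
Proof. by move=> h1 h2; apply: finely_imp (finely_and h1 h2) => M _; tauto. Qed.

Lemma opp_same x y z : opposite_side x y -> same_side y z -> opposite_side x z.
Proof. by move=> h1 h2; apply: finely_imp (finely_and h1 h2) => M _; tauto. Qed.

Lemma segment_const M x y : admissible_mesh M Omega rho mu C ->
  (forall t : R, 0 <= t <= 1 -> ~ bdry (Omegah M) (x + t *: (y - x))) -> Omegah M x <-> Omegah M y.
Proof.
move=> aM h; have cl := Omegah_closed (adm_tdet aM); split => Ox; apply: contrapT => nO.
  by have [t tI] := closed_segment_bdry cl Ox nO; exact: h.
have [t /andP[t0 t1] hb] := closed_segment_bdry cl Ox nO.
apply: (h (1 - t)); first by lra.
by move: hb; congr (bdry _ _); apply: pair_eqP; rewrite !coordE; ring.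
Qed.

(** By the Hausdorff bound the boundary of a fine polygon stays away from a point off the boundary
    of Omega, so short segments there do not cross it. *)
Lemma near_const y : ~ bdry Omega y -> exists2 d : R, 0 < d &
  finely (fun M => forall z z', dist z y < d -> dist z' y < d -> (Omegah M z <-> Omegah M z')).
Proof.
move=> nb; have [d d0 hd] := away_from_closed (@bdry_closed _ Omega) nb.
have e0 : 0 < d / 2 by rewrite divr_gt0.
exists (d / 2) => //; have [r r0 hr] := finely_small e0; exists r => // M aM hM.
have [_ hC] := hr M aM hM; have [_ hn] := hausdorff_near (mesh_hausdorff aM) hC.
suff H z : dist z y < d / 2 -> Omegah M z <-> Omegah M y by move=> z z' h1 h2; rewrite (H z h1) (H z' h2).
move=> hz; apply: (segment_const aM) => t /andP[t0 t1] hb.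
have [q bq dq] := hn _ hb; have := hd q bq.
have := dist_tri q (z + t *: (y - z)) y; rewrite (dist_sym q) => tri.
have E : dist (z + t *: (y - z)) y <= dist z y.
  have -> : dist (z + t *: (y - z)) y = (1 - t) * dist z y.
    rewrite /dist (_ : z + t *: (y - z) - y = (1 - t) *: (z - y)); last by apply: pair_eqP; rewrite !coordE; ring.
    by rewrite enormZ ger0_norm //; lra.
  by rewrite ler_piMl ?enorm_ge0 //; lra.
rewrite (dist_sym q (z + _)) in tri; lra.
Qed.

(** The points on the same side as [x] form a relatively open and closed subset. The mesh threshold
    may vary along [V], but only the pair [x], [y] matters. *)
Lemma connected_same (V : set (R * R)) x y : connected V -> V x -> V y -> (forall z, V z -> ~ bdry Omega z) -> same_side x y.
Proof.
move=> cV Vx Vy hV; pose S : set (R * R) := [set z | same_side x z].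
have loc z : V z -> exists2 d : R, 0 < d & forall z', dist z' z < d -> same_side z z'.
  move=> Vz; have [d d0 hd] := near_const (hV z Vz); exists d => // z' hz'.
  by apply: finely_imp hd => M _; apply => //; rewrite distxx.
suff E : V `&` S = V by move: Vy; rewrite -E => -[].
apply: cV.
- by exists x; split => //; exists 1.
- exists S°; first exact: open_interior.
  apply/seteqP; split => z [Vz Sz]; split => //; last exact: interior_subset.
  have [d d0 hd] := loc z Vz; apply: filterS (nbhs_eball z d0) => z' hz'.
  exact: same_trans Sz (hd z' hz').
- exists (closure S); first exact: closed_closure.
  apply/seteqP; split => z [Vz Sz]; split => //; first exact: subset_closure.
  have [d d0 hd] := loc z Vz; have [z' [Sz' hz']] := Sz _ (nbhs_eball z d0).
  exact: same_trans Sz' (same_sym (hd z' hz')).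
Qed.

Lemma connected_segment x y : connected [set x + t *: (y - x) | t in `[0, 1]%classic].
Proof.
apply: connected_continuous_connected.
  apply/connected_intervalP => a b; rewrite /= !in_itv /= => /andP[a0 a1] /andP[b0 b1] z /andP[az zb].
  by rewrite in_itv /=; apply/andP; split; lra.
apply: continuous_subspaceT => t.
by apply: cvgD; [exact: cvg_cst|apply: cvgZr_tmp; exact: cvg_id].
Qed.

Lemma segment_same x y : (forall t : R, 0 <= t <= 1 -> ~ bdry Omega (x + t *: (y - x))) -> same_side x y.
Proof.
move=> h; refine (@connected_same _ x y (@connected_segment x y) _ _ _).
- by exists 0; rewrite /= ?in_itv /= ?lexx ?ler01 // scale0r addr0.
- by exists 1; rewrite /= ?in_itv /= ?lexx ?ler01 // scale1r addrC subrK.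
- by move=> _ [t tI <-]; apply: h; move: tI; rewrite /= in_itv.
Qed.

Definition btw (s a b : R) := a < s < b \/ b < s < a.

(** Meant for the abscissae of the ends of two boundary edges over a common abscissa: no mesh vertex
    lies inside a subtended arc, so both edges have the same end points. *)
Lemma btw_ends (s a b a' b' : R) : btw s a b -> btw s a' b' -> ~ btw a' a b -> ~ btw b' a b ->
  ~ btw a a' b' -> ~ btw b a' b' -> (a = a' /\ b = b') \/ (a = b' /\ b = a').
Proof.
have ae (x y : R) : ~ x < y -> ~ y < x -> x = y by move=> /negP h1 /negP h2; apply/eqP; rewrite eq_le leNgt h2 leNgt h1.
move=> h1 h2 n1 n2 n3 n4; case: h1 => /andP[p1 p2]; case: h2 => /andP[q1 q2]; [left|right|right|left]; split; apply: ae => h;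
  solve [by apply: n1; (left + right); apply/andP; split; lra|by apply: n2; (left + right); apply/andP; split; lra|by apply: n3; (left + right); apply/andP; split; lra|by apply: n4; (left + right); apply/andP; split; lra].
Qed.

Lemma ratio_btw (s a b : R) : btw s a b -> 0 < (s - a) / (b - a) < 1.
Proof.
case=> /andP[s1 s2].
  have d : 0 < b - a by lra.
  by apply/andP; split; [apply: divr_gt0; lra|rewrite ltr_pdivrMr // mul1r; lra].
have d : 0 < a - b by lra.
have -> : (s - a) / (b - a) = (a - s) / (a - b) by rewrite -(opprB a s) -(opprB a b) invrN mulrNN.
by apply/andP; split; [apply: divr_gt0; lra|rewrite ltr_pdivrMr // mul1r; lra].
Qed.

Lemma half_below (a b c : R) : 0 < a -> a <= b -> a <= c -> [/\ 0 < a / 2, a / 2 < b & a / 2 <= c].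
Proof. by move=> *; split; lra. Qed.

Lemma segment_above (c tau r t : R) : `|c| <= r / 8 -> 0 < tau -> tau <= r / 8 -> 0 <= t -> t <= 1 ->
  `|c + tau + t * (r / 2 - (c + tau))| <= r / 2 /\ c < c + tau + t * (r / 2 - (c + tau)).
Proof.
rewrite ler_norml => /andP[m1 m2] tau0 taur t0 t1.
have q0 : 0 <= t * (r / 2 - (c + tau)) by apply: mulr_ge0 => //; lra.
have q1 : t * (r / 2 - (c + tau)) <= r / 2 - (c + tau) by rewrite ler_piMl //; lra.
by split; [rewrite ler_norml; apply/andP; split; lra|lra].
Qed.

Section Chart.
Variables (p u : R * R) (r dl : R) (f : R -> R).
Hypothesis ch : chart Omega p r u f.
Hypotheses (bp : bdry Omega p) (dl0 : 0 < dl) (dlr : dl <= r / 4).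
Hypothesis fdl : forall a, `|a| <= dl -> `|f a| <= r / 4.

Let r0 : 0 < r. Proof. by case: ch. Qed.
Let u1 : enorm u = 1. Proof. by case: ch. Qed.
Let oO : open Omega. Proof. by case: bO. Qed.

Definition pt (a h : R) : R * R := p + (a *: u + h *: rot90 u).
Definition ab x : R := dot (x - p) u.
Definition ht x : R := dot (x - p) (rot90 u).

Lemma ab_pt a h : ab (pt a h) = a.
Proof. by rewrite /ab /pt addrC addKr; case: (dot_frame a h u1). Qed.
Lemma ht_pt a h : ht (pt a h) = h.
Proof. by rewrite /ht /pt addrC addKr; case: (dot_frame a h u1). Qed.
Lemma pt_frame x : x = pt (ab x) (ht x).
Proof. by rewrite /pt -(frame_dec (x - p) u1) addrC subrK. Qed.
Lemma ab_le x : `|ab x| <= dist x p.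
Proof. by apply: (le_trans (norm_dot_le _ _)); rewrite u1 mulr1. Qed.
Lemma ht_le x : `|ht x| <= dist x p.
Proof. by apply: (le_trans (norm_dot_le _ _)); rewrite enorm_rot90 u1 mulr1. Qed.
Lemma pt_le a h : dist (pt a h) p <= `|a| + `|h|.
Proof.
rewrite /dist /pt addrC addKr; apply: (le_trans (ler_enormD _ _)).
by rewrite !enormZ enorm_rot90 u1 !mulr1.
Qed.
Lemma ab_lip x y : `|ab x - ab y| <= dist x y.
Proof.
have -> : ab x - ab y = dot (x - y) u by rewrite /ab /dot !coordE; ring.
by apply: (le_trans (norm_dot_le _ _)); rewrite u1 mulr1.
Qed.
Lemma ht_lip x y : `|ht x - ht y| <= dist x y.
Proof.
have -> : ht x - ht y = dot (x - y) (rot90 u) by rewrite /ht /dot !coordE; ring.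
by apply: (le_trans (norm_dot_le _ _)); rewrite enorm_rot90 u1 mulr1.
Qed.
Lemma pt_line a h a' h' (t : R) : pt a h + t *: (pt a' h' - pt a h) = pt (a + t * (a' - a)) (h + t * (h' - h)).
Proof. by rewrite /pt; apply: pair_eqP; rewrite !coordE; ring. Qed.
Lemma ab_line x y (t : R) : ab (x + t *: (y - x)) = ab x + t * (ab y - ab x).
Proof. by rewrite /ab /dot !coordE; ring. Qed.

Lemma in_Omega x : dist x p < r -> Omega x <-> f (ab x) < ht x.
Proof. by case: ch => _ _ _; apply. Qed.
Lemma on_bdry x : dist x p < r -> bdry Omega x <-> ht x = f (ab x).
Proof. exact: (chart_bdry oO ch). Qed.

Lemma pt_same a h a' h' : (forall t : R, 0 <= t <= 1 ->
   `|a + t * (a' - a)| + `|h + t * (h' - h)| < r /\ h + t * (h' - h) != f (a + t * (a' - a))) -> same_side (pt a h) (pt a' h').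
Proof.
move=> H; apply: segment_same => t tI; rewrite pt_line; have [h1 /eqP h2] := H t tI.
by move/(on_bdry (le_lt_trans (pt_le _ _) h1)); rewrite ht_pt ab_pt.
Qed.

Lemma side_below x : dist x p < dl -> ~ Omega x -> ~ bdry Omega x -> same_side x (pt 0 (- (r / 2))).
Proof.
have hr0 := r0; have hdl0 := dl0; have hdlr := dlr.
move=> hx; have xr : dist x p < r by lra.
rewrite (in_Omega xr) (on_bdry xr) => /negP; rewrite -leNgt le_eqVlt => /predU1P[|hf _]; first by move=> ->.
have ha := le_lt_trans (ab_le x) hx; have hh := le_lt_trans (ht_le x) hx.
rewrite {1}(pt_frame x); apply: (same_trans (y := pt (ab x) (- (r / 2)))); apply: pt_same => t /andP[t0 t1].
  rewrite subrr mulr0 addr0; move: hh; rewrite ltr_norml => /andP[l1 l2].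
  have m0 : 0 <= t * (ht x + r / 2) by apply: mulr_ge0 => //; lra.
  have m1 : t * (ht x + r / 2) <= ht x + r / 2 by rewrite ler_piMl //; lra.
  have E : ht x + t * (- (r / 2) - ht x) = ht x - t * (ht x + r / 2) by ring.
  rewrite E; split; last by rewrite lt_eqF //; lra.
  have : `|ht x - t * (ht x + r / 2)| <= r / 2 by rewrite ler_norml; apply/andP; split; lra.
  lra.
rewrite subrr mulr0 addr0 sub0r; have E : ab x + t * - ab x = (1 - t) * ab x by ring.
have le1 : `|(1 - t) * ab x| <= `|ab x| by rewrite normrM ler_piMl // ger0_norm; lra.
rewrite E; have := fdl (le_trans le1 (ltW ha)); rewrite ler_norml => /andP[f1 _].
rewrite normrN (ger0_norm (x := r / 2)); last by lra.
by split; [lra|rewrite lt_eqF //; lra].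
Qed.

Lemma top_inside : Omega (pt 0 (r / 2)).
Proof.
have hr0 := r0; have hdl0 := dl0; have hdlr := dlr.
apply/in_Omega; first by apply: (le_lt_trans (pt_le _ _)); rewrite normr0 ger0_norm; lra.
rewrite ab_pt ht_pt; have := fdl (a := 0); rewrite normr0 => /(_ (ltW dl0)); rewrite ler_norml => /andP[_]; lra.
Qed.

(* Near p the polygon boundary is a chain over the graph of f: a vertical line through an interior point of an edge
   crosses it exactly once, since edges over the same abscissa subtend the same arc. *)
Lemma crossing : opposite_side (pt 0 (r / 2)) (pt 0 (- (r / 2))).
Proof.
have hr0 := r0; have hdl0 := dl0; have hdlr := dlr.
have r8 : 0 < dl / 8 by rewrite divr_gt0.
have [ha ha0 harc] := arc_small bO pO r8.
have e0 : 0 < Num.min ha (Num.min (dl / 8) 4^-1) by rewrite !lt_min ha0 r8 /= invr_gt0 ltr0n.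
have eC : 0 < Num.min (dl / 8) (4^-1 / (1 + C)) by rewrite lt_min r8 /= divr_gt0 ?invr_gt0 ?addr_gt0 ?ltr0n.
apply: finely_imp (finely_and (finely_small e0) (finely_small eC)) => M aM [].
rewrite !lt_min => -[/and3P[h1 h2 h3] /and3P[k1 k2 k3]] [/andP[_ hC4] _].
have hm0 := hmax_ge0 M; have d0 := adm_tdet aM; have conf := mesh_conforming aM.
have Ch : C * hmax M < 2^-1.
  move: hC4; rewrite ltr_pdivlMr ?addr_gt0 // mulrDr mulr1 mulrC => h; lra.
have [hn1 hn2] := hausdorff_near (mesh_hausdorff aM) k2.
have [y0 by0 _] := hn1 p bp.
have [k0 _ _] : Omegah M y0.
  by have [c0 _] := by0; have cl := Omegah_closed d0; exact: cl.
have [v Vv vp] := bdry_near_vertex aM k0 Ch bp.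
have arcE (l : 'I_(nel M)) (j : 'I_3) : bd_edge l j -> dist (va l j) p < r / 2 + r / 4 -> [/\ bdry Omega (va l j), bdry Omega (vb l j),
    dist (va l j) p < r /\ dist (vb l j) p < r, ab (va l j) != ab (vb l j) & forall s, btw s (ab (va l j)) (ab (vb l j)) ->
    dist (pt s (f s)) p < r /\ (bd_vertex M (pt s (f s)) -> pt s (f s) = va l j \/ pt s (f s) = vb l j)].
  move=> be hva; have [A [sA Ab AV _ _]] := mesh_arcs aM be.
  have Va : bd_vertex M (va l j) by exists l, j; split => //; left.
  have Vb : bd_vertex M (vb l j) by exists l, j; split => //; right.
  have ba := mesh_vertices aM Va; have bb := mesh_vertices aM Vb.
  have dab : dist (va l j) (vb l j) <= hmax M := le_trans (len_le_hk l j) (hk_le_hmax l).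
  have small := harc (hmax M) (bd_vertex M) A _ _ h1 (@mesh_vertices _ _ _ _ _ _ aM) (bdry_near_vertex aM k0 Ch) sA Ab AV dab.
  have dvb : dist (vb l j) p < r.
    by have := dist_tri (vb l j) (va l j) p; rewrite (dist_sym (vb l j) (va l j)); lra.
  have dva : dist (va l j) p < r by lra.
  have abn : ab (va l j) != ab (vb l j).
    apply/eqP => E; have := len_gt0 d0 l j; rewrite /len.
    have e1' := (on_bdry dva).1 ba; have e2' := (on_bdry dvb).1 bb.
    by rewrite (pt_frame (va l j)) (pt_frame (vb l j)) e1' e2' E distxx ltxx.
  split => // s hs; have [gam [cg g0 g1 _ gA]] := arc_param sA.
  have ch' : continuous (fun t => ab (gam t)).
    by move=> t; apply: (@continuous_comp _ _ _ gam ab); [exact: cg|exact: continuous_dot].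
  have [|t tI ht'] := @IVT R (fun t => ab (gam t)) 0 1 s ler01 (continuous_subspaceT ch').
    rewrite g0 g1 ge_min le_max; case: hs => /andP[s1 s2]; rewrite (ltW s1) (ltW s2) ?orbT //.
  have At : A (gam t) by rewrite gA; exists t.
  have dt : dist (gam t) p < r by have := small _ At; have := dist_tri (gam t) (va l j) p; lra.
  have E : gam t = pt s (f s).
    by rewrite [LHS]pt_frame ((on_bdry dt).1 (Ab _ At)) -ht'.
  rewrite -E; split => // Vt.
  have : (A `&` bd_vertex M) (gam t) by split.
  by rewrite AV.
have [k [i [bk vE]]] := Vv.
have vnear x : elt k x -> dist x p <= 3 * hmax M.
  move=> ex; have ev' : elt k v by case: vE => ->; exact: (tri_vtx (vtx k) _).
  have := dist_tri x v p; have := dist_le_hk ex ev'; have := hk_le_hmax k; lra.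
have va_near : dist (va k i) p < r / 2 + r / 4 by have := vnear _ (tri_vtx (vtx k) (i + 1)); rewrite -/(va k i); lra.
have [ba bb [dva dvb] abn arck] := arcE k i bk va_near.
(* The abscissae of all mesh vertices: the vertical line is taken at an [s] outside this list, so it
   meets the polygon boundary only inside edges. *)
pose L := [seq ab (vtx ki.1 ki.2) | ki <- enum ({: 'I_(nel M) * 'I_3})].
have [s [hs sL]] : exists s, btw s (ab (va k i)) (ab (vb k i)) /\ s \notin L.
  have gen (a b : R) : a < b -> exists s, a < s < b /\ s \notin L.
    move=> lab; have [s [hs h]] := avoid_list L lab; exists s; split => //.
    apply/negP => sL; have := h s sL; rewrite subrr normr0 leNgt divr_gt0 ?subr_gt0 // mulr_gt0 // exprn_gt0 //.
  have [lt|lt|eq] := ltgtP (ab (va k i)) (ab (vb k i)).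
  - by have [s [h1' h2']] := gen _ _ lt; exists s; split => //; left.
  - by have [s [h1' h2']] := gen _ _ lt; exists s; split => //; right.
  - by rewrite eq eqxx in abn.
have notvtx (l : 'I_(nel M)) (j : 'I_3) : ab (vtx l j) != s.
  apply/eqP => E; move/negP: sL; apply; apply/mapP; exists (l, j) => //; by rewrite mem_enum.
pose t0 : R := (s - ab (va k i)) / (ab (vb k i) - ab (va k i)).
have abd : ab (vb k i) - ab (va k i) != 0 by rewrite subr_eq0 eq_sym.
have t01 : 0 < t0 < 1 := ratio_btw hs.
pose m := ept k i t0.
have abm : ab m = s by rewrite /m /ept ab_line /t0 divfK // addrC subrK.
have em : elt k m by apply: (ept_elt d0); rewrite !ltW //; case/andP: t01.
have mp := vnear m em; have hmr := ht_le m; have hms := ab_le m; rewrite abm in hms.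
have htm : `|ht m| <= r / 8 by lra.
have once h : `|h| <= r / 2 -> bdry (Omegah M) (pt s h) -> h = ht m.
  move=> hh hb; have [[l [j E]]|[l [j [bl [t' t'I E]]]]] := bdry_Omegah_cases d0 conf hb.
    by have := notvtx l j; rewrite -E ab_pt eqxx.
  have t'I' : 0 <= t' <= 1 by case/andP: t'I => *; rewrite !ltW.
  have ey : elt l (pt s h) by rewrite E; exact: (ept_elt d0).
  have dl' : dist (va l j) p < r / 2 + r / 4.
    have := dist_tri (va l j) (pt s h) p; have := dist_le_hk (tri_vtx (vtx l) (j + 1)) ey; rewrite -/(va l j).
    have := hk_le_hmax l; have := pt_le s h; lra.
  have [bla blb [dla dlb] abl arcl] := arcE l j bl dl'.
  have sE : s = ab (va l j) + t' * (ab (vb l j) - ab (va l j)) by rewrite -(ab_pt s h) E /ept ab_line.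
  have hs' : btw s (ab (va l j)) (ab (vb l j)).
    case/andP: t'I => t'0 t'1; have [lt|lt|eq] := ltgtP (ab (va l j)) (ab (vb l j)); last by rewrite eq eqxx in abl.
      left; rewrite sE ltrDl mulr_gt0 ?subr_gt0 //=; rewrite -ltrBrDl gtr_pMl ?subr_gt0 //.
    right; rewrite sE; have q0 : 0 < t' * (ab (va l j) - ab (vb l j)) by rewrite mulr_gt0 ?subr_gt0.
    have q1 : t' * (ab (va l j) - ab (vb l j)) < ab (va l j) - ab (vb l j) by rewrite gtr_pMl ?subr_gt0.
    by apply/andP; split; lra.
  have gr x : bdry Omega x -> dist x p < r -> x = pt (ab x) (f (ab x)) by move=> bx dx; rewrite {1}(pt_frame x) ((on_bdry dx).1 bx).
  (* A vertex with abscissa strictly between those of the ends would be an inner mesh vertex of the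
     subtended arc. *)
  have excl (l1 : 'I_(nel M)) (j1 : 'I_3) x : bd_edge l1 j1 -> dist (va l1 j1) p < r / 2 + r / 4 -> bd_vertex M x -> bdry Omega x -> dist x p < r ->
      ~ btw (ab x) (ab (va l1 j1)) (ab (vb l1 j1)).
    move=> b1 v1 Vx bx dx hx; have [_ _ _ _ a1] := arcE l1 j1 b1 v1; have [_ vv] := a1 _ hx.
    rewrite -(gr x bx dx) in vv; have [E1|E1] := vv Vx; move: hx; rewrite E1 => -[/andP[]|/andP[]]; rewrite ltxx //.
  have Vv' (l1 : 'I_(nel M)) (j1 : 'I_3) : bd_edge l1 j1 -> bd_vertex M (va l1 j1) /\ bd_vertex M (vb l1 j1).
    by move=> b1; split; exists l1, j1; split => //; [left|right].
  have [Va Vb] := Vv' k i bk; have [Va' Vb'] := Vv' l j bl.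
  have se : same_edge k i l j.
    have [[E1 E2]|[E1 E2]] := btw_ends hs hs' (excl k i _ bk va_near Va' bla dla) (excl k i _ bk va_near Vb' blb dlb)
       (excl l j _ bl dl' Va ba dva) (excl l j _ bl dl' Vb bb dvb).
      by rewrite /same_edge (gr _ ba dva) (gr _ bb dvb) E1 E2 -(gr _ bla dla) -(gr _ blb dlb) !eqxx.
    by rewrite /same_edge (gr _ ba dva) (gr _ bb dvb) E1 E2 -(gr _ bla dla) -(gr _ blb dlb) !eqxx orbT.
  have [kl|kl] := eqVneq k l; last by have := bd_edge_no_neighbour d0 conf j bk kl; rewrite se.
  subst l; have ij := mesh_one_bd_edge aM bk bl; subst j.
  have tt : t' = t0.
    have -> : t0 = (s - ab (va k i)) / (ab (vb k i) - ab (va k i)) by [].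
    by rewrite sE addrC addKr mulfK.
  by rewrite -(ht_pt s h) E tt.
have nonb (l : 'I_(nel M)) (j : 'I_3) : k != l -> ~~ same_edge k i l j by exact: (bd_edge_no_neighbour d0 conf j bk).
have [d dd0 hd] := no_neighbour_local d0 conf nonb t01; rewrite -/m in hd.
(* The edge is not vertical, so moving upwards changes the barycentric coordinate that decides
   membership near [m]; points just above and just below [m] are therefore on different sides. *)
pose D := dbary (vtx k) i (rot90 u).
have D0 : D != 0.
  rewrite /D (dbaryE0 _ _ (d0 k)) mulf_neq0 ?invr_eq0 ?d0 //.
  have -> : cross (rot90 u) (vtx k (i + 1) - vtx k (i - 1)) = ab (vb k i) - ab (va k i).
    by rewrite /cross /ab /dot /va /vb !coordE /=; ring.
  exact: abd.
have mm0 : 0 < Num.min d (dl / 8) by rewrite lt_min dd0.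
have mm1 : Num.min d (dl / 8) <= d by rewrite ge_min lexx.
have mm2 : Num.min d (dl / 8) <= dl / 8 by rewrite ge_min lexx orbT.
move: mm0 mm1 mm2; set mn : R := Num.min d (dl / 8) => mm0 mm1 mm2; pose tau : R := mn / 2.
have [tau0 taud taul] : [/\ 0 < tau, tau < d & tau <= dl / 8] := half_below mm0 mm1 mm2.
have taur : tau <= r / 8 by lra.
have mE : m = pt s (ht m) by rewrite {1}(pt_frame m) abm.
have loc (h : R) : `|h| < d -> Omegah M (pt s (ht m + h)) <-> 0 <= h * D.
  move=> hh; have E : pt s (ht m + h) - m = h *: rot90 u.
    by rewrite {2}mE /pt; apply: pair_eqP; rewrite !coordE; ring.
  rewrite hd; last by rewrite /dist E enormZ enorm_rot90 u1 mulr1.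
  rewrite (bary_shift _ _ m (d0 k)) (bary_ept d0) add0r E; have -> : dbary (vtx k) i (h *: rot90 u) = h * D; last by [].
  by rewrite /D !dbaryE0 // /cross !coordE; ring.
have up : Omegah M (pt s (ht m + tau)) <-> Omegah M (pt s (r / 2)).
  apply: (segment_const aM) => t /andP[t0' t1']; rewrite pt_line subrr mulr0 addr0 => hb.
  have [y1 y2] := segment_above htm tau0 taur t0' t1'.
  by rewrite (once _ y1 hb) ltxx in y2.
have down : Omegah M (pt s (ht m - tau)) <-> Omegah M (pt s (- (r / 2))).
  apply: (segment_const aM) => t /andP[t0' t1']; rewrite pt_line subrr mulr0 addr0 => hb.
  have htm' : `|- ht m| <= r / 8 by rewrite normrN.
  have [y1 y2] := segment_above htm' tau0 taur t0' t1'.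
  have EE : ht m - tau + t * (- (r / 2) - (ht m - tau)) = - (- ht m + tau + t * (r / 2 - (- ht m + tau))) by ring.
  rewrite EE in hb; rewrite -normrN in y1.
  by move: y2; rewrite -[X in _ < X]opprK (once _ y1 hb) ltxx.
(* At heights r/2 and -r/2 the boundary of Omega, here of height at most r/4, is too far away for
   the polygon boundary to occur, so one may slide horizontally to abscissa 0. *)
have side (h : R) : `|h| = r / 2 -> Omegah M (pt s h) <-> Omegah M (pt 0 h).
  move=> hh; apply: (segment_const aM) => t /andP[t0' t1']; rewrite pt_line subrr mulr0 addr0 sub0r => hb.
  have [q bq dq] := hn2 _ hb; set a := s + t * - s in dq hb.
  have aE : a = (1 - t) * s by rewrite /a; ring.
  have al : `|a| <= `|s| by rewrite aE normrM ler_piMl // ger0_norm ?subr_ge0 // gerBl.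
  have dqp : dist q p < r by have := dist_tri q (pt a h) p; have := pt_le a h; rewrite (dist_sym q (pt a h)); lra.
  have hq := (on_bdry dqp).1 bq.
  have dd1 := ab_lip (pt a h) q; rewrite ab_pt distrC in dd1.
  have dd2 := ht_lip (pt a h) q; rewrite ht_pt in dd2.
  have abq : `|ab q| <= dl by have := ler_normD (ab q - a) a; rewrite subrK; lra.
  have := fdl abq; rewrite -hq; have := ler_normD (h - ht q) (ht q); rewrite subrK hh; lra.
have s1 := side (r / 2); rewrite ger0_norm in s1; last by lra.
have s2 := side (- (r / 2)); rewrite normrN ger0_norm in s2; last by lra.
rewrite -(s1 erefl) -(s2 erefl) -up -down.
have lu := loc tau; rewrite gtr0_norm // in lu; have ld := loc (- tau); rewrite normrN gtr0_norm // in ld.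
rewrite (lu taud) (ld taud) mulNr oppr_ge0; split; first by move=> h1'; apply/negP; rewrite -ltNge lt_neqAle h1' andbT eq_sym mulf_neq0 // gt_eqF.
by move/negP; rewrite -ltNge => /ltW.
Qed.

End Chart.
Let oO : open Omega. Proof. by case: bO. Qed.

Lemma bdry_notin x : bdry Omega x -> ~ Omega x.
Proof. by move=> [_ ni] Ox; apply: ni; rewrite (interior_id _).1. Qed.

Lemma closure_bdry x : closure Omega x -> ~ Omega x -> bdry Omega x.
Proof. by move=> cx nx; split => // ix; apply: nx; exact: interior_subset. Qed.

Lemma corner_list : exists L : seq (R * R), (forall x, x \in L -> bdry Omega x) /\
  forall x, bdry Omega x -> x \notin L -> C2_boundary_at Omega x.
Proof.
have [n [g [_ _ hb hC]]] := pO.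
exists ([seq g i 0 | i <- enum 'I_n] ++ [seq g i 1 | i <- enum 'I_n]); split.
  move=> x; rewrite mem_cat hb => /orP[|] /mapP[i _ ->]; exists i => //.
    by exists 0 => //=; rewrite in_itv /= lexx ler01.
  by exists 1 => //=; rewrite in_itv /= lexx ler01.
move=> x; rewrite hb => -[i _ [t]]; rewrite /= in_itv /= => /andP[t0 t1] <-; rewrite mem_cat negb_or => /andP[n0 n1].
apply: hC; rewrite in_itv /= !lt_neqAle t0 t1 !andbT; apply/andP; split; apply/eqP => E.
  by move/negP: n0; apply; apply/mapP; exists i; rewrite ?mem_enum // -E.
by move/negP: n1; apply; apply/mapP; exists i; rewrite ?mem_enum // E.
Qed.

Lemma chart_scale p : C2_boundary_at Omega p -> exists (r dl : R) u (f : R -> R),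
  [/\ chart Omega p r u f, 0 < dl, dl <= r / 4, forall a, `|a| <= dl -> `|f a| <= r / 4 & f 0 = 0].
Proof.
move=> [bp [r [u [f [r0 u1 cf hO]]]]]; have ch : chart Omega p r u f by [].
have pr : eball p r p by rewrite /eball /= distxx.
have f0 : f 0 = 0.
  have := (chart_bdry oO ch pr).1 bp; rewrite subrr /dot /= !mul0r addr0 => <- //.
have r4 : 0 < r / 4 by rewrite divr_gt0.
have cf0 : continuous f by exact: class_C2_continuous.
have /cvgrPdist_lt/(_ _ r4)/nbhs_ballP[e /= e0 he] := cf0 (0 : R).
exists r, (Num.min (e / 2) (r / 4)), u, f; split => //.
- by rewrite lt_min r4 divr_gt0.
- by rewrite ge_min lexx orbT.
- move=> a; rewrite le_min => /andP[a1 a2]; have := he a; rewrite /ball /= f0 !sub0r !normrN => H.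
  by apply: ltW; apply: H; lra.
Qed.

Lemma ray_near x q (t s : R) : dist (x + t *: (q - x)) (x + s *: (q - x)) = `|t - s| * enorm (q - x).
Proof.
by rewrite /dist (_ : _ - _ = (t - s) *: (q - x)) ?enormZ //; apply: pair_eqP; rewrite !coordE; ring.
Qed.

Lemma step_back (t D e : R) : 0 < t -> 0 <= D -> 0 < e -> exists2 s : R, 0 <= s < t & `|s - t| * D < e.
Proof.
move=> t0 D0 e0; have D1 : 0 < D + 1 by lra.
have m0 : 0 < Num.min t (e / (2 * (D + 1))) by rewrite lt_min t0 divr_gt0 // mulr_gt0.
have m1 : Num.min t (e / (2 * (D + 1))) <= t by rewrite ge_min lexx.
have m2 : Num.min t (e / (2 * (D + 1))) <= e / (2 * (D + 1)) by rewrite ge_min lexx orbT.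
move: m0 m1 m2; set m := Num.min _ _ => m0 m1 m2.
exists (t - m); first by apply/andP; split; lra.
rewrite (_ : t - m - t = - m) ?normrN ?gtr0_norm //; last by ring.
have : m * (D + 1) <= e / 2.
  by apply: (le_trans (ler_wpM2r (ltW D1) m2)); rewrite le_eqVlt; apply/orP; left; apply/eqP; field; rewrite gt_eqF.
rewrite mulrDr mulr1; lra.
Qed.

(** On a segment from [x] into Omega that misses the corners, the first point of the closure of
    Omega is a C^2 boundary point. Before it the side does not change, and there [crossing] flips
    it. *)
Lemma exit_point x : ~ closure Omega x -> exists2 y, Omega y & opposite_side y x.
Proof.
move=> nx; have [[q Oq] _ _ _] := bO; have [L [Lb hL]] := corner_list.
have [e e0 he] := nbhs_eballP (open_nbhs_nbhs (conj oO Oq)).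
have xL : x \notin L by apply/negP => /Lb[].
have xq : x != q by apply/eqP => E; apply: nx; rewrite E; exact: subset_closure.
have [q' dq' av] := segment_avoid xL xq e0; have Oq' : Omega q' by exact: he.
pose l (t : R) := x + t *: (q' - x).
have cl : continuous l by move=> t; apply: cvgD; [exact: cvg_cst|apply: cvgZr_tmp; exact: cvg_id].
pose T : set R := `[0, 1]%classic `&` (l @^-1` closure Omega).
have cT : compact T.
  apply: compact_closedI; first exact: segment_compact.
  by apply: preimage_closed; [move=> t _; exact: cl|exact: closed_closure].
have T1 : T !=set0.
  exists 1; split; first by rewrite /= in_itv /= lexx ler01.
  by rewrite /= /l scale1r addrC subrK; exact: subset_closure.
have [|t Tt ht] := @compact_EVT_max _ R (fun t => - t) T T1 cT.
  by apply: continuous_subspaceT => t; apply: cvgN; exact: cvg_id.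
rewrite inE in Tt; have [tI ct] := Tt; move: tI; rewrite /= in_itv /= => /andP[t0 t1].
have before s : 0 <= s < t -> ~ closure Omega (l s).
  move=> /andP[s0 st] cs; have Ts : T s by split => //; rewrite /= in_itv /= s0 (le_trans (ltW st)).
  by have := ht s; rewrite inE => /(_ Ts); rewrite lerN2 leNgt st.
have tp : 0 < t.
  by rewrite lt_neqAle t0 andbT; apply/eqP => E; apply: nx; move: ct; rewrite /= -E /l scale0r addr0.
have D0 : 0 <= enorm (q' - x) := enorm_ge0 _.
have nOt : ~ Omega (l t).
  move=> Ot; have [e' e'0 he'] := nbhs_eballP (open_nbhs_nbhs (conj oO Ot)).
  have [s sI hs] := step_back tp D0 e'0; apply: (before s sI); apply: subset_closure.
  by apply: he'; rewrite /eball /= ray_near.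
have bt := closure_bdry ct nOt.
have [r [dl [u [f [ch dl0 dlr fdl _]]]]] := chart_scale (hL _ bt (av t)).
have [s sI hs] := step_back tp D0 dl0; have ns := before s sI.
exists (pt (l t) u 0 (r / 2)); first exact: (top_inside ch dl0 dlr fdl).
apply: (opp_same (crossing ch bt dl0 dlr fdl)); apply: same_sym.
have dz : dist (l s) (l t) < dl by rewrite ray_near.
apply: (same_trans (y := l s)); last first.
  have nO : ~ Omega (l s) by move=> Os; apply: ns; exact: subset_closure.
  have nb : ~ bdry Omega (l s) by move=> [].
  exact: (side_below ch dl0 dlr fdl dz nO nb).
apply: segment_same => a /andP[a0 a1]; move/andP: sI => [s0 st].
have -> : x + a *: (l s - x) = l (a * s) by rewrite /l; apply: pair_eqP; rewrite !coordE; ring.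
have as0 : 0 <= a * s by rewrite mulr_ge0.
have as1 : a * s <= s by rewrite ler_piMl.
by case=> cc _; apply: (before (a * s)) => //; rewrite as0; exact: le_lt_trans as1 st.
Qed.

(** Every point off the closure is opposite to some point of Omega, and Omega is connected; so all
    such points are on the same side as a far point, which the uniformly bounded Omega_h does not
    contain. *)
Lemma outside x : ~ closure Omega x -> finely (fun M => ~ Omegah M x).
Proof.
move=> nx; have [r r0 hr] := bounded_domain_enorm bO.
pose y0 : R * R := (r + 2, 0).
have hy : r + 2 <= enorm y0 by have := coord1_le_enorm y0; rewrite /= ger0_norm; lra.
have ny : ~ closure Omega y0 by move=> /hr; lra.
have [y Oy oy] := exit_point nx; have [y' Oy' oy'] := exit_point ny.
have sm : same_side y y'.
  have [_ _ cO _] := bO; refine (@connected_same _ y y' cO Oy Oy' _) => z Oz bz; exact: bdry_notin bz Oz.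
have fr : finely (fun M => ~ Omegah M y0).
  apply: finely_imp (finely_small ltr01) => M aM [_ hC] hO.
  have := Omegah_bounded aM (fun z (bz : bdry Omega z) => hr z bz.1) hC hO; lra.
by apply: finely_imp (finely_and oy (finely_and oy' (finely_and sm fr))) => M _; tauto.
Qed.

(** The points outside Omega, in a fixed ball, at distance at least [d] from the boundary form a
    compact set; [near_const] makes the threshold of [outside] locally uniform there. *)
Lemma strip_near (d : R) : 0 < d ->
  finely (fun M => forall x, Omegah M x -> ~ Omega x -> exists2 y, bdry Omega y & dist x y < d).
Proof.
move=> dp; have [r r0 hr] := bounded_domain_enorm bO.
pose K : set (R * R) := ecball 0 (r + 1) `&` (~` Omega `&` \bigcap_(y in bdry Omega) [set x | d <= dist x y]).
have cK : compact K.
  apply: (heine_borel2 (r := r + 1)).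
    apply: closedI; first exact: closed_ecball.
    apply: closedI; first exact: open_closedC.
    apply: closed_bigI => y _.
    have -> : [set x | d <= dist x y] = (fun x => dist x y) @^-1` [set t | d <= t] by [].
    by apply: preimage_closed; [move=> z _; exact: continuous_dist|exact: closed_ge].
  by move=> x [hx _]; move: hx; rewrite /ecball /= /dist subr0.
pose Q (e : R) z := forall M, admissible_mesh M Omega rho mu C -> hmax M < e -> ~ Omegah M z.
have [|z [_ [nz hz]]|e e0 he] := @compact_uniform R K Q cK.
- by move=> e e' z ee h M aM hM; apply: h => //; exact: lt_le_trans hM ee.
- have nb : ~ bdry Omega z by move=> bz; have := hz z bz; rewrite /= distxx leNgt dp.
  have nc : ~ closure Omega z by move=> cz; apply: nb; exact: closure_bdry.
  have [d' d'0 [e2 e20 h2]] := near_const nb; have [e1' e10 h1] := outside nc.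
  exists (Num.min d' (Num.min e1' e2)); first by rewrite !lt_min d'0 e10.
  move=> y Ky; rewrite lt_min => /andP[hy _] M aM; rewrite !lt_min => /and3P[_ k1 k2] Oy.
  by apply: (h1 M aM k1); apply/(h2 M aM k2 y z) => //; rewrite distxx.
have fe : finely (fun M => hmax M < e) by exists e.
apply: finely_imp (finely_and fe (finely_small ltr01)) => M aM [hM [_ hC]] x Ox nx.
apply: contrapT => no; have Kx : K x.
  split; last split => //.
    by rewrite /ecball /= /dist subr0; exact: (Omegah_bounded aM (fun z (bz : bdry Omega z) => hr z bz.1) hC Ox).
  by move=> y by_; rewrite /= leNgt; apply/negP => h; apply: no; exists y.
exact: (he x Kx M aM hM).
Qed.

(** Excludes slits: boundary points are limits of C^2 boundary points, below whose graph there is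
    exterior. It places open triangles inside Omega when Omega_h is only known to lie in the
    closure. *)
Lemma closure_interior x : (closure Omega)° x -> Omega x.
Proof.
move=> ix; apply: contrapT => nx; have [e e0 he] := nbhs_eballP ix.
have cx : closure Omega x := interior_subset ix.
have [n [g [hg _ hb hC]]] := pO; have := closure_bdry cx nx; rewrite hb => -[i _ [t]].
rewrite /= in_itv /= => /andP[t0 t1] gx; have [cg _ _] := hg i.
have [s [sI hs]] : exists s : R, 0 < s < 1 /\ dist (g i s) x < e / 2.
  have e2 : 0 < e / 2 by rewrite divr_gt0.
  have cgi : continuous (g i) by exact: class_C2_continuous.
  have := cgi t; rewrite /continuous_at gx => /(_ _ (nbhs_eball x e2))/nbhs_ballP[d /= d0 hd].
  have [lt|ge] := ltP t 1.
    pose m := Num.min (d / 2) ((1 - t) / 2).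
    have m0 : 0 < m by rewrite lt_min !divr_gt0 ?subr_gt0.
    have m1 : m <= d / 2 by rewrite ge_min lexx.
    have m2 : m <= (1 - t) / 2 by rewrite ge_min lexx orbT.
    exists (t + m); split; first by apply/andP; split; lra.
    apply: hd; rewrite /ball /= opprD addrA subrr sub0r normrN gtr0_norm //; lra.
  pose m := Num.min (d / 2) (2^-1).
  have m0 : 0 < m by rewrite lt_min divr_gt0 //= invr_gt0.
  have m1 : m <= d / 2 by rewrite ge_min lexx.
  have m2 : m <= 2^-1 by rewrite ge_min lexx orbT.
  exists (t - m); split; first by apply/andP; split; lra.
  apply: hd; rewrite /ball /= opprB addrCA subrr addr0 gtr0_norm //; lra.
have sI' : s \in `]0, 1[ by rewrite in_itv.
have C2 := hC i s sI'; have bs := C2.1; have [r [dl [u [f [ch dl0 dlr fdl f0]]]]] := chart_scale C2.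
have r0 : 0 < r by case: ch.
pose h := Num.min (r / 2) (e / 4).
have h0 : 0 < h by rewrite lt_min !divr_gt0.
have h1 : h <= r / 2 by rewrite ge_min lexx.
have h2 : h <= e / 4 by rewrite ge_min lexx orbT.
pose y := pt (g i s) u 0 (- h).
have dy : dist y (g i s) <= h by apply: (le_trans (pt_le ch _ _)); rewrite normr0 add0r normrN gtr0_norm.
have cy : closure Omega y by apply: he; rewrite /eball /=; have := dist_tri y (g i s) x; lra.
have yr : dist y (g i s) < r by lra.
have E1 : ab (g i s) u y = 0 := ab_pt ch _ _; have E2 : ht (g i s) u y = - h := ht_pt ch _ _.
have nOy : ~ Omega y by rewrite (in_Omega ch yr) E1 E2 f0; lra.
have := closure_bdry cy nOy; rewrite (on_bdry ch yr) E1 E2 f0; lra.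
Qed.

End Sides.

(** * Stability from coercivity on a nearby space *)

Section Abstract_stability.
Context {R : realType} {T : zmodType}.
Variables (D V W : set T) (B : T -> T -> R) (E nrm : T -> R) (Kc Kn dl : R).
Hypotheses (Kc0 : 0 < Kc) (Kn0 : 0 < Kn) (dl0 : 0 <= dl) (dl4 : dl <= 4^-1) (dlK : 512 * Kc ^+ 2 * dl <= 1).
Hypotheses (VD : V `<=` D) (WD : W `<=` D) (DB : forall w v, D w -> D v -> D (w - v)).
Hypotheses (E0 : forall u, 0 <= E u) (Badd : forall w w' v, B (w + w') v = B w v + B w' v).
Hypothesis cont : forall (t : R) w v, D w -> D v -> 0 < t -> `|B w v| <= t * (Kc * E w) + t^-1 * (Kc * E v).
Hypothesis coer : forall v, V v -> E v / 4 <= B v v.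
Hypothesis Eadd : forall u v, E (u + v) <= 2 * E u + 2 * E v.
Hypothesis nrmE : forall u, D u -> nrm u ^+ 2 <= Kn * E u.
Hypothesis nrm0 : forall u, D u -> u != 0 -> 0 < nrm u.
Hypothesis WV : forall w, W w -> exists2 v, V v & E (w - v) <= dl * E w.
Hypothesis VW : forall v, V v -> exists2 w, W w & E (w - v) <= dl * E w.

(** B(w, v) = B(v, v) + B(w - v, v). Coercivity gives E(v)/4; continuity with the weight 8 Kc costs
    E(v)/8 and 8 Kc^2 E(w - v). Since E(w) <= 4 E(v), the latter is at most E(v)/16 under 512 Kc^2
    dl <= 1, where 512 is 8 times 4 times 16. *)
Lemma stability_core w v : D w -> V v -> E (w - v) <= dl * E w -> E v / 16 <= B w v /\ E w <= 4 * E v.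
Proof.
move=> Dw Vv h; have Dv := VD Vv; have k0 := Kc0.
have e1' := E0 w; have e2' := E0 v.
have Ew : E w <= 4 * E v.
  have := Eadd v (w - v); rewrite addrC subrK => h1.
  have := ler_wpM2r (E0 w) dl4; lra.
split => //; have -> : B w v = B v v + B (w - v) v by rewrite -Badd [v + _]addrC subrK.
have t0 : 0 < 8 * Kc by rewrite mulr_gt0.
have := cont (DB Dw Dv) Dv t0; rewrite ler_norml => /andP[h1 _].
have h2 : (8 * Kc)^-1 * (Kc * E v) = E v / 8 by field; rewrite gt_eqF.
have h3 : 8 * Kc * (Kc * E (w - v)) <= E v / 16.
  apply: (@le_trans _ _ (8 * Kc * (Kc * (dl * E w)))).
    by rewrite ler_pM2l // ler_pM2l.
  have -> : 8 * Kc * (Kc * (dl * E w)) = (512 * Kc ^+ 2 * dl) * E w / 64 by field.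
  have := ler_wpM2r (E0 w) dlK; lra.
have := coer Vv; rewrite h2 in h1; lra.
Qed.

(** B(w, v) >= E(v)/16 while the product of the norms is at most 2 Kn E(v), whence the factor 32. *)
Lemma abstract_inf_sup w : W w -> w != 0 -> exists v, [/\ V v, v != 0 & (32 * Kn)^-1 <= B w v / (nrm w * nrm v)].
Proof.
move=> Ww w0; have Dw := WD Ww; have [v Vv h] := WV Ww; have Dv := VD Vv.
have [hB hE] := stability_core Dw Vv h; have nw := nrm0 Dw w0.
have Ew : 0 < E w.
  by rewrite -(pmulr_rgt0 _ Kn0); apply: lt_le_trans (nrmE Dw); rewrite exprn_gt0.
have v0 : v != 0.
  apply/eqP => v0; rewrite v0 subr0 in h; have := ler_wpM2r (E0 w) dl4; lra.
have Ev : 0 < E v by lra.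
have nv := nrm0 Dv v0; exists v; split => //.
have pp : 0 < nrm w * nrm v by rewrite mulr_gt0.
have p0 : 0 <= 2 * Kn * E v by apply: mulr_ge0; [apply: mulr_ge0 => //; exact: ltW|exact: ltW].
have s2 : (nrm w * nrm v) ^+ 2 <= (2 * Kn * E v) ^+ 2.
  rewrite exprMn; have -> : (2 * Kn * E v) ^+ 2 = (Kn * (4 * E v)) * (Kn * E v) by ring.
  apply: ler_pM; [exact: sqr_ge0|exact: sqr_ge0| |exact: nrmE].
  by apply: (le_trans (nrmE Dw)); rewrite ler_pM2l.
have np : nrm w * nrm v <= 2 * Kn * E v.
  by move: s2; rewrite ler_pXn2r // nnegrE // ltW.
rewrite ler_pdivlMr //; apply: le_trans hB.
have K32 : 0 < (32 * Kn)^-1 by rewrite invr_gt0 mulr_gt0.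
apply: (@le_trans _ _ ((32 * Kn)^-1 * (2 * Kn * E v))); first by rewrite ler_pM2l.
by rewrite le_eqVlt; apply/orP; left; apply/eqP; field; rewrite gt_eqF.
Qed.

Lemma abstract_injective v : V v -> (forall w, W w -> B w v = 0) -> v = 0.
Proof.
move=> Vv h; have [w Ww hw] := VW Vv; have Dv := VD Vv.
have [hB _] := stability_core (WD Ww) Vv hw; rewrite (h w Ww) in hB.
apply/eqP; apply: contraT => v0; have nv := nrm0 Dv v0.
have : 0 < nrm v ^+ 2 by rewrite exprn_gt0.
have := nrmE Dv; have : Kn * E v <= 0 by rewrite pmulr_rle0 //; lra.
lra.
Qed.

End Abstract_stability.

(** * Displacement of boundary nodes and local bounds on the convection field *)

Section Geometry.
Context {R : realType}.
Variables (Omega : set (R * R)).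
Hypotheses (bO : bounded_domain Omega) (pO : piecewise_C2_boundary Omega).

(* The cut point on the arc subtended by the edge is close to the node, and the assigned point is at least as close. *)
Lemma displacement_small (rho mu C e : R) (N : nat) (nd : 'I_(Np N) -> R * R) : 0 < rho -> 0 < mu -> 0 < C ->
  0 < e -> e <= 1 ->
  finely Omega rho mu C (fun M => forall P, boundary_points nd Omega P -> forall k i n, @bd_edge R M k i ->
     inner_edge_node nd k i n -> dist (node nd k n) (P k n) <= e * hk k).
Proof.
move=> rho0 mu0 C0 e0 e1'; pose kap : R := rho / mu; have k0 : 0 < kap by rewrite divr_gt0.
pose e' : R := e / (4 * kap); have e'0 : 0 < e' by rewrite divr_gt0 // mulr_gt0.
have ek : 4 * (e' * kap) = e by rewrite /e'; field; rewrite gt_eqF.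
have [h0 h00 hthin] := arc_thin bO pO e'0.
have c0 : 0 < 4^-1 / (1 + C) by rewrite divr_gt0 ?invr_gt0 ?ltr0n // addr_gt0.
have fh : finely Omega rho mu C (fun M => hmax M < h0) by exists h0.
apply: finely_imp (finely_and fh (finely_small Omega rho mu C0 c0)) => M aM [hM [hC4 _]] P hP k i n bk inn.
have hm0 := hmax_ge0 M; have d0 := adm_tdet aM.
have Ch : C * hmax M < 2^-1.
  by move: hC4; rewrite ltr_pdivlMr ?addr_gt0 // mulrDr mulr1 mulrC => h; lra.
have [ei _ _] := inn; have [t tI nE] := (edge_ept k i _).1 ei.
have [A [sA Ab AV _ uA]] := mesh_arcs aM bk.
have dab : dist (va k i) (vb k i) <= hmax M := le_trans (len_le_hk k i) (hk_le_hmax k).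
have [u u1 fl] := hthin (hmax M) (bd_vertex M) A _ _ hM (@mesh_vertices _ _ _ _ _ _ aM) (bdry_near_vertex aM k Ch)
  (@mesh_corners _ _ _ _ _ _ aM) sA Ab AV dab.
have [Aa _] : (A `&` bd_vertex M) (va k i) by rewrite AV; left.
have [Abb _] : (A `&` bd_vertex M) (vb k i) by rewrite AV; right.
have [q [[Aq lq] _]] := uA _ ei.
have [cutP minP] := hP k i n bk inn.
apply: (le_trans (minP q (conj (Ab _ Aq) lq))).
have [_ _ _ sh] := adm_shape aM rho0 mu0 k.
have ve j : elt k (vtx k j) by exact: (tri_vtx (vtx k) j).
have E : cross (vb k i - va k i) (vtx k i - va k i) = tdet (vtx k).
  by rewrite (tdetE (vtx k) i) /cross /va /vb !coordE; ring.
rewrite nE /ept -ek; apply: (displacement u1 fl Aa Abb Aq (hk_gt0 d0 k) k0 (ltW e'0) _ tI _ _ _ _ _).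
- by rewrite ek.
- by apply: dist_le_hk; exact: ve.
- by apply: dist_le_hk; exact: ve.
- by apply: dist_le_hk; exact: ve.
- by rewrite E.
- by rewrite nE in lq.
Qed.

Lemma within_coords (V : set (R * R)) (b : R * R -> R * R) : {within V, continuous b} ->
  {within V, continuous (fun x => (b x).1)} /\ {within V, continuous (fun x => (b x).2)}.
Proof.
move=> cb; split.
  have cf : {within setT, continuous (fst : R * R -> R)} by apply: continuous_subspaceT => x; exact: cvg_fst.
  exact: (within_comp cb (fun x _ => Logic.I) cf).
have cs : {within setT, continuous (snd : R * R -> R)} by apply: continuous_subspaceT => x; exact: cvg_snd.
exact: (within_comp cb (fun x _ => Logic.I) cs).
Qed.

(** Edge integrals use point values of [b], so a pointwise bound is needed on all elements, also on
    those that protrude from Omega. One number [r] serves as radius and, through its inverse, as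
    bound, which keeps the property monotone for [compact_uniform]. *)
Lemma bounded_near (V : set (R * R)) (b : R * R -> R * R) : {within V, continuous b} -> closure Omega `<=` V ->
  exists2 r : R, 0 < r & forall x y, V x -> closure Omega y -> dist x y < r -> enorm (b x) <= r^-1.
Proof.
move=> cb cV; have [c1 c2] := within_coords cb; have [r0 r00 hr0] := bounded_domain_enorm bO.
have cK : compact (closure Omega) by apply: (heine_borel2 (r := r0)) => //; exact: closed_closure.
pose Q (r : R) y := forall x, V x -> dist x y < r -> enorm (b x) <= r^-1.
have [|z cz|r rp hr] := @compact_uniform R (closure Omega) Q cK.
- move=> r r' y rr h x Vx hx; have r'0 : 0 < r' by exact: le_lt_trans (enorm_ge0 _) hx.
  by apply: (le_trans (h x Vx (lt_le_trans hx rr))); rewrite lef_pV2 ?posrE //; exact: lt_le_trans rr.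
- have Vz := cV z cz.
  have [d1 d10 h1] := within_dist c1 Vz ltr01; have [d2 d20 h2] := within_dist c2 Vz ltr01.
  pose B : R := `|(b z).1| + `|(b z).2| + 2.
  have B0 : 0 < B by rewrite ltr_wpDl // addr_ge0.
  pose r : R := Num.min (Num.min d1 d2 / 2) B^-1.
  have r1 : 0 < r by rewrite lt_min invr_gt0 B0 andbT divr_gt0 // lt_min d10.
  exists r => // y _ hy x Vx hx.
  have xz : dist x z < Num.min d1 d2.
    have rr : r <= Num.min d1 d2 / 2 by rewrite ge_min lexx.
    have := dist_tri x y z; lra.
  move: xz; rewrite lt_min => /andP[x1 x2]; have a1 := h1 x Vx x1; have a2 := h2 x Vx x2.
  apply: (@le_trans _ _ B); last by rewrite -[B]invrK lef_pV2 ?posrE ?invr_gt0 // ge_min lexx orbT.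
  apply: (le_trans (enorm_le_coords _)).
  have := ler_normD ((b x).1 - (b z).1) (b z).1; have := ler_normD ((b x).2 - (b z).2) (b z).2.
  rewrite !subrK /B; lra.
by exists r => // x y Vx cy hx; exact: hr cy x Vx hx.
Qed.

End Geometry.

(** * Arithmetic of the final constants *)

Section Constants.
Context {R : realType}.

(** The denominator has m + 1 in place of m because the bound [m] on the coefficients may be 0. *)
Lemma strip_constant (m L E f q : R) : 0 <= m -> 0 < L -> 0 <= E -> 0 <= q -> f <= (16 * (m + 1) * L)^-1 ->
  q <= L * E -> f * (4 * m * q) <= E / 4.
Proof.
move=> m0 L0 E0 q0 hf hq; have m1 : 0 < m + 1 by rewrite ltr_wpDl.
have mq : 4 * m * q <= 4 * m * (L * E) by apply: ler_wpM2l => //; rewrite mulr_ge0.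
have i0 : 0 <= (16 * (m + 1) * L)^-1 by rewrite invr_ge0 ltW // !mulr_gt0.
have p0 : 0 <= 4 * m * q by rewrite !mulr_ge0.
apply: (le_trans (ler_wpM2r p0 hf)); apply: (le_trans (ler_wpM2l i0 mq)).
have -> : (16 * (m + 1) * L)^-1 * (4 * m * (L * E)) = m / (m + 1) * (E / 4) by field; rewrite !gt_eqF.
by rewrite ler_piMl ?divr_ge0 // ler_pdivrMr // mul1r lerDl.
Qed.

Lemma norm_constant (x m G J K Ce B : R) : x <= m + (1 + 2 * Ce) * G + (1 + B) * J -> m <= K * (G + J) ->
  0 <= Ce -> 0 <= B -> 0 <= G -> 0 <= J -> x <= (K + (1 + 2 * Ce + B)) * (G + J).
Proof.
move=> h1 h2 c0 b0 g0 j0; have := mulr_ge0 c0 j0; have := mulr_ge0 b0 g0.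
have -> : (K + (1 + 2 * Ce + B)) * (G + J) = K * (G + J) + ((1 + 2 * Ce) * G + (1 + B) * J) + (2 * (Ce * J) + B * G) by ring.
lra.
Qed.

Lemma defect_constant (Z dl e : R) : 0 <= Z -> 0 < dl -> 0 < e -> e <= 1 -> e <= dl / (Z + 1) -> Z * e ^+ 2 <= dl.
Proof.
move=> Z0 d0 e0 e1' he; have Z1 : 0 < Z + 1 by rewrite ltr_wpDl.
have ee : e ^+ 2 <= e by rewrite expr2 ler_piMl // ltW.
apply: (le_trans (ler_wpM2l Z0 ee)); move: he; rewrite ler_pdivlMr // mulrDr mulr1 mulrC; lra.
Qed.

Lemma min_constant (A z : R) : 0 < A -> A * Num.min z A^-1 <= 1.
Proof.
move=> A0; rewrite -[X in _ <= X](divff (lt0r_neq0 A0)); apply: ler_wpM2l; first exact: ltW.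
by rewrite ge_min lexx orbT.
Qed.

Lemma quarter_lt1 : (4^-1 : R) < 1.
Proof. lra. Qed.

End Constants.

(** * Choice of the constants and proof of both assertions *)

Unset Implicit Arguments.

Theorem theorem3p1 (R : realType) (N : nat) (Omega U : set (R * R))
    (b : R * R -> R * R) (c : R * R -> R) (nd : 'I_(Np N) -> R * R)
    (rho mu C : R) (Th : set (mesh R)) :
  (1 <= N)%N ->
  bounded_domain Omega ->
  piecewise_C2_boundary Omega ->
  coefficients Omega U b c ->
  reference_nodes nd ->
  0 < rho -> 0 < mu -> 0 < C ->
  mesh_family Omega U rho mu C Th ->
  exists2 eta0 : R, 0 < eta0 &
  forall eta : R, eta0 < eta ->
  exists2 h0 : R, 0 < h0 &
  exists2 alpha : R, 0 < alpha &
  forall M : mesh R, Th M -> hmax M < h0 ->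
  forall P : 'I_(nel M) -> 'I_(Np N) -> R * R, boundary_points nd Omega P ->
    (alpha%:E <=
       ereal_inf [set
         ereal_sup [set
           (BDG b c eta w v / (DGnorm b w * DGnorm b v))%:E
         | v in [set v | Vh N v /\ v != 0%R]]
       | w in [set w | Wh nd P w /\ w != 0%R]])%E
    /\
    (forall v : broken M, Vh N v ->
       (forall w : broken M, Wh nd P w -> BDG b c eta w v = 0) -> v = 0).
Proof.
move=> N1 bO pO [[oU OU] cb [W1 W2] [mcU [Mc hMc]] [g1 [g2 [[mg1 [M1 hM1]] [mg2 [M2 hM2]] wd1 wd2 Oc]]]] hnd rho0 mu0 C0 [hadm hfam].
have kap0 : 0 < rho / mu by rewrite divr_gt0.
have [Ce Ce0 LE] := local_estimates N kap0.
have [Cn Cn0 NE] := nodal_estimate (nodes_unisolvent hnd).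
have [rO rO0 hrO] := bounded_domain_enorm bO.
(* On fine meshes Omega_h stays within distance 1 of the ball that contains Omega, so [X] bounds
   |x_1| there. *)
pose X : R := rO + 1; have X1 : 1 <= X by rewrite lerDr ltW.
have cV : closure Omega `<=` U `|` closure Omega by move=> x; right.
have [rb rb0 hb] := bounded_near bO cb cV.
pose Bb : R := rb^-1; have Bb0 : 0 <= Bb by rewrite invr_ge0 ltW.
pose M0 : R := `|Mc| + `|M1| + `|M2|.
have M00 : 0 <= M0 by rewrite !addr_ge0.
have [le_c [le_1 le_2]] : Mc <= M0 /\ M1 <= M0 /\ M2 <= M0.
  have := ler_norm Mc; have := ler_norm M1; have := ler_norm M2.
  have := normr_ge0 Mc; have := normr_ge0 M1; have := normr_ge0 M2; rewrite /M0 => *.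
  by split; [|split]; lra.
have cB : {ae leb2, forall x, U x -> `|c x| <= M0}.
  by apply: leb2_ae_imp hMc => x h Ux; exact: le_trans (h Ux) le_c.
have gB1 : {ae leb2, forall x, U x -> `|g1 x| <= M0}.
  by apply: leb2_ae_imp hM1 => x h Ux; exact: le_trans (h Ux) le_1.
have gB2 : {ae leb2, forall x, U x -> `|g2 x| <= M0}.
  by apply: leb2_ae_imp hM2 => x h Ux; exact: le_trans (h Ux) le_2.
pose KP : R := 4 * (X * (4 + 6 * Ce)) ^+ 2; have KP0 : 0 <= KP by rewrite mulr_ge0 // sqr_ge0.
pose L : R := (4 + 6 * Ce) * (KP + 1).
have C46 : 0 < 4 + 6 * Ce by rewrite addr_gt0 // mulr_gt0.
have L0 : 0 < L by rewrite mulr_gt0 // ltr_wpDl.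
(* [Energy_small] bounds the energy of w - v by Z e^2 times that of w. *)
pose Z : R := (2 * Ce + 6 * (Ce / mu ^+ 2)) * (Cn * ((Np N)%:R * Ce)).
have Q0 : 0 <= Cn * ((Np N)%:R * Ce) by apply: mulr_ge0; [exact: ltW|apply: mulr_ge0; [exact: ler0n|exact: ltW]].
have m6 : 0 <= 6 * (Ce / mu ^+ 2) by apply: mulr_ge0 => //; apply: divr_ge0; [exact: ltW|exact: sqr_ge0].
have Z0 : 0 <= Z by apply: mulr_ge0 => //; apply: addr_ge0 => //; apply: mulr_ge0 => //; exact: ltW.
(* The penalty with which [BDG_coercive] absorbs the consistency terms. *)
exists (24 * Ce + 1); first by rewrite addr_gt0 // mulr_gt0.
move=> eta heta; have eta0 : 0 <= eta by apply: le_trans (ltW heta); rewrite addr_ge0 // mulr_ge0 // ltW.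
have Kt0 : 0 < Kcont Ce M0 Bb eta.
  have BC : 0 <= Bb ^+ 2 * Ce by apply: mulr_ge0; [exact: sqr_ge0|exact: ltW].
  have b2 : 0 <= Bb ^+ 2 := sqr_ge0 _; have m2 : 0 <= M0 ^+ 2 := sqr_ge0 _.
  by rewrite /Kcont; do 5 (apply: ltr_pwDl; last by rewrite ?mulr_ge0 // ltW).
pose Kc : R := Kcont Ce M0 Bb eta * (1 + KP); have Kc0 : 0 < Kc by rewrite mulr_gt0 // ltr_pwDl.
pose Kn : R := KP + (1 + 2 * Ce + Bb).
have Kn0 : 0 < Kn by rewrite ltr_wpDl // ltr_pwDl // addr_gt0 // mulr_gt0.
have [A [A0 AE]] : exists A : R, 0 < A /\ A = 512 * Kc ^+ 2.
  by exists (512 * Kc ^+ 2); split; [apply: mulr_gt0; [by rewrite ltr0n|exact: exprn_gt0]|reflexivity].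
(* Meets both smallness conditions of the stability argument. [Kc] contains eta, so the mesh
   threshold depends on eta through [dl]. *)
pose dl : R := Num.min 4^-1 A^-1.
have dl0 : 0 < dl by rewrite lt_min !invr_gt0 A0 ltr0n.
have dl4 : dl <= 4^-1 by rewrite ge_min lexx.
have dlK : 512 * Kc ^+ 2 * dl <= 1 by rewrite -AE; exact: min_constant.
pose e : R := Num.min 1 (dl / (Z + 1)).
have e0 : 0 < e by rewrite lt_min ltr01 divr_gt0 // ltr_wpDl.
have e1' : e <= 1 by rewrite ge_min lexx.
have eZ : e <= dl / (Z + 1) by rewrite ge_min lexx orbT.
have Ze := defect_constant Z0 dl0 e0 e1' eZ.
(* Size of the strip functions for which the indefinite reaction costs at most a quarter of the
   energy. *)
have es0 : 0 < (16 * (M0 + 1) * L)^-1 by rewrite invr_gt0 !mulr_gt0 // ltr_wpDl.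
have [T [s [G [g [a [F [d [F0 sF dp hG hs]]]]]]]] := strip_family pO es0.
(* Omega_h may protrude by less than [d], for the strip functions, and by less than [rb], for the
   bound on [b]. *)
have db0 : 0 < Num.min d rb by rewrite lt_min dp.
have f1 := @displacement_small R Omega bO pO rho mu C e N nd rho0 mu0 C0 e0 e1'.
have f2 := strip_near rho mu bO pO C0 db0.
have [h0 h00 H] := finely_and f1 (finely_and f2 (finely_small Omega rho mu C0 ltr01)).
exists h0 => //; exists (32 * Kn)^-1; first by rewrite invr_gt0 mulr_gt0.
move=> M TM hM P hP; have aM := hadm M TM; have [disp [near [hm1 hC1]]] := H M aM hM.
have {}hm1 := ltW hm1; have d0 := adm_tdet aM.
have OV : Omegah M `<=` U `|` closure Omega.
  by move=> x Ox; case: hfam => [[_ h]|[_ h]]; [right; exact: (h M TM)|left; exact: (h M TM)].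
have sub (k : 'I_(nel M)) : tri_int (vtx k) `<=` Omegah M by move=> x Tx; exists k => //; exact: (tri_int_sub (d0 k)).
have TU (k : 'I_(nel M)) : tri_int (vtx k) `<=` U.
  move=> x Tx; case: hfam => [[UE h]|[_ h]]; last by apply: (h M TM); exact: sub Tx.
  rewrite UE; apply: (closure_interior bO pO).
  apply: filterS (open_nbhs_nbhs (conj (@open_tri_int _ (vtx k)) Tx)) => y Ty.
  by apply: (h M TM); exact: sub Ty.
have bB (k : 'I_(nel M)) x : elt k x -> enorm (b x) <= Bb.
  move=> ex; have Ox : Omegah M x by exists k.
  have [cx|ncx] := pselect (closure Omega x); first by apply: (hb x x (OV x Ox) cx); rewrite distxx.
  have nx : ~ Omega x by move=> /subset_closure.
  have [y by_ hy] := near x Ox nx; apply: (hb x y (OV x Ox) by_.1).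
  by apply: (lt_le_trans hy); rewrite ge_min lexx orbT.
have eV (k : 'I_(nel M)) : elt k `<=` U `|` closure Omega by move=> x ex; apply: OV; exists k.
have [c1 c2] := within_coords cb.
have cb1 (k : 'I_(nel M)) : {within elt k, continuous (fun x => (b x).1)} := continuous_subspaceW (@eV k) c1.
have cb2 (k : 'I_(nel M)) : {within elt k, continuous (fun x => (b x).2)} := continuous_subspaceW (@eV k) c2.
have mU := open_measurable2 oU.
have mc (k : 'I_(nel M)) : measurable_fun (tri_int (vtx k)) c := measurable_funS mU (@TU k) mcU.
have mk1 (k : 'I_(nel M)) : measurable_fun (tri_int (vtx k)) g1 := measurable_funS mU (@TU k) mg1.
have mk2 (k : 'I_(nel M)) : measurable_fun (tri_int (vtx k)) g2 := measurable_funS mU (@TU k) mg2.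
have hstr (k : 'I_(nel M)) x : tri_int (vtx k) x -> ~ Omega x -> 2^-1 <= \sum_(m <- s) g m x.
  move=> Tx nx; have [y by_ hy] := near x (sub k x Tx) nx; apply: (hs x y by_).
  by apply: (lt_le_trans hy); rewrite ge_min lexx.
have hX x : Omegah M x -> `|x.1| <= X.
  move=> Ox; apply: (le_trans (coord1_le_enorm x)).
  exact: (Omegah_bounded aM (fun z (bz : bdry Omega z) => hrO z bz.1) hC1 Ox).
pose D : set (broken M) := [set u | deg_le N u].
have E0 (u : broken M) : 0 <= Energy u by rewrite addr_ge0 ?Gradient_ge0 ?Jump_ge0.
have mass (u : broken M) : D u -> Mass u <= KP * Energy u.
  by move=> hu; exact: (poincare aM rho0 mu0 hm1 Ce0 LE hu X1 hX).
have VD : @Vh R N M `<=` D by move=> v [hv _].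
have WD : @Wh R N nd M P `<=` D by move=> v [hv _].
have DB (w v : broken M) : D w -> D v -> D (w - v).
  by move=> hw hv k; rewrite !ffunE; exact: total_degreeD (hw k) (total_degreeN (hv k)).
have cont (t : R) (w v : broken M) : D w -> D v -> 0 < t -> `|BDG b c eta w v| <= t * (Kc * Energy w) + t^-1 * (Kc * Energy v).
  move=> hw hv t0; apply: (le_trans (BDG_le aM rho0 mu0 hm1 Ce0 LE M00 Bb0 eta0 TU cb1 cb2 bB mc cB hw hv t0)).
  have K1 (u : broken M) : D u -> Kcont Ce M0 Bb eta * (Energy u + Mass u) <= Kc * Energy u.
    by move=> hu; rewrite /Kc -mulrA ler_pM2l // mulrDl mul1r lerD2l; exact: mass.
  by apply: lerD; rewrite ler_pM2l ?invr_gt0 //; exact: K1.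
have coer (v : broken M) : Vh N v -> Energy v / 4 <= BDG b c eta v v.
  move=> Vv; have hv : D v := VD _ Vv.
  have van : vanishing v.
    move=> [k i] hn t tI; apply: (Vv.2 k i ((has_nbP aM k i).2 hn)).
    by apply/edge_ept; exists t.
  have RR := reaction aM rho0 mu0 hm1 Ce0 LE M00 TU mc cB hv mk1 mk2 gB1 gB2 Oc F0 hG hstr.
  apply: (BDG_coercive aM rho0 mu0 Ce0 LE M00 TU cb1 cb2 mc cB hv van mk1 mk2
    (ex_intro _ M0 gB1) (ex_intro _ M0 gB2) wd1 wd2 (ltW heta)).
  apply: le_trans RR; rewrite lerN2.
  have -> : 4 * M0 * ((size s)%:R * (F * ((4 + 6 * Ce) * (Mass v + Energy v)))) =
     (size s)%:R * F * (4 * M0 * ((4 + 6 * Ce) * (Mass v + Energy v))) by ring.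
  apply: (strip_constant M00 L0 (E0 v) _ sF).
    by apply: mulr_ge0; [exact: ltW|apply: addr_ge0; [exact: Mass_ge0|exact: E0]].
  by rewrite /L -mulrA ler_pM2l // mulrDl mul1r lerD2r; exact: mass.
have Eadd := Energy_add aM.
have nrmE (u : broken M) : D u -> DGnorm b u ^+ 2 <= Kn * Energy u.
  move=> hu; have [n1 _] := DGnorm_le aM rho0 mu0 hm1 Ce0 LE cb1 cb2 bB hu.
  exact: (norm_constant n1 (mass u hu) (ltW Ce0) Bb0 (Gradient_ge0 u) (Jump_ge0 u)).
have nrm0 (u : broken M) : D u -> u != 0 -> 0 < DGnorm b u.
  move=> hu; apply: contra_neqT; rewrite -leNgt => n0.
  have [_ n2] := DGnorm_le aM rho0 mu0 hm1 Ce0 LE cb1 cb2 bB hu.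
  have nz : DGnorm b u = 0 by apply/eqP; rewrite eq_le n0 sqrtr_ge0.
  rewrite nz expr0n /= in n2; apply/ffunP => k; rewrite ffunE; apply: (L2_elt_eq0 aM (k := k)).
  apply: le_trans n2; rewrite /Mass (bigD1 k) //= lerDl.
  by apply: sumr_ge0 => l _; exact: L2_elt_ge0.
have e01 : 0 <= e <= 1 by rewrite (ltW e0).
have DP := disp P hP.
have dZ : (2 * Ce + 6 * (Ce / mu ^+ 2)) * defect N Ce Cn e = Z * e ^+ 2 by rewrite /defect /Z; ring.
have small (w v : broken M) : D w -> D v -> related N Ce Cn e w v -> Energy (w - v) <= dl * Energy w.
  move=> hw hv hr; apply: (le_trans (Energy_small aM rho0 mu0 Ce0 LE hw hv hr)); rewrite dZ.
  apply: ler_pM => //; [by apply: mulr_ge0 => //; exact: sqr_ge0|exact: Gradient_ge0|].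
  by rewrite lerDl; exact: Jump_ge0.
have WV (w : broken M) : Wh nd P w -> exists2 v : broken M, Vh N v & Energy (w - v) <= dl * Energy w.
  move=> Ww; have [v Vv hr] := interp_V aM rho0 mu0 hnd Ce0 LE Cn0 NE e01 DP Ww.
  by exists v => //; apply: small hr; [exact: WD|exact: VD].
have d1' : 2 * Ce * defect N Ce Cn e < 1.
  have df0 : 0 <= defect N Ce Cn e.
    by rewrite /defect; apply: mulr_ge0; [exact: ltW|apply: mulr_ge0; [exact: ler0n|apply: mulr_ge0; [exact: ltW|exact: sqr_ge0]]].
  apply: (@le_lt_trans _ _ dl); last exact: le_lt_trans dl4 quarter_lt1.
  by apply: le_trans Ze; rewrite -dZ; apply: ler_wpM2r => //; rewrite lerDl.
have VW (v : broken M) : Vh N v -> exists2 w : broken M, Wh nd P w & Energy (w - v) <= dl * Energy w.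
  move=> Vv; have [w Ww hr] := interp_W aM rho0 mu0 hnd Ce0 LE Cn0 NE e01 DP d1' Vv.
  by exists w => //; apply: small hr; [exact: WD|exact: VD].
have Badd := BDG_addl aM eta M00 TU cb1 cb2 mc cB.
split.
  apply: le_ereal_inf_tmp => _ [w [Ww w0] <-].
  have [v [Vv v0 hv]] := abstract_inf_sup Kc0 Kn0 dl4 dlK VD WD DB E0 Badd cont coer Eadd nrmE nrm0 WV Ww w0.
  apply: (@le_trans _ _ ((BDG b c eta w v / (DGnorm b w * DGnorm b v))%:E)); first by rewrite lee_fin.
  by apply: ereal_sup_ubound; exists v.
exact: (abstract_injective Kc0 Kn0 dl4 dlK VD WD DB E0 Badd cont coer Eadd nrmE nrm0 VW).
Qed.
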